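(* Let $\alpha<0$, let $B$ be a measure on $]0,1[$ with $\int_0^1 y(1-y)B(dy)<\infty$ and $B(]0,1[)>0$, let $\mu_0$ be a measure on $]0,\infty[$ with $\int_0^\infty x\mu_0(dx)=1$ whose support is bounded with supremum equal to $1$, and let $(\mu_t,t\ge0)$ be the unique solution of the fragmentation equation with parameters $(\alpha,B)$ starting from $\mu_0$. Let $m(t)=\int_0^\infty x\,\mu_t(dx)$, $\phi(t)=\int_0^1(1-x^t)\,x\,B(dx)$, and let $\varphi$ be the inverse function of $t\mapsto t/\phi(t)$ (well defined in a neighborhood of $\infty$). Suppose that $u\in\,]0,1[\,\mapsto\int_0^{1-u}x\,B(dx)$ varies regularly at $0$ with some index $-\beta\in\,]-1,0]$ and that $\int_0^1|\ln(x)|\,x\,B(dx)<\infty$. Then, for all continuous bounded functions $f:]0,\infty[\to\mathbb R$, $$\frac1{m(t)}\int_0^\infty f\Big(\Big(\frac{\varphi(|\alpha|t)}{|\alpha|t}\Big)^{1/|\alpha|}x\Big)\,x\,\mu_t(dx)\ \longrightarrow\ \int_0^\infty f(x)\,x\,\mu_\infty(dx)\qquad(t\to\infty),$$ where $x\mu_\infty(dx)$ is a probability distribution on $]0,\infty[$ that is characterized by its moments $$\int_0^\infty x^{|\alpha|n}\,x\,\mu_\infty(dx)=\phi(|\alpha|)\phi(2|\alpha|)\cdots\phi(n|\alpha|),\qquad n\ge1.$$ The function $t\mapsto\varphi(|\alpha|t)/(|\alpha|t)$ can be replaced by any asymptotically equivalent function (as $t\to\infty$).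
   Context: A solution of the fragmentation equation with parameters $(\alpha,B)$ starting from $\mu_0$ is any family of measures $(\mu_t,t\ge0)$ on $]0,\infty[$, equal to $\mu_0$ at $t=0$, such that: (a) for every real-valued continuously differentiable function $f$ on $]0,\infty[$ with compact support, $\partial_t\int f\,d\mu_t=\int_0^\infty x^\alpha\big(\int_0^1(f(yx)-f(x)y)B(dy)\big)\mu_t(dx)$; (b) $\int_0^\infty x\,\mu_t(dx)\le\int_0^\infty x\,\mu_0(dx)=1$ for all $t\ge0$; (c) if $\mu_0([M,\infty[)=0$ for some $M>0$, then $\mu_t([M,\infty[)=0$ for all $t\ge 0$. When $\alpha<0$ and $\mu_0$ has bounded support, such a solution exists and is unique. The supremum of the support of $\mu_0$ is the real $s$ such that $\mu_0(]s,\infty[)=0$ and $\mu_0(]s-\varepsilon,s])>0$ for all $0<\varepsilon<s$. Two positive functions $g,h$ are asymptotically equivalent if $g(t)/h(t)\to1$ as $t\to\infty$. The function $t\mapsto t/\phi(t)$ is continuous and strictly increasing on $]0,\infty[$ and tends to $\infty$ at $\infty$. *)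

(* Defs.v *)
From HB Require Import structures.
From mathcomp Require Import all_boot all_order all_algebra.
From mathcomp Require Import all_classical all_reals all_analysis.

Set Implicit Arguments.
Unset Strict Implicit.
Unset Printing Implicit Defensive.

Import Order.TTheory GRing.Theory Num.Theory.
Import numFieldNormedType.Exports.

Local Open Scope classical_set_scope.
Local Open Scope ring_scope.

Section Fragmentation.
Variable R : realType.

Local Notation meas := {measure set (measurableTypeR R) -> \bar R}.

(* A measure on the Borel subset D of R is encoded as a Borel measure on R
   that gives no mass to the complement of D. *)
Definition measure_on (D : set R) (mu : meas) : Prop := mu (~` D) = 0%E.

Definition first_moment (mu : meas) : \bar R :=
  (\int[mu]_(x in `]0%R, +oo[) x%:E)%E.

Definition is_support_sup (mu : meas) (s : R) : Prop :=
  mu `]s, +oo[%classic = 0%E /\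
  forall e : R, 0 < e -> e < s -> (0 < mu `](s - e)%R, s]%classic)%E.

(* Only the restriction of f to ]0, +oo[ matters. *)
Definition C1_compact_support (f : R -> R) : Prop :=
  [/\ forall x : R, 0 < x -> derivable f x 1,
      {within `]0, +oo[, continuous (derive1 f)} &
      exists K : set R, [/\ compact K, K `<=` `]0, +oo[ &
        forall x : R, 0 < x -> ~ K x -> f x = 0]].

(* Derivative on the half-line [0, +oo[: two-sided at t > 0, and the right
   derivative at t = 0. *)
Definition has_time_derivative (F : R -> R) (t l : R) : Prop :=
  h^-1 * (F (t + h) - F t) @[h --> within [set h | 0 <= t + h] 0^'] --> l.

Definition frag_generator (alpha : R) (B : meas) (f : R -> R) (x : R) : R :=
  x `^ alpha * \int[B]_(y in `]0, 1[) (f (y * x) - f x * y).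

(* The integrals in the first clause are real-valued ones; the integrands are
   integrable as soon as alpha < 0, y (1 - y) is B-integrable and the moment
   bound of the second clause holds. *)
Definition is_frag_solution (alpha : R) (B mu0 : meas) (mu : R -> meas) :
    Prop :=
  [/\ (forall t : R, 0 <= t -> measure_on `]0, +oo[ (mu t)) /\
      (forall A : set R, measurable A -> mu 0 A = mu0 A),
      forall f : R -> R, C1_compact_support f -> forall t : R, 0 <= t ->
        has_time_derivative (fun s => \int[mu s]_(x in `]0, +oo[) f x) t
          (\int[mu t]_(x in `]0, +oo[) frag_generator alpha B f x),
      (forall t : R, 0 <= t -> (first_moment (mu t) <= first_moment mu0)%E) /\
      first_moment mu0 = 1%E &
      forall M : R, 0 < M -> mu0 `[M, +oo[%classic = 0%E ->
        forall t : R, 0 <= t -> mu t `[M, +oo[%classic = 0%E].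

Definition frag_mass (mu : R -> meas) (t : R) : R := fine (first_moment (mu t)).

Definition frag_phi (B : meas) (t : R) : R :=
  \int[B]_(x in `]0, 1[) ((1 - x `^ t) * x).

(* pinv A h is the inverse of the restriction of h to A; it takes its values
   in A, with h (pinv A h s) = s, whenever s belongs to the image of A. *)
Definition frag_varphi (B : meas) : R -> R :=
  pinv [set t : R | 0 < t] (fun t => t / frag_phi B t).

(* The endpoint 1 - u is included; whether it is or not does not affect the
   regular variation of this monotone function at 0. *)
Definition frag_tail (B : meas) (u : R) : R :=
  \int[B]_(x in `]0, (1 - u)]) x.

Definition regularly_varying_at0 (f : R -> R) (rho : R) : Prop :=
  (exists2 r : R, 0 < r &
     measurable_fun `]0, r[ f /\ forall u : R, 0 < u -> u < r -> 0 < f u) /\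
  forall c : R, 0 < c -> f (c * u) / f u @[u --> 0^'+] --> c `^ rho.

Definition asymp_equiv (g h : R -> R) : Prop :=
  g t / h t @[t --> +oo] --> (1 : R).

(* The measures x mu_t(dx) / m(t), rescaled by psi(t)^(1/|alpha|), converge
   against every bounded continuous function on ]0, +oo[ to x nu(dx). *)
Definition rescaled_cvg (alpha : R) (mu : R -> meas) (nu : meas)
    (psi : R -> R) : Prop :=
  forall f : R -> R,
    {within `]0, +oo[, continuous f} ->
    (exists C : R, forall x : R, 0 < x -> `|f x| <= C) ->
    (frag_mass mu t)^-1 *
      \int[mu t]_(x in `]0, +oo[) (f (psi t `^ (`|alpha|^-1) * x) * x)
      @[t --> +oo] --> \int[nu]_(x in `]0, +oo[) (f x * x).

End Fragmentation.

(* Main.v *)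
Require Import Defs.
From HB Require Import structures.
From mathcomp Require Import all_boot all_order all_algebra.
From mathcomp Require Import all_classical all_reals all_analysis.
From mathcomp Require Import measurable_realfun.
From mathcomp Require Import ring lra.

Set Implicit Arguments.
Unset Strict Implicit.
Unset Printing Implicit Defensive.

Import Order.TTheory GRing.Theory Num.Theory.
Import numFieldNormedType.Exports.

Local Open Scope classical_set_scope.
Local Open Scope ring_scope.

(* In the variable z = x^a, with a = |alpha|, the size-biased moments
   M_n(t) = int x^(1 + n a) mu_t(dx) satisfy M_(n+1)' = - Psi(n + 1) M_n with
   Psi(p) = phi(a p) = int (1 - e^(- p v)) / v N(dv), where N is the finite image of
   a |ln y| y B(dy) under v = - a ln y.  Hence G_n = M_n / (Psi(1) ... Psi(n)) are the
   iterated tail integrals of the mass m = G_0, and n! G_(n+1)(0) are the moments of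
   the density m.  Regular variation of the tail with index > -1 yields
   Psi(K p) <= theta K Psi(p) with theta < 1 for large p, so that
   lam(t) = varphi(a t) / (a t), the solution of lam = Psi(t lam), varies slowly.

   For a single fragment of unit size the mass is exp(- int_0^t h), where the
   nondecreasing hazard rate h solves a fixed-point equation.  Since lam is a
   subsolution and (1 + eta) lam (truncated) a supersolution, Knaster-Tarski provides
   h with lam <= h <= (1 + eta) lam eventually.  The mass m and the mixture of these
   survival functions over x mu_0(dx) have the same moments, at most K C^n n!, hence coincide.
   It follows that m(t + u / lam(t)) / m(t) -> e^(- u), whence lam^n G_n / m -> 1: the
   moments of the rescaled laws converge to Psi(1) ... Psi(n) <= C^n n!.

   Finally the method of moments applies: integrals of polynomials in e^(- d z) converge by
   Taylor expansion, and the Riesz theorem on [0, 1] produces the limit law Q on [0, +oo[.  It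
   has no atom at 0, because mixing survival functions over the restriction of Q to ]0, +oo[
   gives a density with moments n!, which must be e^(- t). *)

(** * Measure-theoretic preliminaries and approximation *)

(** The obstacle is the mass itself. The generator annihilates [f(x) = x], yet mass can be lost at
    size 0, out of reach of compactly supported test functions: the equation gives no rate of decay
    for [m], only its integrals against powers. Hence the detour through a moment problem with an
    explicit candidate.

    The candidate comes from self-similarity: a fragment with [x^a = z] should lose mass like a unit
    fragment observed at time [t / z], since its rate is [x^(- a)]. No solution started from a unit
    fragment is constructed; the fixed point [h] is a purely analytic object, and only the moments
    of its survival function matter.

    Both moment problems are determinate by factorial bounds with a geometric factor, for opposite
    reasons: for [m] because [Psi(n) >= Psi(1)] in the denominators, for the limit law because
    [Psi(p) <= p N(]0, +oo[)]. Finiteness of [N] is exactly the logarithmic moment of [x B(dx)].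

    All weak convergence is handled in the variable [w = e^(- d z)], which maps the half-line into
    [[0, 1]], where polynomials are dense; the two endpoints stand for escape to infinity and for an
    atom at 0, and each is excluded separately. *)

Section WeightedImage.
Context d d' (X : measurableType d) (Y : measurableType d') (R : realType).
Local Open Scope ereal_scope.
Variables (mu : {measure set X -> \bar R}) (E : set X) (w : X -> R) (s : X -> Y).
Hypotheses (mE : measurable E) (mw : measurable_fun E w)
  (w0 : forall x, E x -> (0 <= w x)%R) (ms : measurable_fun setT s).

Let nu0 (A : set Y) : \bar R :=
  \int[mu]_(x in E `&` s @^-1` A) (w x)%:E.

Let mpre (A : set Y) : measurable A -> measurable (s @^-1` A).
Proof. by move=> mA; rewrite -[X in measurable X]setTI; exact: ms. Qed.

Let nu00 : nu0 set0 = 0.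
Proof. by rewrite /nu0 preimage_set0 setI0 integral_set0. Qed.

Let nu0_ge0 A : 0 <= nu0 A.
Proof. by apply: integral_ge0 => x [Ex _]; rewrite lee_fin w0. Qed.

Let nu0_sigma : semi_sigma_additive nu0.
Proof.
move=> F mF tF mUF; rewrite /nu0 preimage_bigcup setI_bigcupr.
rewrite ge0_integral_bigcup//.
- apply: is_cvg_ereal_nneg_natsum => n _.
  by apply: integral_ge0 => x [Ex _]; rewrite lee_fin w0.
- by move=> k; apply: measurableI => //; exact: (mpre (mF k)).
- apply/measurable_EFinP; apply: measurable_funS mw => //.
  by move=> x [k _ []].
- by move=> x [k _ [Ex _]]; rewrite lee_fin w0.
- apply/trivIsetP => i j _ _ ij; rewrite setIACA setIid -preimage_setI.
  by move/trivIsetP : tF => /(_ i j Logic.I Logic.I ij) ->; rewrite preimage_set0 setI0.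
Qed.

Let nu : {measure set Y -> \bar R} := HB.pack nu0
  (isMeasure.Build _ Y R nu0 nu00 nu0_ge0 nu0_sigma).

Import HBNNSimple.

Let integral_nu (D : set Y) (f : Y -> \bar R) : measurable D ->
  measurable_fun D f -> (forall z, D z -> 0 <= f z) ->
  \int[nu]_(z in D) f z = \int[mu]_(x in E `&` s @^-1` D) (f (s x) * (w x)%:E).
Proof.
move=> mD mf f0.
have mED : measurable (E `&` s @^-1` D) by apply: measurableI => //; exact: mpre.
have mwD : measurable_fun (E `&` s @^-1` D) (EFin \o w).
  by apply/measurable_EFinP; apply: measurable_funS mw.
pose f_ := nnsfun_approx mD mf.
have f_cvg z : D z -> EFin \o f_^~ z @ \oo --> f z.
  by move=> Dz; apply: cvg_nnsfun_approx => // y Dy; exact: f0.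
have mf_ n : measurable_fun (E `&` s @^-1` D) (fun x => (f_ n (s x))%:E * (w x)%:E).
  apply: emeasurable_funM => //; apply/measurable_EFinP.
  by apply: measurable_funTS; apply: measurableT_comp.
transitivity (limn (fun n => \int[nu]_(x in D) (f_ n x)%:E)).
  rewrite -monotone_convergence//.
  - apply: eq_integral => y /[!inE] yD; apply/esym/cvg_lim => //.
    exact: f_cvg.
  - by move=> n; exact/measurable_EFinP/measurable_funP.
  - by move=> n y _; rewrite lee_fin.
  - by move=> y _ m n mn; rewrite lee_fin; exact/lefP/nd_nnsfun_approx.
transitivity (limn (fun n =>
    \int[mu]_(x in E `&` s @^-1` D) ((f_ n (s x))%:E * (w x)%:E))); last first.
  rewrite -monotone_convergence//.
  - apply: eq_integral => x /[!inE] -[Ex Dx]; apply/cvg_lim => //.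
    by apply: cvgeZr => //; exact: f_cvg.
  - by move=> n x [Ex _]; rewrite mule_ge0// lee_fin// w0.
  - move=> x [Ex Dx] m n mn; rewrite lee_wpmul2r ?lee_fin ?w0//.
    exact/lefP/nd_nnsfun_approx.
congr (limn _); apply/funext => n.
transitivity (\sum_(k \in range (f_ n))
    \int[mu]_(x in E `&` s @^-1` D) (k%:E * (\1_(f_ n @^-1` [set k]) (s x) * w x)%:E)).
  under eq_integral do rewrite fimfunE -fsumEFin//.
  rewrite ge0_integral_fsum//; last 2 first.
  - by move=> y; exact/measurable_EFinP/measurable_funM.
  - by move=> y x _; rewrite nnfun_muleindic_ge0.
  apply: eq_fsbigr => r rf; rewrite integralZl_indic_nnsfun// integral_indic//=.
  move: rf; rewrite inE => -[y _ <-].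
  rewrite ge0_integralZl_EFin//; last first.
  - apply/measurable_EFinP; apply: measurable_funM.
      apply: measurable_funTS; apply: measurableT_comp => //.
    by apply: measurable_funS mw.
  - by move=> x [Ex _]; rewrite lee_fin mulr_ge0// w0.
  congr (_ * _); rewrite /nu/= /nu0.
  under [RHS]eq_integral do rewrite EFinM.
  under [RHS]eq_integral do rewrite -/((EFin \o w) _).
  rewrite [RHS](eq_integral ((EFin \o w) \_ (s @^-1` (f_ n @^-1` [set f_ n y])))).
    rewrite -integral_mkcondr; congr (integral _ _ _).
    by rewrite preimage_setI; apply/seteqP; split => x /=; tauto.
  move=> x _; rewrite /patch indicE.
  rewrite (_ : (s x \in f_ n @^-1` [set f_ n y]) = (x \in s @^-1` (f_ n @^-1` [set f_ n y]))).
    by case: ifPn; rewrite ?mul1e ?mul0e.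
  by apply/idP/idP; rewrite !inE.
rewrite -ge0_integral_fsum//.
- apply: eq_integral => x _; rewrite [in RHS]fimfunE -EFinM mulr_fsuml fsumEFin//.
  by congr EFin; apply: eq_fsbigr => r _; rewrite mulrA.
- move=> r; apply/measurable_EFinP; apply: measurable_funM => //.
  apply: measurable_funM; last by apply: measurable_funS mw.
  by apply: measurable_funTS; apply: measurableT_comp.
- move=> r x [Ex _]; rewrite EFinM muleA mule_ge0//; last by rewrite lee_fin w0.
  exact: nnfun_muleindic_ge0.
Qed.

Let weighted_image : exists nu : {measure set Y -> \bar R},
  (forall A, measurable A -> nu A = \int[mu]_(x in E `&` s @^-1` A) (w x)%:E) /\
  forall (D : set Y) (f : Y -> \bar R), measurable D -> measurable_fun D f ->
   (forall z, D z -> 0 <= f z) ->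
   \int[nu]_(z in D) f z = \int[mu]_(x in E `&` s @^-1` D) (f (s x) * (w x)%:E).
Proof. by exists nu; split => // D f; exact: integral_nu. Qed.

(** The measure is the image under [s] of the measure with density [w] on [E]; the changes of
    variable below are instances. No integrability is asked of [f]: since [w] is nonnegative, the
    positive and negative parts match separately. *)
Lemma weighted_image_integral : exists nu : {measure set Y -> \bar R},
  (forall A, measurable A -> nu A = \int[mu]_(x in E `&` s @^-1` A) (w x)%:E) /\
  forall (D : set Y) (f : Y -> \bar R), measurable D -> measurable_fun D f ->
   \int[nu]_(z in D) f z = \int[mu]_(x in E `&` s @^-1` D) (f (s x) * (w x)%:E).
Proof.
have [nu' [nuA nuI]] := weighted_image; exists nu'; split => // D f mD mf.
rewrite [LHS]integralE [RHS]integralE !nuI//; last 2 first.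
- exact: measurable_funeneg.
- exact: measurable_funepos.
have w0' x : E x -> (0 <= w x)%R by exact: w0.
congr (_ - _); apply: eq_integral => x; rewrite inE => -[Ex _].
  by rewrite !funeposE !(muleC _ (w x)%:E) maxe_pMr ?mule0 ?lee_fin ?w0'.
by rewrite !funenegE !(muleC _ (w x)%:E) -muleN maxe_pMr ?mule0 ?lee_fin ?w0'.
Qed.

End WeightedImage.

(** * Limit interchange and uniform estimates *)

Section Approximation.
Context {R : realType}.
Implicit Types f : R -> R.

(** The Cauchy criterion with a tolerance: the limits of the approximants need not be known. This is
    the interchange of limits behind the method of moments. *)
Lemma is_cvg_approx {T : Type} (F : set_system T) {FF : ProperFilter F} (u : T -> R) :
  (forall e : R, 0 < e -> exists v : T -> R,
     cvg (v @ F) /\ \forall i \near F, `|u i - v i| <= e) ->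
  cvg (u @ F).
Proof.
move=> uv; apply/cauchy_cvgP/cauchy_exP => _ /posnumP[e].
have e30 : 0 < e%:num / 3 by rewrite divr_gt0.
have [v [cv uve]] := uv _ e30; exists (lim (v @ F)).
have /cvgrPdist_lt/(_ _ e30) vl := cv.
suff : \forall i \near F, ball (lim (v @ F)) e%:num (u i) by [].
near=> i; rewrite /ball/=.
have H1 : `|lim (v @ F) - v i| < e%:num / 3 by near: i; exact: vl.
have H2 : `|u i - v i| <= e%:num / 3 by near: i; exact: uve.
rewrite (_ : _ - u i = (lim (v @ F) - v i) - (u i - v i)); last by ring.
apply: (le_lt_trans (ler_normB _ _)).
have : 0 < e%:num by []. lra.
Unshelve. all: by end_near. Qed.

Lemma cvg_eq_near {T : Type} (F : set_system T) {FF : ProperFilter F} (u v : T -> R) (l l' : R) :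
  u @ F --> l -> v @ F --> l' -> (\forall i \near F, u i = v i) -> l = l'.
Proof.
move=> /cvgrPdist_le ul /cvgrPdist_le vl uv; apply/eqP; rewrite -subr_eq0 -normr_le0.
apply/ler_addgt0Pl => e e0; rewrite addr0; have e20 : 0 < e / 2 by rewrite divr_gt0.
have [i [[h1 h2] h3]] := filter_ex (filterI (filterI (ul _ e20) (vl _ e20)) uv).
rewrite (_ : l - l' = (l - u i) - (l' - v i)); last by rewrite h3; ring.
by apply: (le_trans (ler_normB _ _)); lra.
Qed.

Lemma cvg_le_near {T : Type} (F : set_system T) {FF : ProperFilter F} (u v : T -> R) (l l' : R) :
  u @ F --> l -> v @ F --> l' -> (\forall i \near F, u i <= v i) -> l <= l'.
Proof.
move=> /cvgrPdist_le ul /cvgrPdist_le vl uv.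
apply/ler_addgt0Pl => e e0; have e20 : 0 < e / 2 by rewrite divr_gt0.
have [i [[+ +] h3]] := filter_ex (filterI (filterI (ul _ e20) (vl _ e20)) uv).
by rewrite !ler_distlC => /andP[h1 h1'] /andP[h2 h2']; lra.
Qed.

(** Compactness of the segment in its near-covering form. Only [x] is confined to the segment, so
    points [y] just outside it are covered too. *)
Lemma continuous_unif_itv f (a b : R) : continuous f -> forall e : R, 0 < e ->
  exists2 d : R, 0 < d & forall x y : R, a <= x <= b -> `|x - y| < d -> `|f x - f y| <= e.
Proof.
move=> cf e e0.
have /compact_near_coveringP := @segment_compact R a b.
move=> /(_ _ 0^'+ (fun d x => forall y, `|x - y| < d -> `|f x - f y| <= e)).
have e20 : 0 < e / 2 by rewrite divr_gt0.
case.
- move=> x _; have /cvgrPdist_lt/(_ _ e20) := cf x.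
  rewrite -filter_from_ballE /= => -[r/= r0 xr].
  have r20 : 0 < r / 2 by rewrite divr_gt0.
  exists (ball x (r / 2), [set d | 0 < d < r / 2]) => /=.
    split; first exact: nbhsx_ballx.
    near=> d; rewrite /=; apply/andP; split; near: d; first exact: nbhs_right_gt.
    exact: nbhs_right_lt.
  move=> [z d]/= [xz /andP[d0 dr]] y zy.
  have H1 : `|f x - f z| < e / 2.
    apply: xr; rewrite /ball/=; apply: lt_le_trans xz _; lra.
  have H2 : `|f x - f y| < e / 2.
    apply: xr; rewrite /ball/=; move: xz; rewrite /ball/= => xz.
    rewrite (_ : x - y = (x - z) + (z - y)); last by ring.
    apply: (le_lt_trans (ler_normD _ _)); lra.
  rewrite (_ : f z - f y = (f x - f y) - (f x - f z)); last by ring.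
  apply: (le_trans (ler_normB _ _)); lra.
- move=> d /= d0 H; exists (d / 2); first by rewrite divr_gt0.
  move=> x y xab; apply: (H (d / 2)); last by rewrite /= in_itv/=.
    by rewrite /= sub0r normrN gtr0_norm ?divr_gt0// ltr_pdivrMr// ltr_pMr// ltr1n.
  by rewrite divr_gt0.
Unshelve. all: by end_near. Qed.

Lemma integrable_bounded d (T : measurableType d) (mu : {measure set T -> \bar R})
    (D : set T) (f : T -> R) (M : R) : measurable D -> (mu D < +oo)%E ->
  measurable_fun D f -> (forall x, D x -> `|f x| <= M) -> mu.-integrable D (EFin \o f).
Proof.
move=> mD muD mf fM; apply: measurable_bounded_integrable => //.
exists M; split; first exact: num_real.
by move=> y /ltW My x Dx; exact: le_trans (fM _ Dx) My.
Qed.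

Lemma norm_Rintegral_le d (T : measurableType d) (mu : {measure set T -> \bar R})
    (D : set T) (f g : T -> R) : measurable D ->
  mu.-integrable D (EFin \o f) -> mu.-integrable D (EFin \o g) ->
  (forall x, D x -> `|f x| <= g x) -> `|\int[mu]_(x in D) f x| <= \int[mu]_(x in D) g x.
Proof.
move=> mD fi gi fg; apply: (le_trans (le_normr_Rintegral mD fi)).
by apply: le_Rintegral => //; exact: (integrable_norm fi).
Qed.

End Approximation.

(** * Weierstrass approximation by Bernstein polynomials *)

Section Bernstein.
Context {R : realType}.
Implicit Types (x y e d M : R) (f : R -> R).

Definition bernstein_basis n k x : R :=
  'C(n, k)%:R * x ^+ k * (1 - x) ^+ (n - k).

Lemma bernstein_basis_ge0 n k x : 0 <= x <= 1 -> 0 <= bernstein_basis n k x.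
Proof.
by move=> /andP[x0 x1]; rewrite /bernstein_basis !mulr_ge0 ?exprn_ge0 ?subr_ge0.
Qed.

Lemma sum_bernstein n x : \sum_(k < n.+1) bernstein_basis n k x = 1.
Proof.
have := exprDn (1 - x) x n; rewrite subrK expr1n => E; rewrite [RHS]E.
by apply: eq_bigr => k _; rewrite /bernstein_basis -mulr_natr; ring.
Qed.

(** The identity [k C(n + 1, k) = (n + 1) C(n, k - 1)] absorbs the factor [k]. With [g] constant it
    gives the mean of the binomial law, with [g k = k] its second moment. *)
Lemma sum_bernsteinS n (g : nat -> R) x :
  \sum_(k < n.+2) k%:R * g k * bernstein_basis n.+1 k x =
  n.+1%:R * x * \sum_(k < n.+1) g k.+1 * bernstein_basis n k x.
Proof.
rewrite big_ord_recl /= !mul0r add0r mulr_sumr; apply: eq_bigr => k _.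
rewrite /bernstein_basis /bump/= add1n subSS exprS.
have := congr1 (fun j => j%:R : R) (mul_bin_diag n.+1 k).
rewrite /= !natrM.
move: (n.+1%:R) (k.+1%:R) ('C(n, k)%:R) ('C(n.+1, k.+1)%:R) => N K c c' /= E.
transitivity (K * c' * (g k.+1 * (x * x ^+ k) * (1 - x) ^+ (n - k))); first by ring.
by rewrite -E; ring.
Qed.

Lemma bernstein_var n x :
  \sum_(k < n.+2) (k%:R - n.+1%:R * x) ^+ 2 * bernstein_basis n.+1 k x =
  n.+1%:R * x * (1 - x).
Proof.
have S1 m : \sum_(k < m.+1) k%:R * bernstein_basis m k x = m%:R * x.
  case: m => [|m]; first by rewrite big_ord_recl big_ord0 /= !mul0r addr0.
  under eq_bigr do rewrite -[X in X * _]mulr1.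
  by rewrite (sum_bernsteinS m (fun=> 1)); under eq_bigr do rewrite mul1r;
    rewrite sum_bernstein mulr1.
have S2 := sum_bernsteinS n (fun k => k%:R) x.
have {}S2 : \sum_(k < n.+2) k%:R * k%:R * bernstein_basis n.+1 k x =
    n.+1%:R * x * (n%:R * x + 1).
  rewrite S2; congr (_ * _).
  under eq_bigr do rewrite -natr1 mulrDl mul1r.
  by rewrite big_split/= S1 sum_bernstein.
rewrite (eq_bigr (fun k : 'I_n.+2 => k%:R * k%:R * bernstein_basis n.+1 k x +
  ((- (2 * n.+1%:R * x)) * (k%:R * bernstein_basis n.+1 k x) +
   (n.+1%:R * x) ^+ 2 * bernstein_basis n.+1 k x))); last by move=> k _; ring.
rewrite !big_split/= -!mulr_sumr S2 S1 sum_bernstein -[n.+1%:R]natr1; ring.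
Qed.

(* Chebyshev's inequality for the binomial law with parameters n and x. *)
Lemma bernstein_approx f (e d M : R) n x : 0 < d -> 0 <= x <= 1 ->
  (forall y, 0 <= y <= 1 -> `|x - y| < d -> `|f x - f y| <= e) ->
  (forall y, 0 <= y <= 1 -> `|f x - f y| <= M) ->
  `|f x - \sum_(k < n.+2) f (k%:R / n.+1%:R) * bernstein_basis n.+1 k x|
    <= e + M / d ^+ 2 / n.+1%:R.
Proof.
move=> d0 x01 fd fM.
have n0 : 0 < n.+1%:R :> R by rewrite ltr0n.
have e0 : 0 <= e by apply: le_trans (fd x x01 _); rewrite ?subrr normr0.
have M0 : 0 <= M by apply: le_trans (fM x x01); rewrite normr_ge0.
have -> : f x = \sum_(k < n.+2) f x * bernstein_basis n.+1 k x.
  by rewrite -mulr_sumr sum_bernstein mulr1.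
rewrite -sumrB; apply: (le_trans (ler_norm_sum _ _ _)).
have : \sum_(k < n.+2) (e * bernstein_basis n.+1 k x + M / d ^+ 2 / n.+1%:R ^+ 2 *
    ((k%:R - n.+1%:R * x) ^+ 2 * bernstein_basis n.+1 k x)) <= e + M / d ^+ 2 / n.+1%:R.
  rewrite big_split/= -!mulr_sumr sum_bernstein bernstein_var mulr1 lerD2l.
  rewrite (_ : _ * (_ * x * _) = M / d ^+ 2 / n.+1%:R * (x * (1 - x))); last first.
    by field; rewrite ?gt_eqF.
  rewrite -[leRHS]mulr1 ler_wpM2l ?divr_ge0 ?exprn_ge0// ?ltW//.
  by case/andP: x01 => x0 x1; nra.
apply: le_trans; apply: ler_sum => k _.
have b0 := bernstein_basis_ge0 n.+1 k x01.
rewrite -mulrBl normrM (ger0_norm b0) [X in _ <= _ + X]mulrA -mulrDl ler_wpM2r//.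
have k01 : 0 <= (k%:R / n.+1%:R : R) <= 1.
  by rewrite divr_ge0//= ler_pdivrMr// mul1r ler_nat -ltnS.
have [xk|xk] := ltP `|x - k%:R / n.+1%:R| d.
  apply: le_trans (fd _ k01 xk) _; rewrite lerDl mulr_ge0 ?sqr_ge0//.
  by rewrite !divr_ge0 ?exprn_ge0// ltW.
apply: le_trans (fM _ k01) _; rewrite -[leLHS]add0r lerD//.
rewrite (_ : _ * _ = M * ((x - k%:R / n.+1%:R) ^+ 2 / d ^+ 2)); last first.
  by field; rewrite ?gt_eqF.
rewrite -[leLHS]mulr1 ler_wpM2l// ler_pdivlMr ?exprn_gt0// mul1r.
by rewrite -[leRHS]real_normK ?num_real// lerXn2r// nnegrE ltW.
Qed.

Theorem weierstrass_approx f : continuous f -> forall e, 0 < e ->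
  exists p : {poly R}, forall x, 0 <= x <= 1 -> `|f x - p.[x]| <= e.
Proof.
move=> cf e e0; have e20 : 0 < e / 2 by rewrite divr_gt0.
have [d d0 fd] := @continuous_unif_itv R f 0 1 cf _ e20.
have cf01 : {within `[0, 1], continuous f} by apply: continuous_subspaceT.
have [xM _ hM] := EVT_max ler01 cf01; have [xm _ hm] := EVT_min ler01 cf01.
pose M := f xM - f xm.
have fM x y : 0 <= x <= 1 -> 0 <= y <= 1 -> `|f x - f y| <= M.
  move=> x01 y01; have := hM x; have := hM y; have := hm x; have := hm y.
  rewrite !in_itv/= x01 y01 /M => /(_ isT) ? /(_ isT) ? /(_ isT) ? /(_ isT) ?.
  by rewrite ler_norml; apply/andP; split; lra.
(* This degree makes the Chebyshev term [M / d^2 / (n + 1)] at most [e / 2]. *)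
pose n := Num.truncn (M / d ^+ 2 / (e / 2)).
exists (\sum_(k < n.+2) (f (k%:R / n.+1%:R) * 'C(n.+1, k)%:R) *:
          ('X ^+ k * (1 - 'X) ^+ (n.+1 - k))) => x x01.
rewrite horner_sum.
rewrite (eq_bigr (fun k : 'I_n.+2 => f (k%:R / n.+1%:R) * bernstein_basis n.+1 k x)).
  apply: (le_trans (bernstein_approx n d0 x01 _ _)).
  - by move=> y _; exact: fd.
  - by move=> y y01; exact: fM.
  rewrite {2}(splitr e) lerD2l ler_pdivrMr// -ler_pdivrMl//.
  by rewrite mulrC ltW// truncnS_gt.
by move=> k _; rewrite !hornerE /bernstein_basis; ring.
Qed.

End Bernstein.

(** * Riesz representation on [0, 1] *)

Section Riesz.
Context {R : realType}.
Implicit Types (L : (R -> R) -> R) (f g : R -> R) (x y t N M e c : R).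

(* Only the values on the segment [0, 1] of the functions are relevant. *)
Definition positive_functional L :=
  [/\ forall f g, continuous f -> continuous g ->
        L (fun x => f x + g x) = L f + L g,
      forall c f, continuous f -> L (fun x => c * f x) = c * L f,
      forall f, continuous f -> (forall x, 0 <= x <= 1 -> 0 <= f x) -> 0 <= L f &
      L (fun=> 1) = 1].

Section positive_functional_theory.
Variables (L : (R -> R) -> R) (pL : positive_functional L).

Lemma functionalB f g : continuous f -> continuous g ->
  L (fun x => f x - g x) = L f - L g.
Proof.
case: pL => LD LM _ _ cf cg.
have -> : (fun x => f x - g x) = (fun x => f x + -1 * g x).
  by apply/funext => x; rewrite mulN1r.
rewrite LD// ?LM// ?mulN1r// => x.
by apply: cvgM; [exact: cvg_cst|exact: cg].
Qed.

Lemma functional_le f g : continuous f -> continuous g ->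
  (forall x, 0 <= x <= 1 -> f x <= g x) -> L f <= L g.
Proof.
move=> cf cg fg; rewrite -subr_ge0 -functionalB//.
case: pL => _ _ + _; apply => [x|x x01]; last by rewrite subr_ge0 fg.
by apply: cvgB; [exact: cg|exact: cf].
Qed.

Lemma functional_cst c : L (fun=> c) = c.
Proof.
case: pL => _ LM _ L1.
have -> : (fun=> c) = (fun x : R => c * 1) by apply/funext => x; rewrite mulr1.
by rewrite (LM c (fun=> 1)) ?L1 ?mulr1// => x; exact: cvg_cst.
Qed.

Lemma functional_norm_le f e : continuous f ->
  (forall x, 0 <= x <= 1 -> `|f x| <= e) -> `|L f| <= e.
Proof.
move=> cf fe; rewrite ler_norml -{1}(functional_cst (- e)) -{2}(functional_cst e).
apply/andP; split; apply: functional_le => //; try by move=> x; exact: cvg_cst.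
  by move=> x /fe; rewrite ler_norml => /andP[].
by move=> x /fe; rewrite ler_norml => /andP[].
Qed.

Lemma continuous_bigsum (I : Type) (s : seq I) (F : I -> R -> R) :
  (forall i, continuous (F i)) -> continuous (fun x => \sum_(i <- s) F i x).
Proof.
move=> cF; elim: s => [|i s IH] x.
  by under eq_fun do rewrite big_nil; exact: cvg_cst.
by under eq_fun do rewrite big_cons; apply: cvgD; [exact: cF|exact: IH].
Qed.

Lemma functional_sum (I : Type) (s : seq I) (F : I -> R -> R) :
  (forall i, continuous (F i)) ->
  L (fun x => \sum_(i <- s) F i x) = \sum_(i <- s) L (F i).
Proof.
move=> cF; elim: s => [|i s IH].
  by under eq_fun do rewrite big_nil; rewrite functional_cst big_nil.
under eq_fun do rewrite big_cons.
by case: pL => LD _ _ _; rewrite LD ?IH ?big_cons//; exact: continuous_bigsum.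
Qed.

End positive_functional_theory.

(** Continuous stand-in for the indicator of []-oo, x]]: it is 1 up to [x], then falls with slope
    [- N] and reaches 0 at [x + 1 / N]. *)
Definition ramp (x N t : R) : R := Num.min 1 (Num.max 0 (1 + N * (x - t))).

Lemma continuous_ramp x N : continuous (ramp x N).
Proof.
move=> t; have H : {for t, continuous (fun s : R => 1 + N * (x - s))}.
  apply: cvgD; first exact: cvg_cst.
  by apply: cvgM; [exact: cvg_cst|apply: cvgB; [exact: cvg_cst|exact: cvg_id]].
exact: (continuous_min (cvg_cst _) (continuous_max (cvg_cst _) H)).
Qed.

Lemma ramp_ge0 x N t : 0 <= ramp x N t.
Proof. by rewrite /ramp le_min ler01/= le_max lexx. Qed.

Lemma ramp_le1 x N t : ramp x N t <= 1.
Proof. by rewrite /ramp ge_min lexx. Qed.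

Lemma ramp1 x N t : 0 <= N -> t <= x -> ramp x N t = 1.
Proof.
move=> N0 tx; have := ramp_le1 x N t; rewrite le_eqVlt => /predU1P[//|].
rewrite /ramp gt_min ltxx/= gt_max => /andP[_].
by rewrite ltNge lerDl mulr_ge0// subr_ge0.
Qed.

Lemma ramp0 x N t : 0 < N -> x + N^-1 <= t -> ramp x N t = 0.
Proof.
move=> N0 xt; apply/eqP; rewrite eq_le ramp_ge0 andbT /ramp ge_min; apply/orP; right.
rewrite ge_max lexx/=; have : N * (t - x) >= 1; last lra.
by rewrite mulrC -ler_pdivrMr// mul1r; lra.
Qed.

Lemma ramp_le x y N t : 0 <= N -> x <= y -> ramp x N t <= ramp y N t.
Proof.
move=> N0 xy; rewrite /ramp; apply: le_min2 => //; apply: le_max2 => //.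
by rewrite lerD2l ler_wpM2l// lerB.
Qed.

Lemma ramp_lip x y N t : 0 <= N -> x <= y -> ramp y N t <= ramp x N t + N * (y - x).
Proof.
move=> N0 xy; have d0 : 0 <= N * (y - x) by rewrite mulr_ge0// subr_ge0.
rewrite {2}/ramp addr_minl addr_maxl le_min; apply/andP; split.
  by apply: (le_trans (ramp_le1 _ _ _)); rewrite lerDl.
rewrite le_max /ramp !ge_min !ge_max.
have -> : 1 + N * (x - t) + N * (y - x) = 1 + N * (y - t) by ring.
rewrite lexx add0r d0/= !andbT.
have [h|h] := leP 0 (1 + N * (y - t)); first by rewrite !orbT.
by rewrite (le_trans (ltW h) d0) !orbT.
Qed.

Lemma ramp_decr x N M t : 0 < N -> N <= M -> ramp x M t <= ramp x N t.
Proof.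
move=> N0 NM; have M0 : 0 < M by apply: lt_le_trans NM.
have [tx|xt] := leP t x; first by rewrite !ramp1// ltW.
rewrite /ramp; apply: le_min2 => //; apply: le_max2 => //.
by rewrite lerD2l; nra.
Qed.

(** The shift by one puts [node n 0] at [- 1 / (n + 1)], so that its ramp vanishes on [[0, 1]] once
    [N >= n + 1]; [node n 1] is 0 and [node n (n + 2)] is 1. *)
Definition node (n i : nat) : R := (i%:R - 1) / n.+1%:R.

Lemma le_node n i j : (i <= j)%N -> node n i <= node n j.
Proof. by move=> ij; rewrite ler_pM2r ?invr_gt0 ?ltr0n// lerB// ler_nat. Qed.

(** The differences of consecutive ramps are nonnegative, sum to 1 on [[0, 1]], and each vanishes at
    distance at least [d] from its node, both ramps being 1 or both 0 there: a partition of unity on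
    whose pieces [f] varies by at most [e]. *)
Lemma ramp_approx f e : continuous f -> 0 < e -> exists n, forall N t,
  n.+1%:R <= N -> 0 <= t <= 1 ->
  `|f t - \sum_(i < n.+2) f (node n i.+1) *
      (ramp (node n i.+1) N t - ramp (node n i) N t)| <= e.
Proof.
move=> cf e0; have [d d0 fd] := @continuous_unif_itv R f 0 1 cf _ e0.
pose n := Num.truncn d^-1; exists n => N t nN t01.
have n0 : 0 < n.+1%:R :> R by rewrite ltr0n.
have N0 : 0 < N by apply: lt_le_trans nN.
have nd : n.+1%:R^-1 < d by rewrite invf_plt ?posrE// truncnS_gt.
pose D (i : nat) := ramp (node n i.+1) N t - ramp (node n i) N t.
have D0 i : 0 <= D i.
  by rewrite subr_ge0; apply: ramp_le; [exact: ltW|exact: le_node].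
have DS : \sum_(i < n.+2) D i = 1.
  rewrite -(big_mkord xpredT D) telescope_sumr// ramp1 ?(ltW N0)//; last first.
    rewrite /node -natr1 addrK divff ?gt_eqF//; by case/andP: t01.
  rewrite ramp0 ?subr0// /node sub0r mulN1r.
  case/andP: t01 => + _; apply: le_trans; rewrite addrC subr_le0.
  by rewrite lef_pV2.
have -> : f t = \sum_(i < n.+2) f t * D i by rewrite -mulr_sumr DS mulr1.
rewrite -sumrB; apply: (le_trans (ler_norm_sum _ _ _)).
rewrite -[leRHS]mulr1 -DS mulr_sumr; apply: ler_sum => i _.
rewrite -mulrBl normrM (ger0_norm (D0 _)).
have [h|h] := ltP `|t - node n i.+1| d; first by rewrite ler_wpM2r// fd.
suff -> : D i = 0 by rewrite !mulr0.
have nE : node n i.+1 = node n i + n.+1%:R^-1.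
  by rewrite /node -(natr1 i); field; rewrite gt_eqF.
have NV : N^-1 <= n.+1%:R^-1 by rewrite lef_pV2 ?posrE.
have [h1|h1] := leP t (node n i).
  by rewrite /D !ramp1 ?(ltW N0) ?subrr// (le_trans h1)// le_node.
have h2 : node n i.+1 + N^-1 <= t.
  move: h NV nE nd; move: (n.+1%:R^-1) (N^-1) => u v; rewrite ler_normr => /orP[h|h] uv nE ud;
    clear -h uv nE ud h1; lra.
rewrite /D !ramp0 ?subrr//; apply: le_trans h2; rewrite lerD2r le_node//.
Qed.

(** Combinations of ramps approximate [f] uniformly, hence under both functionals, which then only
    have to be compared on finitely many steep ramps. *)
Lemma positive_functional_eq L L' : positive_functional L -> positive_functional L' ->
  (forall x e, 0 < e -> exists N0, forall N, N0 <= N ->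
     `|L (ramp x N) - L' (ramp x N)| <= e) ->
  forall f, continuous f -> L f = L' f.
Proof.
move=> pL pL' LL' f cf; apply/eqP; rewrite -subr_eq0 -normr_le0.
apply/ler_addgt0Pl => e e0; rewrite addr0.
have e40 : 0 < e / 4 by rewrite divr_gt0.
have [n nf] := ramp_approx cf e40.
(* [C] bounds the sum of the coefficients. Each coefficient multiplies two ramps, so a tolerance
   [e / (4 C)] per ramp costs [e / 2], and the two uniform approximations cost [e / 4] each. The
   summand 1 keeps [C] positive. *)
pose C : R := \sum_(i < n.+2) `|f (node n i.+1)| + 1.
have C0 : 0 < C by rewrite ltr_wpDl// sumr_ge0.
have d0 : 0 < e / (4 * C) by rewrite divr_gt0// mulr_gt0.
have [N nN HN] : exists2 N, n.+1%:R <= N & forall i : 'I_n.+3,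
    `|L (ramp (node n i) N) - L' (ramp (node n i) N)| <= e / (4 * C).
  have /choice[g gP] : forall i : 'I_n.+3, exists g : R, forall N : R, g <= N ->
      `|L (ramp (node n i) N) - L' (ramp (node n i) N)| <= e / (4 * C).
    by move=> i; exact: LL'.
  exists (Num.max n.+1%:R (\big[Num.max/0]_(i < n.+3) g i)).
    by rewrite le_max lexx.
  by move=> i; apply: gP; rewrite le_max; apply/orP; right; apply: le_bigmax.
have cS : forall i, continuous (fun t => f (node n i.+1) *
      (ramp (node n i.+1) N t - ramp (node n i) N t)).
  move=> i t; apply: cvgM; first exact: cvg_cst.
  by apply: cvgB; exact: continuous_ramp.
have main K : positive_functional K -> `|K f - \sum_(i < n.+2) f (node n i.+1) *
   (K (ramp (node n i.+1) N) - K (ramp (node n i) N))| <= e / 4.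
  move=> pK; have : forall i, K (fun t => f (node n i.+1) *
      (ramp (node n i.+1) N t - ramp (node n i) N t)) = f (node n i.+1) *
   (K (ramp (node n i.+1) N) - K (ramp (node n i) N)).
    move=> i; case: (pK) => _ KM _ _; rewrite KM ?functionalB//; try exact: continuous_ramp.
    by move=> t; apply: cvgB; exact: continuous_ramp.
  move=> KE; under eq_bigr do rewrite -KE.
  have cT : continuous (fun t => \sum_(i < n.+2) f (node n i.+1) *
      (ramp (node n i.+1) N t - ramp (node n i) N t)).
    exact: (@continuous_bigsum _ (index_enum 'I_n.+2) (fun i t => f (node n i.+1) *
      (ramp (node n i.+1) N t - ramp (node n i) N t)) (fun i => cS i)).
  rewrite -functional_sum// -functionalB//.
  apply: functional_norm_le => //.
    by move=> t; apply: cvgB; [exact: cf|exact: cT].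
  by move=> t t01; exact: nf.
have HL := main _ pL; have HL' := main _ pL'.
pose D (i : 'I_n.+2) := f (node n i.+1) *
   ((L (ramp (node n i.+1) N) - L' (ramp (node n i.+1) N)) -
    (L (ramp (node n i) N) - L' (ramp (node n i) N))).
have HD : `|\sum_(i < n.+2) D i| <= e / 2.
  apply: (le_trans (ler_norm_sum _ _ _)).
  apply: (@le_trans _ _ (\sum_(i < n.+2) `|f (node n i.+1)| * (2 * (e / (4 * C))))).
    apply: ler_sum => i _; rewrite normrM ler_wpM2l//.
    apply: (le_trans (ler_normB _ _)).
    have := HN (lift ord0 i); have := HN (widen_ord (leqnSn _) i).
    by rewrite /= /bump/= add1n; lra.
  rewrite -mulr_suml.
  apply: (@le_trans _ _ (C * (2 * (e / (4 * C))))).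
    by apply: ler_wpM2r; [rewrite mulr_ge0// ltW|rewrite /C lerDl].
  by rewrite le_eqVlt; apply/orP; left; apply/eqP; field; rewrite gt_eqF.
have -> : L f - L' f = (L f - \sum_(i < n.+2) f (node n i.+1) *
   (L (ramp (node n i.+1) N) - L (ramp (node n i) N))) -
   (L' f - \sum_(i < n.+2) f (node n i.+1) *
   (L' (ramp (node n i.+1) N) - L' (ramp (node n i) N))) + \sum_(i < n.+2) D i.
  have -> : \sum_(i < n.+2) D i = \sum_(i < n.+2) f (node n i.+1) *
     (L (ramp (node n i.+1) N) - L (ramp (node n i) N)) -
     \sum_(i < n.+2) f (node n i.+1) *
     (L' (ramp (node n i.+1) N) - L' (ramp (node n i) N)).
    by rewrite -sumrB; apply: eq_bigr => i _; rewrite /D; ring.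
  by ring.
apply: (le_trans (ler_normD _ _)); have := ler_normB (L f - \sum_(i < n.+2) f (node n i.+1) *
   (L (ramp (node n i.+1) N) - L (ramp (node n i) N)))
   (L' f - \sum_(i < n.+2) f (node n i.+1) *
   (L' (ramp (node n i.+1) N) - L' (ramp (node n i) N))).
by lra.
Qed.

Section representation.
Variables (L : (R -> R) -> R) (pL : positive_functional L).

Let Lpos f : continuous f -> (forall x, 0 <= x <= 1 -> 0 <= f x) -> 0 <= L f.
Proof. by case: pL => _ _ + _; exact. Qed.

Let S x := [set L (ramp x N) | N in [set N : R | 0 < N]].

(** Distribution function of the measure to be built: the ramps decrease to the indicator of []-oo,
    x]] as [N] grows. *)
Let F x := inf (S x).

Let S_lb x : has_lbound (S x).
Proof.
exists 0 => _ [N _ <-]; apply: Lpos; first exact: continuous_ramp.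
by move=> t _; exact: ramp_ge0.
Qed.

Let S_neq0 x : S x !=set0.
Proof. by exists (L (ramp x 1)); exists 1 => //=. Qed.

Let F_le x N : 0 < N -> F x <= L (ramp x N).
Proof. by move=> N0; apply: ge_inf => //; exists N. Qed.

Let F_ge x c : (forall N, 0 < N -> c <= L (ramp x N)) -> c <= F x.
Proof. by move=> h; apply: lb_le_inf => // _ [N N0 <-]; exact: h. Qed.

Let F_cvg x e : 0 < e -> exists2 N0, 0 < N0 & forall N, N0 <= N ->
  L (ramp x N) <= F x + e.
Proof.
move=> e0; have [_ [N N0 <-] NF] := inf_adherent e0 (conj (S_neq0 x) (S_lb x)).
exists N => // M NM; apply: le_trans (ltW NF); apply: functional_le => //.
- exact: continuous_ramp.
- exact: continuous_ramp.
- by move=> t _; exact: ramp_decr.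
Qed.

Let F_nd : {homo F : x y / x <= y}.
Proof.
move=> x y xy; apply: F_ge => N N0; apply: (le_trans (F_le x N0)).
apply: functional_le => //; try exact: continuous_ramp.
by move=> t _; apply: ramp_le => //; exact: ltW.
Qed.

(** A single good ramp suffices: moving its foot from [x] to [y] raises it by at most
    [N (y - x)]. *)
Let F_right x e : 0 < e -> exists2 d, 0 < d & forall y, y < x + d -> F y <= F x + e.
Proof.
move=> e0; have e20 : 0 < e / 2 by rewrite divr_gt0.
have [N N0 NF] := F_cvg x e20; exists (e / 2 / N); first by rewrite divr_gt0.
move=> y yx; have [xy|/ltW yx'] := leP x y; last first.
  by apply: (le_trans (F_nd yx')); rewrite lerDl ltW.
apply: (le_trans (F_le y N0)).
apply: (@le_trans _ _ (L (fun t => ramp x N t + e / 2))).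
  apply: functional_le => //; first exact: continuous_ramp.
    by move=> t; apply: cvgD; [exact: continuous_ramp|exact: cvg_cst].
  move=> t _; apply: (le_trans (ramp_lip t (ltW N0) xy)); rewrite lerD2l.
  by rewrite mulrC -ler_pdivlMr// lerBlDl ltW.
case: (pL) => LD _ _ _; rewrite (LD (ramp x N) (fun=> e / 2)).
- by rewrite (functional_cst pL); have := NF N (lexx _); lra.
- exact: continuous_ramp.
- by move=> t; exact: cvg_cst.
Qed.

Let F_ge0 x : 0 <= F x.
Proof.
apply: F_ge => N N0; apply: Lpos; first exact: continuous_ramp.
by move=> t _; exact: ramp_ge0.
Qed.

Let F0 x : x < 0 -> F x = 0.
Proof.
move=> x0; apply/eqP; rewrite eq_le F_ge0 andbT.
have N0 : 0 < (- x)^-1 by rewrite invr_gt0 oppr_gt0.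
apply: (le_trans (F_le x N0)); rewrite -[leRHS](functional_cst pL).
apply: functional_le => //; first exact: continuous_ramp.
  by move=> t; exact: cvg_cst.
by move=> t /andP[t0 _]; rewrite ramp0// invrK subrr.
Qed.

Let F1 x : 1 <= x -> F x = 1.
Proof.
move=> x1; have c1 : continuous ((fun=> 1) : R -> R) by move=> t; exact: cvg_cst.
have LE N : 0 < N -> 1 <= L (ramp x N) <= 1.
  move=> N0; have cr := @continuous_ramp x N; apply/andP; split.
    have := functional_le pL c1 cr; rewrite functional_cst//; apply.
    by move=> t /andP[_ t1]; rewrite ramp1 ?(ltW N0)// (le_trans t1).
  have := functional_le pL cr c1; rewrite functional_cst//; apply.
  by move=> t _; exact: ramp_le1.
apply/eqP; rewrite eq_le F_ge ?andbT; last by move=> N /LE/andP[].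
by apply: (le_trans (F_le x ltr01)); have /andP[] := LE 1 ltr01.
Qed.

Let F_rc : right_continuous F.
Proof.
move=> x; apply/cvgrPdist_le => e e0; have [d d0 dF] := F_right x e0.
near=> y; have xy : x < y by near: y; exact: nbhs_right_gt.
rewrite ler0_norm ?subr_le0 ?F_nd ?(ltW xy)// opprB lerBlDl.
apply: dF; near: y; apply: nbhs_right_lt; by rewrite ltrDl.
Unshelve. all: by end_near. Qed.

Let F_Ny : F @ -oo --> (0 : R).
Proof.
apply: cvg_near_cst; near=> x; apply: F0; near: x; exact: nbhs_ninfty_lt.
Unshelve. all: by end_near. Qed.

Let F_y : F @ +oo --> (1 : R).
Proof.
apply: cvg_near_cst; near=> x; apply: F1; near: x; exact: nbhs_pinfty_ge.
Unshelve. all: by end_near. Qed.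

Let cF : cumulativeBounded (0 : R) (1 : R) := HB.pack F
  (isCumulative.Build R _ R F F_nd F_rc)
  (isCumulativeBounded.Build R 0 1 F F_Ny F_y).

Let rho : {measure set (measurableTypeR R) -> \bar R} := lebesgue_stieltjes_measure cF.

Let rhoT : rho setT = 1%E.
Proof. exact: (probability_setT (lebesgue_stieltjes_measure cF : probability _ R)). Qed.

Let rho_oc a b : a <= b -> rho `]a, b]%classic = (F b - F a)%:E.
Proof.
move=> ab; rewrite /rho/= /lebesgue_stieltjes_measure /measure_extension.
rewrite measurable_mu_extE/=; last exact: is_ocitv.
by rewrite wlength_itv_bnd.
Qed.

Let rho_neg : rho `]-1, 0[%classic = 0%E.
Proof.
apply: measure_negligible => //.
have -> : `]-1, 0[%classic = \bigcup_n `]-1, - n.+1%:R^-1]%classic :> set R.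
  apply/seteqP; split => x /=.
    rewrite in_itv/= => /andP[x1 x0]; exists (Num.truncn (- x)^-1) => //=.
    rewrite in_itv/= x1/= lerNr ltW// invf_plt ?posrE ?oppr_gt0//.
    exact: truncnS_gt.
  move=> [n _ /=]; rewrite !in_itv/= => /andP[-> xn]/=.
  by apply: (le_lt_trans xn); rewrite oppr_lt0 invr_gt0 ltr0n.
apply: negligible_bigcup => n; exists `]-1, - n.+1%:R^-1]%classic; split => //.
have n0 : 0 < n.+1%:R^-1 :> R by rewrite invr_gt0 ltr0n.
transitivity ((F (- n.+1%:R^-1) - F (-1))%:E).
  by apply: rho_oc; rewrite lerN2 invf_le1 ?ltr0n// ler1n.
by rewrite !F0 ?subrr ?oppr_lt0.
Qed.

Let D : set R := `[0, 1]%classic.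

(** The Stieltjes measure is computed on intervals open on the left, which would miss the point 0.
    One starts from []-1, y]] and removes []-1, 0[], which is null because [F] vanishes on negative
    numbers. *)
Let rhoD x : rho (D `&` `]-oo, x]) = (F x)%:E.
Proof.
have [x0|x0] := ltP x 0.
  rewrite F0// (_ : _ `&` _ = set0) ?measure0//; apply/seteqP; split => // t.
  rewrite /D /= !in_itv/= => -[/andP[t0 _] tx].
  by have := le_lt_trans (le_trans t0 tx) x0; rewrite ltxx.
pose y := Num.min x 1.
have y0 : 0 <= y by rewrite /y le_min x0/=.
have -> : F x = F y.
  by rewrite /y; have [//|x1] := leP x 1; rewrite !F1// ltW.
have : rho `]-1, y]%classic = (F y)%:E.
  transitivity ((F y - F (-1))%:E); last by rewrite (F0 (x := -1)) ?subr0 ?oppr_lt0.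
  by apply: rho_oc; rewrite (le_trans _ y0)// oppr_le0.
rewrite (_ : `]-1, y]%classic = `]-1, 0[ `|` (D `&` `]-oo, x])); last first.
  apply/seteqP; split => t; rewrite /D /= !in_itv/= /y le_min.
    by move=> /andP[-> /andP[-> ->]]; have [t0|t0] := ltP t 0; [left|right].
  case=> [/andP[-> t0]|[/andP[t0 t1] tx]].
    by rewrite /= (le_trans (ltW t0))//= (le_trans (ltW t0)).
  by rewrite tx t1 (lt_le_trans _ t0)// oppr_lt0.
rewrite measureU//; first by rewrite [X in (X + _)%E](_ : _ = 0%E) ?add0e//; exact: rho_neg.
  by apply: measurableI; apply: measurable_itv.
apply/seteqP; split => t //; rewrite /D /= !in_itv/= => -[/andP[_ t0] [/andP[t0' _] _]].
by have := lt_le_trans t0 t0'; rewrite ltxx.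
Qed.

Let rhoD1 : rho D = 1%E.
Proof.
have := rhoD 1; rewrite F1// (_ : D `&` _ = D)//; apply/seteqP; split => [t []//|t].
by rewrite /D /= !in_itv/= => /andP[-> ->].
Qed.

Let mD : measurable (D : set (measurableTypeR R)).
Proof. exact: measurable_itv. Qed.

Let rho_int f : continuous f -> rho.-integrable D (EFin \o f).
Proof.
move=> cf; have cf01 : {within `[0, 1], continuous (fun x => `|f x|)}.
  by apply: continuous_subspaceT => x; apply: cvg_norm; exact: cf.
have [xM _ hM] := EVT_max ler01 cf01.
apply: (@integrable_bounded R _ (measurableTypeR R) rho D f `|f xM|) => //.
  by rewrite rhoD1 ltry.
by apply: measurable_funTS; exact: continuous_measurable_fun.
Qed.

Let L' f := \int[rho]_(x in D) f x.

Let pL' : positive_functional L'.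
Proof.
split.
- by move=> f g cf cg; rewrite /L' RintegralD//; exact: rho_int.
- by move=> c f cf; rewrite /L' RintegralZl//; exact: rho_int.
- by move=> f cf f0; apply: Rintegral_ge0 => x; rewrite /D /= in_itv/=; exact: f0.
- by rewrite /L' Rintegral_cst// rhoD1 mulr1.
Qed.

(** The ramp lies between the indicators of []-oo, x]] and []-oo, x + 1 / N]]. *)
Let L'_ramp x N : 0 < N -> F x <= L' (ramp x N) <= F (x + N^-1).
Proof.
move=> N0.
have mI y : measurable (`]-oo, y]%classic : set (measurableTypeR R)).
  exact: measurable_itv.
have II y : rho.-integrable D (EFin \o \1_(`]-oo, y]%classic : set R)).
  apply: (@integrable_bounded R _ (measurableTypeR R) rho D _ 1) => //.
    by rewrite rhoD1 ltry.
  by move=> t _; rewrite indicE; case: (_ \in _); rewrite ?normr1 ?normr0.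
have IE y : L' \1_(`]-oo, y]%classic : set R) = F y.
  rewrite /L' /Rintegral integral_indic// setIC; have -> := rhoD y; by [].
rewrite -!IE; apply/andP; split; apply: le_Rintegral => //; try exact/rho_int/continuous_ramp.
- move=> t _; rewrite indicE; case: (boolP (t \in _)); last by rewrite ramp_ge0.
  by rewrite inE/= in_itv/= => tx; rewrite ramp1// ltW.
- move=> t _; rewrite indicE; case: (boolP (t \in _)); first by rewrite ramp_le1.
  by rewrite notin_setE/= in_itv/= => /negP; rewrite -ltNge => /ltW tx; rewrite ramp0.
Qed.

Theorem riesz_representation : exists rho : {measure set (measurableTypeR R) -> \bar R},
  [/\ rho (~` `[0, 1]%classic) = 0%E, rho `[0, 1]%classic = 1%E &
  forall f, continuous f -> \int[rho]_(x in `[0, 1]) f x = L f].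
Proof.
exists rho; split; [|exact: rhoD1|].
  have mCD : measurable (~` D : set (measurableTypeR R)) by exact: measurableC.
  have E : 1%E = (rho D + rho (~` D))%E.
    by rewrite -(measureU rho mD mCD (setICr D)) setUCr; exact/esym/rhoT.
  have fC : rho (~` D) \is a fin_num.
    rewrite ge0_fin_numE//; apply: (@le_lt_trans _ _ 1%E); rewrite ?ltry//.
    by rewrite E leeDr.
  move: E; rewrite rhoD1 -[X in _ = (_ + X)%E -> _]fineK// -EFinD => -[] h.
  by rewrite -[LHS]fineK//; congr EFin; lra.
apply: (positive_functional_eq pL' pL) => x e e0.
have [N1 N10 HN1] := F_cvg x e0; have [d d0 Hd] := F_right x e0.
(* [N1] brings [L (ramp x N)] within [e] of [F x]; [2 / d] gives [1 / N < d], so that right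
   continuity controls [F (x + 1 / N)]. *)
exists (Num.max N1 (2 / d)) => N; rewrite ge_max => /andP[NN1 Nd].
have N0 : 0 < N by apply: lt_le_trans NN1.
have /andP[h1 h2] := L'_ramp x N0; have h3 := HN1 _ NN1; have h4 := F_le x N0.
have h5 : F (x + N^-1) <= F x + e.
  apply: Hd; rewrite ltrD2l invf_plt ?posrE//; apply: lt_le_trans Nd.
  by rewrite ltr_pMl ?invr_gt0// ltr1n.
by rewrite ler_norml; apply/andP; split; lra.
Qed.

End representation.

End Riesz.

(** * The method of moments *)

Section ExpTaylor.
Context {R : realType}.
Implicit Types (x y : R).

Definition expN_taylor n : {poly R} := \sum_(i < n) ((-1) ^+ i / i`!%:R) *: 'X^i.

Lemma deriv_expN_taylor n : (expN_taylor n.+1)^`() = - expN_taylor n.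
Proof.
rewrite /expN_taylor big_ord_recl /= derivD derivZ expr0 derivC scaler0 add0r.
rewrite raddf_sum/= -sumrN; apply: eq_bigr => i _.
rewrite /bump/= add1n derivZ derivXn -scalerMnr scalerMnl -scaleNr; congr (_ *: _).
rewrite -[LHS]mulr_natr.
rewrite factS natrM exprS; move: (pnatr_eq0 R i.+1) (pnatr_eq0 R i`!).
by rewrite (gtn_eqF (fact_gt0 i)) /= => /negbT h1 /negbT h2; field; apply/andP; split.
Qed.

(** The bound is integrated once per order. With [T_n] for [expN_taylor n] and [s] equal to 1 or -1,
    the function [y^(n+1) / (n+1)! - s T_(n+1)(y) + s e^(- y)] vanishes at 0 and has derivative
    [y^n / n! - s (e^(- y) - T_n(y))], nonnegative by induction. *)
Lemma expN_taylor_le n y : 0 <= y ->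
  `|expR (- y) - (expN_taylor n).[y]| <= y ^+ n / n`!%:R.
Proof.
elim: n y => [|n IH] y y0.
  rewrite /expN_taylor big_ord0 hornerC subr0 expr0 divr1.
  by rewrite ger0_norm ?expR_ge0// -expR0 ler_expR oppr_le0.
have key (s : R) : `|s| <= 1 ->
    0 <= y ^+ n.+1 / n.+1`!%:R - s * (expN_taylor n.+1).[y] + s * expR (- y).
  move=> s1.
  pose q : {poly R} := n.+1`!%:R^-1 *: 'X^(n.+1) - s *: expN_taylor n.+1.
  pose f : R -> R := horner q + s *: (expR \o -%R).
  have df x : is_derive x 1 f (q^`().[x] + s * (- expR (- x))).
    rewrite -[- expR (- x)]mulrN1; exact: is_deriveD.
  have cf : {within `[0, y], continuous f}.
    apply: continuous_subspaceT => x; apply/differentiable_continuous.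
    by apply/derivable1_diffP; have [] := df x.
  have [c] := MVT_segment y0 (fun x _ => df x) cf.
  rewrite in_itv/= => /andP[c0 cy].
  have f0 : f 0 = 0.
    rewrite /f !fctE/= /GRing.scale/= oppr0 expR0 /q !hornerE expr0n/= mulr0 add0r.
    have -> : (expN_taylor n.+1).[0] = 1.
      rewrite horner_sum big_ord_recl/= big1 ?addr0.
        by rewrite hornerZ hornerXn !expr0 mulr1 fact0 divr1.
      by move=> i _; rewrite hornerZ hornerXn expr0n/= mulr0.
    by rewrite !mulr1 addNr.
  rewrite f0 !subr0 => fy.
  suff : 0 <= f y by rewrite /f !fctE/= /GRing.scale/= /q !hornerE [_^-1 * _]mulrC.
  rewrite fy mulr_ge0//.
  have -> : q^`().[c] = c ^+ n / n`!%:R + s * (expN_taylor n).[c].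
    rewrite /q derivB !derivZ deriv_expN_taylor derivXn !hornerE hornerMn !hornerE.
    rewrite -mulr_natr factS natrM; field.
    by rewrite nat1r !pnatr_eq0 /= andbT -lt0n fact_gt0.
  have := IH c c0; set A := c ^+ n / _ => HA.
  have -> : A + s * (expN_taylor n).[c] + s * - expR (- c) =
    A - s * (expR (- c) - (expN_taylor n).[c]) by ring.
  rewrite subr_ge0; apply: le_trans HA; apply: (le_trans (ler_norm _)).
  by rewrite normrM ler_piMl.
rewrite ler_norml; have := key 1; have := key (-1); rewrite normrN normr1 lexx.
by move=> /(_ isT) h1 /(_ isT) h2; apply/andP; split; lra.
Qed.

End ExpTaylor.

(** * From convergence of moments to convergence of integrals of functions of [e^(- d z)] *)

Section MomentConvergence.
Context {R : realType}.
Local Notation meas := {measure set (measurableTypeR R) -> \bar R}.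
Local Notation P := (`]0%R, +oo[%classic : set (measurableTypeR R)).
Implicit Types (nu : meas) (f g : R -> R).

Definition has_moments nu := forall n, nu.-integrable P (EFin \o (fun z : R => z ^+ n)).

Definition moment nu n : R := \int[nu]_(z in P) z ^+ n.

Let mP : measurable P. Proof. exact: measurable_itv. Qed.

Lemma has_moments_integrable nu k (M : R) f : has_moments nu -> measurable_fun P f ->
  (forall z, 0 < z -> `|f z| <= M * z ^+ k) -> nu.-integrable P (EFin \o f).
Proof.
move=> hnu mf fM.
have := integrableZl mP M (hnu k); apply: le_integrable => //.
  exact/measurable_EFinP.
move=> z /=; rewrite in_itv/= andbT => z0; rewrite lee_fin normrM.
apply: (le_trans (fM _ z0)); rewrite -normrM ler_norm//.
Qed.

Lemma has_moments_finite nu : has_moments nu -> (nu P < +oo)%E.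
Proof.
move=> /(_ 0%N)/integrableP[_]; under eq_integral do rewrite /= expr0 normr1.
by rewrite integral_cst// mul1e.
Qed.

Section convergence.
Variables (T : Type) (F : set_system T) (FF : ProperFilter F) (nu : T -> meas).
Variables (c : nat -> R) (K C : R).
Hypotheses (K0 : 0 <= K) (C0 : 0 < C) (cKC : forall n, c n <= K * C ^+ n * n`!%:R).
Hypothesis (nuF : \forall i \near F, has_moments (nu i)).
Hypothesis (nuc : forall n, moment (nu i) n @[i --> F] --> c n).

(** Since [(k + N)! <= 2^(k + N) k! N!], the Taylor remainder of order [N] of [e^(- d z)],
    integrated against [z^k], is at most [K (2 C)^k k! (2 C d)^N] in the limit. This choice of [d]
    makes the last factor [2^(- N)]. *)
Let d : R := (4 * C)^-1.

Let d0 : 0 < d. Proof. by rewrite invr_gt0 mulr_gt0. Qed.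

Let mexp (k : nat) (a : R) : measurable_fun setT (fun z : R => z ^+ k * expR (- (a * z))).
Proof.
apply: continuous_measurable_fun => z; apply: cvgM.
  by apply: exprn_continuous.
apply: continuous_cvg; first exact: continuous_expR.
by apply: cvgN; apply: cvgM; [exact: cvg_cst|exact: cvg_id].
Qed.

Let exp_int i k (a : R) : 0 <= a -> has_moments (nu i) ->
  (nu i).-integrable P (EFin \o (fun z : R => z ^+ k * expR (- (a * z)))).
Proof.
move=> a0 hi; apply: (@has_moments_integrable _ k 1) => //.
  by apply: measurable_funTS; exact: mexp.
move=> z z0; rewrite mul1r normrM ger0_norm ?exprn_ge0 ?(ltW z0)//.
by rewrite ger0_norm ?expR_ge0// ler_piMr ?exprn_ge0 ?(ltW z0)// expR_le1 oppr_le0 mulr_ge0// ltW.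
Qed.

Lemma fact_add_le k N : ((k + N)`! <= 2 ^ (k + N) * k`! * N`!)%N.
Proof.
have := bin_fact (leq_addr N k); rewrite addKn => <-.
rewrite -mulnA leq_mul2r; apply/orP; right.
have := Pascal (1 : nat) 1 (k + N); rewrite addn1 => ->.
have := leq_addr N k; rewrite -ltnS => h.
by rewrite (bigD1 (Ordinal h))//= !exp1n !muln1 leq_addr.
Qed.

Lemma is_cvg_Rintegral_comb N (a : nat -> R) (h : nat -> R -> R) :
  (forall l, \forall i \near F, (nu i).-integrable P (EFin \o h l)) ->
  (forall l, cvg ((\int[nu i]_(z in P) h l z) @[i --> F])) ->
  (\forall i \near F, (nu i).-integrable P (EFin \o (fun z => \sum_(l < N) a l * h l z))) /\
  cvg ((\int[nu i]_(z in P) (\sum_(l < N) a l * h l z)) @[i --> F]).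
Proof.
move=> hI hc; elim: N => [|N [IHI IHc]].
  split.
    near=> i; under [X in _.-integrable _ X]eq_fun do rewrite big_ord0.
    exact: integrable0.
  under [X in X @ F]eq_fun do (under eq_Rintegral do rewrite big_ord0).
  under [X in X @ F]eq_fun do rewrite Rintegral_cst// mul0r.
  exact: is_cvg_cst.
split.
  near=> i; under [X in _.-integrable _ X]eq_fun do rewrite big_ord_recr/= EFinD.
  apply: integrableD => //; first by near: i.
  have hIi : (nu i).-integrable P (EFin \o h N) by near: i; exact: hI.
  exact: (integrableZl mP (a N) hIi).
(* Additivity of the integral holds only for [i] near [F], where integrability is known; the two
   families are therefore compared up to an error that is eventually 0. *)
apply: is_cvg_approx => e e0.
exists (fun i => \int[nu i]_(z in P) (\sum_(l < N) a l * h l z) +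
                 a N * \int[nu i]_(z in P) h N z); split.
  by apply: is_cvgD => //; apply: is_cvgM; [exact: is_cvg_cst|exact: hc].
near=> i; under eq_Rintegral do rewrite big_ord_recr/=.
have hIi : (nu i).-integrable P (EFin \o h N) by near: i; exact: hI.
have hSi : (nu i).-integrable P (EFin \o (fun z => \sum_(l < N) a l * h l z)) by near: i.
rewrite RintegralD//; last exact: (integrableZl mP _ hIi).
by rewrite RintegralZl// subrr normr0 ltW.
Unshelve. all: by end_near. Qed.

(** Continuation by steps of length [d]: one factor [e^(- d z)] is replaced by its Taylor
    polynomial, which leaves combinations of [z^(k + l) e^(- j d z)]. The remaining factor
    [e^(- j d z)] is at most 1 and does not spoil the remainder, so the same [d] serves at every
    step. *)
Lemma cvg_exp_moment j k :
  cvg ((\int[nu i]_(z in P) (z ^+ k * expR (- (j%:R * d * z)))) @[i --> F]).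
Proof.
elim: j k => [|j IH] k.
  have := nuc (n := k); rewrite (_ : (fun i => moment (nu i) k) = fun i =>
      \int[nu i]_(z in P) (z ^+ k * expR (- (0 * d * z)))).
    by move=> nuk; apply/cvg_ex; exists (c k).
  by apply/funext => i; apply: eq_Rintegral => z _; rewrite !mul0r oppr0 expR0 mulr1.
apply: is_cvg_approx => e e0.
have e20 : 0 < e / 2 by rewrite divr_gt0.
pose A := K * (2 * C) ^+ k * k`!%:R.
have A0 : 0 <= A by rewrite !mulr_ge0// exprn_ge0// mulr_ge0// ltW.
(* [A / 2^N] bounds the remainder computed with the limit moment of order [k + N]; the other [e / 2]
   pays for that moment not having reached its limit. *)
have [N HN] : exists N : nat, A / 2 ^+ N <= e / 2.
  exists (Num.truncn (A / (e / 2))).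
  set n := Num.truncn _; have := truncnS_gt (A / (e / 2)); rewrite -/n => h.
  rewrite ler_pdivrMr ?exprn_gt0// mulrC -ler_pdivrMr// (le_trans (ltW h))//.
  by rewrite -natrX ler_nat ltn_expl.
have jd0 : 0 <= j%:R * d by rewrite mulr_ge0// ltW.
pose h l z : R := z ^+ (k + l) * expR (- (j%:R * d * z)).
have [hI hc] : (\forall i \near F, (nu i).-integrable P (EFin \o (fun z : R =>
    \sum_(l < N) ((-d) ^+ l / l`!%:R) * h l z))) /\
  cvg ((\int[nu i]_(z in P) (\sum_(l < N) ((-d) ^+ l / l`!%:R) * h l z)) @[i --> F]).
  apply: (@is_cvg_Rintegral_comb N (fun l => ((-d) ^+ l / l`!%:R)) h).
    by move=> l; near=> i; apply: exp_int => //; near: i.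
  by move=> l; exact: IH.
exists (fun i => \int[nu i]_(z in P) (\sum_(l < N) ((-d) ^+ l / l`!%:R) * h l z)); split => //.
have dN0 : 0 < d ^+ N / N`!%:R by rewrite divr_gt0 ?exprn_gt0// ltr0n fact_gt0.
near=> i.
have hi : has_moments (nu i) by near: i.
have hIi : (nu i).-integrable P (EFin \o (fun z : R =>
    \sum_(l < N) ((-d) ^+ l / l`!%:R) * h l z)) by near: i.
have uI : (nu i).-integrable P (EFin \o (fun z : R => z ^+ k * expR (- (j.+1%:R * d * z)))).
  by apply: exp_int => //; rewrite mulr_ge0// ltW.
have pI : (nu i).-integrable P (EFin \o (fun z : R => d ^+ N / N`!%:R * z ^+ (k + N))).
  exact: (integrableZl mP _ (hi (k + N)%N)).
rewrite -RintegralB//.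
apply: (@le_trans _ _ (\int[nu i]_(z in P) (d ^+ N / N`!%:R * z ^+ (k + N)))).
  apply: norm_Rintegral_le => //; first exact: (integrableB mP uI hIi).
  move=> z /=; rewrite in_itv/= andbT => z0.
  have dz0 : 0 <= d * z by rewrite mulr_ge0// ltW.
  have -> : \sum_(l < N) (- d) ^+ l / l`!%:R * h l z =
      z ^+ k * expR (- (j%:R * d * z)) * (expN_taylor N).[d * z].
    rewrite horner_sum mulr_sumr; apply: eq_bigr => l _.
    by rewrite /h hornerZ hornerXn (exprMn l d z) exprD (exprNn d l); ring.
  have -> : expR (- (j.+1%:R * d * z)) = expR (- (j%:R * d * z)) * expR (- (d * z)).
    by rewrite -expRD -natr1; congr expR; ring.
  rewrite mulrA -mulrBr normrM ger0_norm; last first.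
    by rewrite mulr_ge0 ?expR_ge0// exprn_ge0// ltW.
  apply: (@le_trans _ _ (z ^+ k * ((d * z) ^+ N / N`!%:R))); last first.
    by rewrite exprMn exprD le_eqVlt; apply/orP; left; apply/eqP; ring.
  rewrite -[leLHS]mulrA ler_wpM2l ?exprn_ge0 ?(ltW z0)//.
  apply: le_trans (expN_taylor_le N dz0).
  by rewrite ler_piMl// expR_le1 oppr_le0 mulr_ge0// ltW.
rewrite (RintegralZl _ mP (hi (k + N)%N)).
rewrite -/(moment (nu i) (k + N)).
have hm : moment (nu i) (k + N) <= c (k + N)%N + e / 2 / (d ^+ N / N`!%:R).
  near: i; have := nuc (n := (k + N)%N) => /cvgrPdist_le.
  move=> /(_ (e / 2 / (d ^+ N / N`!%:R)) (divr_gt0 e20 dN0)); apply: filterS => i.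
  by rewrite ler_distlC => /andP[].
apply: (@le_trans _ _ (d ^+ N / N`!%:R * (c (k + N)%N + e / 2 / (d ^+ N / N`!%:R)))).
  by rewrite ler_pM2l.
rewrite mulrDr [X in _ + X]mulrC divfK ?gt_eqF// [leRHS]splitr lerD2r.
apply: le_trans HN; apply: (@le_trans _ _ (d ^+ N / N`!%:R * (K * C ^+ (k + N) * (k + N)`!%:R))).
  by rewrite ler_pM2l.
have fN0 : 0 < N`!%:R :> R by rewrite ltr0n fact_gt0.
apply: (@le_trans _ _ (d ^+ N / N`!%:R * (K * C ^+ (k + N) * (2 ^ (k + N) * k`! * N`!)%:R))).
  rewrite ler_pM2l// ler_wpM2l ?mulr_ge0 ?exprn_ge0 ?(ltW C0)// ler_nat.
  exact: fact_add_le.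
rewrite !natrM natrX !exprD /A exprMn.
have -> : d ^+ N = (2 ^+ N * 2 ^+ N * C ^+ N)^-1.
  by rewrite -!exprMn -exprVn; congr (_ ^+ _); rewrite /d; congr (_^-1); ring.
rewrite le_eqVlt; apply/orP; left; apply/eqP; field.
by rewrite !gt_eqF// exprn_gt0.
Unshelve. all: by end_near. Qed.

Lemma cvg_poly_exp (p : {poly R}) :
  cvg ((\int[nu i]_(z in P) p.[expR (- (d * z))]) @[i --> F]).
Proof.
pose h l z : R := expR (- (l%:R * d * z)).
have [_] : (\forall i \near F, (nu i).-integrable P (EFin \o (fun z : R =>
    \sum_(l < size p) p`_l * h l z))) /\
  cvg ((\int[nu i]_(z in P) (\sum_(l < size p) p`_l * h l z)) @[i --> F]).
  apply: (@is_cvg_Rintegral_comb (size p) (fun l => p`_l) h) => l.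
    near=> i; have hi : has_moments (nu i) by near: i.
    have := @exp_int i 0 (l%:R * d) _ hi.
    rewrite mulr_ge0 ?(ltW d0)// => /(_ isT); apply: eq_integrable => // z _ /=.
    by rewrite expr0 mul1r.
  have := @cvg_exp_moment l 0.
  rewrite (_ : (fun i => _) = fun i => \int[nu i]_(z in P) h l z)//.
  by apply/funext => i; apply: eq_Rintegral => z _; rewrite expr0 mul1r.
rewrite (_ : (fun i => _) = fun i => \int[nu i]_(z in P) p.[expR (- (d * z))])//.
apply/funext => i; apply: eq_Rintegral => z _; rewrite horner_coef.
apply: eq_bigr => l _; rewrite /h -expRM_natl; congr (_ * expR _); ring.
Unshelve. all: by end_near. Qed.

Lemma cvg_continuous_exp (G : R -> R) : continuous G ->
  cvg ((\int[nu i]_(z in P) G (expR (- (d * z)))) @[i --> F]).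
Proof.
move=> cG; apply: is_cvg_approx => e e0.
(* The total mass is eventually at most [|c 0| + 1], so a uniform error [e / (|c 0| + 1)] integrates
   to at most [e]. *)
have c01 : 0 < `|c 0%N| + 1 by rewrite ltr_wpDl.
have [p pG] := weierstrass_approx cG (divr_gt0 e0 c01).
exists (fun i => \int[nu i]_(z in P) p.[expR (- (d * z))]); split.
  exact: cvg_poly_exp.
have w01 z : 0 < z -> 0 <= expR (- (d * z)) <= 1.
  by move=> z0; rewrite expR_ge0 expR_le1 oppr_le0 mulr_ge0// ltW.
near=> i.
have hi : has_moments (nu i) by near: i.
have ce : continuous (fun z : R => expR (- (d * z))).
  move=> z; apply: continuous_cvg; first exact: continuous_expR.
  by apply: cvgN; apply: cvgM; [exact: cvg_cst|exact: cvg_id].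
have cI (H : R -> R) : continuous H ->
    (nu i).-integrable P (EFin \o (fun z => H (expR (- (d * z))))).
  move=> cH; have cf01 : {within `[0, 1], continuous (fun x => `|H x|)}.
    by apply: continuous_subspaceT => x; apply: cvg_norm; exact: cH.
  have [xM _ hM] := EVT_max ler01 cf01.
  apply: (@has_moments_integrable _ 0 `|H xM|) => //.
    apply: measurable_funTS; apply: continuous_measurable_fun => z.
    exact: (@continuous_comp _ _ _ (fun z => expR (- (d * z))) H z (ce z) (cH _)).
  by move=> z z0; rewrite expr0 mulr1; apply: hM; rewrite in_itv/= w01.
have cp : continuous (horner p).
  by move=> x; apply/differentiable_continuous/derivable1_diffP/derivable_horner.
have GI := cI _ cG; have pI := cI _ cp.
have eI : (nu i).-integrable P (EFin \o (fun z : R => e / (`|c 0%N| + 1))).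
  apply: (@has_moments_integrable _ 0 `|e / (`|c 0%N| + 1)|) => //.
  by move=> z z0; rewrite expr0 mulr1.
rewrite -RintegralB//.
apply: (@le_trans _ _ (\int[nu i]_(z in P) (e / (`|c 0%N| + 1)))).
  apply: norm_Rintegral_le => //; first exact: (integrableB mP GI pI).
  by move=> z /=; rewrite in_itv/= andbT => z0; apply: pG; exact: w01.
have m0 : moment (nu i) 0 <= `|c 0%N| + 1.
  near: i; have := nuc (n := 0%N) => /cvgrPdist_le/(_ _ ltr01); apply: filterS => i.
  by rewrite ler_distlC => /andP[_ h]; apply: (le_trans h); rewrite lerD2r ler_norm.
have -> : \int[nu i]_(z in P) (e / (`|c 0%N| + 1)) = e / (`|c 0%N| + 1) * moment (nu i) 0.
  rewrite /moment -(RintegralZl (e / (`|c 0%N| + 1)) mP (hi 0%N)).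
  by apply: eq_Rintegral => z _; rewrite expr0 mulr1.
by rewrite mulrAC ler_pdivrMr// ler_pM2l.
Unshelve. all: by end_near. Qed.

End convergence.
End MomentConvergence.

(** * Determinacy, and existence of a limit law on the closed half-line *)

Section MomentLimit.
Context {R : realType}.
Local Notation meas := {measure set (measurableTypeR R) -> \bar R}.
Local Notation P := (`]0%R, +oo[%classic : set (measurableTypeR R)).

Let mP : measurable P. Proof. exact: measurable_itv. Qed.

Let expNd_continuous (d : R) : continuous (fun z : R => expR (- (d * z))).
Proof.
move=> z; apply: continuous_cvg; first exact: continuous_expR.
by apply: cvgN; apply: cvgM; [exact: cvg_cst|exact: cvg_id].
Qed.

Let expNd01 (d z : R) : 0 < d -> 0 < z -> 0 <= expR (- (d * z)) <= 1.
Proof. by move=> d0 z0; rewrite expR_ge0 expR_le1 oppr_le0 mulr_ge0// ltW. Qed.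

Lemma integrable_exp_comp (nu : meas) (d : R) (G : R -> R) : 0 < d -> (nu P < +oo)%E ->
  continuous G -> nu.-integrable P (EFin \o (fun z => G (expR (- (d * z))))).
Proof.
move=> d0 nuP cG; have cf01 : {within `[0, 1], continuous (fun x => `|G x|)}.
  by apply: continuous_subspaceT => x; apply: cvg_norm; exact: cG.
have [xM _ hM] := EVT_max ler01 cf01.
apply: (@integrable_bounded R _ (measurableTypeR R) nu P _ `|G xM|) => //.
  apply: measurable_funTS; apply: continuous_measurable_fun => z.
  exact: (@continuous_comp _ _ _ (fun z => expR (- (d * z))) G z (@expNd_continuous d z) (cG _)).
by move=> z /=; rewrite in_itv/= andbT => z0; apply: hM; rewrite in_itv/= expNd01.
Qed.

Section uniqueness.
Variables (nu nu' : meas) (K C : R).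
Hypotheses (K0 : 0 <= K) (C0 : 0 < C) (hnu : has_moments nu) (hnu' : has_moments nu').
Hypotheses (nuKC : forall n, moment nu n <= K * C ^+ n * n`!%:R)
  (nunu' : forall n, moment nu n = moment nu' n).

Let d : R := (4 * C)^-1.

Let d0 : 0 < d. Proof. by rewrite invr_gt0 mulr_gt0. Qed.

(** Uniqueness is convergence of a two-element family: along the filter whose only member is the set
    of all booleans, a convergent function is constant. *)
Lemma moment_eq_exp (G : R -> R) : continuous G ->
  \int[nu]_(z in P) G (expR (- (d * z))) = \int[nu']_(z in P) G (expR (- (d * z))).
Proof.
move=> cG; pose N (b : bool) : meas := if b then nu else nu'.
have FF : ProperFilter (globally [set: bool]) := @globally_properfilter _ setT true Logic.I.
have hN : \forall b \near globally [set: bool], has_moments (N b) by case.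
have hc n : moment (N b) n @[b --> globally [set: bool]] --> moment nu n.
  rewrite (_ : (fun b => _) = fun=> moment nu n); first exact: cvg_cst.
  by apply/funext => -[]//; rewrite /N nunu'.
have /cvg_ex[l /cvgrPdist_le Nl] := cvg_continuous_exp FF K0 C0 nuKC hN hc cG.
have Hl b : \int[N b]_(z in P) G (expR (- (d * z))) = l.
  apply/eqP; rewrite eq_sym -subr_eq0 -normr_le0; apply/ler_addgt0Pl => e e0.
  by rewrite addr0; exact: (Nl _ e0 b Logic.I).
by rewrite (Hl true) -(Hl false).
Qed.

End uniqueness.

(** In the decreasing variable [w = e^(- d z)] the tail [[x, +oo[] becomes a lower set, and the ramp
    falling from [w x] to [w y] lies between the indicators of [[x, +oo[] and [[y, +oo[]. *)
Let tail_le (m m' : meas) (d x y : R) : 0 < d -> (m P < +oo)%E -> (m' P < +oo)%E ->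
  (forall G, continuous G ->
    \int[m]_(z in P) G (expR (- (d * z))) = \int[m']_(z in P) G (expR (- (d * z)))) ->
  0 < y < x -> (m `[x, +oo[%classic <= m' `[y, +oo[%classic)%E.
Proof.
move=> d0 mP' m'P mm' /andP[y0 yx].
pose w z := expR (- (d * z)).
have wE a b : (w a <= w b) = (b <= a) by rewrite /w ler_expR lerN2 ler_pM2l.
have wxy : 0 < w y - w x by rewrite subr_gt0 /w ltr_expR ltrN2 ltr_pM2l.
pose G := ramp (w x) (w y - w x)^-1.
have cG : continuous G by exact: continuous_ramp.
have IG (m0 : meas) : (m0 P < +oo)%E ->
    (\int[m0]_(z in P) G (w z))%:E = (\int[m0]_(z in P) (G (w z))%:E)%E.
  move=> m0P; rewrite /Rintegral fineK//; apply: integrable_fin_num => //.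
  exact: integrable_exp_comp.
have mI a : measurable (`[a, +oo[%classic : set (measurableTypeR R)) by exact: measurable_itv.
have mG : measurable_fun P (EFin \o (fun z => G (w z))).
  by have /integrableP[] := integrable_exp_comp d0 mP' cG.
have II (m0 : meas) a : 0 < a ->
    m0 `[a, +oo[%classic = (\int[m0]_(z in P) (\1_(`[a, +oo[%classic : set R) z)%:E)%E.
  move=> a0; rewrite integral_indic//; congr (m0 _); apply/seteqP; split => z /=.
    by rewrite !in_itv/= !andbT => az; split=> //; rewrite (lt_le_trans a0).
  by case.
have x0 : 0 < x by rewrite (lt_trans y0).
rewrite (II m)// (II m')//.
apply: (@le_trans _ _ (\int[m]_(z in P) (G (w z))%:E)%E).
  apply: ge0_le_integral => //.
  - by apply/measurable_EFinP; exact: measurable_indic.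
  - move=> z _; rewrite lee_fin indicE; case: (boolP (z \in _)); last by rewrite ramp_ge0.
    rewrite inE/= in_itv/= andbT => xz; rewrite /G ramp1 ?wE//.
    by rewrite invr_ge0 ltW.
rewrite -IG// mm'// IG//; apply: ge0_le_integral => //.
- by move=> z _; rewrite lee_fin ramp_ge0.
- by apply/measurable_EFinP; exact: measurable_indic.
- move=> z _; rewrite lee_fin indicE; case: (boolP (z \in _)); first by rewrite ramp_le1.
  rewrite notin_setE/= in_itv/= andbT => /negP; rewrite -ltNge => /ltW zy.
  by rewrite /G ramp0 ?invr_gt0// invrK addrC subrK wE.
Qed.

Let tail_le_open (m m' : meas) (d x : R) : 0 < d -> (m P < +oo)%E -> (m' P < +oo)%E ->
  (forall G, continuous G ->
    \int[m]_(z in P) G (expR (- (d * z))) = \int[m']_(z in P) G (expR (- (d * z)))) ->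
  0 <= x -> (m `]x, +oo[%classic <= m' `]x, +oo[%classic)%E.
Proof.
move=> d0 mP' m'P mm' x0.
pose F n : set (measurableTypeR R) := `[x + n.+1%:R^-1, +oo[%classic.
have mF n : measurable (F n) by exact: measurable_itv.
have FE : \bigcup_n F n = `]x, +oo[%classic.
  apply/seteqP; split => z /=.
    move=> [n _]; rewrite /F/= !in_itv/= !andbT; apply: lt_le_trans.
    by rewrite ltrDl invr_gt0 ltr0n.
  rewrite in_itv/= andbT => xz; exists (Num.truncn (z - x)^-1) => //.
  rewrite /F/= in_itv/= andbT -lerBrDl ltW// invf_plt ?posrE ?subr_gt0//.
  exact: truncnS_gt.
have : m \o F @ \oo --> m (\bigcup_n F n).
  apply: nondecreasing_cvg_mu => //; first by rewrite FE; exact: measurable_itv.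
  move=> i j ij; apply/subsetPset => z; rewrite /F/= !in_itv/= !andbT; apply: le_trans.
  by rewrite lerD2l lef_pV2 ?posrE ?ltr0n// ler_nat.
rewrite FE => mc; rewrite -(cvg_lim _ mc)//; apply: lime_le;
  first by apply/cvg_ex; eexists; exact: mc.
near=> n; have n0 : 0 < n.+1%:R^-1 :> R by rewrite invr_gt0 ltr0n.
have n20 : 0 < n.+1%:R^-1 / 2 :> R by rewrite divr_gt0.
apply: (@le_trans _ _ (m' `[x + n.+1%:R^-1 / 2, +oo[%classic)).
  apply: (tail_le d0 mP' m'P mm').
  by rewrite ltr_wpDl//= ltrD2l ltr_pdivrMr// ltr_pMr// ltr1n.
apply: le_measure; rewrite ?inE; [exact: measurable_itv|exact: measurable_itv|].
by move=> z /=; rewrite !in_itv/= !andbT; apply: lt_le_trans; rewrite ltrDl.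
Unshelve. all: by end_near. Qed.

Theorem moment_unique (nu nu' : meas) (K C : R) : 0 <= K -> 0 < C ->
  has_moments nu -> has_moments nu' ->
  (forall n, moment nu n <= K * C ^+ n * n`!%:R) ->
  (forall n, moment nu n = moment nu' n) ->
  forall A, measurable (A : set (measurableTypeR R)) -> nu (A `&` P) = nu' (A `&` P).
Proof.
move=> K0 C0 hnu hnu' nuKC nunu' A mA.
have E := moment_eq_exp K0 C0 hnu hnu' nuKC nunu'.
have nuP := has_moments_finite hnu; have nu'P := has_moments_finite hnu'.
have d0 : 0 < (4 * C)^-1 by rewrite invr_gt0 mulr_gt0.
pose r : meas := mrestr nu mP; pose r' : meas := mrestr nu' mP.
suff : r A = r' A by [].
apply: (@measure_unique _ R (measurableTypeR R) (@RGenOInfty.G R)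
  (fun n => `](- n%:R), +oo[%classic) _ _ _ _ r r') => //.
- exact: RGenOInfty.measurableE.
- move=> _ _ [x ->] [y ->]; exists (Num.max x y); apply/seteqP; split => z /=.
    by rewrite !in_itv/= !andbT gt_max => -[-> ->].
  by rewrite !in_itv/= !andbT gt_max => /andP[-> ->].
- by move=> n; exists (- n%:R).
- apply/seteqP; split => // z _; exists (Num.truncn (- z)).+1 => //=.
  by rewrite in_itv/= andbT ltrNl truncnS_gt.
- move=> _ [x ->]; rewrite /= /mrestr.
  have -> : `]x, +oo[ `&` P = `]Num.max x 0, +oo[%classic.
    apply/seteqP; split => z /=; first by rewrite !in_itv/= !andbT gt_max => -[-> ->].
    by rewrite !in_itv/= !andbT gt_max => /andP[-> ->].
  apply/eqP; rewrite eq_le; apply/andP; split.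
    by apply: (tail_le_open d0) => //; rewrite le_max lexx orbT.
  apply: (tail_le_open d0) => //; last by rewrite le_max lexx orbT.
  by move=> G cG; rewrite E.
- move=> n; apply: le_lt_trans nuP; apply: le_measure; rewrite ?inE//.
  by apply: measurableI => //; exact: measurable_itv.
Qed.

Section limit.
Variables (T : Type) (F : set_system T) (FF : ProperFilter F) (nu : T -> meas).
Variables (c : nat -> R) (K C : R).
Hypotheses (K0 : 0 <= K) (C0 : 0 < C) (cKC : forall n, c n <= K * C ^+ n * n`!%:R).
Hypothesis (nuF : \forall i \near F, has_moments (nu i)).
Hypothesis (nuc : forall n, moment (nu i) n @[i --> F] --> c n).
Hypothesis (c0 : c 0%N = 1).

Let d : R := (4 * C)^-1.

Let d0 : 0 < d. Proof. by rewrite invr_gt0 mulr_gt0. Qed.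

Let L (G : R -> R) := lim ((\int[nu i]_(z in P) G (expR (- (d * z)))) @[i --> F]).

Let Lcvg G : continuous G -> \int[nu i]_(z in P) G (expR (- (d * z))) @[i --> F] --> L G.
Proof. by move=> cG; exact: (cvg_continuous_exp FF K0 C0 cKC nuF nuc cG). Qed.

Let nu_fin : \forall i \near F, ((nu i) P < +oo)%E.
Proof. by apply: filterS nuF => i; exact: has_moments_finite. Qed.

Let pL : positive_functional L.
Proof.
split.
- move=> f g cf cg.
  have cfg : continuous (fun x => f x + g x) by move=> x; apply: cvgD; [exact: cf|exact: cg].
  apply: (cvg_eq_near (FF := FF) (Lcvg cfg) (cvgD (Lcvg cf) (Lcvg cg))).
  near=> i; rewrite !fctE -RintegralD//; (apply: integrable_exp_comp => //); by near: i.
- move=> a f cf.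
  have caf : continuous (fun x => a * f x) by move=> x; apply: cvgM; [exact: cvg_cst|exact: cf].
  apply: (cvg_eq_near (FF := FF) (Lcvg caf) (cvgM (cvg_cst a) (Lcvg cf))).
  near=> i; rewrite /= -RintegralZl//; (apply: integrable_exp_comp => //); by near: i.
- move=> f cf f0; apply: (limr_ge (Lcvg cf)).
  near=> i; apply: Rintegral_ge0 => z /=; rewrite in_itv/= andbT => z0.
  by apply: f0; exact: expNd01.
- have c1 : continuous ((fun=> 1) : R -> R) by move=> x; exact: cvg_cst.
  rewrite -[RHS]c0; apply: (cvg_eq_near (FF := FF) (Lcvg c1) (nuc (n := 0%N))).
  by near=> i; apply: eq_Rintegral => z _; rewrite expr0.
Unshelve. all: by end_near. Qed.

(** The function [min z A] read in the variable [w = e^(- d z)]; the maximum makes it continuous at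
    [w = 0], which stands for [z = +oo]. *)
Let trunc (A w : R) : R := - ln (Num.max w (expR (- (d * A)))) / d.

Let trunc_continuous A : continuous (trunc A).
Proof.
move=> w; rewrite /trunc; apply: cvgM; last exact: cvg_cst.
apply: cvgN; have H : {for w, continuous (fun v : R => Num.max v (expR (- (d * A))))}.
  by apply: (@continuous_max R R idfun (fun=> expR (- (d * A)))); [exact: cvg_id|exact: cvg_cst].
apply: (continuous_comp H); apply: continuous_ln.
by rewrite lt_max expR_gt0 orbT.
Qed.

Let truncE A z : trunc A (expR (- (d * z))) = Num.min z A.
Proof.
rewrite /trunc; have [zA|Az] := leP z A.
  by rewrite max_l ?ler_expR ?lerN2 ?ler_pM2l// expRK opprK mulrC mulKf// gt_eqF.
rewrite max_r ?ler_expR ?lerN2 ?ler_pM2l ?(ltW Az)//.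
by rewrite expRK opprK mulrC mulKf// gt_eqF.
Qed.

Let trunc_ge0 A w : 0 <= A -> w <= 1 -> 0 <= trunc A w.
Proof.
move=> A0 w1; rewrite /trunc divr_ge0 ?(ltW d0)// oppr_ge0 ln_le0//.
by rewrite ge_max w1 expR_le1 oppr_le0 mulr_ge0// ltW.
Qed.

Let ctrunc A n : continuous (fun w => trunc A w ^+ n).
Proof.
by move=> w; apply: (@continuous_comp _ _ _ (trunc A) (fun x : R => x ^+ n));
  [exact: trunc_continuous|exact: exprn_continuous].
Qed.

(** From [z^n - z^(n+1) / A <= (min z A)^n <= z^n]: the next moment controls what the truncation
    removes, uniformly along [F]. *)
Let L_trunc A n : 0 < A -> c n - c n.+1 / A <= L (fun w => trunc A w ^+ n) <= c n.
Proof.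
move=> A0; have cv := Lcvg (@ctrunc A n).
have mI i k : has_moments (nu i) -> (nu i).-integrable P (EFin \o (fun z : R => z ^+ k)).
  by apply.
apply/andP; split.
  have cl : moment (nu i) n - moment (nu i) n.+1 / A @[i --> F] --> c n - c n.+1 / A.
    apply: cvgB; first exact: nuc.
    by apply: cvgM; [exact: nuc|exact: cvg_cst].
  apply: (cvg_le_near (FF := FF) cl cv); near=> i.
  have hi : has_moments (nu i) by near: i.
  have fi : (nu i P < +oo)%E by near: i.
  have i1 : (nu i).-integrable P (EFin \o (fun z : R => z ^+ n.+1 / A)).
    have := integrableZr mP A^-1 (mI _ n.+1 hi); by [].
  rewrite /moment -(RintegralZr A^-1 mP (mI _ n.+1 hi)) -(RintegralB mP (mI _ n hi) i1).
  apply: le_Rintegral => //.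
  - exact: (integrableB mP (mI _ n hi) i1).
  - exact: (@integrable_exp_comp (nu i) d (fun w => trunc A w ^+ n)).
  move=> z /=; rewrite in_itv/= andbT => z0; rewrite truncE exprSr.
  have zn0 : 0 <= z ^+ n by rewrite exprn_ge0// ltW.
  have [zA|Az] := leP z A; first by rewrite lerBlDr lerDl divr_ge0 ?mulr_ge0// ltW.
  apply: (@le_trans _ _ 0); last by rewrite exprn_ge0// ltW.
  by rewrite subr_le0 -mulrA ler_peMr// ler_pdivlMr// mul1r ltW.
apply: (cvg_le_near (FF := FF) cv (nuc (n := n))); near=> i.
have hi : has_moments (nu i) by near: i.
have fi : (nu i P < +oo)%E by near: i.
apply: le_Rintegral => //; first exact: (@integrable_exp_comp (nu i) d (fun w => trunc A w ^+ n)).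
move=> z /=; rewrite in_itv/= andbT => z0; rewrite truncE.
by apply: lerXn2r; rewrite ?nnegrE ?le_min ?ge_min ?lexx ?(ltW z0)//= ltW.
Unshelve. all: by end_near. Qed.

Let I01 : set (measurableTypeR R) := `[0, 1]%classic.
Let E01 : set (measurableTypeR R) := `]0, 1]%classic.
Let D0 : set (measurableTypeR R) := `[0, +oo[%classic.

Let zeta (w : R) : R := - ln w / d.

Section with_rho.
Variable rho : meas.
Hypotheses (rhoC : rho (~` I01) = 0%E) (rho1 : rho I01 = 1%E).
Hypothesis (rhoL : forall f, continuous f -> \int[rho]_(x in I01) f x = L f).

Let mI01 : measurable I01. Proof. exact: measurable_itv. Qed.
Let mE01 : measurable E01. Proof. exact: measurable_itv. Qed.

Let rho_int f : continuous f -> rho.-integrable I01 (EFin \o f).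
Proof.
move=> cf; have cf01 : {within `[0, 1], continuous (fun x => `|f x|)}.
  by apply: continuous_subspaceT => x; apply: cvg_norm; exact: cf.
have [xM _ hM] := EVT_max ler01 cf01.
apply: (@integrable_bounded R _ (measurableTypeR R) rho I01 f `|f xM|) => //.
  by rewrite rho1 ltry.
by apply: measurable_funTS; exact: continuous_measurable_fun.
Qed.

Let rhoE f : continuous f -> (\int[rho]_(x in I01) (f x)%:E = (L f)%:E)%E.
Proof.
move=> cf; rewrite -rhoL// /Rintegral fineK//.
by apply: integrable_fin_num => //; exact: rho_int.
Qed.

Let Z0 : set (measurableTypeR R) := [set (0 : R)].

Let mZ0 : measurable Z0. Proof. exact: measurable_set1. Qed.

(** No mass escapes to [z = +oo]: the truncation takes the value [A] at [w = 0], so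
    [A rho {0} <= c 1] for every [A]. *)
Let rho0 : rho Z0 = 0%E.
Proof.
have H A : 0 < A -> (A%:E * rho Z0 <= (c 1)%:E)%E.
  move=> A0; have /andP[_ h] := L_trunc 1 A0.
  apply: (@le_trans _ _ (\int[rho]_(x in I01) (trunc A x ^+ 1)%:E)%E); last first.
    by rewrite rhoE ?lee_fin//; exact: ctrunc.
  apply: (@le_trans _ _ (\int[rho]_(x in Z0) (trunc A x ^+ 1)%:E)%E).
    rewrite (eq_integral (fun=> A%:E)) ?integral_cst//.
    move=> x; rewrite inE/= => ->; rewrite expr1 /trunc max_r ?expR_ge0//.
    by rewrite expRK opprK mulrC mulKf// gt_eqF.
  apply: ge0_subset_integral => //.
  - apply/measurable_EFinP; apply: measurable_funTS.
    by apply: continuous_measurable_fun; exact: ctrunc.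
  - move=> x; rewrite /I01/= in_itv/= => /andP[_ x1].
    by rewrite lee_fin exprn_ge0// trunc_ge0// ltW.
  - by move=> x /= ->; rewrite /I01/= in_itv/= lexx ler01.
have fin0 : rho Z0 \is a fin_num.
  rewrite ge0_fin_numE//; apply: le_lt_trans (ltry 1); rewrite -rho1.
  apply: le_measure; rewrite ?inE//.
  by move=> x ->; rewrite /I01/= in_itv/= lexx ler01.
rewrite -(fineK fin0); congr EFin; apply/eqP; rewrite eq_le fine_ge0// andbT.
rewrite leNgt; apply/negP => r0.
have c10 : 0 < `|c 1| + 1 by rewrite ltr_wpDl.
have := H ((`|c 1| + 1) / fine (rho Z0)) (divr_gt0 c10 r0).
rewrite -[X in (_ * X)%E](fineK fin0) -EFinM lee_fin divfK ?gt_eqF//.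
by have := ler_norm (c 1); lra.
Qed.

Let intE01 (f : R -> \bar R) : rho.-integrable I01 f ->
  (\int[rho]_(x in I01) f x = \int[rho]_(x in E01) f x)%E.
Proof.
move=> mf; have -> : E01 = I01 `\` Z0.
  apply/seteqP; split => x; rewrite /E01/I01/= !in_itv/=.
    by move=> /andP[x0 x1]; rewrite (ltW x0) x1; split => //; apply/eqP; rewrite gt_eqF.
  by move=> [/andP[x0 x1] /eqP x0']; rewrite x1 lt_neqAle x0 eq_sym x0'.
exact: (negligible_integral mZ0).
Qed.

Lemma moment_limit_rho : exists Q : meas, [/\ Q (~` D0) = 0%E,
  forall n, (\int[Q]_(z in D0) (z ^+ n)%:E = (c n)%:E)%E &
  forall G : R -> R, continuous G ->
    \int[nu i]_(z in P) G (expR (- (d * z))) @[i --> F] -->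
    \int[Q]_(z in D0) G (expR (- (d * z)))].
Proof.
have mz : measurable_fun [set: measurableTypeR R] zeta.
  apply: measurable_funM => //; apply: measurableT_comp => //; exact: measurable_ln.
have [Q [QA QI]] := @weighted_image_integral _ _ (measurableTypeR R) (measurableTypeR R) R
  rho E01 (fun=> 1) zeta mE01 (measurable_cst _) (fun _ _ => ler01) mz.
have zD w : E01 w -> D0 (zeta w).
  rewrite /E01/D0/= !in_itv/= andbT => /andP[w0 w1].
  by rewrite divr_ge0 ?(ltW d0)// oppr_ge0 ln_le0.
have ED : E01 `&` zeta @^-1` D0 = E01.
  by apply/seteqP; split => [w []//|w Ew]; split => //; exact: zD.
have QI' f : measurable_fun D0 f ->
    (\int[Q]_(z in D0) f z = \int[rho]_(w in E01) f (zeta w))%E.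
  move=> mf; rewrite QI//; last exact: measurable_itv.
  by rewrite ED; apply: eq_integral => w _; rewrite mule1.
have ez w : E01 w -> expR (- (d * zeta w)) = w.
  rewrite /E01/= in_itv/= => /andP[w0 w1]; rewrite /zeta mulrC divfK ?gt_eqF// opprK.
  by rewrite lnK.
exists Q; split.
- rewrite QA; last by apply: measurableC; exact: measurable_itv.
  rewrite (_ : _ `&` _ = set0) ?integral_set0//; apply/seteqP; split => // w [Ew].
  by apply; exact: zD.
- move=> n; rewrite QI'; last first.
    apply/measurable_EFinP; apply: measurable_funTS.
    by apply: continuous_measurable_fun; exact: exprn_continuous.
  pose g k w := ((trunc k.+1%:R w) ^+ n)%:E : \bar R.
  have tz k w : E01 w -> trunc k.+1%:R w = Num.min (zeta w) k.+1%:R.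
    by move=> Ew; rewrite -{1}(ez w Ew) truncE.
  transitivity (\int[rho]_(w in E01) limn (g^~ w))%E.
    apply: eq_integral => w; rewrite inE => Ew; apply/esym/cvg_lim => //.
    apply: cvg_near_cst; near=> k; rewrite /g tz// min_l//.
    near: k; exists (Num.truncn (zeta w)) => // k /= hk.
    by rewrite (le_trans (ltW (truncnS_gt _)))// ler_nat ltnS.
  rewrite monotone_convergence//; last 3 first.
  - move=> k; apply/measurable_EFinP; apply: measurable_funTS; apply: continuous_measurable_fun.
    exact: ctrunc.
  - move=> k w Ew; rewrite lee_fin exprn_ge0// tz// le_min ler0n andbT.
    by have := zD _ Ew; rewrite /D0/= in_itv/= andbT.
  - move=> w Ew k l kl; rewrite lee_fin !tz//; apply: lerXn2r; rewrite ?nnegrE ?le_min ?ler0n ?andbT//.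
    + by have := zD _ Ew; rewrite /D0/= in_itv/= andbT.
    + by have := zD _ Ew; rewrite /D0/= in_itv/= andbT.
    + by rewrite !ge_min lexx/= ler_nat ltnS kl orbT.
  have -> : (fun k => \int[rho]_(w in E01) g k w)%E =
      fun k => (L (fun w => trunc k.+1%:R w ^+ n))%:E.
    apply/funext => k; rewrite -rhoE//; apply/esym/intE01/rho_int.
    exact: ctrunc.
  apply/cvg_lim => //; apply/cvg_EFin; first exact: nearW.
  apply: (@squeeze_cvgr _ _ _ _ (fun k => c n - c n.+1 / k.+1%:R) (fun=> c n)).
  - by near=> k; apply: L_trunc.
  - rewrite -[X in _ --> X]subr0 -(mulr0 (c n.+1)); apply: cvgB; first exact: cvg_cst.
    by apply: cvgM; [exact: cvg_cst|exact: cvg_harmonic].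
  - exact: cvg_cst.
- move=> G cG; rewrite (_ : \int[Q]_(z in D0) _ = L G); first exact: Lcvg.
  rewrite /Rintegral QI'; last first.
    apply/measurable_EFinP; apply: measurable_funTS; apply: continuous_measurable_fun => z.
    exact: (@continuous_comp _ _ _ (fun z => expR (- (d * z))) G z (@expNd_continuous d z) (cG _)).
  rewrite -[RHS]rhoL// /Rintegral; congr fine; rewrite (intE01 (rho_int cG)).
  by apply: eq_integral => w; rewrite inE => Ew; rewrite ez.
Unshelve. all: by end_near. Qed.

End with_rho.

(** Moments prevent escape to infinity but not, in general, an atom at 0, hence the closed
    half-line. Excluding the atom takes the special form of the moments and is done for the limit
    law below. *)
Theorem moment_limit : exists Q : meas, [/\ Q (~` D0) = 0%E,
  forall n, (\int[Q]_(z in D0) (z ^+ n)%:E = (c n)%:E)%E &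
  forall G : R -> R, continuous G ->
    \int[nu i]_(z in P) G (expR (- (d * z))) @[i --> F] -->
    \int[Q]_(z in D0) G (expR (- (d * z)))].
Proof.
have [rho [rhoC rho1 rhoL]] := riesz_representation pL.
exact: (@moment_limit_rho rho rho1 rhoL).
Qed.

End limit.
End MomentLimit.

(** * From functions of [e^(- d z)] to bounded continuous functions *)

Section Portmanteau.
Context {R : realType}.
Local Notation meas := {measure set (measurableTypeR R) -> \bar R}.
Local Notation P := (`]0%R, +oo[%classic : set (measurableTypeR R)).
Variables (T : Type) (F : set_system T) (FF : ProperFilter F) (nu : T -> meas)
  (Q : meas) (d : R).
Hypotheses (d0 : 0 < d) (nuP : \forall i \near F, (nu i P < +oo)%E) (QP : (Q P < +oo)%E).
Hypothesis nuQ : forall G : R -> R, continuous G ->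
  \int[nu i]_(z in P) G (expR (- (d * z))) @[i --> F] -->
  \int[Q]_(z in P) G (expR (- (d * z))).

Let mP : measurable P. Proof. exact: measurable_itv. Qed.

(** It vanishes near both ends of [[0, 1]], that is for [z] near infinity and [z] near 0; the
    product with it turns a function that is continuous only on the open half-line into a continuous
    function of [w]. *)
Let cutoff (e w : R) : R := (1 - ramp e e^-1 w) * ramp (1 - 2 * e) e^-1 w.

Let cutoff_continuous e : continuous (cutoff e).
Proof.
move=> w; apply: cvgM; last exact: continuous_ramp.
by apply: cvgB; [exact: cvg_cst|exact: continuous_ramp].
Qed.

Let cutoff01 e w : 0 <= cutoff e w <= 1.
Proof.
rewrite /cutoff; have := ramp_ge0 e e^-1 w; have := ramp_le1 e e^-1 w.
have := ramp_ge0 (1 - 2 * e) e^-1 w; have := ramp_le1 (1 - 2 * e) e^-1 w.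
by move=> h1 h2 h3 h4; apply/andP; split; nra.
Qed.

Let cutoff0l e w : 0 < e -> w <= e -> cutoff e w = 0.
Proof. by move=> e0 we; rewrite /cutoff ramp1 ?subrr ?mul0r// invr_ge0 ltW. Qed.

Let cutoff0r e w : 0 < e -> 1 - e <= w -> cutoff e w = 0.
Proof.
by move=> e0 we; rewrite /cutoff (@ramp0 _ (1 - 2 * e)) ?mulr0 ?invr_gt0// invrK; lra.
Qed.

Let cutoff1 e w : 0 < e -> 2 * e <= w <= 1 - 2 * e -> cutoff e w = 1.
Proof.
move=> e0 /andP[w1 w2]; rewrite /cutoff ramp0 ?invr_gt0//; last by rewrite invrK; lra.
by rewrite subr0 mul1r ramp1// invr_ge0 ltW.
Qed.

Let w z := expR (- (d * z)).

Let cutoff_cvg : \int[Q]_(z in P) (1 - cutoff n.+1%:R^-1 (w z)) @[n --> \oo] --> (0 : R).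
Proof.
have cn (n : nat) : continuous (fun v : R => 1 - cutoff n.+1%:R^-1 v).
  by move=> v; apply: cvgB; [exact: cvg_cst|exact: cutoff_continuous].
have c1 : continuous ((fun=> 1) : R -> R) by move=> v; exact: cvg_cst.
have mf n : measurable_fun P (fun z => (1 - cutoff n.+1%:R^-1 (w z))%:E).
  by have /integrableP[] := integrable_exp_comp d0 QP (@cn n).
have := @dominated_convergence _ (measurableTypeR R) R Q P mP
  (fun n z => (1 - cutoff n.+1%:R^-1 (w z))%:E) (fun=> 0%E) (fun=> 1%E) mf.
case.
- exact: measurable_cst.
- apply: aeW => z; rewrite /= in_itv/= andbT => z0.
  apply/cvg_EFin; first exact: nearW.
  have wz0 : 0 < w z by exact: expR_gt0.
  have wz1 : 0 < 1 - w z by rewrite subr_gt0 expR_lt1 oppr_lt0 mulr_gt0.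
  apply: cvg_near_cst; near=> n; rewrite /comp/= cutoff1 ?subrr//.
  have n1 : n.+1%:R^-1 < w z / 2.
    by near: n; apply: (near_infty_natSinv_lt (PosNum (divr_gt0 wz0 (ltr0n _ 2)))).
  have n2 : n.+1%:R^-1 < (1 - w z) / 2.
    by near: n; apply: (near_infty_natSinv_lt (PosNum (divr_gt0 wz1 (ltr0n _ 2)))).
  by move: n1 n2; move: (_^-1) => u n1 n2; apply/andP; split; lra.
- exact: (integrable_exp_comp d0 QP c1).
- apply: aeW => z n _; rewrite /= lee_fin ler_norml.
  by have /andP[h1 h2] := cutoff01 n.+1%:R^-1 (w z); apply/andP; split; lra.
move=> _ _; rewrite integral0 => /fine_cvg; apply.
Unshelve. all: by end_near. Qed.

Theorem cvg_bounded_continuous (f : R -> R) (M : R) : {within P, continuous f} ->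
  (forall z, 0 < z -> `|f z| <= M) ->
  \int[nu i]_(z in P) f z @[i --> F] --> \int[Q]_(z in P) f z.
Proof.
move=> cf fM; have M0 : 0 <= M by apply: le_trans (fM _ ltr01).
have cfP x : 0 < x -> {for x, continuous f}.
  move=> x0; have oP : open (`]0%R, +oo[%classic : set R) by exact: interval_open.
  have := cf; rewrite (continuous_open_subspace _ oP) => /(_ x); apply.
  by rewrite inE/= in_itv/= x0.
pose H e v := f (- ln v / d) * cutoff e v.
have cH e : 0 < e -> continuous (H e).
  move=> e0 v; have [v0|v0] := leP v 0.
    have Hv : H e v = 0 by rewrite /H cutoff0l ?mulr0// (le_trans v0)// ltW.
    rewrite /continuous_at Hv.
    apply: cvg_near_cst; near=> u; rewrite /H cutoff0l ?mulr0//.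
    by apply: ltW; near: u; apply: lt_nbhsl; exact: le_lt_trans v0 e0.
  have [v1|v1] := leP 1 v.
    have Hv : H e v = 0 by rewrite /H cutoff0r ?mulr0// (le_trans _ v1)// gerBl ltW.
    rewrite /continuous_at Hv.
    apply: cvg_near_cst; near=> u; rewrite /H cutoff0r ?mulr0//.
    suff : - u < e - 1 by move=> ?; lra.
    by near: u; apply: Nlt_nbhsl; lra.
  apply: cvgM; last exact: cutoff_continuous.
  apply: (@continuous_comp _ _ _ (fun v : R => - ln v / d) f).
    by apply: cvgM; [apply: cvgN; exact: continuous_ln|exact: cvg_cst].
  by apply: cfP; rewrite divr_gt0// oppr_gt0 ln_lt0// v0.
have mf : measurable_fun P f by exact: subspace_continuous_measurable_fun.
have If (m : meas) : (m P < +oo)%E -> m.-integrable P (EFin \o f).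
  move=> mP'; apply: (@integrable_bounded R _ (measurableTypeR R) m P f M) => //.
  by move=> z /=; rewrite in_itv/= andbT; exact: fM.
have fH e (m : meas) : 0 < e -> (m P < +oo)%E ->
    `|\int[m]_(z in P) f z - \int[m]_(z in P) H e (w z)| <=
    M * \int[m]_(z in P) (1 - cutoff e (w z)).
  move=> e0 mP'.
  have cc : continuous (fun v : R => 1 - cutoff e v).
    by move=> v; apply: cvgB; [exact: cvg_cst|exact: cutoff_continuous].
  have I1 := If _ mP'; have I2 := integrable_exp_comp d0 mP' (cH _ e0).
  have I3 := integrable_exp_comp d0 mP' cc.
  rewrite -RintegralB// -RintegralZl//; apply: norm_Rintegral_le => //.
  - exact: (integrableB mP I1 I2).
  - exact: (integrableZl mP M I3).
  move=> z /=; rewrite in_itv/= andbT => z0; 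
  have -> : H e (w z) = f z * cutoff e (w z).
    by rewrite /H /w expRK opprK [d * z]mulrC mulfK ?gt_eqF.
  have /andP[h1 h2] := cutoff01 e (w z).
  rewrite -[X in X - _]mulr1 -mulrBr normrM ler_pM ?fM//.
  by rewrite ger0_norm ?subr_ge0.
apply/cvgrPdist_le => e e0.
(* Budget: the part cut off costs [e / 5] under [Q] and, by convergence of the integrals of
   [1 - cutoff], at most [2 e / 5] under [nu i]; the part kept costs [e / 5]. The denominator
   [M + 1] covers [M = 0]. *)
have e1 : 0 < e / 5 / (M + 1) by rewrite !divr_gt0// ltr_wpDl.
have /cvgrPdist_le/(_ _ e1)[N _ HN] := cutoff_cvg.
have := HN N (leqnn N); rewrite /= sub0r normrN; set r : R := N.+1%:R^-1 => HNr.
have r0 : 0 < r by rewrite invr_gt0 ltr0n.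
have cc : continuous (fun v : R => 1 - cutoff r v).
  by move=> v; apply: cvgB; [exact: cvg_cst|exact: cutoff_continuous].
have /cvgrPdist_le nuQ1 := nuQ cc; have /cvgrPdist_le nuQ2 := nuQ (cH _ r0).
have e5 : 0 < e / 5 by rewrite divr_gt0.
near=> i.
have ni : (nu i P < +oo)%E by near: i.
have h1 : `|\int[Q]_(z in P) (1 - cutoff r (w z)) - \int[nu i]_(z in P) (1 - cutoff r (w z))|
   <= e / 5 / (M + 1) by near: i; exact: nuQ1.
have h2 : `|\int[Q]_(z in P) H r (w z) - \int[nu i]_(z in P) H r (w z)| <= e / 5.
  by near: i; exact: nuQ2.
have h3 := fH _ _ r0 QP; have h4 := fH _ _ r0 ni.
set a := \int[Q]_(z in P) (1 - cutoff r (w z)) in h1 h3 HNr.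
set b := \int[nu i]_(z in P) (1 - cutoff r (w z)) in h1 h4.
have ha : M * a <= e / 5.
  apply: (@le_trans _ _ ((M + 1) * (e / 5 / (M + 1)))); last first.
    by rewrite mulrC divfK// gt_eqF// ltr_wpDl.
  apply: (@le_trans _ _ (M * (e / 5 / (M + 1)))).
    by rewrite ler_wpM2l// (le_trans (ler_norm _)).
  by rewrite ler_wpM2r ?(ltW e1)// lerDl.
have hb : M * b <= 2 * (e / 5).
  apply: (@le_trans _ _ ((M + 1) * (2 * (e / 5 / (M + 1))))); last first.
    by rewrite mulrCA ler_pM2l// mulrC divfK// gt_eqF// ltr_wpDl.
  apply: (@le_trans _ _ (M * (2 * (e / 5 / (M + 1))))).
    rewrite ler_wpM2l//; move: h1 HNr; rewrite ler_distlC => /andP[h1 h1'].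
    by rewrite ler_norml => /andP[_]; lra.
  by rewrite ler_wpM2r ?lerDl// mulr_ge0// ltW.
move: h2 h3 h4; set x := \int[Q]_(z in P) f z; set y := \int[nu i]_(z in P) f z.
rewrite !ler_norml => /andP[? ?] /andP[? ?] /andP[? ?]; apply/andP; split; lra.
Unshelve. all: by end_near. Qed.

End Portmanteau.

(** * The Bernstein function Psi *)

Section BernsteinFunction.
Context {R : realType}.
Local Notation meas := {measure set (measurableTypeR R) -> \bar R}.
Local Notation P := (`]0%R, +oo[%classic : set (measurableTypeR R)).
Variable N : meas.
Hypothesis N01 : (0 < N P < +oo)%E.
Local Notation NP := (proj2 (andP N01)).
Local Notation N0 := (proj1 (andP N01)).
Implicit Types p q x y v K : R.

Let mP : measurable P. Proof. exact: measurable_itv. Qed.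

Definition kern p v : R := (1 - expR (- (p * v))) / v.

Definition Psi p : R := \int[N]_(v in P) kern p v.

Definition Ntail v : R := \int[N]_(u in `[v, +oo[) u^-1.

Lemma kern_ge0 p v : 0 <= p -> 0 < v -> 0 <= kern p v.
Proof.
by move=> p0 v0; rewrite divr_ge0 ?(ltW v0)// subr_ge0 expR_le1 oppr_le0 mulr_ge0// ltW.
Qed.

Lemma kern_gt0 p v : 0 < p -> 0 < v -> 0 < kern p v.
Proof. by move=> p0 v0; rewrite divr_gt0// subr_gt0 expR_lt1 oppr_lt0 mulr_gt0. Qed.

Lemma kern_le p v : 0 <= p -> 0 < v -> kern p v <= p.
Proof.
by move=> p0 v0; rewrite ler_pdivrMr// lerBlDr addrC -lerBlDr; exact: expR_ge1Dx.
Qed.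

Lemma kern_nd p q v : 0 < v -> p <= q -> kern p v <= kern q v.
Proof.
by move=> v0 pq; rewrite ler_pM2r ?invr_gt0// lerB// ler_expR lerN2 ler_pM2r.
Qed.

(** The chord slopes from 0 of the concave function [1 - e^(- x)] decrease; the form without
    division covers [x = 0]. *)
Lemma expN_slope x y : 0 <= x -> x <= y ->
  x * (1 - expR (- y)) <= y * (1 - expR (- x)).
Proof.
move=> x0 xy; have e0 : 0 < expR (- x) by exact: expR_gt0.
have h1 : expR (- x) * (1 + x) <= 1.
  by rewrite expRN ler_pdivrMl ?expR_gt0// mulr1 expR_ge1Dx.
have h2 : expR (- x) * (1 + (x - y)) <= expR (- y).
  have -> : expR (- y) = expR (- x) * expR (x - y) by rewrite -expRD; congr expR; ring.
  by rewrite ler_pM2l// expR_ge1Dx.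
nra.
Qed.

Lemma kern_scale p v K : 0 <= p -> 0 < v -> 1 <= K -> kern (K * p) v <= K * kern p v.
Proof.
move=> p0 v0 K1; rewrite mulrA ler_pM2r ?invr_gt0//.
have := @expN_slope (p * v) (K * p * v) (mulr_ge0 p0 (ltW v0)).
have [/eqP pv0 _|pv0] := boolP (p * v == 0).
  by rewrite -mulrA pv0 mulr0 oppr0 expR0 subrr mulr0.
have {}pv0 : 0 < p * v by rewrite lt_neqAle eq_sym pv0 mulr_ge0// ltW.
rewrite -mulrA ler_peMl ?(ltW pv0)// => /(_ isT).
by rewrite [K * (p * v) * _]mulrAC [leRHS]mulrC ler_pM2l.
Qed.

Lemma measurable_invP : measurable_fun P (fun v : R => v^-1).
Proof.
apply: open_continuous_measurable_fun; first exact: interval_open.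
by move=> v; rewrite inE/= in_itv/= andbT => v0; apply: inv_continuous; rewrite gt_eqF.
Qed.

Lemma measurable_kern p : measurable_fun P (kern p).
Proof.
apply: measurable_funM; last exact: measurable_invP.
apply: measurable_funTS; apply: measurable_funB => //; apply: measurableT_comp => //.
by apply: measurableT_comp => //; exact: measurable_funM.
Qed.

Lemma kern_integrable p : 0 <= p -> N.-integrable P (EFin \o kern p).
Proof.
move=> p0; apply: (@integrable_bounded R _ (measurableTypeR R) N P _ p) => //.
- exact: NP.
- exact: measurable_kern.

move=> v /=; rewrite in_itv/= andbT => v0.
by rewrite ger0_norm ?kern_ge0// kern_le.
Qed.

Lemma Psi_nd p q : 0 <= p -> p <= q -> Psi p <= Psi q.
Proof.
move=> p0 pq; apply: le_Rintegral => //.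
- exact: kern_integrable.
- by apply: kern_integrable; exact: le_trans pq.
- by move=> v /=; rewrite in_itv/= andbT => v0; exact: kern_nd.
Qed.

Lemma Psi_ge0 p : 0 <= p -> 0 <= Psi p.
Proof.
by move=> p0; apply: Rintegral_ge0 => v /=; rewrite in_itv/= andbT; exact: kern_ge0.
Qed.

Lemma Psi_le p : 0 <= p -> Psi p <= p * fine (N P).
Proof.
move=> p0; rewrite -Rintegral_cst//; apply: le_Rintegral => //.
- exact: kern_integrable.
- apply: (@integrable_bounded R _ (measurableTypeR R) N P _ `|p|) => //; exact: NP.
- by move=> v /=; rewrite in_itv/= andbT; exact: kern_le.
Qed.

Lemma Psi_scale p K : 0 <= p -> 1 <= K -> Psi (K * p) <= K * Psi p.
Proof.
move=> p0 K1; rewrite -RintegralZl//; last exact: kern_integrable.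
have Kp0 : 0 <= K * p by rewrite mulr_ge0// (le_trans ler01).
apply: le_Rintegral => //.
- exact: kern_integrable.
- exact: (integrableZl mP K (kern_integrable p0)).
- by move=> v /=; rewrite in_itv/= andbT => v0; exact: kern_scale.
Qed.

Lemma Psi_gt0 p : 0 < p -> 0 < Psi p.
Proof.
move=> p0; rewrite lt_neqAle Psi_ge0 ?(ltW p0)// andbT eq_sym; apply/negP => /eqP Psi0.
have : (\int[N]_(v in P) `|(kern p v)%:E| = 0)%E.
  transitivity (\int[N]_(v in P) (kern p v)%:E)%E.
    apply: eq_integral => v; rewrite inE/= in_itv/= andbT => v0.
    by rewrite /= ger0_norm// kern_ge0// ltW.
  have fP : (\int[N]_(v in P) (kern p v)%:E)%E \is a fin_num.
    by apply: integrable_fin_num => //; apply: kern_integrable; exact: ltW.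
  by rewrite -(fineK fP); congr EFin.
have mk : measurable_fun P (EFin \o kern p) by apply/measurable_EFinP; exact: measurable_kern.
move/(ae_eq_integral_abs N mP mk) => [A [mA NA0 PA]].
have PAs : P `<=` A.
  move=> v Pv; apply: PA => /(_ Pv) /eqP; rewrite eqe => /eqP k0.
  by move: Pv; rewrite /= in_itv/= andbT => /(kern_gt0 p0); rewrite k0 ltxx.
by have := N0; rewrite ltNge -NA0 le_measure// inE.
Qed.

(** [Psi_scale] pinches the growth: [Psi b - Psi a <= (b - a) / a * Psi a] for [a <= b]. With
    monotonicity this is a local Lipschitz bound, which dictates [d]. *)
Lemma Psi_continuous p : 0 < p -> {for p, continuous Psi}.
Proof.
move=> p0; apply/cvgrPdist_le => e e0.
have P0 := Psi_gt0 p0.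
pose d := Num.min (p / 2) (p * e / (2 * Psi p)).
have d0 : 0 < d by rewrite lt_min !divr_gt0// ?mulr_gt0.
near=> q.
have pq : `|p - q| < d by near: q; exact: cvgr_dist_lt.
have pq1 : `|p - q| < p / 2 by apply: lt_le_trans pq _; rewrite ge_min lexx.
have pq2 : `|p - q| <= p * e / (2 * Psi p).
  by apply: ltW; apply: lt_le_trans pq _; rewrite ge_min lexx orbT.
have q0 : p / 2 < q by move: pq1; rewrite ltr_distlC => /andP[]; lra.
have q0' : 0 < q by lra.
have key a b : 0 < a -> a <= b -> b <= 2 * p -> p / 2 <= a -> `|p - q| = b - a ->
    a = p \/ b = p -> Psi b - Psi a <= e.
  move=> a0 ab bp pa pqE h; have K1 : 1 <= b / a by rewrite ler_pdivlMr// mul1r.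
  have := Psi_scale (ltW a0) K1; rewrite divfK ?gt_eqF// => H.
  have H2 : Psi b - Psi a <= (b - a) / a * Psi a.
    have -> : (b - a) / a = b / a - 1 by rewrite mulrBl divff ?gt_eqF.
    by rewrite mulrBl mul1r lerD2r.
  apply: (le_trans H2); case: h => hp.
    rewrite -pqE hp; apply: (@le_trans _ _ (p * e / (2 * Psi p) / p * Psi p)).
      by rewrite ler_pM2r// ler_pM2r ?invr_gt0.
    have -> : p * e / (2 * Psi p) / p * Psi p = e / 2 by field; rewrite !gt_eqF.
    by rewrite ler_pdivrMr// ler_pMr// ler1n.
  rewrite -pqE; apply: (@le_trans _ _ (p * e / (2 * Psi p) / (p / 2) * Psi p)).
    apply: ler_pM; rewrite ?divr_ge0 ?Psi_ge0 ?(ltW a0)//.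
      by apply: ler_pM; rewrite ?invr_ge0 ?(ltW a0)// lef_pV2 ?posrE ?divr_gt0.
    by rewrite -hp Psi_nd// ltW.
  by rewrite le_eqVlt; apply/orP; left; apply/eqP; field; rewrite !gt_eqF.
have [pleq|qltp] := leP p q.
  rewrite ler0_norm ?subr_le0 ?Psi_nd ?(ltW p0)// opprB.
  apply: key => //.
  - by move: pq1; rewrite ltr_distlC => /andP[]; lra.
  - by lra.
  - by rewrite ler0_norm ?subr_le0// opprB.
  - by left.
rewrite ger0_norm ?subr_ge0 ?Psi_nd ?(ltW q0') ?(ltW qltp)//.
apply: key => //.
- exact: ltW.
- by lra.
- exact: ltW.
- by rewrite ger0_norm ?subr_ge0// ltW.
- by right.
Unshelve. all: by end_near. Qed.

End BernsteinFunction.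

(** * Strict subhomogeneity of [Psi] from the tail of [N] *)

Section SubRegular.
Context {R : realType}.
Local Notation meas := {measure set (measurableTypeR R) -> \bar R}.
Local Notation P := (`]0%R, +oo[%classic : set (measurableTypeR R)).
Variable N : meas.
Hypothesis N01 : (0 < N P < +oo)%E.
Local Notation NP := (proj2 (andP N01)).
Implicit Types p q x y v K u : R.
Local Notation PsiN := (Psi N).
Local Notation TN := (Ntail N).

Let mP : measurable P. Proof. exact: measurable_itv. Qed.

Let NfinS (A : set (measurableTypeR R)) : measurable A -> A `<=` P -> (N A < +oo)%E.
Proof. by move=> mA AP; apply: le_lt_trans NP; apply: le_measure; rewrite ?inE. Qed.

Variables (kappa v0 : R).
Hypotheses (k0 : 0 < kappa) (k2 : kappa < 2) (v00 : 0 < v0).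
Hypothesis tail_half : forall v, 0 < v -> v <= v0 -> TN (v / 2) <= kappa * TN v.

Let tail_int (A : set (measurableTypeR R)) v : measurable A -> 0 < v ->
  A `<=` `[v, +oo[ -> N.-integrable A (EFin \o (fun u : R => u^-1)).
Proof.
move=> mA v0' Av; have AP : A `<=` P.
  by move=> u /Av /=; rewrite !in_itv/= !andbT; exact: lt_le_trans.
apply: (@integrable_bounded R _ (measurableTypeR R) N A _ v^-1) => //.
- exact: NfinS.
- exact: (measurable_funS mP AP (@measurable_invP R)).
- move=> u /Av /=; rewrite in_itv/= andbT => vu.
  by rewrite ger0_norm ?invr_ge0 ?(le_trans (ltW v0'))// lef_pV2 ?posrE// (lt_le_trans v0').
Qed.

Let TN_ge0 v : 0 < v -> 0 <= TN v.
Proof.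
move=> v0'; apply: Rintegral_ge0 => u /=; rewrite in_itv/= andbT => vu.
by rewrite invr_ge0 (le_trans (ltW v0')).
Qed.

Let Nint v : R := fine (N `]0%R, v[%classic).

Let itvP (i : interval R) : measurable ([set` i] : set (measurableTypeR R)).
Proof. exact: measurable_itv. Qed.

Let Nint_half u : 0 < u -> Nint u <= Nint (u / 2) + u * TN (u / 2).
Proof.
move=> u0; have u20 : 0 < u / 2 by rewrite divr_gt0.
pose A : set (measurableTypeR R) := `[u / 2, u[%classic.
have E : `]0%R, u[%classic = `]0%R, u / 2[%classic `|` A :> set R.
  apply/seteqP; split => x /=; rewrite /A/= !in_itv/=.
    by move=> /andP[-> xu]/=; have [h|h] := ltP x (u / 2); [left|right].
  by case=> /andP[h1 h2]; apply/andP; split; lra.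
have AP : A `<=` P by move=> x; rewrite /A/= !in_itv/= andbT => /andP[+ _]; exact: lt_le_trans.
have fA : N A \is a fin_num by rewrite ge0_fin_numE//; apply: NfinS => //; exact: itvP.
have f2 : N `]0%R, u / 2[%classic \is a fin_num.
  rewrite ge0_fin_numE//; apply: NfinS; first exact: itvP.
  by move=> x /=; rewrite !in_itv/= andbT => /andP[].
rewrite /Nint E measureU//; last 2 first.
- exact: itvP.
- by apply/seteqP; split => // x [] /=; rewrite /A/= !in_itv/= => /andP[_ h] /andP[h' _]; lra.
rewrite fineD// lerD2l.
have mA : measurable A by exact: itvP.
have sA : A `<=` `[u / 2, +oo[ by move=> x; rewrite /A/= !in_itv/= andbT => /andP[].
have -> : fine (N A) = \int[N]_(x in A) 1 by rewrite Rintegral_cst// mul1r.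
have iA := tail_int mA u20 sA.
apply: (@le_trans _ _ (\int[N]_(x in A) (u * x^-1))).
  apply: le_Rintegral => //.
  - apply: (@integrable_bounded R _ (measurableTypeR R) N A _ 1) => //; first exact: NfinS.
    by move=> x _; rewrite normr1.
  - exact: (integrableZl mA u iA).
  - move=> x; rewrite /A/= in_itv/= => /andP[h1 h2].
    by rewrite ler_pdivlMr ?mul1r ?(ltW h2)// (lt_le_trans u20).
rewrite RintegralZl// ler_pM2l//.
have mT : measurable (`[u / 2, +oo[ : set (measurableTypeR R)) by exact: itvP.
rewrite /Ntail /Rintegral fine_le//.
- exact: integrable_fin_num.
- by apply: integrable_fin_num => //; exact: (tail_int mT u20).
- apply: ge0_subset_integral => //.
  + by have /integrableP[] := tail_int mT u20 (@subset_refl _ _).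
  + move=> x /=; rewrite in_itv/= andbT lee_fin invr_ge0 => h.
    by rewrite (le_trans (ltW u20)).
Qed.

(** Dyadic summation: [tail_half] makes the mass of [[u / 2^(n+1), u / 2^n[] at most [kappa u TN(u)]
    times [(kappa / 2)^n], and [kappa < 2] makes the series converge. The remainder [N ]0, u / 2^n[]
    tends to 0 because [N] is finite. *)
Let Nint_le u : 0 < u -> u <= v0 -> Nint u <= kappa / (1 - kappa / 2) * (u * TN u).
Proof.
move=> u0 uv0; pose q := kappa / 2.
have q1 : 0 < 1 - q by rewrite subr_gt0 ltr_pdivrMr// mul1r.
have q0 : 0 < q by rewrite divr_gt0.
pose X := kappa * (u * TN u).
have X0 : 0 <= X by rewrite mulr_ge0 ?(ltW k0)// mulr_ge0 ?TN_ge0// ltW.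
have un0 n : 0 < u / 2 ^+ n by rewrite divr_gt0// exprn_gt0.
have unv n : u / 2 ^+ n <= v0.
  apply: le_trans uv0; rewrite ler_pdivrMr ?exprn_gt0// ler_peMr ?(ltW u0)//.
  by rewrite exprn_ege1// ler1n.
have tn n : TN (u / 2 ^+ n) <= kappa ^+ n * TN u.
  elim: n => [|n IH]; first by rewrite !expr0 divr1 mul1r.
  rewrite exprSr invfM mulrA; apply: (le_trans (tail_half (un0 n) (unv n))).
  by rewrite exprS -mulrA ler_pM2l.
have step n : Nint (u / 2 ^+ n) <= Nint (u / 2 ^+ n.+1) + X * q ^+ n.
  have := Nint_half (un0 n); rewrite -mulrA -invfM -exprSr => /le_trans; apply.
  rewrite lerD2l; apply: (@le_trans _ _ (u / 2 ^+ n * (kappa ^+ n.+1 * TN u))).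
    by rewrite ler_pM2l.
  rewrite /X /q expr_div_n exprS le_eqVlt; apply/orP; left; apply/eqP.
  by field; rewrite gt_eqF// exprn_gt0.
have sum n : Nint u <= Nint (u / 2 ^+ n) + X * (1 - q ^+ n) / (1 - q).
  elim: n => [|n IH]; first by rewrite !expr0 divr1 subrr mulr0 mul0r addr0.
  apply: (le_trans IH); have := step n.
  have -> : X * (1 - q ^+ n.+1) / (1 - q) = X * q ^+ n + X * (1 - q ^+ n) / (1 - q).
    by rewrite exprS; field; rewrite gt_eqF.
  by lra.
have lim0 : Nint (u / 2 ^+ n) @[n --> \oo] --> (0 : R).
  pose F n : set (measurableTypeR R) := `]0, (u / 2 ^+ n)[%classic.
  have F0 : \bigcap_n F n = set0.
    apply/seteqP; split => // x H; have := H 0%N Logic.I.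
    rewrite /F/= in_itv/= expr0 divr1 => /andP[x0 _].
    have := H (Num.truncn (u / x)) Logic.I; rewrite /F/= in_itv/= => /andP[_].
    rewrite ltr_pdivlMr ?exprn_gt0// mulrC -ltr_pdivlMr// => h.
    have := lt_trans h (truncnS_gt _); rewrite -natrX ltr_nat ltnS.
    by rewrite leqNgt ltn_expl.
  have : N \o F @ \oo --> N (\bigcap_n F n).
    apply: nonincreasing_cvg_mu.
    - rewrite /F; apply: NfinS; first exact: itvP.
      by move=> x /=; rewrite !in_itv/= andbT => /andP[].
    - by move=> n; exact: itvP.
    - by rewrite F0.
    - move=> m n mn; apply/subsetPset => x; rewrite /F/= !in_itv/= => /andP[-> /=].
      move=> /lt_le_trans; apply; rewrite ler_pM2l// lef_pV2 ?posrE ?exprn_gt0//.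
      by rewrite ler_weXn2l// ler1n.
  by rewrite F0 measure0 => /fine_cvg.
have cl : Nint (u / 2 ^+ n) + X / (1 - q) @[n --> \oo] --> 0 + X / (1 - q).
  by apply: cvgD => //; exact: cvg_cst.
rewrite (_ : kappa / (1 - kappa / 2) * (u * TN u) = 0 + X / (1 - q)); last first.
  by rewrite /X add0r mulrAC.
apply: (cvg_le_near (cvg_cst (Nint u)) cl).
near=> n; apply: (le_trans (sum n)); rewrite lerD2l ler_pM2r ?invr_gt0//.
by rewrite ler_piMr// gerBl exprn_ge0// ltW.
Unshelve. all: by end_near. Qed.

(** Split at [1 / p]: the kernel is at most [p] below and at most [1 / v] above. [Nint_le] brings
    the lower part back to the tail, so that [Psi p] is governed by [v >= 1 / p]. *)
Let Psi_tail p : 0 < p -> v0^-1 <= p -> PsiN p <= (1 + kappa / (1 - kappa / 2)) * TN p^-1.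
Proof.
move=> p0 pv; have ip0 : 0 < p^-1 by rewrite invr_gt0.
have ipv : p^-1 <= v0 by rewrite invf_ple ?posrE.
pose A : set (measurableTypeR R) := `]0, p^-1[%classic.
pose A' : set (measurableTypeR R) := `[p^-1, +oo[%classic.
have mA : measurable A by exact: itvP.
have mA' : measurable A' by exact: itvP.
have E : P = A `|` A'.
  apply/seteqP; split => x /=; rewrite /A/A'/= !in_itv/= !andbT.
    by move=> x0; have [h|h] := ltP x p^-1; [left; rewrite x0|right].
  by case=> [/andP[]//|]; exact: lt_le_trans.
have AP : A `<=` P by rewrite E => x; left.
have AP' : A' `<=` P by rewrite E => x; right.
have iP := kern_integrable N01 (ltW p0).
have iA := integrableS mP mA AP iP; have iA' := integrableS mP mA' AP' iP.
rewrite /Psi [X in Rintegral _ X _]E Rintegral_setU//; last 2 first.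
- by rewrite -E.
- by apply/disj_setPS => x [] /=; rewrite /A/A'/= !in_itv/= andbT => /andP[_ h] h'; lra.
rewrite mulrDl mul1r addrC lerD//.
  apply: le_Rintegral => //; first exact: (tail_int mA' ip0).
  move=> x; rewrite /A'/= in_itv/= andbT => px; have x0 := lt_le_trans ip0 px.
  by rewrite ler_piMl ?invr_ge0 ?(ltW x0)// lerBlDr lerDl expR_ge0.
apply: (@le_trans _ _ (p * Nint p^-1)).
  rewrite /Nint -Rintegral_cst//; apply: le_Rintegral => //.
    apply: (@integrable_bounded R _ (measurableTypeR R) N A _ `|p|) => //.
    exact: NfinS.
  by move=> x; rewrite /A/= in_itv/= => /andP[x0 _]; apply: kern_le => //; exact: ltW.
have := Nint_le ip0 ipv; rewrite -(ler_pM2l p0) => /le_trans; apply.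
by rewrite mulrCA mulVKf// gt_eqF.
Qed.

(** The quotient [D K (p v) / v] is the homogeneity defect [kern p v - kern (K p) v / K]. *)
Let D K x : R := (1 - expR (- x)) - (1 - expR (- (K * x))) / K.

Let D_nd K x y : 1 < K -> 0 <= x -> x < y -> D K x < D K y.
Proof.
move=> K1 x0 xy; have K0 : 0 < K by lra.
have dD z : is_derive z (1 : R) (D K) (expR (- z) - expR (- (K * z))).
  have d1 : is_derive z (1 : R) (expR \o -%R) (- expR (- z)).
    by rewrite -mulrN1; apply: is_derive1_comp.
  have d2 : is_derive z (1 : R) (expR \o ( *%R (- K))) (- K * expR (- (K * z))).
    rewrite [_ * expR _]mulrC -mulNr; apply: is_derive1_comp.
    rewrite -[X in is_derive _ _ _ X]mulr1.
    exact: (@is_deriveZ R R R id (- K) z 1 1 (is_derive_id z 1)).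
  have -> : D K = cst (1 - K^-1) - (expR \o -%R) + K^-1 *: (expR \o ( *%R (- K))).
    by apply/funext => t; rewrite /D !fctE/= /GRing.scale/= mulNr; field; rewrite gt_eqF.
  have -> : expR (- z) - expR (- (K * z)) = 0 - (- expR (- z)) + K^-1 * (- K * expR (- (K * z))).
    by field; rewrite gt_eqF.
  by apply: is_deriveD.
have cD : {within `[x, y], continuous (D K)}.
  apply: continuous_subspaceT => z; apply/differentiable_continuous.
  by apply/derivable1_diffP; have [] := dD z.
have [c] := MVT xy (fun z _ => dD z) cD.
rewrite in_itv/= => /andP[xc cy] E; rewrite -subr_gt0 E mulr_gt0 ?subr_gt0//.
rewrite ltr_expR ltrN2 ltr_pMl//; lra.
Qed.

(** The defect is at least [cK / v] for [v >= 1 / p], so it integrates to at least [cK TN(1 / p)],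
    and [Psi_tail] turns this into the fraction [cK / C] of [Psi p]. Hence [theta = 1 - cK / C]. *)
Lemma Psi_subregular K : 1 < K -> exists2 theta, 0 < theta < 1 &
  exists p0, 0 < p0 /\ forall p, p0 <= p -> PsiN (K * p) <= theta * K * PsiN p.
Proof.
move=> K1; have K0 : 0 < K by lra.
pose cK := D K 1; pose C := 1 + kappa / (1 - kappa / 2).
have D0 : D K 0 = 0 by rewrite /D mulr0 oppr0 expR0 !subrr mul0r subr0.
have cK0 : 0 < cK by rewrite -D0; exact: D_nd.
have C0 : 0 < C by rewrite addr_gt0// divr_gt0// subr_gt0 ltr_pdivrMr// mul1r.
have key p : 0 < p -> v0^-1 <= p -> PsiN (K * p) <= K * (1 - cK / C) * PsiN p.
  move=> p0 pv; have ip0 : 0 < p^-1 by rewrite invr_gt0.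
  have h1 := Psi_tail p0 pv.
  have h2 : cK * TN p^-1 <= PsiN p - PsiN (K * p) / K.
    pose A' : set (measurableTypeR R) := `[p^-1, +oo[%classic.
    have mA' : measurable A' by exact: itvP.
    have AP' : A' `<=` P.
      by move=> x; rewrite /A'/= !in_itv/= !andbT; exact: lt_le_trans.
    have iT := tail_int mA' ip0 (@subset_refl _ _).
    have ip := kern_integrable N01 (ltW p0).
    have iKp := kern_integrable N01 (ltW (mulr_gt0 K0 p0)).
    have iKp' : N.-integrable P (EFin \o (fun v => kern (K * p) v / K)).
      exact: (integrableZr mP K^-1 iKp).
    have idf := integrableB mP ip iKp'.
    have kD v : 0 < v -> kern p v - kern (K * p) v / K = D K (p * v) / v.
      by move=> v0'; rewrite /kern /D mulrA; field; rewrite !gt_eqF.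
    have D_ge0 x : 0 <= x -> 0 <= D K x.
      rewrite le_eqVlt => /predU1P[<-|x0]; first by rewrite D0.
      by apply/ltW; rewrite -D0; exact: D_nd.
    rewrite /Psi -(RintegralZr K^-1 mP iKp) -(RintegralB mP ip iKp').
    apply: (@le_trans _ _ (\int[N]_(v in A') (kern p v - kern (K * p) v / K))).
      rewrite -RintegralZl//; apply: le_Rintegral => //.
      - exact: (integrableZl mA' cK iT).
      - exact: (integrableS mP mA' AP' idf).
      move=> v Av; have v0' : 0 < v by have := AP' _ Av; rewrite /= in_itv/= andbT.
      move: Av; rewrite /A'/= in_itv/= andbT => pv'.
      rewrite kD// ler_pM2r ?invr_gt0// /cK.
      have : 1 <= p * v by rewrite -ler_pdivrMl// mulr1.
      by rewrite le_eqVlt => /predU1P[<-//|h]; apply/ltW/D_nd.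
    rewrite /Rintegral fine_le//.
    - by apply: integrable_fin_num => //; exact: (integrableS mP mA' AP' idf).
    - exact: integrable_fin_num.
    - apply: ge0_subset_integral => //.
      + by have /integrableP[] := idf.
      + move=> v /=; rewrite in_itv/= andbT lee_fin => v0'.
        by rewrite kD// divr_ge0 ?(ltW v0')// D_ge0// mulr_ge0// ltW.
  have h3 : cK / C * PsiN p <= PsiN p - PsiN (K * p) / K.
    apply: le_trans h2; rewrite -mulrA ler_pM2l// ler_pdivrMl//.
  have h4 : PsiN (K * p) / K <= (1 - cK / C) * PsiN p by lra.
  by move: h4; rewrite ler_pdivrMr// => /le_trans; apply; rewrite mulrC mulrA.
have th1 : 1 - cK / C < 1 by rewrite ltrBlDr ltrDl divr_gt0.
(* Read off from [key] at one point, as [Psi] is positive on both sides. *)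
have th0 : 0 < 1 - cK / C.
  have p0 : 0 < v0^-1 by rewrite invr_gt0.
  have := key _ p0 (lexx _); have := Psi_gt0 N01 (mulr_gt0 K0 p0) => h /(lt_le_trans h).
  by rewrite pmulr_lgt0 ?(Psi_gt0 N01)// pmulr_rgt0.
exists (1 - cK / C); first by rewrite th0.
exists v0^-1; split; first by rewrite invr_gt0.
move=> p pv; rewrite [_ * K]mulrC; apply: key => //.
by apply: lt_le_trans pv; rewrite invr_gt0.
Qed.

End SubRegular.

(** * Hazard rates *)

Section FixedPoint.
Context {R : realType}.
Local Notation meas := {measure set (measurableTypeR R) -> \bar R}.
Local Notation P := (`]0%R, +oo[%classic : set (measurableTypeR R)).
Local Notation leb := (@lebesgue_measure R).
Variable N : meas.
Hypothesis N01 : (0 < N P < +oo)%E.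
Local Notation NP := (proj2 (andP N01)).
Implicit Types (p q x y v K u t s : R) (h : R -> R).

Let mP : measurable P. Proof. exact: measurable_itv. Qed.

Let pos x : R := Num.max x 0.

Let pos_ge0 x : 0 <= pos x. Proof. by rewrite /pos le_max lexx orbT. Qed.

Let posE x : 0 <= x -> pos x = x. Proof. by move=> x0; rewrite /pos max_l. Qed.

Let pos_nd x y : x <= y -> pos x <= pos y.
Proof. by move=> xy; rewrite /pos; apply: le_max2. Qed.

Definition nd_ge0 h := {homo h : x y / x <= y} /\ forall x, 0 <= h x.

(** For [x > 0] this is the integral of [h] over [[x, x e^v]], rescaled so that the domain no longer
    depends on [x]; monotonicity in [h] and in [x] is then pointwise. Negative [x] counts as 0, so
    that everything is monotone on the whole line. *)
Definition hazard_int h x v : R :=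
  \int[leb]_(s in `[1, expR v]) (pos x * h (pos x * s)).

(* With [S x = expR (- \int_0^x h)], the fixed points of [hazard_op] are given by
   [h x * S x = \int[N]_v (S x - S (x * expR v)) / v], the equation of the mass at
   time [x] of a system started from one fragment of unit size. *)
Definition hazard_op h x : R :=
  \int[N]_(v in P) ((1 - expR (- hazard_int h x v)) / v).

Section hazard_theory.

Let I v : set R := `[1, expR v]%classic.

Let mI v : measurable (I v : set (measurableTypeR R)). Proof. exact: measurable_itv. Qed.

Let lebI v : 0 <= v -> leb (I v) = (expR v - 1)%:E.
Proof.
move=> v0; rewrite /I lebesgue_measure_itv/= lte_fin.
case: ltP => [_|h]; first by rewrite EFinB.
have /eqP -> : expR v == 1 by rewrite eq_le h -expR0 ler_expR.
by rewrite subrr.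
Qed.

Let lebI_lty v : 0 <= v -> (leb (I v) < +oo)%E.
Proof. by move=> v0; rewrite lebI// ltry. Qed.

Let integrand_le h x v s : nd_ge0 h -> I v s ->
  pos x * h (pos x) <= pos x * h (pos x * s) <= pos x * h (pos x * expR v).
Proof.
move=> [hnd h0]; rewrite /I/= in_itv/= => /andP[s1 sv].
by rewrite !ler_wpM2l//; apply: hnd; rewrite ?ler_wpM2l// ler_peMr.
Qed.

Lemma hazard_integrable h x v : nd_ge0 h -> 0 <= v ->
  leb.-integrable (I v) (EFin \o (fun s => pos x * h (pos x * s))).
Proof.
move=> hnd v0; apply: (@integrable_bounded R _ (measurableTypeR R) leb (I v) _
  (pos x * h (pos x * expR v))) => //.
- exact: lebI_lty.
- apply: nondecreasing_measurable; first exact: mI.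
  by move=> a b ab; rewrite ler_wpM2l//; apply: hnd.1; rewrite ler_wpM2l.
- move=> s Is; have /andP[h1 h2] := integrand_le x hnd Is.
  by rewrite ger0_norm// mulr_ge0// hnd.2.
Qed.

Lemma hazard_int_bounds h x v : nd_ge0 h -> 0 <= v ->
  pos x * h (pos x) * (expR v - 1) <= hazard_int h x v <=
  pos x * h (pos x * expR v) * (expR v - 1).
Proof.
move=> hnd v0; have lv : fine (leb (I v)) = expR v - 1 by rewrite lebI.
have ci (c : R) : leb.-integrable (I v) (EFin \o (fun=> c)).
  by apply: (@integrable_bounded R _ (measurableTypeR R) leb (I v) _ `|c|) => //; exact: lebI_lty.
have hi := hazard_integrable x hnd v0.
have cE (c : R) : c * (expR v - 1) = \int[leb]_(s in I v) c.
  by rewrite (@Rintegral_cst _ (measurableTypeR R) R leb (I v) (mI v)) lv.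
rewrite !cE; apply/andP; split; apply: le_Rintegral => //.
  by move=> s Is; have /andP[] := integrand_le x hnd Is.
by move=> s Is; have /andP[] := integrand_le x hnd Is.
Qed.

Lemma hazard_int_ge0 h x v : nd_ge0 h -> 0 <= hazard_int h x v.
Proof. by move=> [_ h0]; apply: Rintegral_ge0 => s _; rewrite mulr_ge0. Qed.

Lemma hazard_int_le h h' x y v : nd_ge0 h -> nd_ge0 h' -> (forall z, h z <= h' z) ->
  x <= y -> 0 <= v -> hazard_int h x v <= hazard_int h' y v.
Proof.
move=> hnd hnd' hh' xy v0; apply: le_Rintegral => //; try exact: hazard_integrable.
move=> s; rewrite /I/= in_itv/= => /andP[s1 _].
have [_ h0] := hnd; rewrite ler_pM ?pos_nd//.
apply: (le_trans (hh' _)); apply: hnd'.1; rewrite ler_pM2r ?pos_nd//.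
exact: lt_le_trans s1.
Qed.

Lemma hazard_int_ndv h x v v' : nd_ge0 h -> 0 <= v -> v <= v' ->
  hazard_int h x v <= hazard_int h x v'.
Proof.
move=> hnd v0 vv'; have v0' := le_trans v0 vv'.
rewrite /hazard_int /Rintegral; apply: fine_le.
- by apply: integrable_fin_num; [exact: mI|exact: hazard_integrable].
- by apply: integrable_fin_num; [exact: mI|exact: hazard_integrable].
- apply: ge0_subset_integral; [exact: mI|exact: mI|..].
  + by have /integrableP[] := hazard_integrable x hnd v0'.
  + by move=> s _; rewrite lee_fin mulr_ge0// hnd.2.
  + move=> s; rewrite /= !in_itv/= => /andP[-> /le_trans]; apply.
    by rewrite ler_expR.
Qed.

Definition hazard_kern h x v : R := (1 - expR (- hazard_int h x v)) / v.

Lemma hazard_kern_ge0 h x v : nd_ge0 h -> 0 < v -> 0 <= hazard_kern h x v.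
Proof.
move=> hnd v0; rewrite divr_ge0 ?(ltW v0)// subr_ge0 expR_le1 oppr_le0.
exact: hazard_int_ge0.
Qed.

(** The bound has to be uniform in [v]: for [v <= 1] the numerator is at most the hazard integral,
    of order [e^v - 1 <= v e^v]; for [v > 1] the quotient is at most 1. *)
Lemma hazard_kern_le h x v : nd_ge0 h -> 0 < v ->
  hazard_kern h x v <= 1 + Num.max x 0 * h (Num.max x 0 * expR 1) * expR 1.
Proof.
move=> hnd v0; have h0 := hnd.2; rewrite -/(pos x).
have [v1|v1] := leP v 1; last first.
  rewrite -[leLHS]addr0 lerD ?mulr_ge0 ?expR_ge0//.
  rewrite ler_pdivrMr// mul1r (le_trans _ (ltW v1))// gerBl expR_ge0//.
rewrite -[leLHS]add0r lerD// ler_pdivrMr//.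
apply: (@le_trans _ _ (hazard_int h x v)).
  by rewrite lerBlDr addrC -lerBlDr; exact: expR_ge1Dx.
have /andP[_ h2] := hazard_int_bounds x hnd (ltW v0); apply: (le_trans h2).
rewrite -[leRHS]mulrA; apply: ler_pM.
- by rewrite mulr_ge0.
- by rewrite subr_ge0 -expR0 ler_expR ltW.
- by rewrite ler_wpM2l//; apply: hnd.1; rewrite ler_wpM2l// ler_expR.
have h3 : 1 - expR (- v) <= v by rewrite lerBlDr addrC -lerBlDr; exact: expR_ge1Dx.
have -> : expR v - 1 = expR v * (1 - expR (- v)) by rewrite mulrBr mulr1 expRxMexpNx_1.
by apply: ler_pM; rewrite ?expR_ge0 ?ler_expR// subr_ge0 expR_le1 oppr_le0 ltW.
Qed.

Lemma hazard_kern_integrable h x : nd_ge0 h -> N.-integrable P (EFin \o hazard_kern h x).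
Proof.
move=> hnd; apply: (@integrable_bounded R _ (measurableTypeR R) N P _
  (1 + Num.max x 0 * h (Num.max x 0 * expR 1) * expR 1)) => //.
  exact: NP.
  apply: measurable_funM; last exact: measurable_invP.
  pose f v := 1 - expR (- hazard_int h x (pos v)).
  have mf : measurable_fun P f.
    apply: nondecreasing_measurable; first exact: mP.
    move=> a b ab; rewrite /f; apply: lerB; first exact: lexx.
    rewrite ler_expR lerN2; apply: hazard_int_ndv; [exact: hnd|exact: pos_ge0|].
    exact: pos_nd.
  apply: eq_measurable_fun mf => v; rewrite inE/= in_itv/= andbT => v0.
  by rewrite /f posE// ltW.
move=> v /=; rewrite in_itv/= andbT => v0; rewrite ger0_norm ?hazard_kern_ge0//.
exact: hazard_kern_le.
Qed.

Lemma hazard_op_ge0 h x : nd_ge0 h -> 0 <= hazard_op h x.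
Proof.
by move=> hnd; apply: Rintegral_ge0 => v /=; rewrite in_itv/= andbT; exact: hazard_kern_ge0.
Qed.

Lemma hazard_op_le h h' x y : nd_ge0 h -> nd_ge0 h' -> (forall z, h z <= h' z) ->
  x <= y -> hazard_op h x <= hazard_op h' y.
Proof.
move=> hnd hnd' hh' xy; apply: le_Rintegral => //; try exact: hazard_kern_integrable.
move=> v /=; rewrite in_itv/= andbT => v0.
by rewrite ler_pM2r ?invr_gt0// lerB// ler_expR lerN2 hazard_int_le// ltW.
Qed.

Lemma nd_hazard_op h : nd_ge0 h -> nd_ge0 (hazard_op h).
Proof.
move=> hnd; split; last by move=> x; exact: hazard_op_ge0.
by move=> x y xy; exact: hazard_op_le.
Qed.

(** As [h] is nondecreasing and [e^v - 1 >= v], the hazard integral is at least [x h(x) v]. Combined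
    with [lam = Psi(t lam)], this makes [lam] a subsolution. *)
Lemma hazard_op_ge h x : nd_ge0 h -> 0 <= x -> Psi N (x * h x) <= hazard_op h x.
Proof.
move=> hnd x0; have xh0 : 0 <= x * h x by rewrite mulr_ge0// hnd.2.
apply: le_Rintegral => //; [exact: kern_integrable|exact: hazard_kern_integrable|].
move=> v /=; rewrite in_itv/= andbT => v0.
rewrite ler_pM2r ?invr_gt0// lerB// ler_expR lerN2.
have /andP[+ _] := hazard_int_bounds x hnd (ltW v0); rewrite posE//; apply: le_trans.
by rewrite ler_wpM2l// lerBrDl; exact: expR_ge1Dx.
Qed.

(** A linear bound on the hazard integral is available for small [v] only. For [v > d] the numerator
    is bounded by 1, at the price of the factor [1 / (1 - e^(- q d))], close to 1 when [q] is
    large. *)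
Lemma hazard_op_le_Psi h x (q d : R) : nd_ge0 h -> 0 < q -> 0 < d ->
  (forall v, 0 < v -> v <= d -> hazard_int h x v <= q * v) ->
  hazard_op h x <= Psi N q / (1 - expR (- (q * d))).
Proof.
move=> hnd q0 d0 hq.
have e0 : 0 < 1 - expR (- (q * d)) by rewrite subr_gt0 expR_lt1 oppr_lt0 mulr_gt0.
have iq := kern_integrable N01 (ltW q0).
rewrite /Psi -RintegralZr//; apply: le_Rintegral => //.
- exact: hazard_kern_integrable.
- exact: (integrableZr mP _ iq).
move=> v /=; rewrite in_itv/= andbT => v0; rewrite /kern mulrAC ler_pM2r ?invr_gt0//.
have [vd|dv] := leP v d; last first.
  rewrite (@le_trans _ _ 1) ?gerBl ?expR_ge0// ler_pdivlMr// mul1r lerB// ler_expR lerN2.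
  by rewrite ler_pM2l// ltW.
apply: (@le_trans _ _ (1 - expR (- (q * v)))).
  by rewrite lerB// ler_expR lerN2 hq.
rewrite ler_pdivlMr// ler_piMr ?gerBl ?expR_ge0// subr_ge0 expR_le1 oppr_le0.
by rewrite mulr_ge0// ltW.
Qed.

End hazard_theory.

End FixedPoint.

(** * The scale [lam] defined by [g = t F(g)] *)

Section SubregularInverse.
Context {R : realType}.
Implicit Types p q x y v K u t s : R.
Variable F : R -> R.
Hypotheses (F_nd : forall p q, 0 <= p -> p <= q -> F p <= F q)
  (F_scale : forall p K, 0 <= p -> 1 <= K -> F (K * p) <= K * F p)
  (F_gt0 : forall p, 0 < p -> 0 < F p).

Variables (g : R -> R) (t1 : R).
Hypotheses (t10 : 0 < t1) (gP : forall t, t1 <= t -> 0 < g t /\ g t = t * F (g t)).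
Hypothesis star : forall K, 1 < K -> exists2 theta : R, 0 < theta < 1 &
  exists p0 : R, 0 < p0 /\ forall p, p0 <= p -> F (K * p) <= theta * K * F p.

Definition lam t : R := g t / t.

Let F_slope p q : 0 < p -> p <= q -> p * F q <= q * F p.
Proof.
move=> p0 pq; have K1 : 1 <= q / p by rewrite ler_pdivlMr// mul1r.
have := F_scale (ltW p0) K1; rewrite divfK ?gt_eqF// => h.
by rewrite mulrC -ler_pdivlMr// mulrAC.
Qed.

Lemma lamE t : t1 <= t -> lam t = F (g t).
Proof.
move=> tt1; have [_ gE] := gP tt1; rewrite /lam {1}gE mulrC mulKf// gt_eqF//.
exact: lt_le_trans tt1.
Qed.

Lemma g_nd s t : t1 <= s -> s <= t -> g s <= g t.
Proof.
move=> s1 st; have t1' := le_trans s1 st.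
have [gs0 gsE] := gP s1; have [gt0 gtE] := gP t1'.
rewrite leNgt; apply/negP => gts.
have h := F_slope gt0 (ltW gts); have s0 := lt_le_trans t10 s1.
have Ps : 0 < F (g s) by exact: F_gt0.
have Pt : 0 < F (g t) by exact: F_gt0.
move: h; rewrite {1}gtE {2}gsE -!mulrA [F (g t) * _]mulrC.
rewrite ler_pM2r ?mulr_gt0// => ts.
have E : s = t by apply/eqP; rewrite eq_le st ts.
by rewrite E ltxx in gts.
Qed.

Lemma lam_gt0 t : t1 <= t -> 0 < lam t.
Proof.
by move=> tt1; have [g0 _] := gP tt1; rewrite divr_gt0// (lt_le_trans t10).
Qed.

Lemma lam_nd s t : t1 <= s -> s <= t -> lam s <= lam t.
Proof.
move=> s1 st; rewrite !lamE ?(le_trans s1)//; apply: F_nd => //; last exact: g_nd.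
by apply: ltW; have [] := gP s1.
Qed.

Lemma g_unbounded (W : R) : exists t0, t1 <= t0 /\ forall t, t0 <= t -> W < g t.
Proof.
have W0 : 0 < `|W| + 1 by rewrite ltr_wpDl.
pose V := `|W| + 1; have PV : 0 < F V by exact: F_gt0.
exists (Num.max t1 (V / F V + 1)); split; first by rewrite le_max lexx.
move=> t; rewrite ge_max => /andP[tt1 tV]; have [g0 gE] := gP tt1.
apply: (@lt_trans _ _ V); first by rewrite /V (le_lt_trans (ler_norm W))// ltrDl.
rewrite ltNge; apply/negP => gV.
have h := F_slope g0 gV; have Pg : 0 < F (g t) by exact: F_gt0.
have : t * F V <= V.
  by move: h; rewrite {1}gE mulrAC ler_pM2r.
by rewrite -ler_pdivlMr// => h'; have := le_trans tV h'; rewrite gerDl ler10.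
Qed.

(** If [g(delta t) > K g(t)], then, as [p / F(p)] is nondecreasing,
    [delta t = g(delta t) / F(g(delta t))] is at least [K g(t) / F(K g(t)) >= t / theta]. Any
    [delta] with [delta theta < 1] excludes this; [2 / (1 + theta)] also exceeds 1. So
    [g(delta t) <= K g(t)], and [lam = F(g)] inherits the factor [K]. *)
Lemma lam_slow K : 1 < K -> exists2 delta : R, 1 < delta &
  exists t0, t1 <= t0 /\ forall t, t0 <= t -> lam (delta * t) <= K * lam t.
Proof.
move=> K1; have K0 : 0 < K by rewrite (lt_trans ltr01).
have [theta /andP[th0 th1] [p0 [p00 Hp]]] := star K1.
have [t0 [t10' Ht0]] := g_unbounded p0.
pose delta := 2 / (1 + theta).
have d1 : 1 < delta by rewrite /delta ltr_pdivlMr ?mul1r; lra.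
exists delta => //; exists t0; split => // t tt0.
have tt1 := le_trans t10' tt0; have tpos := lt_le_trans t10 tt1.
have dt : t <= delta * t by rewrite ler_peMl// ltW.
have dtt1 := le_trans tt1 dt.
have [g0 gE] := gP tt1; have [gd0 gdE] := gP dtt1.
rewrite !lamE//.
suff gK : g (delta * t) <= K * g t.
  by apply: (le_trans (F_nd (ltW gd0) gK)); apply: F_scale => //; exact: ltW.
rewrite leNgt; apply/negP => gK.
have Kg0 : 0 < K * g t by rewrite mulr_gt0.
have h1 := F_slope Kg0 (ltW gK); have h2 := Hp _ (ltW (Ht0 _ tt0)).
have Pd : 0 < F (g (delta * t)) by exact: F_gt0.
have Pg : 0 < F (g t) by exact: F_gt0.
have h3 : K * g t * F (g (delta * t)) <=
    delta * t * F (g (delta * t)) * (theta * K * F (g t)).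
  by rewrite -gdE; apply: (le_trans h1); rewrite ler_pM2l.
have h4 : 1 <= delta * theta.
  have : K * (t * F (g t)) * F (g (delta * t)) * 1 <=
         K * (t * F (g t)) * F (g (delta * t)) * (delta * theta).
    rewrite mulr1 -{1}gE; apply: (le_trans h3).
    by rewrite le_eqVlt; apply/orP; left; apply/eqP; ring.
  by rewrite ler_pM2l// !mulr_gt0.
move: h4; rewrite /delta mulrAC ler_pdivlMr ?mul1r; lra.
Qed.

End SubregularInverse.

(** * A hazard rate squeezed between [lam] and [(1 + eta) lam] *)

Section HazardFixpoint.
Context {R : realType}.
Local Notation meas := {measure set (measurableTypeR R) -> \bar R}.
Local Notation P := (`]0%R, +oo[%classic : set (measurableTypeR R)).
Variable N : meas.
Hypothesis N01 : (0 < N P < +oo)%E.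
Implicit Types (p q x y v K u t s : R) (h : R -> R).

Variables (g : R -> R) (t1 : R).
Hypotheses (t10 : 0 < t1) (gP : forall t, t1 <= t -> 0 < g t /\ g t = t * Psi N (g t)).
Hypothesis star : forall K, 1 < K -> exists2 theta : R, 0 < theta < 1 &
  exists p0 : R, 0 < p0 /\ forall p, p0 <= p -> Psi N (K * p) <= theta * K * Psi N p.

Local Notation lam := (lam g).
Let Pnd := Psi_nd N01.
Let Psc := Psi_scale N01.
Let Pgt := Psi_gt0 N01.

Let lamE t : t1 <= t -> lam t = Psi N (g t).
Proof. exact: (lamE t10 gP). Qed.

Let lam_gt0 t : t1 <= t -> 0 < lam t.
Proof. exact: (lam_gt0 t10 gP). Qed.

Let lam_nd s t : t1 <= s -> s <= t -> lam s <= lam t.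
Proof. exact: (lam_nd Pnd Psc Pgt t10 gP). Qed.

Let Lam x : R := if t1 <= x then lam x else 0.

Let Lam_nd : nd_ge0 Lam.
Proof.
split=> [x y xy|x]; rewrite /Lam; case: ifPn => // x1.
- by rewrite (le_trans x1 xy) lam_nd.
- by case: ifPn => // y1; exact/ltW/lam_gt0.
- exact/ltW/lam_gt0.
Qed.

Let Lam_sub x : Lam x <= hazard_op N Lam x.
Proof.
rewrite {1}/Lam; case: ifPn => x1; last exact: hazard_op_ge0.
have x0 := lt_le_trans t10 x1.
apply: le_trans (hazard_op_ge N01 Lam_nd (ltW x0)).
have -> : x * Lam x = g x by rewrite /Lam x1 /lam mulrC divfK ?gt_eqF.
by rewrite -lamE.
Qed.

(** Constant below [x0]: there the supersolution inequality follows from the one at [x0], the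
    operator being monotone in [x]. *)
Let Sup (eta x0 : R) x : R := (1 + eta) * lam (Num.max x x0).

Let Sup_nd eta x0 : 0 < eta -> t1 <= x0 -> nd_ge0 (Sup eta x0).
Proof.
move=> e0 x01; have le1 x : t1 <= Num.max x x0 by rewrite le_max x01 orbT.
have e1 : 0 <= 1 + eta by rewrite addr_ge0// ltW.
split=> [x y xy|x]; rewrite /Sup; last by rewrite mulr_ge0//; exact/ltW/lam_gt0.
by rewrite ler_wpM2l//; apply: lam_nd => //; exact: le_max2.
Qed.

(** Flatness of [lam] over the ratio [e^d] bounds the hazard integral by [q v] with
    [q = K (1 + eps)^2 g(x)]. Then [Psi q <= (1 + eps)^2 theta K Psi(g x)], and the strict gain
    [theta < 1] pays both for [eps] and for the large values of [v]. *)
Let Sup_super eta : 0 < eta -> exists x0, t1 <= x0 /\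
  forall x, hazard_op N (Sup eta x0) x <= Sup eta x0 x.
Proof.
move=> e0; pose K := 1 + eta; have K1 : 1 < K by rewrite /K ltrDl.
have K0 : 0 < K by rewrite (lt_trans ltr01).
have [theta /andP[th0 th1] [p0 [p00 Hp]]] := star K1.
(* A sixth of the gap leaves room for [(1 + eps)^2 theta < 1]. *)
pose eps := (1 - theta) / 6.
have eps0 : 0 < eps by rewrite divr_gt0// subr_gt0.
have eps1 : 1 < 1 + eps by rewrite ltrDl.
have [delta' d1 [t0 [t10' Hd]]] := lam_slow Pnd Psc Pgt t10 gP star eps1.
pose d := Num.min (ln (1 + eps)) (ln delta').
have d0 : 0 < d by rewrite lt_min !ln_gt0.
have ed1 : expR d <= 1 + eps.
  rewrite -[leRHS]lnK ?posrE ?(lt_trans ltr01)// ler_expR.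
  by rewrite /d ge_min lexx.
have ed2 : expR d <= delta'.
  rewrite -[leRHS]lnK ?posrE ?(lt_trans ltr01)// ler_expR.
  by rewrite /d ge_min lexx orbT.
pose r := (1 + eps) ^+ 2 * theta.
have r0 : 0 < r by rewrite mulr_gt0// exprn_gt0// (lt_trans ltr01).
have r1 : r < 1.
  have : (1 + eps) ^+ 2 <= 1 + (1 - theta) / 2 by rewrite /eps; nra.
  move=> h; apply: (@le_lt_trans _ _ ((1 + (1 - theta) / 2) * theta)).
    by rewrite ler_pM2r.
  nra.
(* Beyond [p0] the inequality of [star] holds; beyond [- ln (1 - r) / d] one has
   [1 - e^(- q d) >= r], because [q >= g x]. *)
have [x0 [x01 Hx0]] := g_unbounded Psc Pgt gP (Num.max p0 (- ln (1 - r) / d)).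
pose xe := Num.max x0 t0; exists xe.
have xet1 : t1 <= xe by rewrite /xe le_max x01.
split=> //; have Snd := Sup_nd e0 xet1.
have main x : xe <= x -> hazard_op N (Sup eta xe) x <= Sup eta xe x.
  move=> xex; have x0x : x0 <= x by apply: le_trans xex; rewrite /xe le_max lexx.
  have t0x : t0 <= x by apply: le_trans xex; rewrite /xe le_max lexx orbT.
  have x1 := le_trans xet1 xex; have xp := lt_le_trans t10 x1.
  have [g0 gE] := gP x1.
  have := Hx0 _ x0x; rewrite gt_max => /andP[gp0 gd].
  pose q := K * (1 + eps) ^+ 2 * g x.
  have e2 : 0 < (1 + eps) ^+ 2 by rewrite exprn_gt0// (lt_trans ltr01).
  have q0 : 0 < q by apply: mulr_gt0 => //; exact: mulr_gt0.
  have l0 := lam_gt0 x1.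
  apply: (le_trans (@hazard_op_le_Psi R N N01 (Sup eta xe) x q d Snd q0 d0 _)).
    move=> v v0 vd; have /andP[_ h] := hazard_int_bounds x Snd (ltW v0).
    apply: (le_trans h); rewrite (max_l (ltW xp)) /Sup.
    have ev1 : 1 <= expR v by rewrite -expR0 ler_expR ltW.
    have xev : xe <= x * expR v by apply: (le_trans xex); rewrite ler_peMr// ltW.
    rewrite (max_l xev).
    have h1 : lam (x * expR v) <= (1 + eps) * lam x.
      apply: le_trans (Hd _ t0x); apply: lam_nd; first exact: le_trans xev.
      by rewrite mulrC ler_pM2r// (le_trans _ ed2)// ler_expR.
    have h2 : expR v - 1 <= (1 + eps) * v.
      have h3 : 1 - expR (- v) <= v by rewrite lerBlDr addrC -lerBlDr; exact: expR_ge1Dx.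
      have -> : expR v - 1 = expR v * (1 - expR (- v)) by rewrite mulrBr mulr1 expRxMexpNx_1.
      apply: ler_pM; rewrite ?expR_ge0// ?subr_ge0 ?expR_le1 ?oppr_le0 ?(ltW v0)//.
      by apply: le_trans ed1; rewrite ler_expR.
    have -> : q * v = x * (K * ((1 + eps) * lam x)) * ((1 + eps) * v).
      by rewrite /q /lam; field; rewrite gt_eqF.
    apply: ler_pM => //.
    - by rewrite mulr_ge0 ?(ltW xp)// mulr_ge0 ?(ltW K0)//; apply/ltW/lam_gt0/(le_trans xet1).
    - by rewrite subr_ge0.
    - by rewrite ler_pM2l// ler_pM2l.
  have eq : r <= 1 - expR (- (q * d)).
    rewrite lerBrDr addrC -lerBrDr -[leRHS]lnK ?posrE ?subr_gt0// ler_expR.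
    rewrite lerNl; apply: ltW; move: gd; rewrite ltr_pdivrMr// => /lt_le_trans; apply.
    rewrite ler_pM2r// /q ler_peMl ?(ltW g0)//.
    by rewrite mulr_ege1 ?(ltW K1)// exprn_ege1// ltW.
  have rp : 0 < 1 - expR (- (q * d)) by exact: lt_le_trans eq.
  rewrite ler_pdivrMr// /Sup (max_l xex) lamE//.
  have P0 : 0 < Psi N (g x) by exact: Psi_gt0.
  apply: (@le_trans _ _ ((1 + eta) * Psi N (g x) * r)); last first.
    by rewrite ler_pM2l// mulr_gt0.
  have -> : q = (1 + eps) ^+ 2 * (K * g x) by rewrite /q; ring.
  have h1 : 1 <= (1 + eps) ^+ 2 by rewrite exprn_ege1// ltW.
  apply: (le_trans (Psi_scale N01 (mulr_ge0 (ltW K0) (ltW g0)) h1)).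
  have -> : (1 + eta) * Psi N (g x) * r = (1 + eps) ^+ 2 * (theta * K * Psi N (g x)).
    by rewrite /r /K; ring.
  by rewrite ler_pM2l// Hp// ltW.
move=> x; have [xex|xxe] := leP xe x; first exact: main.
apply: (@le_trans _ _ (hazard_op N (Sup eta xe) xe)).
  by apply: hazard_op_le => //; exact: ltW.
apply: (le_trans (main _ (lexx _))).
by rewrite /Sup maxxx max_r// ltW.
Qed.

(* Knaster-Tarski: the fixed point is the supremum of the post-fixed points
   lying between [lam] and all its supersolutions [(1 + eta) * lam]. *)
Lemma hazard_fixpoint : exists h, [/\ nd_ge0 h, forall x, h x = hazard_op N h x,
  forall x, t1 <= x -> lam x <= h x &
  forall eta : R, 0 < eta -> exists x0, t1 <= x0 /\
    forall x, x0 <= x -> h x <= (1 + eta) * lam x].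
Proof.
(* [U] collects the supersolutions above [Lam], and [W] the subsolutions between [Lam] and every
   member of [U]. Bounding by all of [U] rather than by one member gives the upper estimate for
   every [eta] with a single [h]. *)
pose U S := [/\ nd_ge0 S, forall x, hazard_op N S x <= S x & forall x, Lam x <= S x].
pose W h := [/\ nd_ge0 h, forall x, Lam x <= h x, forall x, h x <= hazard_op N h x &
  forall S, U S -> forall x, h x <= S x].
have US eta : 0 < eta -> exists x0, t1 <= x0 /\ U (Sup eta x0).
  move=> e0; have [x0 [x01 Hx0]] := Sup_super e0; exists x0; split => //.
  split => // [|x]; first exact: Sup_nd.
  rewrite /Lam; case: ifPn => x1; last by have [_] := Sup_nd e0 x01; exact.
  rewrite /Sup; apply: (@le_trans _ _ (lam (Num.max x x0))).
    by apply: lam_nd => //; rewrite le_max lexx.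
  by rewrite ler_peMl ?lerDl ?(ltW e0)//; apply/ltW/lam_gt0; rewrite le_max x1.
have WLam : W Lam by split => // S [].
have [x1 [x11 U1]] := US 1 ltr01.
pose E x : set R := [set h x | h in W].
have hsE x : has_sup (E x).
  split; first by exists (Lam x), Lam.
  by exists (Sup 1 x1 x) => _ [h [_ _ _ hU] <-]; exact: hU.
pose hh x := sup (E x).
have hle h x : W h -> h x <= hh x by move=> Wh; apply: ub_le_sup; [exact: (hsE x).2|exists h].
have hub x (c : R) : (forall h, W h -> h x <= c) -> hh x <= c.
  by move=> H; apply: ge_sup; [exact: (hsE x).1|move=> _ [h Wh <-]; exact: H].
have hnd : nd_ge0 hh.
  split=> [x y xy|x]; last by apply: le_trans (hle Lam x WLam); exact: Lam_nd.2.
  apply: hub => h Wh; apply: le_trans (hle h y Wh).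
  by have [[+ _] _ _ _] := Wh; exact.
have Whh : W hh.
  split.
  - exact: hnd.
  - by move=> x; exact: hle.
  - move=> x; apply: hub => h Wh; have [hn _ hO _] := Wh.
    apply: (le_trans (hO x)).
    exact: (hazard_op_le N01 hn hnd (fun z => hle h z Wh) (lexx x)).
  - by move=> S US' x; apply: hub => h [_ _ _]; exact.
(* The image of the supremum is again in [W], hence below the supremum: this is the missing
   inequality. *)
have WO : W (hazard_op N hh).
  have [_ hL hO hU] := Whh; split.
  - exact: nd_hazard_op.
  - by move=> x; exact: le_trans (hL x) (hO x).
  - by move=> x; exact: (hazard_op_le N01 hnd (nd_hazard_op N01 hnd) hO (lexx x)).
  - move=> S US' x; have [Sn SO _] := US'; apply: le_trans (SO x).
    exact: (hazard_op_le N01 hnd Sn (hU S US') (lexx x)).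
have [_ hL hO hU] := Whh.
exists hh; split.
- exact: hnd.
- by move=> x; apply/eqP; rewrite eq_le hO/=; exact: (hle _ x WO).
- by move=> x xt1; have := hL x; rewrite /Lam xt1.
- move=> eta e0; have [x0 [x01 U0]] := US eta e0; exists x0; split => // x xx0.
  by have := hU _ U0 x; rewrite /Sup max_l.
Qed.

End HazardFixpoint.

(** * Scaling and Tonelli identities for Lebesgue measure *)

Section LebesgueTools.
Context {R : realType}.
Local Notation leb := (@lebesgue_measure R).
Local Notation P := (`]0%R, +oo[%classic : set (measurableTypeR R)).
Local Open Scope ereal_scope.

(** Lebesgue measure is determined by half-open intervals, and on these it agrees with the image of
    [c] times itself under [x -> c x]. *)
Lemma lebesgue_scale (c : R) (D : set (measurableTypeR R)) (f : measurableTypeR R -> \bar R) :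
  (0 < c)%R -> measurable D -> measurable_fun D f ->
  \int[leb]_(z in D) f z = \int[leb]_(x in (fun x : R => c * x)%R @^-1` D) (f (c * x)%R * c%:E).
Proof.
move=> c0 mD mf.
have ms : measurable_fun (setT : set (measurableTypeR R))
    ((fun x => c * x)%R : measurableTypeR R -> measurableTypeR R).
  exact: measurable_funM.
have [nu [nuA nuf]] := @weighted_image_integral _ _ (measurableTypeR R) (measurableTypeR R) R
  leb setT (fun=> c) _ measurableT (measurable_cst _) (fun _ _ => ltW c0) ms.
transitivity (\int[nu]_(z in D) f z); last by rewrite nuf// setTI.
apply: eq_measure_integral => A mA _.
apply: lebesgue_measure_unique => //= _ [[a b]] _ <-.
rewrite nuA/=; last exact: measurable_itv.
have -> : [set: R] `&` (fun x : R => (c * x)%R) @^-1` `]a, b] = `]a / c, b / c]%classic%R.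
  rewrite setTI; apply/seteqP; split => x /=; rewrite !in_itv/=.
    by rewrite ltr_pdivrMr// ler_pdivlMr// mulrC.
  by rewrite ltr_pdivrMr// ler_pdivlMr// mulrC.
rewrite integral_cst//= !lebesgue_measure_itv/= !lte_fin ltr_pM2r ?invr_gt0//.
case: ifPn => ab; last by rewrite mule0.
by rewrite -!EFinB -EFinM; congr EFin; field; rewrite gt_eqF.
Qed.

Lemma lebesgue_scaleP (c : R) (f : measurableTypeR R -> \bar R) :
  (0 < c)%R -> measurable_fun P f ->
  \int[leb]_(z in P) f z = \int[leb]_(x in P) (f (c * x)%R * c%:E).
Proof.
move=> c0 mf; have mP : measurable P by exact: measurable_itv.
rewrite (lebesgue_scale c0 mP mf).
suff -> : (fun x : R => c * x)%R @^-1` P = P by [].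
by apply/seteqP; split => x /=; rewrite !in_itv/= !andbT pmulr_rgt0.
Qed.

Lemma tonelli_triangle (f g : measurableTypeR R -> \bar R) :
  measurable_fun P f -> measurable_fun P g ->
  (forall s, P s -> 0 <= f s) -> (forall t, P t -> 0 <= g t) ->
  \int[leb]_(s in P) (f s * \int[leb]_(t in `[s, +oo[) g t) =
  \int[leb]_(t in P) (g t * \int[leb]_(s in `]0%R, t]) f s).
Proof.
move=> mf mg f0 g0; have mP : measurable P by exact: measurable_itv.
pose f' := f \_ P; pose g' := g \_ P.
have mf' : measurable_fun setT f' by apply/(measurable_restrictT f mP).
have mg' : measurable_fun setT g' by apply/(measurable_restrictT g mP).
have f'0 s : 0 <= f' s by rewrite /f' patchE; case: ifPn => // /set_mem /f0.
have g'0 s : 0 <= g' s by rewrite /g' patchE; case: ifPn => // /set_mem /g0.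
pose A : set (measurableTypeR R * measurableTypeR R) := [set z | (z.1 <= z.2)%R].
have mA : measurable A.
  rewrite -[A]setTI; exact: (@measurable_fun_le _ _ R setT fst snd).
pose k z := (f' z.1 * g' z.2) * (\1_A z)%:E.
have mk : measurable_fun setT k.
  apply: emeasurable_funM; first apply: emeasurable_funM.
  - exact: (measurableT_comp mf').
  - exact: (measurableT_comp mg').
  - by apply/measurable_EFinP; exact: measurable_indic.
have k0 z : 0 <= k z by rewrite /k !mule_ge0// lee_fin.
have := fubini_tonelli (m1 := leb) (m2 := leb) k mk k0.
rewrite /fubini_F /fubini_G/= => E; clear mk k0 mA mf' mg' f'0 g'0.
rewrite integral_mkcond [RHS]integral_mkcond.
transitivity (\int[leb]_x \int[leb]_y k (x, y)); last rewrite E.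
  apply: eq_integral => s _; rewrite patchE; case: ifPn => [/set_mem sP|sP]; last first.
    apply/esym; apply: integral0_eq => t _.
    by rewrite /k /f'/= patchE (negPf sP) mul0e mul0e.
  have fE : f' s = f s by rewrite /f' patchE mem_set.
  rewrite integral_mkcond -ge0_integralZl; last 4 first.
  - exact: measurableT.
  - apply/(measurable_restrictT g (measurable_itv `[s, +oo[)).
    apply: (measurable_funS mP _ mg) => t /=; rewrite !in_itv/= !andbT.
    by move: sP; rewrite /= in_itv/= andbT; exact: lt_le_trans.
  - move=> t _; rewrite patchE; case: ifPn => [/set_mem/=|_]; last exact: lexx.
    rewrite in_itv/= andbT => st.
    by apply: g0; move: sP; rewrite /= !in_itv/= !andbT => /lt_le_trans; apply.
  - exact: (f0 _ sP).
  apply: eq_integral => t _; rewrite /k/= fE -muleA; congr *%E.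
  rewrite /g' !patchE indicE mem_setE in_itv/= andbT.
  have -> : ((s, t) \in A) = (s <= t)%R by apply/idP/idP => [/set_mem//|h]; rewrite inE.
  have [st|_] := leP s t; last by rewrite mule0.
  have -> : t \in P.
    by rewrite inE/= in_itv/= andbT; move: sP; rewrite /= in_itv/= andbT => h; exact: lt_le_trans h st.
  by rewrite mule1.
apply: eq_integral => t _; rewrite patchE; case: ifPn => [/set_mem tP|tP]; last first.
  apply: integral0_eq => s _.
  by rewrite /k /g'/= patchE (negPf tP) mule0 mul0e.
have gE : g' t = g t by rewrite /g' patchE mem_set.
rewrite [X in _ = _ * X]integral_mkcond -ge0_integralZl; last 4 first.
- exact: measurableT.
- apply/(measurable_restrictT f (measurable_itv `]0%R, t])).
  by apply: (measurable_funS mP _ mf) => s /=; rewrite !in_itv/= andbT => /andP[].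
- move=> s _; rewrite patchE; case: ifPn => [/set_mem/=|_]; last exact: lexx.
  rewrite in_itv/= => /andP[s0 _].
  by apply: f0; rewrite /= in_itv/= s0.
- exact: (g0 _ tP).
apply: eq_integral => s _; rewrite /k/= gE [f' s * _]muleC -muleA; congr *%E.
rewrite /f' !patchE indicE mem_setE in_itv/=.
have -> : ((s, t) \in A) = (s <= t)%R by apply/idP/idP => [/set_mem//|h]; rewrite inE.
have -> : (s \in `]0%R, t]%classic) = (0 < s)%R && (s <= t)%R.
  by apply/idP/idP => [/set_mem/=|h]; rewrite ?inE/= ?in_itv.
rewrite andbT.
by case: (0 < s)%R; case: (s <= t)%R; rewrite /= ?mule1 ?mule0 ?mul0e.
Qed.

Lemma integral_exprn (n : nat) (t : R) : (0 < t)%R ->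
  \int[leb]_(s in `]0%R, t]) (n.+1%:R * s ^+ n)%R%:E = (t ^+ n.+1)%:E.
Proof.
move=> t0.
have D (x : R) : is_derive x (1%R : R) (fun y : R => y ^+ n.+1)%R (n.+1%:R * x ^+ n)%R.
  have := @is_deriveX R R id n.+1 x 1%R 1%R (is_derive_id x 1%R).
  by rewrite /GRing.scale/= mulr1 exprfctE.
have c : continuous (fun s : R => n.+1%:R * s ^+ n)%R.
  by move=> x; apply: cvgM; [exact: cvg_cst|exact: exprn_continuous].
rewrite integral_itv_obnd_cbnd; last first.
  by apply/measurable_EFinP; apply: measurable_funTS; exact: continuous_measurable_fun.
rewrite (@continuous_FTC2 R _ (fun y : R => y ^+ n.+1)%R)//.
- by rewrite expr0n/= sube0.
- exact: continuous_subspaceT.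
- split.
  + by move=> x _; have [] := D x.
  + by apply: cvg_at_right_filter; exact: exprn_continuous.
  + by apply: cvg_at_left_filter; exact: exprn_continuous.
- by move=> x _; rewrite derive1E; have [_ ->] := D x.
Qed.

(** Write [t^(n+1)] as the integral of [(n+1) s^n] over []0, t]] and exchange the integrals: an
    integration by parts that asks for no decay at infinity. *)
Lemma tail_moment (n : nat) (g : measurableTypeR R -> \bar R) :
  measurable_fun P g -> (forall t, P t -> 0 <= g t) ->
  \int[leb]_(t in P) ((t ^+ n.+1)%:E * g t) =
  \int[leb]_(s in P) ((n.+1%:R * s ^+ n)%:E * \int[leb]_(t in `[s, +oo[) g t).
Proof.
move=> mg g0; rewrite (@tonelli_triangle (fun s => (n.+1%:R * s ^+ n)%R%:E))//.
- apply: eq_integral => t; rewrite inE/= in_itv/= andbT => t0.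
  by rewrite integral_exprn// muleC.
- apply/measurable_EFinP; apply: measurable_funTS; apply: continuous_measurable_fun.
  by move=> x; apply: cvgM; [exact: cvg_cst|exact: exprn_continuous].
- by move=> s /=; rewrite in_itv/= andbT => s0; rewrite lee_fin mulr_ge0// exprn_ge0// ltW.
Qed.

End LebesgueTools.

Section TonelliOn.
Context {R : realType}.
Local Notation meas := {measure set (measurableTypeR R) -> \bar R}.
Local Notation leb := (@lebesgue_measure R).
Local Notation P := (`]0%R, +oo[%classic : set (measurableTypeR R)).
Local Open Scope ereal_scope.

(** [N] is finite on [P] only; restricting it to [P] gives the finite measure [N'] to which
    Tonelli's theorem applies, with the integrand extended by 0. *)
Lemma tonelli_on (N : meas) (k : measurableTypeR R * measurableTypeR R -> \bar R) :
  N P < +oo -> measurable_fun (P `*` P) k ->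
  (forall z, (P `*` P) z -> 0 <= k z) ->
  \int[leb]_(t in P) \int[N]_(v in P) k (t, v) =
  \int[N]_(v in P) \int[leb]_(t in P) k (t, v).
Proof.
move=> NP mk k0; have mP : measurable P by exact: measurable_itv.
pose N' := mfrestr mP NP.
have NN' (f : measurableTypeR R -> \bar R) : \int[N]_(v in P) f v = \int[N']_(v in P) f v.
  apply: eq_measure_integral => A mA AP.
  by rewrite /N' /= /mfrestr /mrestr setIidl.
pose k' := k \_ (P `*` P).
have mPP : measurable (P `*` P) by exact: measurableX.
have mk' : measurable_fun setT k' by apply/(measurable_restrictT k mPP).
have k'0 z : 0 <= k' z.
  by rewrite /k' patchE; case: ifPn => [/set_mem/k0|_]; [|exact: lexx].
have := fubini_tonelli (m1 := leb) (m2 := N') k' mk' k'0.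
rewrite /fubini_F /fubini_G/= => E.
have inPP t v : ((t, v) \in P `*` P) = (t \in P) && (v \in P).
  apply/idP/idP => [/set_mem[/= tP vP]|/andP[/set_mem tP /set_mem vP]].
    by rewrite !mem_set.
  by rewrite mem_set.
clear mk' k'0.
transitivity (\int[leb]_t \int[N']_v k' (t, v)).
  rewrite integral_mkcond; apply: eq_integral => t _; rewrite patchE.
  case: ifPn => tP; last first.
    apply/esym; apply: integral0_eq => v _.
    by rewrite /k' patchE inPP (negPf tP).
  rewrite NN' integral_mkcond; apply: eq_integral => v _.
  by rewrite /k' !patchE inPP tP.
rewrite E NN' [RHS]integral_mkcond; apply: eq_integral => v _; rewrite patchE.
case: ifPn => vP; last first.
  apply: integral0_eq => t _.
  by rewrite /k' patchE inPP (negPf vP) andbF.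
rewrite [RHS]integral_mkcond; apply: eq_integral => t _.
by rewrite /k' !patchE inPP vP andbT.
Qed.

End TonelliOn.

(** * Survival functions of nondecreasing hazard rates *)

Section Survival.
Context {R : realType}.
Local Notation leb := (@lebesgue_measure R).
Local Notation P := (`]0%R, +oo[%classic : set (measurableTypeR R)).
Implicit Types (x y v u t s : R).
Variable h : R -> R.
Hypothesis hnd : nd_ge0 h.

Definition cumh t : R := \int[leb]_(s in `[0, t]) h s.

Definition surv t : R := expR (- cumh t).

Lemma hazard_itv_integrable (i : interval R) (b : R) : (leb [set` i] < +oo)%E ->
  (forall x, x \in i -> x <= b) -> leb.-integrable [set` i] (EFin \o h).
Proof.
move=> il ib; apply: (@integrable_bounded R _ (measurableTypeR R) leb _ _ (h b)).
- exact: measurable_itv.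
- exact: il.
- apply: nondecreasing_measurable; first exact: measurable_itv.
  by move=> x y; exact: hnd.1.
- by move=> x xi; rewrite ger0_norm ?hnd.2//; apply: hnd.1; exact: ib.
Qed.

Let hint t : leb.-integrable `[0, t] (EFin \o h).
Proof.
apply: (@hazard_itv_integrable _ t); first by rewrite lebesgue_measure_itv/=; case: ifP; rewrite ?ltry.
by move=> x; rewrite in_itv/= => /andP[].
Qed.

Lemma cumhB s t : 0 <= s -> s <= t -> cumh t - cumh s = \int[leb]_(x in `]s, t]) h x.
Proof. by move=> s0 st; rewrite /cumh Rintegral_itvB. Qed.

Lemma cumh_bounds s t : 0 <= s -> s <= t ->
  h s * (t - s) <= cumh t - cumh s <= h t * (t - s).
Proof.
move=> s0 st; rewrite cumhB//.
have lst : leb `]s, t] = (t - s)%:E.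
  rewrite lebesgue_measure_itv/= lte_fin; case: ltP => [_|ts]; first by rewrite EFinB.
  by rewrite (@le_anti _ _ s t) ?st// subrr.
have lfin : (leb `]s, t] < +oo)%E by rewrite lst ltry.
have ih : leb.-integrable `]s, t] (EFin \o h).
  apply: (@hazard_itv_integrable _ t) => //.
  by move=> x; rewrite in_itv/= => /andP[].
have m : measurable (`]s, t]%classic : set (measurableTypeR R)) by exact: measurable_itv.
have cE (c : R) : c * (t - s) = \int[leb]_(x in `]s, t]) c.
  rewrite (@Rintegral_cst _ (measurableTypeR R) R leb _ m); congr (_ * _).
  exact: (esym (congr1 fine lst)).
have ci (c : R) : leb.-integrable `]s, t] (EFin \o (fun=> c)).
  exact: (@integrable_bounded R _ (measurableTypeR R) leb _ _ `|c|).
rewrite !cE; apply/andP; split; apply: le_Rintegral => //.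
  by move=> x; rewrite /= in_itv/= => /andP[sx _]; apply: hnd.1; exact: ltW.
by move=> x; rewrite /= in_itv/= => /andP[_ xt]; exact: hnd.1.
Qed.

Lemma cumh_ltr0 t : t <= 0 -> cumh t = 0.
Proof.
rewrite le_eqVlt => /predU1P[->|t0]; last first.
  by rewrite /cumh set_itv_ge ?Rintegral_set0// bnd_simp -ltNge.
by rewrite /cumh set_itv1 Rintegral_set1.
Qed.

Lemma cumh_nd : {homo cumh : x y / x <= y}.
Proof.
move=> x y xy; have [x0|x0] := leP 0 x.
  have /andP[h1 _] := cumh_bounds x0 xy; rewrite -subr_ge0; apply: le_trans h1.
  by rewrite mulr_ge0 ?hnd.2// subr_ge0.
rewrite (cumh_ltr0 (ltW x0)); have [y0|/ltW/cumh_ltr0 ->//] := leP 0 y.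
have /andP[h1 _] := cumh_bounds (lexx 0) y0.
move: h1; rewrite (cumh_ltr0 (lexx 0)) !subr0 => h1; apply: le_trans h1.
by rewrite mulr_ge0 ?hnd.2.
Qed.

Lemma surv_ni s t : s <= t -> surv t <= surv s.
Proof. by move=> st; rewrite ler_expR lerN2 cumh_nd. Qed.

Lemma surv0 : surv 0 = 1. Proof. by rewrite /surv cumh_ltr0// oppr0 expR0. Qed.

Lemma surv_gt0 t : 0 < surv t. Proof. exact: expR_gt0. Qed.

Lemma surv_ge0 t : 0 <= surv t. Proof. exact: expR_ge0. Qed.

Lemma surv_le1 t : surv t <= 1.
Proof.
rewrite -surv0; have [t0|t0] := leP 0 t; first exact: surv_ni.
by rewrite /surv (cumh_ltr0 (ltW t0)) (cumh_ltr0 (lexx 0)).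
Qed.

Lemma measurable_surv (D : set (measurableTypeR R)) : measurable D -> measurable_fun D surv.
Proof.
by move=> mD; apply: nonincreasing_measurable; [exact: mD|move=> x y; exact: surv_ni].
Qed.

Lemma hazard_intE x v : 0 < x -> 0 <= v -> hazard_int h x v = cumh (x * expR v) - cumh x.
Proof.
move=> x0 v0; have ev : 1 <= expR v by rewrite -expR0 ler_expR.
rewrite cumhB ?(ltW x0)// ?ler_peMr ?(ltW x0)//.
rewrite /hazard_int /Rintegral; congr fine.
have mh : measurable_fun (`[x, x * expR v] : set (measurableTypeR R)) (EFin \o h).
  apply/measurable_EFinP; apply: nondecreasing_measurable; first exact: measurable_itv.
  by move=> a b; exact: hnd.1.
rewrite integral_itv_obnd_cbnd; last first.
  apply: measurable_funS mh; first exact: measurable_itv.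
  by move=> y /=; rewrite !in_itv/= => /andP[/ltW -> ->].
rewrite (lebesgue_scale x0) //=.
have -> : (fun x1 : R => x * x1) @^-1` `[x, x * expR v] = `[1, expR v]%classic.
  apply/seteqP; split => y /=; rewrite !in_itv/=.
    by rewrite ler_pM2l// -{1}[x]mulr1 ler_pM2l.
  by move=> /andP[y1 y2]; rewrite ler_peMr ?(ltW x0)//= ler_pM2l.
by apply: eq_integral => y _; rewrite (max_l (ltW x0)) -EFinM mulrC.
Qed.

Hypothesis hcont : forall x, 0 < x -> {for x, continuous h}.

Lemma is_derive_surv t : 0 < t -> is_derive t (1 : R) surv (- (h t * surv t)).
Proof.
move=> t0; have t1 : t < t + 1 by rewrite ltrDl.
have [d dE] := continuous_FTC1_closed t1 (hint (t + 1)) t0 (hcont t0).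
have dc : is_derive t (1 : R) cumh (h t).
  exact: (DeriveDef d (etrans (esym (derive1E _ _)) dE)).
have dn : is_derive t (1 : R) (fun x => - cumh x) (- h t) by exact: is_deriveN.
have := @is_derive1_comp R expR (fun x => - cumh x) t _ _ (is_derive_expR _) dn.
by rewrite mulrN [_ * h t]mulrC.
Qed.

Variable x0 : R.
Hypotheses (x00 : 0 < x0) (hx0 : 0 < h x0).

Lemma surv_cvg0 : surv t @[t --> +oo] --> 0.
Proof.
have E : expR (- (h x0 * (t - x0))) @[t --> +oo] --> (0 : R).
  apply: (@cvg_comp _ _ _ (fun t : R => h x0 * (t - x0)) (fun z => expR (- z)) _
    (+oo : set_system R)); last exact: cvgr_expR.
  apply: gt0_cvgMry => //; exact: cvg_addrr.
apply: (@squeeze_cvgr _ _ _ _ (fun=> 0) (fun t => expR (- (h x0 * (t - x0))))) => //; last first.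
  exact: cvg_cst.
near=> t; rewrite surv_ge0/= ler_expR lerN2.
have xt : x0 <= t by near: t; apply: nbhs_pinfty_ge; exact: num_real.
have /andP[h1 _] := cumh_bounds (ltW x00) xt.
apply: (le_trans h1); rewrite gerBl -(cumh_ltr0 (lexx 0)); exact/cumh_nd/ltW.
Unshelve. all: by end_near. Qed.

Lemma surv_tail s : 0 < s -> (\int[leb]_(x in `[s, +oo[) (h x * surv x)%:E = (surv s)%:E)%E.
Proof.
move=> s0.
have D (x : R) : 0 < x -> is_derive x (1 : R) (fun y => - surv y) (h x * surv x).
  by move=> /is_derive_surv dx; rewrite -[X in is_derive _ _ _ X]opprK; exact: is_deriveN.
have C' (x : R) : 0 < x -> {for x, continuous surv}.
  move=> /is_derive_surv dx; apply: differentiable_continuous; apply/derivable1_diffP.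
  by have [] := dx.
have C (x : R) : 0 < x -> {for x, continuous (fun y => - surv y)}.
  by move=> /C' Cx; exact: cvgN.
rewrite (@ge0_continuous_FTC2y R _ (fun y => - surv y) s 0).
- by rewrite sub0e EFinN oppeK.
- by move=> x _; rewrite mulr_ge0 ?hnd.2// surv_ge0.
- apply: continuous_in_subspaceT => x; rewrite inE/= in_itv/= andbT => sx.
  have xp := lt_le_trans s0 sx.
  by apply: cvgM; [exact: hcont|exact: C'].
- by rewrite -oppr0; apply: cvgN; exact: surv_cvg0.
- by move=> x sx; have [] := D x (lt_trans s0 sx).
- by apply: cvg_at_right_filter; exact: C.
- move=> x; rewrite in_itv/= andbT => sx; rewrite derive1E.
  by have [_ ->] := D x (lt_trans s0 sx).
Qed.

Let mP : measurable P. Proof. exact: measurable_itv. Qed.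

Let mhs : measurable_fun P (fun t => (h t * surv t)%:E).
Proof.
apply/measurable_EFinP; apply: measurable_funM; last exact: measurable_surv.
by apply: nondecreasing_measurable => // x y; exact: hnd.1.
Qed.

Let hs0 t : P t -> (0 <= (h t * surv t)%:E)%E.
Proof. by move=> _; rewrite lee_fin mulr_ge0 ?hnd.2// surv_ge0. Qed.

Definition survM n : \bar R := (\int[leb]_(t in P) (t ^+ n * surv t)%:E)%E.

Lemma surv_moment_hazard n :
  (\int[leb]_(t in P) (t ^+ n.+1 * (h t * surv t))%:E = n.+1%:R%:E * survM n)%E.
Proof.
transitivity (\int[leb]_(t in P) ((t ^+ n.+1)%:E * (h t * surv t)%:E))%E.
  by apply: eq_integral => t _; rewrite EFinM.
rewrite (tail_moment _ mhs hs0) /survM -ge0_integralZl; last 4 first.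
- exact: mP.
- apply/measurable_EFinP; apply: measurable_funM; last exact: measurable_surv.
  by apply: measurable_funTS; apply: continuous_measurable_fun; exact: exprn_continuous.
- by move=> t; rewrite /= in_itv/= andbT => /ltW t0; rewrite lee_fin mulr_ge0 ?exprn_ge0 ?surv_ge0.
- by rewrite lee_fin.
apply: eq_integral => t; rewrite inE/= in_itv/= andbT => t0.
by rewrite surv_tail// -!EFinM mulrA.
Qed.

(** [surv_tail] needs [s > 0], the hazard rate being continuous on the open half-line; 0 is reached
    by monotone convergence along [s = 1 / (n + 1)]. *)
Lemma surv_integral_hazard : (\int[leb]_(t in P) (h t * surv t)%:E = 1)%E.
Proof.
pose F n : set (measurableTypeR R) := `[n.+1%:R^-1, +oo[%classic.
have mF n : measurable (F n) by exact: measurable_itv.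
have FP : \bigcup_n F n = P.
  apply/seteqP; split=> x; rewrite /F/=.
    by move=> [n _] /=; rewrite !in_itv/= !andbT; apply: lt_le_trans; rewrite invr_gt0.
  rewrite in_itv/= andbT => x0'; have [n _ nx] := near_infty_natSinv_lt (PosNum x0').
  exists n => //=; rewrite in_itv/= andbT; apply/ltW.
  exact: (nx n (leqnn n)).
have ndF : nondecreasing_seq F.
  move=> m n mn; apply/subsetPset => x; rewrite /F/= !in_itv/= !andbT; apply: le_trans.
  by rewrite lef_pV2 ?posrE// ler_nat.
have FS n : F n `<=` P.
  by move=> x; rewrite /F/= !in_itv/= !andbT; apply: lt_le_trans; rewrite invr_gt0.
have mhsF : measurable_fun (\bigcup_n F n) (fun t => (h t * surv t)%:E) by rewrite FP.
have := @ge0_nondecreasing_set_cvg_integral _ (measurableTypeR R) R F _ leb ndF mF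
  (fun n => measurable_funS mP (FS n) mhs) (fun n x Fx => hs0 (FS n x Fx)).
rewrite FP => cv.
suff cv1 : (\int[leb]_(t in F n) (h t * surv t)%:E)%E @[n --> \oo] --> (1%:E : \bar R).
  exact: (cvg_unique _ cv cv1).
have -> : (fun n => \int[leb]_(t in F n) (h t * surv t)%:E)%E = (fun n => (surv n.+1%:R^-1)%:E).
  by apply/funext => n; rewrite /F surv_tail// invr_gt0.
apply: cvg_EFin; first exact: nearW.
have i1 n : n.+1%:R^-1 <= 1 :> R by rewrite invf_le1// ler1n.
have i0 n : 0 <= n.+1%:R^-1 :> R by rewrite invr_ge0.
have lim1 : expR (- (h 1 * n.+1%:R^-1)) @[n --> \oo] --> (1 : R).
  rewrite [X in _ --> X](_ : 1 = expR (- (h 1 * 0))); last by rewrite mulr0 oppr0 expR0.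
  apply: continuous_cvg; first exact: continuous_expR.
  by apply: cvgN; apply: cvgM; [exact: cvg_cst|exact: cvg_harmonic].
have lim2 : (1 : R) @[n --> \oo] --> (1 : R) by exact: cvg_cst.
suff H : \forall n \near \oo, expR (- (h 1 * n.+1%:R^-1)) <= surv n.+1%:R^-1 <= 1.
  exact: (squeeze_cvgr H lim1 lim2).
apply: nearW => n; rewrite /= surv_le1 andbT.
rewrite ler_expR lerN2.
have /andP[_] := cumh_bounds (lexx 0) (i0 n).
rewrite (cumh_ltr0 (lexx 0)) !subr0 => /le_trans; apply.
by rewrite ler_wpM2r// hnd.1.
Qed.

(** Beyond [x0] the survival function is at most [h surv / h(x0)], so its moment of order [k] is
    finite as soon as that of the density [h surv] is. The latter is 1 for order 0 and
    [(n + 1) survM n] for order [n + 1], which closes the induction. *)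
Lemma survM_lty n : (survM n < +oo)%E.
Proof.
pose c := h x0.
have key k : (\int[leb]_(t in P) (t ^+ k * (h t * surv t))%:E < +oo)%E -> (survM k < +oo)%E.
  move=> hk.
  have mk : measurable_fun P (fun t => (t ^+ k * surv t)%:E).
    apply/measurable_EFinP; apply: measurable_funM; last exact: measurable_surv.
    by apply: measurable_funTS; apply: continuous_measurable_fun; exact: exprn_continuous.
  have mk' : measurable_fun P (fun t => (t ^+ k * (h t * surv t))%:E).
    apply/measurable_EFinP; apply: measurable_funM; last exact/measurable_EFinP.
    by apply: measurable_funTS; apply: continuous_measurable_fun; exact: exprn_continuous.
  have mi : measurable_fun P (fun t =>
      (c * x0 ^+ k * \1_(`]0, x0]%classic : set (measurableTypeR R)) t)%:E).
    apply/measurable_EFinP; apply: measurable_funM; first exact: measurable_cst.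
    by apply: measurable_indic; exact: measurable_itv.
  have c0 : 0 <= c * x0 ^+ k by rewrite mulr_ge0 ?exprn_ge0 ?ltW.
  have t0 (t : R) : P t -> 0 <= t ^+ k * surv t.
    by rewrite /= in_itv/= andbT => t0; rewrite mulr_ge0 ?surv_ge0// exprn_ge0// ltW.
  have t0' (t : R) : P t -> 0 <= t ^+ k * (h t * surv t).
    rewrite /= in_itv/= andbT => t0'; rewrite mulr_ge0 ?exprn_ge0 ?(ltW t0')//.
    by rewrite mulr_ge0 ?hnd.2 ?surv_ge0.
  have : (c%:E * survM k < +oo)%E.
    rewrite /survM -ge0_integralZl; [|exact: mP|exact: mk|by move=> t /t0; rewrite lee_fin|
      by rewrite lee_fin ltW].
    apply: (@le_lt_trans _ _ (\int[leb]_(t in P) ((t ^+ k * (h t * surv t))%:E +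
      (c * x0 ^+ k * \1_(`]0, x0]%classic : set (measurableTypeR R)) t)%:E))%E).
      apply: ge0_le_integral.
      - exact: mP.
      - by move=> t /t0 h1; rewrite -EFinM lee_fin mulr_ge0// ltW.
      - by apply: measurable_funeM; exact: mk.
      - exact: emeasurable_funD.
      - move=> t Pt; rewrite -EFinM -EFinD lee_fin.
        have tp : 0 < t by move: Pt; rewrite /= in_itv/= andbT.
        have [xt|tx] := leP x0 t.
          apply: (@le_trans _ _ (t ^+ k * (h t * surv t))); last first.
            by rewrite lerDl mulr_ge0.
          rewrite mulrCA ler_wpM2l ?exprn_ge0 ?(ltW tp)// ler_wpM2r ?surv_ge0//.
          exact: hnd.1.
        apply: (@le_trans _ _ (c * x0 ^+ k)); last first.
          rewrite indicE mem_set ?mulr1 ?lerDr ?t0'//=.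
          by rewrite in_itv/= tp ltW.
        rewrite ler_pM2l// -[leRHS]mulr1 ler_pM ?surv_le1 ?surv_ge0 ?exprn_ge0 ?(ltW tp)//.
        by rewrite lerXn2r ?nnegrE ?ltW.
    rewrite ge0_integralD; [|exact: mP|by move=> t /t0'; rewrite lee_fin|exact: mk'|
      by move=> t _; rewrite lee_fin mulr_ge0|exact: mi].
    rewrite lte_add_pinfty//.
    under eq_integral do rewrite EFinM.
    rewrite ge0_integralZl; [|exact: mP| |by move=> t _; rewrite lee_fin|by rewrite lee_fin].
      rewrite integral_indic; [|exact: mP|exact: measurable_itv].
      apply: lte_mul_pinfty; [by rewrite lee_fin|by []|].
      apply: (@le_lt_trans _ _ (leb `]0%R, x0]%classic)).
        apply: le_measure; rewrite ?inE; [|exact: measurable_itv|by move=> y []].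
        by apply: measurableI; exact: measurable_itv.
      by rewrite lebesgue_measure_itv/=; case: ifP; rewrite ?ltry.
    by apply/measurable_EFinP; apply: measurable_indic; exact: measurable_itv.
  apply: contraTT; rewrite -!leNgt !leye_eq => /eqP ->.
  by rewrite gt0_muley// lte_fin.
elim: n => [|n IH]; apply: key.
  by under eq_integral do rewrite expr0 mul1r; rewrite surv_integral_hazard ltry.
by rewrite surv_moment_hazard lte_mul_pinfty// lee_fin.
Qed.

End Survival.

(** * Moments of the survival function of the fixed point *)

Section FixedPointSurvival.
Context {R : realType}.
Local Notation meas := {measure set (measurableTypeR R) -> \bar R}.
Local Notation leb := (@lebesgue_measure R).
Local Notation P := (`]0%R, +oo[%classic : set (measurableTypeR R)).
Implicit Types (x y v u t s : R).
Variables (N : meas) (h : R -> R).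
Hypothesis N01 : (0 < N P < +oo)%E.
Hypotheses (hnd : nd_ge0 h) (hE : forall x, h x = hazard_op N h x).

Let mP : measurable P. Proof. exact: measurable_itv. Qed.

Lemma continuous_cumh : continuous (cumh h).
Proof.
move=> x; apply/cvgrPdist_le => e e0.
have H0 : 0 < h (`|x| + 1) + 1 by rewrite ltr_wpDl// hnd.2.
pose pos z : R := Num.max z 0.
have posE z : cumh h z = cumh h (pos z).
  by rewrite /pos; case: (leP z 0) => // z0; rewrite !(cumh_ltr0 h).
have pos_lip a b : a <= b -> 0 <= pos b - pos a <= b - a.
  by rewrite /pos => ab; case: (leP a 0); case: (leP b 0) => ? ?; lra.
have key a b : a <= b -> b <= `|x| + 1 -> 0 <= cumh h b - cumh h a <= (h (`|x| + 1) + 1) * (b - a).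
  move=> ab bx; rewrite (posE a) (posE b); have /andP[p1 p2] := pos_lip _ _ ab.
  have pa : 0 <= pos a by rewrite /pos le_max lexx orbT.
  have pab : pos a <= pos b by rewrite -subr_ge0.
  have /andP[_ c2] := cumh_bounds hnd pa pab.
  rewrite subr_ge0 cumh_nd//=; apply: (le_trans c2).
  apply: ler_pM; rewrite ?hnd.2//.
  apply: (@le_trans _ _ (h (`|x| + 1))); last by rewrite lerDl.
  by apply: hnd.1; rewrite /pos ge_max bx/= addr_ge0.
near=> y.
have xy1 : `|x - y| <= 1 by near: y; exact: cvgr_dist_le.
have xy2 : `|x - y| <= e / (h (`|x| + 1) + 1) by near: y; apply: cvgr_dist_le => //; exact: divr_gt0.
have xb : x <= `|x| + 1 by rewrite (le_trans (ler_norm x))// lerDl.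
have yb : y <= `|x| + 1.
  have -> : y = x - (x - y) by ring.
  by rewrite (le_trans (ler_norm _))// (le_trans (ler_normB _ _))// lerD2l.
move: xy2; rewrite ler_pdivlMr// mulrC => xy2; apply: le_trans xy2.
have [xy|/ltW yx] := leP x y.
  have /andP[k1 k2] := key _ _ xy yb.
  by rewrite ler0_norm ?opprB ?[`|x - y|]ler0_norm ?opprB// -oppr_ge0 opprB// subr_ge0.
have /andP[k1 k2] := key _ _ yx xb.
by rewrite ger0_norm// [`|x - y|]ger0_norm// subr_ge0.
Unshelve. all: by end_near. Qed.

(** The fixed point is only known to be monotone, but its equation regularizes: the right side
    involves [h] through the continuous function [cumh], under a domination uniform in [v]. *)
Lemma hazard_continuous x : 0 < x -> {for x, continuous h}.
Proof.
move=> x0; have x2 : x < 2 * x by rewrite mulr2n mulrDl mul1r ltrDl.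
have -> : h = hazard_op N h by apply/funext => y; exact: hE.
pose M := 1 + Num.max (2 * x) 0 * h (Num.max (2 * x) 0 * expR 1) * expR 1.
apply: (@continuity_under_integral R _ _ N (fun y v => hazard_kern h y v) P mP 0 (2 * x)
  _ _ (fun=> M)).
- by move=> y _; exact: hazard_kern_integrable.
- apply/aeW => v Pv y; rewrite inE/= in_itv/= => /andP[y0 _].
  have v0 : 0 < v by move: Pv; rewrite /= in_itv/= andbT.
  have E : \forall z \near y, hazard_kern h z v =
      (1 - expR (- (cumh h (z * expR v) - cumh h z))) / v.
    near=> z; rewrite /hazard_kern hazard_intE//; last exact: ltW.
    by near: z; apply: (@cvgr_gt _ _ _ _ id y) => //; exact: cvg_id.
  apply: (@cvg_trans _ (((1 - expR (- (cumh h (z * expR v) - cumh h z))) / v) @[z --> y])).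
    by apply: near_eq_cvg; near=> z; apply/esym; near: z; exact: E.
  rewrite /hazard_kern hazard_intE ?ltW//.
  have H1 : cumh h (z * expR v) @[z --> y] --> cumh h (y * expR v).
    apply: (@cvg_comp _ _ _ (fun z : R => z * expR v) (cumh h) _ (nbhs (y * expR v)));
    last exact: continuous_cumh.
    by apply: cvgM; [exact: cvg_id|exact: cvg_cst].
  have H2 : expR (- (cumh h (z * expR v) - cumh h z)) @[z --> y] -->
      expR (- (cumh h (y * expR v) - cumh h y)).
    apply: continuous_cvg; first exact: continuous_expR.
    by apply: cvgN; exact: (cvgB H1 (@continuous_cumh y)).
  have H3 : 1 - expR (- (cumh h (z * expR v) - cumh h z)) @[z --> y] -->
      1 - expR (- (cumh h (y * expR v) - cumh h y)).
    by apply: cvgB; [exact: cvg_cst|exact: H2].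
  have H4 : (1 - expR (- (cumh h (z * expR v) - cumh h z))) / (v : R) @[z --> y] -->
      (1 - expR (- (cumh h (y * expR v) - cumh h y))) / (v : R).
    by apply: cvgM; [exact: H3|exact: cvg_cst].
  exact: H4.
- apply: (@integrable_bounded R _ (measurableTypeR R) N P _ `|M|) => //.
  by case/andP: N01.
- move=> y; rewrite /= in_itv/= => /andP[y0 yx]; apply/aeW => v Pv.
  have v0 : 0 < v by move: Pv; rewrite /= in_itv/= andbT.
  rewrite ger0_norm ?hazard_kern_ge0//; apply: (le_trans (hazard_kern_le y hnd v0)).
  rewrite lerD2l ler_wpM2r ?expR_ge0//.
  have my : Num.max y 0 <= Num.max (2 * x) 0 by rewrite le_max2// ltW.
  have my0 : 0 <= Num.max y 0 by rewrite le_max lexx orbT.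
  by rewrite ler_pM ?hnd.2// hnd.1// ler_wpM2r ?expR_ge0.
- by rewrite inE/= in_itv/= x0.
Unshelve. all: by end_near. Qed.

Variable x0 : R.
Hypotheses (x00 : 0 < x0) (hx0 : 0 < h x0).

Lemma hazard_survE t : 0 < t ->
  (h t * surv h t)%:E = (\int[N]_(v in P) ((surv h t - surv h (t * expR v)) / v)%:E)%E.
Proof.
move=> t0; rewrite hE /hazard_op.
rewrite -/(Rintegral N P (hazard_kern h t)).
have ik := hazard_kern_integrable N01 t hnd.
have fk : (\int[N]_(v in P) (hazard_kern h t v)%:E)%E \is a fin_num by exact: integrable_fin_num.
rewrite mulrC EFinM /Rintegral fineK// -integralZl//.
apply: eq_integral => v; rewrite inE/= in_itv/= andbT => v0.
rewrite -EFinM /hazard_kern hazard_intE ?ltW//; congr EFin.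
rewrite mulrA mulrBr mulr1 /surv -expRD; congr ((_ - expR _) / _).
by rewrite opprB addrA addNr add0r.
Qed.

(** Exchange the integrals and rescale: integrating [t^n surv(t e^v)] in [t] gives
    [e^(- (n + 1) v) survM n], so the bracket produces [kern (n + 1) v], whose integral is
    [Psi(n + 1)]. *)
Lemma survM_rec (n : nat) :
  (\int[leb]_(t in P) (t ^+ n * (h t * surv h t))%:E = (Psi N n.+1%:R)%:E * survM h n)%E.
Proof.
have [N0 NP] := andP N01.
have mk : measurable_fun (P `*` P) (fun z : measurableTypeR R * measurableTypeR R =>
   (z.1 ^+ n * ((surv h z.1 - surv h (z.1 * expR z.2)) / z.2))%:E).
  apply/measurable_EFinP.
  have mS := measurable_surv hnd (@measurableT _ (measurableTypeR R)).
  apply: measurable_funM.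
    apply: measurable_funTS; apply: (@measurableT_comp _ _ _ _ _ _ (fun x : R => x ^+ n)) => //.
  apply: measurable_funM.
    apply: measurable_funTS; apply: measurable_funB.
      exact: (measurableT_comp mS).
    apply: (measurableT_comp mS); apply: measurable_funM => //.
    exact: measurableT_comp.
  apply: (@measurable_comp _ _ _ _ _ _ P (fun v : R => v^-1)) => //.
  - by move=> _ [[a b] [/= _ ?] <-].
  - exact: measurable_invP.
  - by apply: measurable_funTS.
have k0 z : (P `*` P) z -> (0 <= (z.1 ^+ n * ((surv h z.1 - surv h (z.1 * expR z.2)) / z.2))%:E)%E.
  case: z => t v [/=]; rewrite !in_itv/= !andbT => t0 v0; rewrite lee_fin.
  rewrite mulr_ge0 ?exprn_ge0 ?(ltW t0)// divr_ge0 ?(ltW v0)// subr_ge0 surv_ni//.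
  by rewrite ler_peMr ?(ltW t0)// -expR0 ler_expR ltW.
transitivity (\int[leb]_(t in P) \int[N]_(v in P)
   (t ^+ n * ((surv h t - surv h (t * expR v)) / v))%:E)%E.
  apply: eq_integral => t; rewrite inE/= in_itv/= andbT => t0.
  rewrite EFinM hazard_survE// -ge0_integralZl//.
  - apply/measurable_EFinP; apply: measurable_funM; last exact: measurable_invP.
    apply: measurable_funB; first exact: measurable_cst.
    have mS := measurable_surv hnd (@measurableT _ (measurableTypeR R)).
    apply: (measurableT_comp mS); apply: measurable_funM => //.
    by apply: measurable_funTS.
  - move=> v; rewrite /= in_itv/= andbT => v0.
    rewrite lee_fin divr_ge0 ?(ltW v0)// subr_ge0 surv_ni//.
    by rewrite ler_peMr ?(ltW t0)// -expR0 ler_expR ltW.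
  - by rewrite lee_fin exprn_ge0// ltW.
rewrite (tonelli_on NP mk k0) /=; clear mk k0 N0 NP.
have hc := hazard_continuous.
have Mfin := survM_lty hnd hc x00 hx0 n.
have M0 : (0 <= survM h n)%E.
  apply: integral_ge0 => t; rewrite /= in_itv/= andbT => t0.
  by rewrite lee_fin mulr_ge0 ?surv_ge0// exprn_ge0// ltW.
have MF : survM h n \is a fin_num by rewrite ge0_fin_numE.
have fS : measurable_fun P (fun t => (t ^+ n * surv h t)%:E).
  apply/measurable_EFinP; apply: measurable_funM; last exact: measurable_surv.
  by apply: measurable_funTS; apply: continuous_measurable_fun; exact: exprn_continuous.
have iS : leb.-integrable P (fun t => (t ^+ n * surv h t)%:E).
  apply/integrableP; split => //.
  apply: le_lt_trans Mfin; rewrite le_eqVlt; apply/orP; left; apply/eqP.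
  apply: eq_integral => t; rewrite inE/= in_itv/= andbT => t0.
  by rewrite /= ger0_norm// mulr_ge0 ?surv_ge0// exprn_ge0// ltW.
transitivity (\int[N]_(v in P) ((kern n.+1%:R v)%:E * survM h n))%E; last first.
  have ik := kern_integrable N01 (ler0n R n.+1).
  have fk : (\int[N]_(v in P) (kern n.+1%:R v)%:E)%E \is a fin_num by exact: integrable_fin_num.
  by rewrite -(fineK MF) integralZr// fineK// /Psi /Rintegral fineK.
apply: eq_integral => v; rewrite inE/= in_itv/= andbT => v0.
clear Mfin M0; have e0 : 0 < expR v by exact: expR_gt0.
have en0 : 0 < expR v ^+ n.+1 by exact: exprn_gt0.
have m2 : measurable_fun P (fun t => (t ^+ n * surv h (t * expR v))%:E).
  apply/measurable_EFinP; apply: measurable_funM.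
    by apply: measurable_funTS; apply: continuous_measurable_fun; exact: exprn_continuous.
  have mS := measurable_surv hnd (@measurableT _ (measurableTypeR R)).
  apply: (measurableT_comp mS); apply: measurable_funM; last exact: measurable_cst.
  exact: measurable_id.
have p2 t : P t -> 0 <= t ^+ n * surv h (t * expR v).
  by rewrite /= in_itv/= andbT => t0; rewrite mulr_ge0 ?surv_ge0// exprn_ge0// ltW.
have sc : survM h n = ((expR v ^+ n.+1)%:E *
    \int[leb]_(t in P) (t ^+ n * surv h (t * expR v))%:E)%E.
  rewrite {1}/survM (lebesgue_scaleP e0 fS) -ge0_integralZl; last 4 first.
  - exact: mP.
  - exact: m2.
  - by move=> t /p2; rewrite lee_fin.
  - by rewrite lee_fin ltW.
  apply: eq_integral => t _; rewrite -!EFinM; congr EFin.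
  have E (a b c : R) : (a * b) ^+ n * c * b = b ^+ n.+1 * (a ^+ n * c).
    by rewrite exprMn exprS; ring.
  by rewrite [expR v * t]mulrC; exact: E.
have i2 : leb.-integrable P (fun t => (t ^+ n * surv h (t * expR v))%:E).
  apply: (le_integrable mP m2 _ iS) => t; rewrite /= in_itv/= andbT => t0.
  have tn0 : 0 <= t ^+ n by rewrite exprn_ge0// ltW.
  rewrite lee_fin !ger0_norm; [|exact: mulr_ge0 tn0 (surv_ge0 _ _)..].
  apply: ler_wpM2l; first exact: tn0.
  apply: surv_ni; first exact: hnd.
  by rewrite ler_peMr ?(ltW t0)// -expR0 ler_expR ltW.
have iB := integrable_fin_num mP i2.
have -> : (\int[leb]_(t in P) (t ^+ n * ((surv h t - surv h (t * expR v)) / v))%:E =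
    v^-1%:E * (survM h n - \int[leb]_(t in P) (t ^+ n * surv h (t * expR v))%:E))%E.
  rewrite /survM -(integralB mP iS i2) -integralZl; last 2 first.
  - exact: mP.
  - exact: (integrableB mP iS i2).
  apply: eq_integral => t _; rewrite -EFinB -EFinM; congr EFin.
  by rewrite mulrA -mulrBr [LHS]mulrC.
have F (c b w : R) : c != 0 -> w != 0 -> w^-1 * (c * b - b) = (1 - c^-1) / w * (c * b).
  by move=> c0 w0; field; rewrite ?c0 ?w0.
rewrite -(fineK iB) in sc *; set b := fine _ in sc *.
rewrite sc; transitivity ((v^-1 * (expR v ^+ n.+1 * b - b))%:E) => //.
rewrite -!EFinM; congr EFin.
by rewrite /kern expRN expRM_natl; apply: F; rewrite gt_eqF.
Qed.

End FixedPointSurvival.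

(** * Asymptotics of iterated tail integrals *)

Section MonotoneTail.
Context {R : realType}.
Local Notation leb := (@lebesgue_measure R).
Local Notation P := (`]0%R, +oo[%classic : set (measurableTypeR R)).
Implicit Types s t u x y : R.

Lemma eq0_halving (x c : R) : (forall k, `|x| <= c / 2 ^+ k) -> x = 0.
Proof.
move=> H; apply/eqP; rewrite -normr_eq0; apply/negPn/negP => x0.
have x1 : 0 < `|x| by rewrite lt_neqAle eq_sym x0/=.
have g : geometric c 2^-1 @ \oo --> (0 : R).
  by apply: cvg_geometric; rewrite ger0_norm ?invf_lt1 ?ltr1n.
have [k _ Hk] := cvgr_lt _ g _ x1; have := Hk k (leqnn k).
by rewrite /geometric/= exprVn ltNge H.
Qed.

Section sandwich.
Variables F f : R -> R.
Hypothesis sandwich : forall s t, 0 <= s -> s <= t ->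
  (t - s) * f t <= F s - F t <= (t - s) * f s.

(** The hypothesis [sandwich] is a derivative-free form of [F' = - f] that is stable under limits
    and presumes no continuity of [f]; comparing its two ends already yields monotonicity. *)
Lemma sandwich_ni s t : 0 <= s -> s <= t -> f t <= f s.
Proof.
move=> s0; rewrite le_eqVlt => /predU1P[->//|st].
have /andP[h1 h2] := sandwich s0 (ltW st).
by move: (le_trans h1 h2); rewrite ler_pM2l// subr_gt0.
Qed.

Lemma sandwich_measurable (D : set (measurableTypeR R)) : measurable D ->
  (forall x, D x -> 0 <= x) -> measurable_fun D f.
Proof.
move=> mD D0; apply: (@eq_measurable_fun _ _ _ _ D (fun x => f (Num.max x 0))).
  by move=> x; rewrite inE => /D0 x0; rewrite max_l.
apply: nonincreasing_measurable; first exact: mD.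
move=> x y xy; apply: sandwich_ni; first by rewrite le_max lexx orbT.
exact: le_max2.
Qed.

Hypothesis f0 : forall t, 0 <= t -> 0 <= f t.

Let fint s t : 0 <= s -> leb.-integrable `]s, t] (EFin \o f).
Proof.
move=> s0; have mI : measurable (`]s, t]%classic : set (measurableTypeR R)) by exact: measurable_itv.
have I0 x : `]s, t]%classic x -> s <= x by rewrite /= in_itv/= => /andP[/ltW].
have lfin : (leb `]s, t] < +oo)%E by rewrite lebesgue_measure_itv/=; case: ifP; rewrite ?ltry.
apply: (@integrable_bounded R _ (measurableTypeR R) leb _ _ (f s)).
- exact: mI.
- exact: lfin.
- by apply: sandwich_measurable => // x /I0; exact: le_trans.
- move=> x /I0 sx; rewrite ger0_norm ?f0 ?(le_trans s0)//; exact: sandwich_ni.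
Qed.

Let I s t := \int[leb]_(x in `]s, t]) f x.

Let I_bounds s t : 0 <= s -> s <= t -> (t - s) * f t <= I s t <= (t - s) * f s.
Proof.
move=> s0 st; have mI : measurable (`]s, t]%classic : set (measurableTypeR R)) by exact: measurable_itv.
have lst : leb `]s, t] = (t - s)%:E.
  rewrite lebesgue_measure_itv/= lte_fin; case: ltP => [_|ts]; first by rewrite EFinB.
  by rewrite (@le_anti _ _ s t) ?st// subrr.
have lfin : (leb `]s, t] < +oo)%E by rewrite lst ltry.
have cE (c : R) : (t - s) * c = \int[leb]_(x in `]s, t]) c.
  rewrite mulrC (@Rintegral_cst _ (measurableTypeR R) R leb _ mI); congr (_ * _).
  exact: (esym (congr1 fine lst)).
have ci (c : R) : leb.-integrable `]s, t] (EFin \o (fun=> c)).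
  exact: (@integrable_bounded R _ (measurableTypeR R) leb _ _ `|c|).
rewrite !cE; apply/andP; split; apply: le_Rintegral => //; try exact: fint.
  by move=> x; rewrite /= in_itv/= => /andP[sx xt]; apply: sandwich_ni xt; rewrite (le_trans s0)// ltW.
by move=> x; rewrite /= in_itv/= => /andP[sx xt]; apply: sandwich_ni => //; exact: ltW.
Qed.

Let I_add s u t : 0 <= s -> s <= u -> u <= t -> I s t = I s u + I u t.
Proof.
move=> s0 su ut; rewrite /I -(@Rintegral_itvB _ f (BRight s) (BRight t) u).
- by rewrite addrC subrK.
- exact: fint.
- by rewrite bnd_simp.
- by rewrite bnd_simp.
Qed.

(** Both sides lie between [(t - s) f(t)] and [(t - s) f(s)], so they differ by at most
    [(t - s) (f s - f t)]. Bisection halves the length while the increments of [f] add up to the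
    same total, so the error is halved each time. *)
Lemma sandwich_integral s t : 0 <= s -> s <= t -> F s - F t = \int[leb]_(x in `]s, t]) f x.
Proof.
move=> s0 st; apply/eqP; rewrite -subr_eq0; apply/eqP.
apply: (@eq0_halving _ ((t - s) * (f s - f t))) => k.
elim: k s t s0 st => [|k IH] s t s0 st.
  have /andP[h1 h2] := sandwich s0 st; have /andP[h3 h4] := I_bounds s0 st.
  rewrite expr0 divr1 mulrBr ler_norml; apply/andP; split; rewrite -/(I s t); lra.
pose u := (s + t) / 2.
have su : s <= u by rewrite /u; lra.
have ut : u <= t by rewrite /u; lra.
have u0 := le_trans s0 su.
have E : F s - F t - I s t = (F s - F u - I s u) + (F u - F t - I u t).
  by rewrite (I_add s0 su ut); ring.
rewrite -/(I s t) E; apply: (le_trans (ler_normD _ _)).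
apply: (le_trans (lerD (IH _ _ s0 su) (IH _ _ u0 ut))).
rewrite le_eqVlt; apply/orP; left; apply/eqP; rewrite exprS /u; field.
by rewrite gt_eqF// exprn_gt0.
Qed.

Lemma sandwich_tail : F t @[t --> +oo] --> 0 -> forall t, 0 <= t ->
  (\int[leb]_(s in `[t, +oo[) (f s)%:E = (F t)%:E)%E.
Proof.
move=> Foo t t0.
have mT : measurable (`]t, +oo[%classic : set (measurableTypeR R)) by exact: measurable_itv.
have mTf : measurable_fun (`]t, +oo[ : set (measurableTypeR R)) (EFin \o f).
  apply/measurable_EFinP; apply: sandwich_measurable; first exact: mT.
  by move=> x; rewrite /= in_itv/= andbT => /ltW; exact: le_trans.
rewrite -integral_itv_obnd_cbnd//.
pose E n : set (measurableTypeR R) := `]t, t + n%:R]%classic.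
have mE n : measurable (E n) by exact: measurable_itv.
have UE : \bigcup_n E n = `]t, +oo[%classic :> set R.
  apply/seteqP; split=> x; rewrite /E/=.
    by move=> [n _] /=; rewrite !in_itv/= andbT => /andP[].
  rewrite in_itv/= andbT => tx; exists (Num.bound (x - t)) => //=.
  rewrite in_itv/= tx/= -lerBlDl; apply/ltW/archi_boundP.
  by rewrite subr_ge0 ltW.
have ES n : E n `<=` `]t, +oo[%classic by rewrite -UE; exact: bigcup_sup.
have E0 n x : E n x -> (0 <= (EFin \o f) x)%E.
  by rewrite /E/= in_itv/= => /andP[/ltW tx _]; rewrite lee_fin f0// (le_trans t0).
have ndE : nondecreasing_seq E.
  move=> m n mn; apply/subsetPset => x; rewrite /E/= !in_itv/= => /andP[-> /le_trans]; apply.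
  by rewrite lerD2l ler_nat.
have := @ge0_nondecreasing_set_cvg_integral _ (measurableTypeR R) R E _ leb ndE mE
  (fun n => measurable_funS mT (ES n) mTf) E0.
rewrite UE => cv.
suff cv1 : (\int[leb]_(s in E n) (f s)%:E)%E @[n --> \oo] --> ((F t)%:E : \bar R).
  exact: (cvg_unique _ cv cv1).
have -> : (fun n => \int[leb]_(s in E n) (f s)%:E)%E = (fun n => (F t - F (t + n%:R))%:E).
  apply/funext => n; rewrite sandwich_integral ?lerDl// /Rintegral fineK//.
  by apply: integrable_fin_num => //; exact: fint.
apply: cvg_EFin; first exact: nearW.
rewrite -[X in _ --> X]subr0; apply: cvgB; first exact: cvg_cst.
have H : (t + n%:R) @[n --> \oo] --> +oo%R.
  apply/cvgryPge => A; near=> n; rewrite -lerBlDl; near: n; exact: nbhs_infty_ger.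
exact: (cvg_comp _ _ H Foo).
Unshelve. all: by end_near. Qed.

End sandwich.

Lemma exp_sandwich (k : R) : 0 < k -> forall s t, 0 <= s -> s <= t ->
  (t - s) * (k * expR (- (k * t))) <= expR (- (k * s)) - expR (- (k * t)) <=
  (t - s) * (k * expR (- (k * s))).
Proof.
move=> k0 s t s0 st.
have e1 : expR (- (k * s)) = expR (- (k * t)) * expR (k * (t - s)).
  by rewrite -expRD; congr expR; ring.
have e2 : expR (- (k * t)) = expR (- (k * s)) * expR (- (k * (t - s))).
  by rewrite -expRD; congr expR; ring.
have h1 := expR_ge1Dx (k * (t - s)); have h2 := expR_ge1Dx (- (k * (t - s))).
have p1 := expR_ge0 (- (k * t)); have p2 := expR_ge0 (- (k * s)).
apply/andP; split.
  rewrite e1; apply: (@le_trans _ _ (expR (- (k * t)) * (k * (t - s)))).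
    by rewrite le_eqVlt; apply/orP; left; apply/eqP; ring.
  have -> (A B : R) : A * B - A = A * (B - 1) by rewrite mulrBr mulr1.
  by rewrite ler_wpM2l// lerBrDl.
rewrite e2; apply: (@le_trans _ _ (expR (- (k * s)) * (k * (t - s)))); last first.
  by rewrite le_eqVlt; apply/orP; left; apply/eqP; ring.
have -> (A B : R) : A - A * B = A * (1 - B) by rewrite mulrBr mulr1.
by rewrite ler_wpM2l// lerBlDr addrC -lerBlDr.
Qed.

Lemma expN_cvg0 (k : R) : 0 < k -> expR (- (k * t)) @[t --> +oo] --> (0 : R).
Proof.
move=> k0; apply: (@cvg_comp _ _ _ (fun t : R => k * t) (fun z => expR (- z)) _ (+oo : set_system R)).
  exact: gt0_cvgMry.
exact: cvgr_expR.
Qed.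

Lemma exp_tail (k t : R) : 0 < k -> 0 <= t ->
  (\int[leb]_(s in `[t, +oo[) (k * expR (- (k * s)))%:E = (expR (- (k * t)))%:E)%E.
Proof.
move=> k0; apply: (sandwich_tail (exp_sandwich k0)); last exact: expN_cvg0.
by move=> s _; rewrite mulr_ge0 ?expR_ge0// ltW.
Qed.

Lemma bernoulli_1B (e : R) n : 0 <= e -> e <= 1 -> 1 - n%:R * e <= (1 - e) ^+ n.
Proof.
move=> e0 e1; elim: n => [|n IH]; first by rewrite mul0r subr0 expr0.
have h : 0 <= 1 - e by rewrite subr_ge0.
rewrite exprS; apply: le_trans (ler_wpM2l h IH).
have n0 : 0 <= n%:R * e * e by rewrite !mulr_ge0.
rewrite -natr1; lra.
Qed.

End MonotoneTail.

(** * Iterated tails of a function with a slowly changing exponential rate *)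

Section IteratedTails.
Context {R : realType}.
Local Notation leb := (@lebesgue_measure R).
Local Notation P := (`]0%R, +oo[%classic : set (measurableTypeR R)).
Implicit Types s t u x y : R.
Variables (m la : R -> R) (G : nat -> R -> R) (t1 : R).
Hypotheses (t10 : 0 < t1) (m0 : forall t, 0 < m t)
  (la0 : forall t, t1 <= t -> 0 < la t)
  (la_nd : forall s t, t1 <= s -> s <= t -> la s <= la t).
Hypothesis m_decay : forall s t, t1 <= t -> t <= s -> m s <= expR (- (la t * (s - t))) * m t.
Hypothesis m_lower : forall e U : R, 0 < e -> e < 1 -> 0 < U -> exists T, t1 <= T /\
  forall t s, T <= t -> t <= s -> la t * (s - t) <= U ->
    (1 - e) * expR (- ((1 + e) * (la t * (s - t)))) * m t <= m s.
Hypothesis la_flat : forall e U : R, 0 < e -> 0 < U -> exists T, t1 <= T /\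
  forall t, T <= t -> la (t + U / la t) <= (1 + e) * la t.
Hypotheses (G0 : forall t, 0 <= t -> G 0%N t = m t)
  (Gge0 : forall n t, 0 <= t -> 0 <= G n t)
  (mG : forall n, measurable_fun P (G n))
  (GS : forall n t, 0 <= t -> ((G n.+1 t)%:E = \int[leb]_(s in `[t, +oo[) (G n s)%:E)%E).

Let mtail t : measurable (`[t, +oo[%classic : set (measurableTypeR R)).
Proof. exact: measurable_itv. Qed.

Let mP : measurable P. Proof. exact: measurable_itv. Qed.

Let tailP t : 0 < t -> `[t, +oo[ `<=` P.
Proof. by move=> t0 x; rewrite /= !in_itv/= !andbT; exact: lt_le_trans. Qed.

Let mexp (D : set (measurableTypeR R)) (c k : R) : measurable D ->
  measurable_fun D (fun s => (c * (k * expR (- (k * s))))%:E).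
Proof.
move=> mD; apply/measurable_EFinP; apply: measurable_funTS; apply: continuous_measurable_fun => x.
apply: cvgM; first exact: cvg_cst.
apply: cvgM; first exact: cvg_cst.
apply: continuous_cvg; first exact: continuous_expR.
by apply: cvgN; apply: cvgM; [exact: cvg_cst|exact: cvg_id].
Qed.

Let exp_tailZ (c k t : R) : 0 <= c -> 0 < k -> 0 <= t ->
  (\int[leb]_(s in `[t, +oo[) (c * (k * expR (- (k * s))))%:E = (c * expR (- (k * t)))%:E)%E.
Proof.
move=> c0 k0 t0; rewrite EFinM -exp_tail// -ge0_integralZl.
- by apply: eq_integral => s _; rewrite EFinM.
- exact: mtail.
- by have := mexp 1 k (mtail t); apply: eq_measurable_fun => s _; rewrite mul1r.
- by move=> s _; rewrite lee_fin mulr_ge0 ?expR_ge0// ltW.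
- by rewrite lee_fin.
Qed.

(** Each integration of [m s <= e^(- la(t) (s - t)) m t] gains a factor [1 / la(t)]; as [la] is
    nondecreasing, the bound obtained at [s] may be weakened to the rate at [t]. *)
Lemma iter_tail_le n t : t1 <= t -> la t ^+ n * G n t <= m t.
Proof.
elim: n t => [|n IH] t tt1.
  by rewrite expr0 mul1r G0// (le_trans (ltW t10)).
have t0 := lt_le_trans t10 tt1; have l0 := la0 tt1.
have ln0 : 0 < la t ^+ n by exact: exprn_gt0.
(* With this [c], the integrand [c la(t) e^(- la(t) s)] is the decay bound for [m s] divided by
   [la(t)^n]. *)
pose c := m t / la t ^+ n / la t * expR (la t * t).
have c0 : 0 <= c by rewrite mulr_ge0 ?expR_ge0// !divr_ge0 ?ltW.
suff : ((G n.+1 t)%:E <= (c * expR (- (la t * t)))%:E)%E.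
  have -> : c * expR (- (la t * t)) = m t / la t ^+ n / la t.
    by rewrite /c -mulrA expRxMexpNx_1 mulr1.
  by rewrite lee_fin !ler_pdivlMr// exprS => h; rewrite mulrC mulrA.
rewrite GS ?(ltW t0)// -exp_tailZ ?(ltW t0)//.
apply: ge0_le_integral.
- exact: mtail.
- move=> s; rewrite /= in_itv/= andbT => ts; rewrite lee_fin Gge0//.
  exact: le_trans (ltW t0) ts.
- by apply/measurable_EFinP; apply: (measurable_funS mP (tailP t0)); exact: mG.
- exact: mexp.
- move=> s; rewrite /= in_itv/= andbT => ts; rewrite lee_fin.
  have ss1 := le_trans tt1 ts.
  have h1 : la t ^+ n * G n s <= m s.
    apply: le_trans (IH s ss1); rewrite ler_wpM2r ?Gge0 ?(le_trans (ltW t0))//.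
    by rewrite lerXn2r ?nnegrE ?(ltW l0) ?(ltW (la0 ss1))// la_nd.
  have h2 := le_trans h1 (m_decay tt1 ts).
  rewrite -(ler_pM2l ln0); apply: (le_trans h2).
  have -> : expR (- (la t * (s - t))) = expR (la t * t) * expR (- (la t * s)).
    by rewrite -expRD; congr expR; ring.
  rewrite /c le_eqVlt; apply/orP; left; apply/eqP; field.
  by rewrite !gt_eqF.
Qed.

(** Only the window [[t, t + U / la(t)[] is kept: on it [la] is nearly constant and [m] nearly
    exponential, and it carries almost all of the exponential. *)
Lemma iter_tail_ge n (e : R) : 0 < e -> e < 1 -> exists T, t1 <= T /\
  forall t, T <= t -> (1 - e) * m t <= la t ^+ n * G n t.
Proof.
elim: n e => [|n IH] e e0 e1.
  exists t1; split => // t tt1; rewrite expr0 mul1r G0 ?(le_trans (ltW t10))//.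
  by rewrite ler_piMl ?(ltW (m0 t))// gerBl ltW.
(* Three factors [1 - d] are lost (induction, [m_lower], window), as well as [(1 + d)^n] from
   [la s <= (1 + d) la t] and [1 + d] from the rate [k]. Since [1 / (1 + d) >= 1 - d], the total is
   at least [(1 - d)^(n + 4) >= 1 - e]. *)
pose d := e / n.+4%:R.
have n40 : 0 < n.+4%:R :> R by [].
have d0 : 0 < d by rewrite divr_gt0.
have d1 : d < 1 by rewrite ltr_pdivrMr// mul1r (lt_le_trans e1)// ler1n.
have d1' : 0 < 1 - d by rewrite subr_gt0.
(* An exponential of rate [k] has at most the fraction [d] of its integral beyond this window. *)
pose U := - ln d; have U0 : 0 < U by rewrite oppr_gt0 ln_lt0// d0.
have [T1 [T11 H1]] := IH d d0 d1.
have [T2 [T21 H2]] := m_lower d0 d1 U0.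
have [T3 [T31 H3]] := la_flat d0 U0.
exists (Num.max T1 (Num.max T2 T3)); split; first by rewrite le_max T11.
move=> t; rewrite !ge_max => /and3P[tT1 tT2 tT3].
have tt1 := le_trans T11 tT1; have t0 := lt_le_trans t10 tt1.
have l0 := la0 tt1; have ln0 : 0 < la t ^+ n by exact: exprn_gt0.
have dp : 0 < 1 + d by rewrite addr_gt0.
pose k := (1 + d) * la t; have k0 : 0 < k by rewrite mulr_gt0.
have p0 : 0 < (1 + d) ^+ n by exact: exprn_gt0.
pose c := (1 - d) ^+ 2 * m t / ((1 + d) ^+ n * la t ^+ n) / k * expR (k * t).
have c0 : 0 <= c.
  by rewrite mulr_ge0 ?expR_ge0// divr_ge0 ?(ltW k0)// divr_ge0 ?mulr_ge0
    ?(ltW ln0) ?(ltW p0) ?(ltW d1') ?(ltW (m0 t)).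
pose s1 := t + U / la t.
have ts1 : t <= s1 by rewrite lerDl divr_ge0 ?ltW.
have s10 : 0 <= s1 by rewrite (le_trans (ltW t0)).
(* The integral of an exponential over [[t, s1[] appears as the difference of its tails at [t] and
   [s1]. *)
have low : ((c * expR (- (k * t)))%:E - (c * expR (- (k * s1)))%:E <= (G n.+1 t)%:E)%E.
  rewrite leeBlDr// GS ?(ltW t0)// -!exp_tailZ ?(ltW t0)//.
  have IE : `[t, +oo[%classic = `[t, s1[%classic `|` `[s1, +oo[%classic :> set (measurableTypeR R).
    apply/seteqP; split=> x /=; rewrite !in_itv/= !andbT.
      by move=> ->/=; have [h|h] := ltP x s1; [left|right].
    by case=> [/andP[]//|]; exact: le_trans.
  have mI : measurable (`[t, s1[%classic : set (measurableTypeR R)) by exact: measurable_itv.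
  have disj : [disjoint `[t, s1[%classic & `[s1, +oo[%classic : set (measurableTypeR R)].
    apply/disj_setPS => x [] /=; rewrite !in_itv/= andbT => /andP[_ h1] h2.
    by move: (lt_le_trans h1 h2); rewrite ltxx.
  rewrite {1}IE ge0_integral_setU.
  - apply: leeD2r; apply: (@le_trans _ _ (\int[leb]_(s in `[t, s1[) (G n s)%:E)%E).
      apply: ge0_le_integral.
      + exact: mI.
      + by move=> s _; rewrite lee_fin; exact: mulr_ge0 c0 (mulr_ge0 (ltW k0) (expR_ge0 _)).
      + exact: mexp.
      + apply/measurable_EFinP; apply: (measurable_funS mP) (mG n) => x.
        by rewrite /= !in_itv/= andbT => /andP[+ _]; exact: lt_le_trans.
      + move=> s; rewrite /= in_itv/= => /andP[ts ss1]; rewrite lee_fin.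
        have sT1 := le_trans tT1 ts; have st1 := le_trans tt1 ts.
        have h1 := H1 _ sT1.
        have sU : la t * (s - t) <= U.
          by rewrite mulrC -ler_pdivlMr// lerBlDl ltW.
        have h2 := H2 _ _ tT2 ts sU.
        have h3 : la s <= (1 + d) * la t.
          by apply: le_trans (H3 _ tT3); apply: la_nd => //; exact: ltW.
        have g0 : 0 <= G n s by rewrite Gge0// (le_trans (ltW t0)).
        have h4 : la s ^+ n * G n s <= ((1 + d) ^+ n * la t ^+ n) * G n s.
          rewrite ler_wpM2r// -exprMn lerXn2r ?nnegrE ?(ltW (la0 st1))//.
          by rewrite mulr_ge0 ?ltW.
        have h5 : (1 - d) * ((1 - d) * expR (- ((1 + d) * (la t * (s - t)))) * m t) <=
            ((1 + d) ^+ n * la t ^+ n) * G n s.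
          by apply: le_trans h4; apply: le_trans h1; rewrite ler_pM2l.
        rewrite -(ler_pM2l (mulr_gt0 p0 ln0)); apply: le_trans h5.
        have -> : expR (- ((1 + d) * (la t * (s - t)))) = expR (k * t) * expR (- (k * s)).
          by rewrite -expRD; congr expR; rewrite /k; ring.
        rewrite /c le_eqVlt; apply/orP; left; apply/eqP; field.
        by rewrite !gt_eqF.
    apply: ge0_subset_integral; [exact: mI|exact: mtail| | |].
    + by apply/measurable_EFinP; apply: (measurable_funS mP (tailP t0)); exact: mG.
    + move=> s; rewrite /= in_itv/= andbT => ts; rewrite lee_fin Gge0//.
      exact: le_trans (ltW t0) ts.
    + by move=> x; rewrite /= !in_itv/= andbT => /andP[].
  - exact: mI.
  - exact: mtail.
  - by rewrite -IE; exact: mexp.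
  - by move=> s _; rewrite lee_fin; exact: mulr_ge0 c0 (mulr_ge0 (ltW k0) (expR_ge0 _)).
  - exact: disj.
move: low; rewrite -EFinB lee_fin => low.
rewrite -ler_pdivrMl ?exprn_gt0//; apply: le_trans low.
have Ek : expR (- (k * s1)) = expR (- (k * t)) * expR (- ((1 + d) * U)).
  by rewrite -expRD; congr expR; rewrite /k /s1; field; rewrite gt_eqF.
have eU : expR (- ((1 + d) * U)) <= d.
  rewrite -[leRHS]lnK ?posrE// ler_expR /U mulrN opprK.
  by rewrite mulrDl mul1r gerDl nmulr_lle0 ?ltW// ln_lt0// d0.
rewrite Ek -[X in c * X - _]mulr1 -mulrBr -mulrBr.
have -> : c * (expR (- (k * t)) * (1 - expR (- ((1 + d) * U)))) =
   (1 - d) ^+ 2 * m t / ((1 + d) ^+ n * la t ^+ n) / k * (1 - expR (- ((1 + d) * U))).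
  by rewrite /c -[LHS]mulrA [expR (k * t) * (_ * _)]mulrA expRxMexpNx_1 mul1r.
apply: (@le_trans _ _ ((1 - d) ^+ 2 * m t / ((1 + d) ^+ n * la t ^+ n) / k * (1 - d))); last first.
  rewrite ler_wpM2l// ?lerB// !divr_ge0 ?(ltW k0)// ?mulr_ge0 ?ltW//.
have -> : (1 - d) ^+ 2 * m t / ((1 + d) ^+ n * la t ^+ n) / k * (1 - d) =
    (la t ^+ n.+1)^-1 * (((1 - d) ^+ 3 / (1 + d) ^+ n.+1) * m t).
  by rewrite /k !exprS expr0; field; rewrite !gt_eqF.
rewrite ler_pM2l ?invr_gt0 ?exprn_gt0// ler_pM2r//.
have i1 : 1 - d <= (1 + d)^-1.
  by rewrite -[leRHS]mul1r ler_pdivlMr//; have := sqr_ge0 d; rewrite expr2; lra.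
apply: (@le_trans _ _ ((1 - d) ^+ n.+4)).
  apply: le_trans (bernoulli_1B n.+4 (ltW d0) (ltW d1)).
  by rewrite /d mulrCA mulfV ?mulr1// gt_eqF.
rewrite -[n.+4]/((3 + n.+1)%N) exprD ler_pM2l ?exprn_gt0//.
by rewrite -exprVn lerXn2r ?nnegrE ?(ltW d1')// invr_ge0 ltW.
Qed.

Lemma iter_tail_cvg n : la t ^+ n * G n t / m t @[t --> +oo] --> (1 : R).
Proof.
apply/cvgrPdist_le => e e0.
pose d := Num.min e 2^-1.
have d0 : 0 < d by rewrite lt_min e0/= invr_gt0.
have d1 : d < 1 by rewrite gt_min orbC invf_lt1 ?ltr1n.
have [T [T1 HT]] := iter_tail_ge n d0 d1.
near=> t; have tT : T <= t by near: t; apply: nbhs_pinfty_ge; exact: num_real.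
have h1 := HT _ tT; have h2 := iter_tail_le n (le_trans T1 tT).
have r1 : la t ^+ n * G n t / m t <= 1 by rewrite ler_pdivrMr// mul1r.
have r2 : 1 - d <= la t ^+ n * G n t / m t by rewrite ler_pdivlMr.
rewrite ger0_norm ?subr_ge0// lerBlDl -lerBlDr; apply: le_trans r2.
by rewrite lerB// /d ge_min lexx.
Unshelve. all: by end_near. Qed.

End IteratedTails.

(** * Moments of a solution of the fragmentation equation *)

Section ParametricIntegral.
Context {R : realType}.
Local Notation meas := {measure set (measurableTypeR R) -> \bar R}.
Local Notation P := (`]0%R, +oo[%classic : set (measurableTypeR R)).
Local Open Scope ereal_scope.

Lemma measurable_integral_param (N : meas) (k : measurableTypeR R * measurableTypeR R -> \bar R) :
  N P < +oo -> measurable_fun setT k ->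
  measurable_fun setT (fun x => \int[N]_(v in P) k (x, v)).
Proof.
move=> NP mk; have mP : measurable P by exact: measurable_itv.
pose N' := mfrestr mP NP.
have NN' (f : measurableTypeR R -> \bar R) : \int[N]_(v in P) f v = \int[N']_v (f \_ P) v.
  rewrite -integral_mkcond; apply: eq_measure_integral => A mA AP.
  by rewrite /N' /= /mfrestr /mrestr setIidl.
have mX : measurable ([set: measurableTypeR R] `*` P) by exact: measurableX.
have key (f : measurableTypeR R * measurableTypeR R -> \bar R) : measurable_fun setT f ->
    (forall z, 0 <= f z) -> measurable_fun setT (fun x => \int[N]_(v in P) f (x, v)).
  move=> mf f0; pose f' := f \_ ([set: measurableTypeR R] `*` P).
  have mf' : measurable_fun setT f'.
    by apply/(measurable_restrictT f mX); exact: measurable_funTS.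
  have f'0 z : 0 <= f' z by rewrite /f' patchE; case: ifPn => _; [exact: f0|exact: lexx].
  have := @measurable_fun_fubini_tonelli_F _ _ _ _ R N' f' mf' f'0.
  apply: eq_measurable_fun => x _; rewrite /fubini_F NN'; apply: eq_integral => v _.
  rewrite /f' !patchE.
  have -> // : ((x, v) \in [set: measurableTypeR R] `*` P) = (v \in P).
  by apply/idP/idP => [/set_mem[/= _ vP]|/set_mem vP]; rewrite mem_set.
have := emeasurable_funB (key _ (measurable_funepos mk) (fun z => funepos_ge0 k z))
  (key _ (measurable_funeneg mk) (fun z => funeneg_ge0 k z)).
apply: eq_measurable_fun => x _; rewrite [RHS]integralE.
by congr (_ - _); apply: eq_integral => v _; rewrite ?funeposE ?funenegE.
Qed.

(* [v = - a ln y] turns [a |ln y| y B(dy)] into the finite measure [N]. *)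
Lemma log_image_measure (a : R) (B : meas) : (0 < a)%R -> 0 < B `]0%R, 1%R[%classic ->
  \int[B]_(x in `]0%R, 1%R[) (`|ln x| * x)%:E < +oo ->
  exists N : meas, 0 < N P < +oo /\
    forall k : measurableTypeR R -> R, measurable_fun setT k ->
      \int[B]_(y in `]0%R, 1%R[) (y * k y)%:E =
      \int[N]_(v in P) (k (expR (- (v / a))) / v)%:E.
Proof.
move=> a0 B0 Bln; set E := (`]0%R, 1%R[%classic : set (measurableTypeR R)).
have mE : measurable E by exact: measurable_itv.
have mP : measurable P by exact: measurable_itv.
have E01 y : E y -> (0 < y)%R /\ (y < 1)%R by rewrite /E/= in_itv/= => /andP[].
have mln D : measurable D -> measurable_fun D (fun y : measurableTypeR R => `|ln y| * y)%R.
  move=> mD; apply: measurable_funM; last exact: measurable_id.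
  by apply: measurableT_comp => //; apply: measurable_funTS; exact: measurable_ln.
(* With [v = s y = - a ln y], this density is [v y]: dividing by [v] on the side of [N] recovers
   [y B(dy)]. *)
pose w (y : measurableTypeR R) : R := (a * (`|ln y| * y))%R.
have mw : measurable_fun E w by apply: measurable_funM; [exact: measurable_cst|exact: mln].
have w0 y : E y -> (0 <= w y)%R.
  by move=> /E01[y0 y1]; rewrite /w mulr_ge0 ?(ltW a0)// mulr_ge0 ?normr_ge0// ltW.
pose s (y : measurableTypeR R) : measurableTypeR R := (- (a * ln y))%R.
have ms : measurable_fun setT s.
  apply: measurableT_comp => //; apply: measurable_funM; first exact: measurable_cst.
  exact: measurable_ln.
have sP : E `&` s @^-1` P = E.
  apply/seteqP; split=> y; first by case.
  move=> Ey; split=> //; have [y0 y1] := E01 _ Ey.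
  by rewrite /s/= in_itv/= andbT oppr_gt0 pmulr_rlt0// ln_lt0// y0.
have lnE y : E y -> (`|ln y| = - ln y)%R.
  by move=> /E01[y0 y1]; rewrite ler0_norm// ltW// ln_lt0// y0.
have [N [NA Nf]] := @weighted_image_integral _ _ (measurableTypeR R) (measurableTypeR R) R
  B E w s mE mw w0 ms.
exists N; split; last first.
  move=> k mk; rewrite Nf; last 2 first.
  - exact: mP.
  - apply/measurable_EFinP; apply: measurable_funM; last exact: measurable_invP.
    apply: (measurableT_comp mk); apply: measurableT_comp => //; apply: measurableT_comp => //.
    exact: measurable_funM.
  rewrite sP; apply: eq_integral => y; rewrite inE => Ey; rewrite -EFinM; congr EFin.
  have [y0 y1] := E01 _ Ey.
  have ly : (ln y < 0)%R by rewrite ln_lt0// y0.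
  have -> : expR (- (s y / a)) = y.
    by rewrite /s mulNr opprK mulrAC mulfV ?gt_eqF// mul1r lnK.
  rewrite /w /s lnE//; field.
  by rewrite (lt_eqF ly) (gt_eqF a0).
rewrite NA// sP; apply/andP; split.
  rewrite lt_neqAle integral_ge0 ?andbT; last by move=> y /w0; rewrite lee_fin.
  apply/eqP => /esym I0.
  have : \int[B]_(y in E) `|(w y)%:E| = 0.
    rewrite -[RHS]I0; apply: eq_integral => y; rewrite inE => /w0 wy.
    by rewrite /= ger0_norm.
  have mwE : measurable_fun E (EFin \o w) by apply/measurable_EFinP.
  move/(ae_eq_integral_abs B mE mwE) => [A [mA BA0 EA]].
  have EsA : E `<=` A.
    move=> y Ey; apply: EA => /(_ Ey) /eqP; rewrite eqe => /eqP.
    have [y0 y1] := E01 _ Ey; have ly : (ln y < 0)%R by rewrite ln_lt0// y0.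
    by rewrite /w lnE// => /eqP; rewrite !mulf_eq0 !gt_eqF// oppr_gt0.
  by move: B0; rewrite ltNge -BA0 le_measure// inE.
have -> : \int[B]_(x in E) (w x)%:E = a%:E * \int[B]_(x in E) (`|ln x| * x)%:E.
  rewrite -ge0_integralZl//.
  - by apply/measurable_EFinP; exact: mln.
  - by move=> y /E01[y0 _]; rewrite lee_fin mulr_ge0// ltW.
  - by rewrite lee_fin ltW.
by rewrite lte_mul_pinfty// lee_fin ltW.
Qed.

End ParametricIntegral.

(** * Mean value theorem in time *)

Section TimeDerivative.
Context {R : realType}.
Implicit Types (F : R -> R) (s t x : R).

(** Only the left endpoint needs care: at time 0 the derivative is one-sided, so continuity from the
    right at [s] is drawn from the boundedness of the difference quotients. *)
Lemma time_MVT F (l : R -> R) s t : (forall u : R, 0 <= u -> has_time_derivative F u (l u)) ->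
  0 <= s -> s < t -> exists2 c, s < c < t & F t - F s = l c * (t - s).
Proof.
move=> HF s0 st.
have D x : 0 < x -> is_derive x (1 : R) F (l x).
  move=> x0; have H := HF x (ltW x0).
  have cv : h^-1 *: (F (h *: (1 : R) + x) - F x) @[h --> 0^'] --> l x.
    move=> A /H /= HA.
    have xn : \forall h \near (0 : R)^', 0 <= x + h.
      apply: nbhs_dnbhs; near=> h.
      have : `|0 - h| < x by near: h; apply: cvgr_dist_lt => //; exact: cvg_id.
      by rewrite sub0r normrN ltr_norml => /andP[h1 _]; lra.
    have HA' : \forall h \near (0 : R)^', 0 <= x + h -> A (h^-1 * (F (x + h) - F x)) by exact: HA.
    change (\forall h \near (0 : R)^', A (h^-1 *: (F (h *: (1 : R) + x) - F x))).
    apply: filterS2 HA' xn => h HA1 xh; have := HA1 xh.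
    by rewrite /GRing.scale/= mulr1 [h + x]addrC.
  by apply: DeriveDef; [apply/cvg_ex; exists (l x)|exact: cvg_lim].
have C x : 0 < x -> {for x, continuous F}.
  move=> /D dx; apply: differentiable_continuous; apply/derivable1_diffP.
  by have [] := dx.
have D' x : x \in `]s, t[ -> is_derive x (1 : R) F (l x).
  by rewrite in_itv/= => /andP[sx _]; apply: D; exact: le_lt_trans sx.
suff Cw : {within `[s, t], continuous F}.
  by have [c] := MVT st D' Cw; rewrite in_itv/= => cst E; exists c.
apply/(continuous_within_itvP _ st); split.
  + by move=> x; rewrite in_itv/= => /andP[sx _]; apply: C; exact: le_lt_trans sx.
  + have H := HF s s0.
    have H0 : (x - s) @[x --> s^'+] --> within [set h | 0 <= s + h] (0 : R)^'.
      move=> A /= /nbhs_ballP[e /= e0 HA].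
      change (\forall x \near s^'+, A (x - s)); near=> x; apply: HA => /=.
      * rewrite /ball/= sub0r normrN ger0_norm ?subr_ge0; last by near: x; exact: nbhs_right_ge.
        by rewrite ltrBlDl; near: x; apply: nbhs_right_lt; rewrite ltrDl.
      * by rewrite subr_eq0; apply/eqP => xs; have : s < x by [near: x; exact: nbhs_right_gt];
          rewrite xs ltxx.
      * by rewrite addrC subrK (le_trans s0)//; near: x; exact: nbhs_right_ge.
    have Hq := cvg_comp _ _ H0 H.
    have Hq1 : \forall x \near s^'+, `|l s - (x - s)^-1 * (F (s + (x - s)) - F s)| <= 1.
      have B : nbhs (l s) [set z | `|l s - z| <= 1].
        by apply/nbhs_ballP; exists 1 => //= z; rewrite /ball/= => /ltW.
      exact: (Hq _ B).
    apply/cvgrPdist_le => e e0.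
    have le0 : 0 < `|l s| + 1 by rewrite ltr_wpDl.
    near=> x; have sx : s < x by near: x; exact: nbhs_right_gt.
    have q1 : `|l s - (x - s)^-1 * (F (s + (x - s)) - F s)| <= 1 by near: x; exact: Hq1.
    have xe : x < s + e / (`|l s| + 1) by near: x; apply: nbhs_right_lt; rewrite ltrDl divr_gt0.
    have xs0 : 0 < x - s by rewrite subr_gt0.
    have E : F x - F s = (x - s) * ((x - s)^-1 * (F (s + (x - s)) - F s)).
      by rewrite mulrA mulfV ?gt_eqF// mul1r [s + _]addrC subrK.
    rewrite distrC E normrM (gtr0_norm xs0).
    have q2 : `|(x - s)^-1 * (F (s + (x - s)) - F s)| <= `|l s| + 1.
      have := lerD (lexx `|l s|) q1; apply: le_trans.
      by rewrite -lerBlDl; apply: le_trans (lerB_dist _ _) _; rewrite distrC.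
    apply: (le_trans (ler_wpM2l (ltW xs0) q2)).
    by rewrite -ler_pdivlMr// lerBlDl ltW.
  + by apply: cvg_at_left_filter; apply: C; exact: le_lt_trans st.
Unshelve. all: by end_near. Qed.

End TimeDerivative.

Section C1Calculus.
Context {R : realType}.
Implicit Types (f g : R -> R) (x u : R).

Definition C1pos f := exists df : R -> R, (forall x, 0 < x -> is_derive x (1 : R) f (df x)) /\
  (forall x, 0 < x -> {for x, continuous df}).

Lemma is_derive_continuous f (df : R) x : is_derive x (1 : R) f df -> {for x, continuous f}.
Proof.
by move=> dx; apply: differentiable_continuous; apply/derivable1_diffP; have [] := dx.
Qed.

Lemma C1pos_cst (c : R) : C1pos (fun=> c).
Proof. by exists (fun=> 0); split=> x _; [exact: is_derive_cst|exact: cvg_cst]. Qed.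

Lemma C1pos_id : C1pos id.
Proof. by exists (fun=> 1); split=> x _; [exact: is_derive_id|exact: cvg_cst]. Qed.

Lemma C1posB f g : C1pos f -> C1pos g -> C1pos (fun x => f x - g x).
Proof.
move=> [df [Df Cf]] [dg [Dg Cg]]; exists (fun x => df x - dg x); split=> x x0.
  by have := Df _ x0; have := Dg _ x0 => ? ?; exact: is_deriveB.
by apply: cvgB; [exact: Cf|exact: Cg].
Qed.

Lemma C1posM f g : C1pos f -> C1pos g -> C1pos (fun x => f x * g x).
Proof.
move=> [df [Df Cf]] [dg [Dg Cg]]; exists (fun x => f x * dg x + g x * df x); split=> x x0.
  by have := Df _ x0; have := Dg _ x0 => ? ?; exact: is_deriveM.
have Cf' := is_derive_continuous (Df _ x0); have Cg' := is_derive_continuous (Dg _ x0).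
by apply: cvgD; apply: cvgM => //; [exact: Cg|exact: Cf].
Qed.

Lemma C1pos_powR (p : R) : C1pos (fun x => x `^ p).
Proof.
exists (fun x => p * x `^ (p - 1)); split=> x x0; first exact: is_derive1_powR.
apply: cvgM; first exact: cvg_cst.
exact: (is_derive_continuous (is_derive1_powR (p - 1) x0)).
Qed.

(** A continuously differentiable substitute for the positive part, from which the admissible
    truncations of powers are composed. *)
Definition sqpos u : R := Num.max u 0 ^+ 2.

Lemma sqpos_ge0 u : 0 <= sqpos u. Proof. exact: sqr_ge0. Qed.

Lemma sqposE u : 0 <= u -> sqpos u = u ^+ 2.
Proof. by move=> u0; rewrite /sqpos max_l. Qed.

Lemma sqpos0 u : u <= 0 -> sqpos u = 0.
Proof. by move=> u0; rewrite /sqpos max_r// expr0n. Qed.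

Lemma sqpos_nd u v : u <= v -> sqpos u <= sqpos v.
Proof.
have p (w : R) : 0 <= Num.max w 0 by rewrite le_max lexx orbT.
by move=> uv; rewrite /sqpos lerXn2r ?nnegrE//; exact: le_max2.
Qed.

Lemma is_derive_sqpos u : is_derive u (1 : R) sqpos (2 * Num.max u 0).
Proof.
have cv : h^-1 *: (sqpos (h *: (1 : R) + u) - sqpos u) @[h --> 0^'] --> 2 * Num.max u 0.
  apply/cvgrPdist_le => e e0.
  near=> h; have h0 : h != 0 by near: h; exact: nbhs_dnbhs_neq.
  have he : `|h| <= e by near: h; exact: dnbhs0_le.
  apply: le_trans he; rewrite /GRing.scale/= mulr1.
  have hh : 0 < `|h| by rewrite normr_gt0.
  have -> : 2 * Num.max u 0 - h^-1 * (sqpos (h + u) - sqpos u) =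
     h^-1 * (2 * Num.max u 0 * h - (sqpos (h + u) - sqpos u)) by field.
  rewrite normrM normfV ler_pdivrMl// -normrM -expr2 [leRHS]ger0_norm ?sqr_ge0//.
  rewrite /sqpos ler_norml.
  by case: (leP u 0) => u0; case: (leP (h + u) 0) => hu0;
    rewrite ?expr0n/= ?expr2; apply/andP; split; nra.
by apply: DeriveDef; [apply/cvg_ex; exists (2 * Num.max u 0)|exact: cvg_lim].
Unshelve. all: by end_near. Qed.

Lemma continuous_max0 : continuous (fun u : R => Num.max u 0).
Proof.
move=> u; apply/cvgrPdist_le => e e0; near=> v.
have h : `|u - v| <= e by near: v; apply: cvgr_dist_le => //; exact: cvg_id.
apply: le_trans h; rewrite ler_norml.
have := ler_norm (u - v); have := ler_norm (v - u); rewrite -[`|v - u|]normrN opprB.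
by case: (leP u 0) => u0; case: (leP v 0) => v0 h1 h2; apply/andP; split; lra.
Unshelve. all: by end_near. Qed.

Lemma C1pos_sqpos f : C1pos f -> C1pos (fun x => sqpos (f x)).
Proof.
move=> [df [Df Cf]]; exists (fun x => 2 * Num.max (f x) 0 * df x); split=> x x0.
  have dfx := Df _ x0.
  exact: (@is_derive1_comp R sqpos f x _ _ (is_derive_sqpos (f x)) dfx).
apply: cvgM; last exact: Cf.
apply: cvgM; first exact: cvg_cst.
apply: (@cvg_comp _ _ _ f (fun u => Num.max u 0) _ (nbhs (f x))); last exact: continuous_max0.
exact: (is_derive_continuous (Df _ x0)).
Qed.

Lemma C1pos_compact_support f (k M : R) : 0 < k -> C1pos f ->
  (forall x, 0 < x -> x <= k -> f x = 0) -> (forall x, M <= x -> f x = 0) ->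
  C1_compact_support f.
Proof.
move=> k0 [df [Df Cf]] fk fM; split.
- by move=> x x0; have [] := Df _ x0.
- apply: continuous_in_subspaceT => x; rewrite inE/= in_itv/= andbT => x0.
  have E : \forall y \near x, derive1 f y = df y.
    near=> y; have y0 : 0 < y by near: y; apply: (@cvgr_gt _ _ _ _ id x) => //; exact: cvg_id.
    by rewrite derive1E; have [_ ->] := Df _ y0.
  rewrite /continuous_at /prop_for (nbhs_singleton E); apply: cvg_trans (Cf _ x0).
  by apply: near_eq_cvg; near=> y; apply/esym; near: y; exact: E.
- exists `[k, M]%classic; split.
  + exact: segment_compact.
  + by move=> x /=; rewrite !in_itv/= andbT => /andP[kx _]; exact: lt_le_trans kx.
  + move=> x x0 /= /negP; rewrite in_itv/= negb_and -!ltNge => /orP[/ltW xk|/ltW Mx].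
      exact: fk.
    exact: fM.
Unshelve. all: by end_near. Qed.

End C1Calculus.

(** * Truncated powers as test functions *)

Section CutPower.
Context {R : realType}.
Implicit Types (x y r q k v : R).

(** Equal to [((1 - (k / x)^q)_+)^2] for [x > 0]: zero up to [k], increasing, and tending to 1 as
    [k] tends to 0. *)
Definition cut q k x : R := sqpos (1 - k `^ q * x `^ (- q)).

(** The last factor is 1 on []0, 1]] and 0 beyond 2; it only serves to make the support compact, the
    solution being carried by []0, 1]]. *)
Definition cutpow r q k x : R := x `^ r * cut q k x * sqpos (1 - sqpos (x - 1)).

Lemma cut_ge0 q k x : 0 <= cut q k x. Proof. exact: sqpos_ge0. Qed.

Lemma cut_le1 q k x : cut q k x <= 1.
Proof.
have h : 1 - k `^ q * x `^ (- q) <= 1 by rewrite gerBl mulr_ge0 ?powR_ge0.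
by apply: (le_trans (sqpos_nd h)); rewrite sqposE// expr1n.
Qed.

Lemma cut_nd q k x y : 0 <= q -> 0 < x -> x <= y -> cut q k x <= cut q k y.
Proof.
move=> q0 x0 xy; have y0 := lt_le_trans x0 xy.
apply: sqpos_nd; rewrite lerB// ler_wpM2l ?powR_ge0//.
rewrite !powRN lef_pV2 ?posrE ?powR_gt0//.
by apply: ge0_ler_powR => //; rewrite nnegrE ltW.
Qed.

Lemma cut0 q k x : 0 <= q -> 0 < x -> x <= k -> cut q k x = 0.
Proof.
move=> q0 x0 xk; apply: sqpos0; rewrite subr_le0 powRN ler_pdivlMr ?powR_gt0// mul1r.
by apply: ge0_ler_powR => //; rewrite nnegrE ltW// (lt_le_trans x0).
Qed.

Lemma cutpowE r q k x : 0 < x -> x <= 1 -> cutpow r q k x = x `^ r * cut q k x.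
Proof.
move=> x0 x1; rewrite /cutpow (sqpos0 (u := x - 1)) ?subr_le0// subr0 sqposE//.
by rewrite expr1n mulr1.
Qed.

Lemma sqpos_continuous : continuous (@sqpos R).
Proof. by move=> u; exact: is_derive_continuous (is_derive_sqpos u). Qed.

Lemma measurable_cutpow r q k : measurable_fun setT (cutpow r q k : measurableTypeR R -> R).
Proof.
have mq : measurable_fun setT (sqpos : measurableTypeR R -> R).
  by apply: continuous_measurable_fun; exact: sqpos_continuous.
apply: measurable_funM; first apply: measurable_funM.
- exact: measurable_powR.
- apply: (measurableT_comp mq); apply: measurable_funB; first exact: measurable_cst.
  by apply: measurable_funM; [exact: measurable_cst|exact: measurable_powR].
- apply: (measurableT_comp mq); apply: measurable_funB; first exact: measurable_cst.
  apply: (measurableT_comp mq); apply: measurable_funB; last exact: measurable_cst.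
  exact: measurable_id.
Qed.

Lemma cutpow_C1 r q k : 0 <= q -> 0 < k -> C1_compact_support (fun x => x * cutpow r q k x).
Proof.
move=> q0 k0; apply: (@C1pos_compact_support _ _ k 2) => //.
- apply: C1posM; first exact: C1pos_id.
  apply: C1posM; first apply: C1posM.
  + exact: C1pos_powR.
  + apply: C1pos_sqpos; apply: C1posB; first exact: C1pos_cst.
    by apply: C1posM; [exact: C1pos_cst|exact: C1pos_powR].
  + apply: C1pos_sqpos; apply: C1posB; first exact: C1pos_cst.
    apply: C1pos_sqpos; apply: C1posB; [exact: C1pos_id|exact: C1pos_cst].
- by move=> x x0 xk; rewrite /cutpow cut0// mulr0 mul0r mulr0.
- move=> x x2; rewrite /cutpow [X in _ * _ * X]sqpos0 ?mulr0// subr_le0.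
  have h : 1 <= x - 1 by rewrite lerBrDr.
  by apply: le_trans (sqpos_nd h); rewrite sqposE// expr1n.
Qed.

Lemma cutpow_nd r q k x y : 0 <= r -> 0 <= q -> 0 < x -> x <= y -> y <= 1 ->
  cutpow r q k x <= cutpow r q k y.
Proof.
move=> r0 q0 x0 xy y1; have y0 := lt_le_trans x0 xy.
rewrite !cutpowE// ?(le_trans xy)// ler_pM ?powR_ge0 ?cut_ge0// ?cut_nd//.
by apply: ge0_ler_powR => //; rewrite nnegrE ltW.
Qed.

Lemma cutpow_scale r q k x y : 0 <= q -> 0 < x -> x <= 1 -> 0 < y -> y <= 1 ->
  cutpow r q k (y * x) <= y `^ r * cutpow r q k x.
Proof.
move=> q0 x0 x1 y0 y1; have yx : y * x <= x by rewrite ler_piMl// ltW.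
have yx0 : 0 < y * x by rewrite mulr_gt0.
rewrite !cutpowE// ?(le_trans yx)// powRM ?(ltW y0) ?(ltW x0)// mulrA.
by rewrite ler_wpM2l ?mulr_ge0 ?powR_ge0// cut_nd.
Qed.

(** For [z >= e] the defect is [2 e - e^2 / z], and below [e] it is [z] itself. With [z = x^r] and
    [e = k^r], that is with the cut exponent equal to [r], the increments of the truncated power
    never exceed those of [x^r], uniformly in [k]. *)
Lemma cut_defect_nd (e z z' : R) : 0 < e -> 0 < z -> z <= z' ->
  z - z * sqpos (1 - e / z) <= z' - z' * sqpos (1 - e / z').
Proof.
move=> e0 z0 zz; have z'0 := lt_le_trans z0 zz.
have big u : 0 < u -> e <= u -> u - u * sqpos (1 - e / u) = 2 * e - e * (e / u).
  move=> u0 eu; rewrite sqposE; first by field; rewrite gt_eqF.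
  by rewrite subr_ge0 ler_pdivrMr// mul1r.
have small u : 0 < u -> u <= e -> u - u * sqpos (1 - e / u) = u.
  move=> u0 ue; rewrite sqpos0 ?mulr0 ?subr0//.
  by rewrite subr_le0 ler_pdivlMr// mul1r.
have ev u : 0 < u -> e <= u -> e * (e / u) <= e.
  by move=> u0 eu; rewrite ler_piMr ?(ltW e0)// ler_pdivrMr// mul1r.
have [ze|/ltW ez] := leP z e; have [z'e|/ltW ez'] := leP z' e.
- by rewrite !small.
- by rewrite small// big//; have := ev _ z'0 ez'; lra.
- have E : z = z' by apply/le_anti; rewrite zz (le_trans z'e).
  by rewrite E.
- rewrite !big// lerB// ler_pM2l// ler_pM2l// lef_pV2 ?posrE//.
Qed.

Lemma cutpow_defect r k x y : 0 < k -> 0 < x -> x <= 1 -> 0 < y -> y <= 1 -> 0 <= r ->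
  cutpow r r k x - cutpow r r k (y * x) <= x `^ r - (y * x) `^ r.
Proof.
move=> k0 x0 x1 y0 y1 r0; have yx : y * x <= x by rewrite ler_piMl// ltW.
have yx0 : 0 < y * x by rewrite mulr_gt0.
rewrite !cutpowE// ?(le_trans yx)//.
have := @cut_defect_nd (k `^ r) ((y * x) `^ r) (x `^ r) (powR_gt0 r k0) (powR_gt0 r yx0).
rewrite /cut !powRN => /(_ _); set A := _ * sqpos _; set A' := _ * sqpos _.
move=> h; have : (y * x) `^ r <= x `^ r by apply: ge0_ler_powR => //; rewrite nnegrE ltW.
by move=> /h; lra.
Qed.

Lemma cvg_harmonic_right : n.+1%:R^-1 @[n --> \oo] --> (0 : R)^'+.
Proof.
move=> A A0; have H : \forall n \near \oo, 0 < n.+1%:R^-1 :> R -> A n.+1%:R^-1.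
  exact: (@cvg_harmonic R _ A0).
change (\forall n \near \oo, A n.+1%:R^-1).
by apply: filterS H => n; apply; rewrite invr_gt0.
Qed.

Lemma cutpow_cvg r q x : 0 < q -> 0 < x -> x <= 1 ->
  x * cutpow r q n.+1%:R^-1 x @[n --> \oo] --> x * x `^ r.
Proof.
move=> q0 x0 x1.
have -> : (fun n : nat => x * cutpow r q n.+1%:R^-1 x) =
     (fun n : nat => x * (x `^ r * sqpos (1 - n.+1%:R^-1 `^ q * x `^ (- q)))).
  by apply/funext => n; rewrite cutpowE.
apply: cvgM; first exact: cvg_cst.
rewrite -[X in _ --> X]mulr1; apply: cvgM; first exact: cvg_cst.
rewrite [X in _ --> X](_ : 1 = sqpos (1 - 0 * x `^ (- q))); last first.
  by rewrite mul0r subr0 sqposE ?expr1n.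
apply: continuous_cvg; first exact: sqpos_continuous.
apply: cvgB; first exact: cvg_cst.
apply: cvgM; last exact: cvg_cst.
exact: (cvg_comp _ _ cvg_harmonic_right (powR_cvg0 q0)).
Qed.

End CutPower.

(** * Moments of a solution without differentiability in time *)

Section Forward.
Context {R : realType}.
Local Notation meas := {measure set (measurableTypeR R) -> \bar R}.
Local Notation P := (`]0%R, +oo[%classic : set (measurableTypeR R)).
Local Notation D := (`]0%R, 1%R]%classic : set (measurableTypeR R)).
Implicit Types (r q k s t x y v : R).
Variables (alpha : R) (B mu0 N : meas) (mu : R -> meas).
Hypothesis alpha0 : alpha < 0.
Let a := - alpha.
Hypothesis N01 : (0 < N P < +oo)%E.
Hypothesis NB : forall k : measurableTypeR R -> R, measurable_fun setT k ->
  (\int[B]_(y in `]0%R, 1%R[) (y * k y)%:E = \int[N]_(v in P) (k (expR (- (v / a))) / v)%:E)%E.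
Hypothesis hmu : is_frag_solution alpha B mu0 mu.
Hypothesis mu01 : mu0 `]1, +oo[%classic = 0%E.

Let a0 : 0 < a. Proof. by rewrite oppr_gt0. Qed.
Let mP : measurable P. Proof. exact: measurable_itv. Qed.
Let mD : measurable D. Proof. exact: measurable_itv. Qed.
Let DP : D `<=` P.
Proof. by move=> x /=; rewrite !in_itv/= andbT => /andP[]. Qed.
Let D01 x : D x -> 0 < x /\ x <= 1.
Proof. by rewrite /= in_itv/= => /andP[]. Qed.

(** The support clause concerns closed half-lines that [mu0] does not charge; it applies to [[1 + 1
    / (n + 1), +oo[] and passes to the union. *)
Lemma solution_above1 t : 0 <= t -> mu t `]1, +oo[%classic = 0%E.
Proof.
move=> t0; have [_ _ _ hM] := hmu.
pose E n : set (measurableTypeR R) := `[1 + n.+1%:R^-1, +oo[%classic.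
have E1 n : 1 < 1 + n.+1%:R^-1 :> R by rewrite ltrDl invr_gt0.
have mE n : measurable (E n) by exact: measurable_itv.
have mI : measurable (`]1, +oo[%classic : set (measurableTypeR R)) by exact: measurable_itv.
have UE : \bigcup_n E n = `]1, +oo[%classic :> set R.
  apply/seteqP; split=> x; rewrite /E/=.
    by move=> [n _] /=; rewrite !in_itv/= !andbT; exact: lt_le_trans.
  rewrite in_itv/= andbT -subr_gt0 => x1; have [n _ nx] := near_infty_natSinv_lt (PosNum x1).
  exists n => //=; rewrite in_itv/= andbT -lerBrDl; apply/ltW.
  exact: (nx n (leqnn n)).
have E0 n : mu t (E n) = 0%E.
  have M0 : 0 < 1 + n.+1%:R^-1 :> R by exact: lt_trans (E1 n).
  apply: (hM _ M0 _ _ t0).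
  apply/eqP; rewrite -measure_le0 -mu01 le_measure ?inE// => x /=.
  by rewrite !in_itv/= !andbT; exact: lt_le_trans.
have ndE : nondecreasing_seq E.
  move=> m n mn; apply/subsetPset => x; rewrite /E/= !in_itv/= !andbT; apply: le_trans.
  by rewrite lerD2l lef_pV2 ?posrE// ler_nat.
have := @nondecreasing_cvg_mu _ _ _ (mu t) E mE (bigcup_measurable (fun n _ => mE n)) ndE.
rewrite UE => cv.
have cv0 : (mu t \o E) n @[n --> \oo] --> (0%E : \bar R).
  have -> : mu t \o E = (fun=> 0%E) by apply/funext => n; exact: E0.
  exact: cvg_cst.
exact: (cvg_unique _ cv cv0).
Qed.

Let Rint_le0 (m : meas) (A : set (measurableTypeR R)) (f : R -> R) :
  (forall x, A x -> f x <= 0) -> \int[m]_(x in A) f x <= 0.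
Proof.
move=> f0; rewrite /Rintegral; apply: fine_le0; rewrite integralE.
rewrite [X in (X - _)%E]integral0_eq ?sub0e ?oppe_le0 ?integral_ge0//.
by move=> x /f0 fx; rewrite funeposE; apply/max_idPr; rewrite lee_fin.
Qed.

Let RintN (m : meas) (A : set (measurableTypeR R)) (f : R -> R) : measurable A ->
  m.-integrable A (EFin \o f) -> \int[m]_(x in A) (- f x) = - \int[m]_(x in A) f x.
Proof.
move=> mA fi; rewrite -mulN1r -(RintegralZl (-1) mA fi).
by apply: eq_Rintegral => x _; rewrite mulN1r.
Qed.

Lemma solution_integral_PD t (f : measurableTypeR R -> R) : 0 <= t -> measurable_fun P f ->
  \int[mu t]_(x in P) f x = \int[mu t]_(x in D) f x.
Proof.
move=> t0 mf; rewrite /Rintegral; congr fine.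
have -> : D = P `&` D by apply/esym/setIidr.
rewrite integral_mkcondr; apply: ae_eq_integral.
- exact: mP.
- exact/measurable_EFinP.
- apply/(measurable_restrict _ mD mP); apply/measurable_EFinP; apply: measurable_funS mf => //.
- exists `]1, +oo[%classic; split.
  + exact: measurable_itv.
  + exact: solution_above1.
  + move=> x /= /not_implyP[Px]; rewrite patchE; case: ifPn => // /negP; rewrite inE/= => nD _.
    move: Px nD; rewrite /= !in_itv/= !andbT => -> /negP.
    by rewrite -ltNge.
Qed.

Lemma first_moment_integrable t : 0 <= t -> (mu t).-integrable P (fun x => x%:E).
Proof.
move=> t0; have [_ _ [hm h1] _] := hmu.
apply/integrableP; split.
  by apply/measurable_EFinP; exact: measurable_id.
apply: (@le_lt_trans _ _ 1%E); last exact: ltry.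
rewrite -h1; apply: le_trans (hm _ t0); rewrite le_eqVlt; apply/orP; left; apply/eqP.
by apply: eq_integral => x; rewrite inE/= in_itv/= andbT => x0; rewrite gtr0_norm.
Qed.

Definition fmoment r t : R := \int[mu t]_(x in P) (x * x `^ r).

Let mxr r (A : set (measurableTypeR R)) : measurable A -> measurable_fun A (fun x : R => x * x `^ r).
Proof.
move=> mA; apply: measurable_funM; first exact: measurable_id.
by apply: measurable_funTS; exact: measurable_powR.
Qed.

Let intD t (f : measurableTypeR R -> R) (c : R) : 0 <= t -> measurable_fun D f ->
  (forall x, D x -> `|f x| <= c * x) -> (mu t).-integrable D (EFin \o f).
Proof.
move=> t0 mf fc; have i1 := integrableS mP mD DP (first_moment_integrable t0).
have i2 := integrableZl mD c i1.
apply: (le_integrable mD _ _ i2); first exact/measurable_EFinP.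
move=> x Dx; rewrite /= lee_fin; apply: (le_trans (fc _ Dx)).
exact: ler_norm.
Qed.

Let powD r x : 0 <= r -> D x -> 0 <= x `^ r <= 1.
Proof.
move=> r0 /D01[x0 x1]; rewrite powR_ge0/=.
have := @ge0_ler_powR R r r0 x 1; rewrite !nnegrE powR1; apply => //.
exact: ltW.
Qed.

Lemma fmoment_integrable r t : 0 <= r -> 0 <= t ->
  (mu t).-integrable D (EFin \o (fun x : R => x * x `^ r)).
Proof.
move=> r0 t0; apply: (@intD _ _ 1) => //; first exact: mxr.
move=> x Dx; have [x0 _] := D01 Dx; have /andP[p0 p1] := powD r0 Dx.
by rewrite ger0_norm ?mul1r ?ler_piMr ?mulr_ge0 ?(ltW x0).
Qed.

Lemma fmomentE r t : 0 <= t -> fmoment r t = \int[mu t]_(x in D) (x * x `^ r).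
Proof. by move=> t0; apply: solution_integral_PD => //; exact: mxr. Qed.

Let test r q k t : R := \int[mu t]_(x in P) (x * cutpow r q k x).

Let mtest r q k (A : set (measurableTypeR R)) : measurable A ->
  measurable_fun A (fun x : R => x * cutpow r q k x).
Proof.
move=> mA; apply: measurable_funM; first exact: measurable_id.
by apply: measurable_funTS; exact: measurable_cutpow.
Qed.

Let cutpowD r q k x : 0 <= r -> D x -> 0 <= cutpow r q k x <= x `^ r.
Proof.
move=> r0 Dx; have [x0 x1] := D01 Dx; rewrite cutpowE// mulr_ge0 ?powR_ge0 ?cut_ge0//=.
by rewrite ler_piMr ?powR_ge0// cut_le1.
Qed.

Let itest r q k t : 0 <= r -> 0 <= t ->
  (mu t).-integrable D (EFin \o (fun x : R => x * cutpow r q k x)).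
Proof.
move=> r0 t0; apply: (@intD _ _ 1) => //; first exact: mtest.
move=> x Dx; have [x0 _] := D01 Dx; have /andP[p0 p1] := powD r0 Dx.
have /andP[c0 c1] := cutpowD q k r0 Dx.
rewrite ger0_norm; last exact: mulr_ge0 (ltW x0) c0.
by rewrite mul1r ler_piMr ?(ltW x0)// (le_trans c1).
Qed.

Lemma test_cvg r q t : 0 <= r -> 0 < q -> 0 <= t ->
  test r q n.+1%:R^-1 t @[n --> \oo] --> fmoment r t.
Proof.
move=> r0 q0 t0; rewrite fmomentE//.
have -> : (fun n : nat => test r q n.+1%:R^-1 t) =
    (fun n : nat => \int[mu t]_(x in D) (x * cutpow r q n.+1%:R^-1 x)).
  by apply/funext => n; apply: solution_integral_PD => //; exact: mtest.
have fr := integrable_fin_num mD (fmoment_integrable r0 t0).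
rewrite /Rintegral; apply: fine_cvg; rewrite fineK//.
have h1 n : measurable_fun D (fun x => (x * cutpow r q n.+1%:R^-1 x)%:E).
  by apply/measurable_EFinP; exact: mtest.
have h2 : measurable_fun D (fun x => (x * x `^ r)%:E).
  by apply/measurable_EFinP; exact: mxr.
have h3 : {ae mu t, forall x, D x ->
    (x * cutpow r q n.+1%:R^-1 x)%:E @[n --> \oo] --> (x * x `^ r)%:E}.
  apply/aeW => x Dx; apply: cvg_EFin; first exact: nearW.
  have [x0 x1] := D01 Dx; exact: cutpow_cvg.
have h4 := integrableS mP mD DP (first_moment_integrable t0).
have h5 : {ae mu t, forall x (n : nat), D x -> (`|(x * cutpow r q n.+1%:R^-1 x)%:E| <= x%:E)%E}.
  apply/aeW => x n Dx; have [x0 _] := D01 Dx; have /andP[p0 p1] := powD r0 Dx.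
  have /andP[c0 c1] := cutpowD q n.+1%:R^-1 r0 Dx.
  rewrite /= lee_fin ger0_norm; last exact: mulr_ge0 (ltW x0) c0.
  by rewrite ler_piMr ?(ltW x0)// (le_trans c1).
by have [_ _ H] := dominated_convergence mD h1 h2 h3 h4 h5; exact: H.
Qed.

Let gen r q k x := frag_generator alpha B (fun x => x * cutpow r q k x) x.

Let genE r q k x : gen r q k x =
  x `^ alpha * \int[N]_(v in P) (x * (cutpow r q k (expR (- (v / a)) * x) - cutpow r q k x) / v).
Proof.
rewrite /gen /frag_generator; congr (_ * _); rewrite /Rintegral; congr fine.
rewrite -(NB (k := fun y => x * (cutpow r q k (y * x) - cutpow r q k x))).
  by apply: eq_integral => y _; congr EFin; ring.
apply: measurable_funM; first exact: measurable_cst.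
apply: measurable_funB; last exact: measurable_cst.
apply: (measurableT_comp (measurable_cutpow r q k)).
by apply: measurable_funM; [exact: measurable_id|exact: measurable_cst].
Qed.

Let mgen r q k (A : set (measurableTypeR R)) : measurable A -> measurable_fun A (gen r q k).
Proof.
move=> mA; apply: measurable_funTS.
have -> : gen r q k = fun x => x `^ alpha *
   \int[N]_(v in P) (x * (cutpow r q k (expR (- (v / a)) * x) - cutpow r q k x) / v).
  by apply/funext => x; exact: genE.
apply: measurable_funM; first exact: measurable_powR.
apply: (@measurableT_comp _ _ _ _ _ _ fine _ (fun x => \int[N]_(v in P)
  (x * (cutpow r q k (expR (- (v / a)) * x) - cutpow r q k x) / v)%:E)%E) => //.
have [_ NP] := andP N01.
pose K (z : measurableTypeR R * measurableTypeR R) : \bar R :=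
  ((z.1 * (cutpow r q k (expR (- (z.2 / a)) * z.1) - cutpow r q k z.1)) * (\1_P z.2 / z.2))%:E.
have mK : measurable_fun setT K.
  have mc := measurable_cutpow r q k.
  apply/measurable_EFinP; apply: measurable_funM.
    apply: measurable_funM => //.
    apply: measurable_funB.
      apply: (measurableT_comp mc); apply: measurable_funM => //.
      apply: measurableT_comp => //; apply: measurableT_comp => //.
      by apply: measurable_funM.
    exact: (measurableT_comp mc).
  have mi : measurable_fun setT (fun v : measurableTypeR R => \1_P v / v : R).
    have -> : (fun v : measurableTypeR R => \1_P v / v : R) = (fun v : R => v^-1) \_ P.
      apply/funext => v; rewrite patchE indicE; case: ifPn => _; first by rewrite mul1r.
      by rewrite mul0r.
    by apply/(measurable_restrictT _ mP); exact: measurable_invP.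
  exact: (measurableT_comp mi).
have := measurable_integral_param NP mK; apply: eq_measurable_fun => x _.
apply: eq_integral => v vP; rewrite /K/=; congr EFin.
by rewrite indicE vP mul1r.
Qed.

Let yv v : 0 < v -> 0 < expR (- (v / a)) /\ expR (- (v / a)) <= 1.
Proof. by move=> v0; rewrite expR_gt0 expR_le1 oppr_le0 divr_ge0 ?ltW. Qed.

Let gen_le0 r q k x : 0 <= r -> 0 <= q -> D x -> gen r q k x <= 0.
Proof.
move=> r0 q0 Dx; have [x0 x1] := D01 Dx; rewrite genE mulr_ge0_le0 ?powR_ge0//.
apply: Rint_le0 => v; rewrite /= in_itv/= andbT => v0.
have [y0 y1] := yv v0.
rewrite pmulr_lle0 ?invr_gt0// pmulr_rle0// subr_le0 cutpow_nd// ?mulr_gt0//.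
by rewrite ler_piMl// ltW.
Qed.

(** On an exact power the generator gives [- Psi(r / a) x^(1 + r - a)]. For a truncated power,
    [cutpow_scale] gives the lower bound and [cutpow_defect] the upper one; both become this value
    as [k] tends to 0. *)
Let gen_bounds r k x : 0 < k -> 0 <= r -> D x ->
  Psi N (r / a) * (x * cutpow (r - a) r k x) <= - gen r r k x <=
  Psi N (r / a) * (x * x `^ (r - a)).
Proof.
move=> k0 r0 Dx; have [x0 x1] := D01 Dx.
have ra : 0 <= r / a by rewrite divr_ge0// ltW.
have kernE v : 0 < v -> (1 - expR (- (v / a)) `^ r) / v = kern (r / a) v.
  move=> v0; rewrite /kern /powR gt_eqF ?expR_gt0// expRK; congr ((1 - expR _) / _).
  by field; rewrite gt_eqF.
have b v : P v -> cutpow r r k x * x * kern (r / a) v <=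
    - (x * (cutpow r r k (expR (- (v / a)) * x) - cutpow r r k x) / v) <=
    x `^ r * x * kern (r / a) v.
  rewrite /= in_itv/= andbT => v0; have [y0 y1] := yv v0.
  have h1 := @cutpow_scale R r r k x _ r0 x0 x1 y0 y1.
  have h2 := @cutpow_defect R r k x _ k0 x0 x1 y0 y1 r0.
  move: h2; rewrite powRM ?(ltW x0) ?(ltW y0)// => h2.
  rewrite -kernE//; set Y := expR _ in h1 h2 *; set C := cutpow r r k (Y * x) in h1 h2 *.
  set C0 := cutpow r r k x in h1 h2 *; set Z := Y `^ r in h1 h2 *.
  rewrite -mulNr !mulrA !ler_pM2r ?invr_gt0//; apply/andP; split.
    have : x * (C0 - Z * C0) <= x * (C0 - C) by rewrite ler_pM2l// lerB.
    by move=> h; apply: le_trans (le_trans h _); rewrite le_eqVlt; apply/orP; left; apply/eqP; ring.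
  have : x * (C0 - C) <= x * (x `^ r - Z * x `^ r) by rewrite ler_pM2l.
  by move=> h; apply: le_trans (le_trans _ h) _; rewrite le_eqVlt; apply/orP; left; apply/eqP; ring.
have ik := kern_integrable N01 ra.
have x0' : x != 0 by rewrite gt_eqF.
have pE : x `^ (r - a) = x `^ r * x `^ alpha.
  by rewrite /a opprK powRD ?x0' ?implybT.
have xr1 : x `^ alpha * (x `^ r * x) = x * x `^ (r - a).
  by rewrite pE; ring.
have cr1 : x `^ alpha * (cutpow r r k x * x) = x * cutpow (r - a) r k x.
  by rewrite !cutpowE// pE; ring.
have mX : measurable_fun P (fun v => x * (cutpow r r k (expR (- (v / a)) * x) - cutpow r r k x) / v).
  apply: measurable_funM; last exact: measurable_invP.
  apply: measurable_funM; first exact: measurable_cst.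
  apply: measurable_funB; last exact: measurable_cst.
  apply: (measurableT_comp (measurable_cutpow r r k)); apply: measurable_funM; last exact: measurable_cst.
  apply: measurableT_comp => //; apply: measurableT_comp => //.
  by apply: measurable_funM.
have c0 : 0 <= cutpow r r k x * x.
  by have /andP[h _] := cutpowD r k r0 Dx; rewrite mulr_ge0// ltW.
have iX : N.-integrable P (EFin \o (fun v =>
    x * (cutpow r r k (expR (- (v / a)) * x) - cutpow r r k x) / v)).
  apply: (le_integrable mP _ _ (integrableZl mP (x `^ r * x) ik)); first exact/measurable_EFinP.
  move=> v Pv; have /andP[h1 h2] := b v Pv; rewrite /= lee_fin.
  have v0 : 0 < v by move: Pv; rewrite /= in_itv/= andbT.
  apply: le_trans (ler_norm _); rewrite -normrN ger0_norm//.
  by apply: le_trans h1; rewrite mulr_ge0// kern_ge0.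
have iXN := integrableN iX.
have G (u p c y : R) : p * (u * (c * y)) = u * (c * (y * p)) by ring.
have L1 : Psi N (r / a) * (x * cutpow (r - a) r k x) =
    x `^ alpha * (cutpow r r k x * (x * Psi N (r / a))) by rewrite -cr1; exact: G.
have L2 : Psi N (r / a) * (x * x `^ (r - a)) = x `^ alpha * (x `^ r * (x * Psi N (r / a))).
  by rewrite -xr1; exact: G.
rewrite L1 L2 genE -mulrN.
rewrite -(RintN mP iX).
have ZE c : c * (x * Psi N (r / a)) = \int[N]_(v in P) (c * x * kern (r / a) v).
  by rewrite mulrA /Psi (RintegralZl _ mP ik).
rewrite !ZE; apply/andP; split; apply: ler_wpM2l; rewrite ?powR_ge0//; apply: le_Rintegral => //.
- exact: (integrableZl mP _ ik).
- by move=> v /b /andP[].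
- exact: (integrableZl mP _ ik).
- by move=> v /b /andP[].
Qed.

Let test_MVT r q k s t : 0 <= q -> 0 < k -> 0 <= s -> s < t ->
  exists2 c, s < c < t & test r q k t - test r q k s =
    (\int[mu c]_(x in D) gen r q k x) * (t - s).
Proof.
move=> q0 k0 s0 st; have [_ hf _ _] := hmu.
have := time_MVT (hf _ (cutpow_C1 r q0 k0)) s0 st.
move=> [c /andP[sc ct] E]; exists c; first by rewrite sc ct.
rewrite /test E -solution_integral_PD ?(le_trans s0 (ltW sc))//; exact: mgen.
Qed.

Let test_ni r q k s t : 0 <= r -> 0 <= q -> 0 < k -> 0 <= s -> s <= t ->
  test r q k t <= test r q k s.
Proof.
move=> r0 q0 k0 s0; rewrite le_eqVlt => /predU1P[->//|st].
have [c _ E] := test_MVT r q0 k0 s0 st.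
rewrite -subr_le0 E mulr_le0_ge0 ?subr_ge0 ?(ltW st)//.
by apply: Rint_le0 => x Dx; exact: gen_le0.
Qed.

(** The mean value theorem yields an unknown intermediate time; since the truncated moments decrease
    in time, it may be replaced by [t] below and by [s] above. No continuity in time of the
    integrated generator is involved. *)
Let test_sandwich r k s t : a <= r -> 0 < k -> 0 <= s -> s <= t ->
  (t - s) * (Psi N (r / a) * test (r - a) r k t) <= test r r k s - test r r k t <=
  (t - s) * (Psi N (r / a) * fmoment (r - a) s).
Proof.
move=> ar k0 s0; rewrite le_eqVlt => /predU1P[->|st].
  by rewrite !subrr !mul0r lexx.
have r0 : 0 <= r by rewrite (le_trans (ltW a0)).
have rp : 0 < r by rewrite (lt_le_trans a0).
have ra0 : 0 <= r - a by rewrite subr_ge0.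
have [c /andP[sc ct] E] := test_MVT r r0 k0 s0 st.
have c0 : 0 <= c by rewrite (le_trans s0)// ltW.
have P0 : 0 <= Psi N (r / a) by rewrite Psi_ge0// divr_ge0// ltW.
have igen : (mu c).-integrable D (EFin \o gen r r k).
  apply: (@intD _ _ (Psi N (r / a))) => //; first exact: mgen.
  move=> x Dx; have /andP[h1 h2] := gen_bounds k0 r0 Dx.
  have [x0 x1] := D01 Dx; have /andP[p0 p1] := powD ra0 Dx.
  rewrite -normrN ger0_norm ?oppr_ge0 ?gen_le0//; apply: (le_trans h2).
  by rewrite ler_wpM2l// ler_piMr// ltW.
have igN := integrableN igen.
have EN : test r r k s - test r r k t = (t - s) * \int[mu c]_(x in D) (- gen r r k x).
  by rewrite (RintN mD igen) -opprB E mulrN mulrC.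
have ts0 : 0 < t - s by rewrite subr_gt0.
rewrite EN !ler_pM2l//; apply/andP; split.
  apply: (@le_trans _ _ (Psi N (r / a) * test (r - a) r k c)).
    by rewrite ler_wpM2l// test_ni// ltW.
  have it := itest r k ra0 c0.
  rewrite {1}/test solution_integral_PD//; last exact: mtest.
  rewrite -(RintegralZl _ mD it); apply: le_Rintegral => //.
  - exact: (integrableZl mD _ it).
  - by move=> x Dx; have /andP[] := gen_bounds k0 r0 Dx.
apply: (@le_trans _ _ (Psi N (r / a) * fmoment (r - a) c)).
  have im := fmoment_integrable ra0 c0.
  rewrite fmomentE// -(RintegralZl _ mD im); apply: le_Rintegral => //.
  - exact: (integrableZl mD _ im).
  - by move=> x Dx; have /andP[] := gen_bounds k0 r0 Dx.
rewrite ler_wpM2l//; apply: (cvg_le_near (test_cvg ra0 rp c0) (test_cvg ra0 rp s0)).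
by apply: nearW => n; apply: test_ni => //; exact: ltW.
Qed.

(** Limit of [test_sandwich] as [k] tends to 0. The condition [a <= r] keeps the order [r - a]
    nonnegative; in the extreme case [r = a] the mass appears on the right, and this is how the
    equation sees it. *)
Lemma fmoment_sandwich r s t : a <= r -> 0 <= s -> s <= t ->
  (t - s) * (Psi N (r / a) * fmoment (r - a) t) <= fmoment r s - fmoment r t <=
  (t - s) * (Psi N (r / a) * fmoment (r - a) s).
Proof.
move=> ar s0 st; have t0 := le_trans s0 st.
have rp : 0 < r by rewrite (lt_le_trans a0).
have ra0 : 0 <= r - a by rewrite subr_ge0.
have k0 n : 0 < n.+1%:R^-1 :> R by rewrite invr_gt0.
have c1 : test r r n.+1%:R^-1 s - test r r n.+1%:R^-1 t @[n --> \oo] --> fmoment r s - fmoment r t.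
  by apply: cvgB; exact: test_cvg (ltW rp) rp _.
have c2 : (t - s) * (Psi N (r / a) * test (r - a) r n.+1%:R^-1 t) @[n --> \oo] -->
    (t - s) * (Psi N (r / a) * fmoment (r - a) t).
  apply: cvgM; first exact: cvg_cst.
  by apply: cvgM; [exact: cvg_cst|exact: test_cvg].
apply/andP; split.
  apply: (cvg_le_near c2 c1); apply: nearW => n.
  by have /andP[] := test_sandwich ar (k0 n) s0 st.
apply: (cvg_le_near c1 (cvg_cst _)); apply: nearW => n.
by have /andP[] := test_sandwich ar (k0 n) s0 st.
Qed.

End Forward.

(** * The mass as a mixture of survival functions *)

Section ItvIntegralBounds.
Context {R : realType}.
Local Notation meas := {measure set (measurableTypeR R) -> \bar R}.
Local Notation leb := (@lebesgue_measure R).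
Local Notation P := (`]0%R, +oo[%classic : set (measurableTypeR R)).

Lemma itv_integral_bounds (f : R -> R) (s u lo hi : R) : s < u -> 0 <= lo ->
  measurable_fun (`]s, u] : set (measurableTypeR R)) (EFin \o f) ->
  (forall x, s < x -> x <= u -> lo <= f x <= hi) ->
  ((lo * (u - s))%:E <= \int[leb]_(x in `]s, u]) (f x)%:E <= (hi * (u - s))%:E)%E.
Proof.
move=> su lo0 mf b; pose A : set (measurableTypeR R) := `]s, u]%classic.
have mA : measurable A by exact: measurable_itv.
have lA : leb A = (u - s)%:E by rewrite /A lebesgue_measure_itv/= lte_fin su EFinB.
have bA x : A x -> lo <= f x <= hi by rewrite /A/= in_itv/= => /andP[? ?]; exact: b.
have cE (w : R) : (\int[leb]_(x in A) w%:E = (w * (u - s))%:E)%E.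
  by rewrite (@integral_cst _ (measurableTypeR R) R leb A mA w%:E) EFinM; congr (_ * _)%E; exact: lA.
rewrite -!cE; apply/andP; split; apply: ge0_le_integral.
- exact: mA.
- by move=> x _; rewrite lee_fin.
- exact: measurable_cst.
- exact: mf.
- by move=> x /bA /andP[]; rewrite lee_fin.
- exact: mA.
- by move=> x /bA /andP[h _]; rewrite lee_fin (le_trans lo0).
- exact: mf.
- exact: measurable_cst.
- by move=> x /bA /andP[_]; rewrite lee_fin.
Qed.

(** Turns a density with known moments into a measure, the form in which [moment_unique] applies. *)
Lemma density_measure (w : R -> R) (c : nat -> R) :
  measurable_fun P w -> (forall t, P t -> 0 <= w t) ->
  (forall n, (\int[leb]_(t in P) (t ^+ n * w t)%:E = (c n)%:E)%E) ->
  exists nu : meas, [/\ has_moments nu, forall n, moment nu n = c n &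
    forall A, measurable A -> A `<=` P -> nu A = (\int[leb]_(t in A) (w t)%:E)%E].
Proof.
move=> mw w0 wM; have mP : measurable P by exact: measurable_itv.
have P0 z : P z -> 0 < z by rewrite /= in_itv/= andbT.
have [nu [nuA nuf]] := @weighted_image_integral _ _ (measurableTypeR R) (measurableTypeR R) R
  leb P w id mP mw w0 (@measurable_id _ _ _).
have pre (A : set (measurableTypeR R)) : A `<=` P -> P `&` id @^-1` A = A.
  by move=> AP; apply/seteqP; split=> x; [case|move=> Ax; split => //; exact: AP].
have mx n : measurable_fun P (fun z : measurableTypeR R => (z ^+ n)%:E).
  apply/measurable_EFinP; apply: measurable_funTS; apply: continuous_measurable_fun.
  exact: exprn_continuous.
have I n : (\int[nu]_(z in P) (z ^+ n)%:E = (c n)%:E)%E.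
  by rewrite nuf// pre// -wM; apply: eq_integral => t _; rewrite EFinM.
exists nu; split.
- move=> n; apply/integrableP; split; first exact: mx.
  apply: (@le_lt_trans _ _ (c n)%:E); last exact: ltry.
  rewrite -I le_eqVlt; apply/orP; left; apply/eqP.
  by apply: eq_integral => t; rewrite inE => /P0 /ltW t0; rewrite /= ger0_norm// exprn_ge0.
- by move=> n; rewrite /moment /Rintegral I.
- by move=> A mA AP; rewrite nuA// pre.
Qed.

End ItvIntegralBounds.

Section MassRepresentation.
Context {R : realType}.
Local Notation meas := {measure set (measurableTypeR R) -> \bar R}.
Local Notation leb := (@lebesgue_measure R).
Local Notation P := (`]0%R, +oo[%classic : set (measurableTypeR R)).
Local Notation D := (`]0%R, 1%R]%classic : set (measurableTypeR R)).
Implicit Types (s t x y z v : R) (n k : nat).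
Variables (N rho : meas) (h : R -> R) (x0 : R) (M : nat -> R -> R).
Hypothesis N01 : (0 < N P < +oo)%E.
Hypotheses (hnd : nd_ge0 h) (hE : forall x, h x = hazard_op N h x).
Hypotheses (x00 : 0 < x0) (hx0 : 0 < h x0).

Definition Psi_prod n : R := \prod_(1 <= i < n.+1) Psi N i%:R.

Lemma Psi_prodS n : Psi_prod n.+1 = Psi_prod n * Psi N n.+1%:R.
Proof. by rewrite /Psi_prod big_nat_recr. Qed.

Lemma Psi_prod0 : Psi_prod 0 = 1. Proof. by rewrite /Psi_prod big_nil. Qed.

Lemma Psi_prod_gt0 n : 0 < Psi_prod n.
Proof.
elim: n => [|n IH]; first by rewrite Psi_prod0.
by rewrite Psi_prodS mulr_gt0// Psi_gt0.
Qed.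

Let mP : measurable P. Proof. exact: measurable_itv. Qed.
Let mD : measurable D. Proof. exact: measurable_itv. Qed.
Let DP : D `<=` P. Proof. by move=> x /=; rewrite !in_itv/= andbT => /andP[]. Qed.
Let D01 z : D z -> 0 < z /\ z <= 1. Proof. by rewrite /= in_itv/= => /andP[]. Qed.
Let P0 z : P z -> 0 < z. Proof. by rewrite /= in_itv/= andbT. Qed.
Let hcont := hazard_continuous N01 hnd hE.

(** The moments of the density [h surv] are evaluated twice: by parts and by the fixed-point
    equation. Comparing gives [(n + 1) survM n = Psi(n + 2) survM (n + 1)]. *)
Lemma survM_eq n : survM h n = (n`!%:R / Psi_prod n.+1)%:E.
Proof.
have M0 k : (0 <= survM h k)%E.
  apply: integral_ge0 => t /P0 t0.
  by rewrite lee_fin mulr_ge0 ?surv_ge0// exprn_ge0// ltW.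
have MF k : survM h k = (fine (survM h k))%:E.
  by rewrite fineK// ge0_fin_numE//; exact: (survM_lty hnd hcont x00 hx0).
have solve (p q : R) k : 0 < p -> q%:E = (p%:E * survM h k)%E -> survM h k = (q / p)%:E.
  move=> p0; rewrite MF -EFinM => -[->]; congr EFin.
  by rewrite mulrAC mulfV ?gt_eqF// mul1r.
have rec k := survM_rec N01 hnd hE x00 hx0 k.
elim: n => [|n IH].
  rewrite Psi_prodS Psi_prod0 mul1r fact0; apply: solve; first exact: Psi_gt0.
  rewrite -rec -[LHS](surv_integral_hazard hnd hcont x00 hx0).
  by apply: eq_integral => t _; rewrite expr0 mul1r.
have H : (n.+1%:R * (n`!%:R / Psi_prod n.+1))%:E = ((Psi N n.+2%:R)%:E * survM h n.+1)%E.
  by rewrite -rec (surv_moment_hazard hnd hcont x00 hx0) IH EFinM.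
rewrite (solve _ _ _ (Psi_gt0 N01 (ltr0Sn R n.+1)) H); congr EFin.
by rewrite [in RHS]Psi_prodS factS natrM invfM !mulrA.
Qed.

(** Rescaling time by [z] extracts [z^(n+1)] from the inner integral. The lemma serves twice: for
    the initial mass distribution on []0, 1]] and for the limit law on []0, +oo[]. *)
Lemma moments_surv_mixture n (nu : meas) (E : set (measurableTypeR R)) :
  measurable E -> E `<=` P -> (nu P < +oo)%E ->
  (\int[leb]_(t in P) ((t ^+ n)%:E * \int[nu]_(z in E) (surv h (t / z))%:E) =
   (n`!%:R / Psi_prod n.+1)%:E * \int[nu]_(z in E) (z ^+ n.+1)%:E)%E.
Proof.
move=> mE EP nuP.
have mST := measurable_surv hnd (@measurableT _ (measurableTypeR R)).
pose k (w : measurableTypeR R * measurableTypeR R) : \bar R :=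
  (\1_E w.2 * (w.1 ^+ n * surv h (w.1 / w.2)))%:E.
have k0 w : (P `*` P) w -> (0 <= k w)%E.
  by move=> [/= /P0 /ltW w1 _]; rewrite lee_fin mulr_ge0// mulr_ge0 ?exprn_ge0 ?surv_ge0.
have mk : measurable_fun (P `*` P) k.
  apply/measurable_EFinP; apply: measurable_funM.
    apply: measurable_funTS; apply: (measurableT_comp (measurable_indic mE)) => //.
  apply: measurable_funM.
    by apply: measurable_funTS; apply: (@measurableT_comp _ _ _ _ _ _ (fun x : R => x ^+ n)).
  apply: (measurableT_comp mST); apply: measurable_funM; first by apply: measurable_funTS.
  apply: (@measurable_comp _ _ _ _ _ _ P (fun v : R => v^-1)) => //.
  - by move=> _ [[u v] [/= _ ?] <-].
  - exact: measurable_invP.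
  - by apply: measurable_funTS.
have restr (f : R -> R) : (\int[nu]_(z in P) (\1_E z * f z)%:E = \int[nu]_(z in E) (f z)%:E)%E.
  rewrite -[in RHS](setIidr EP) integral_mkcondr; apply: eq_integral => z _.
  by rewrite patchE indicE; case: ifPn => zD; rewrite ?mul1r ?mul0r.
transitivity (\int[leb]_(t in P) \int[nu]_(z in P) k (t, z))%E.
  apply: eq_integral => t; rewrite inE => /P0 t0.
  rewrite /k/= restr -ge0_integralZl; [|exact: mE| | |by rewrite lee_fin exprn_ge0// ltW].
  - by apply: eq_integral => z _; rewrite EFinM.
  - apply/measurable_EFinP; apply: (measurableT_comp mST).
    apply: measurable_funM; first exact: measurable_cst.
    exact: (measurable_funS mP EP (@measurable_invP R)).
  - by move=> z _; rewrite lee_fin surv_ge0.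
rewrite (tonelli_on nuP mk k0) /k/=; clear k k0 mk.
have inner z : P z -> (\int[leb]_(t in P) (\1_E z * (t ^+ n * surv h (t / z)))%:E =
    (\1_E z * (z ^+ n.+1 * (n`!%:R / Psi_prod n.+1)))%:E)%E.
  move=> /P0 z0.
  have mS : measurable_fun P (fun t => (t ^+ n * surv h (t / z))%:E).
    apply/measurable_EFinP; apply: measurable_funM.
      by apply: measurable_funTS; apply: continuous_measurable_fun; exact: exprn_continuous.
    apply: (measurableT_comp mST).
    by apply: measurable_funM; [exact: measurable_id|exact: measurable_cst].
  transitivity ((\1_E z)%:E * \int[leb]_(t in P) (t ^+ n * surv h (t / z))%:E)%E.
    rewrite -ge0_integralZl; [|exact: mP|exact: mS| |by rewrite lee_fin].
      by apply: eq_integral => t _; rewrite EFinM.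
    by move=> t /P0 /ltW t0; rewrite lee_fin mulr_ge0 ?exprn_ge0 ?surv_ge0.
  rewrite EFinM; congr (_ * _)%E; rewrite (lebesgue_scaleP z0 mS) EFinM -survM_eq /survM.
  have zE t (w : R) : (z * t) ^+ n * w * z = z ^+ n.+1 * (t ^+ n * w).
    by rewrite exprMn exprS; ring.
  rewrite -ge0_integralZl; [|exact: mP| | |by rewrite lee_fin exprn_ge0// ltW].
  - apply: eq_integral => t _; rewrite -!EFinM; congr EFin.
    have -> : z * t / z = t by rewrite mulrAC mulfV ?gt_eqF// mul1r.
    exact: zE.
  - apply/measurable_EFinP; apply: measurable_funM; last exact: measurable_surv.
    by apply: measurable_funTS; apply: continuous_measurable_fun; exact: exprn_continuous.
  - by move=> t /P0 /ltW t0; rewrite lee_fin mulr_ge0 ?exprn_ge0 ?surv_ge0.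
have p0 := Psi_prod_gt0 n.+1.
transitivity (\int[nu]_(z in P) (\1_E z * (z ^+ n.+1 * (n`!%:R / Psi_prod n.+1)))%:E)%E.
  by apply: eq_integral => z; rewrite inE; exact: inner.
rewrite restr -ge0_integralZl; [|exact: mE| | |by rewrite lee_fin divr_ge0// ltW].
- by apply: eq_integral => z _; rewrite -EFinM mulrC.
- apply/measurable_EFinP; apply: measurable_funTS; apply: continuous_measurable_fun.
  exact: exprn_continuous.
- by move=> z /EP /P0 /ltW z0; rewrite lee_fin exprn_ge0.
Qed.

Hypotheses (rhoP : (rho P < +oo)%E) (rhoD : rho D = 1%E).
Hypothesis M_ge0 : forall n t, 0 <= t -> 0 <= M n t.
Hypothesis M_sandwich : forall n s t, 0 <= s -> s <= t ->
  (t - s) * (Psi N n.+1%:R * M n t) <= M n.+1 s - M n.+1 t <=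
  (t - s) * (Psi N n.+1%:R * M n s).
Hypothesis M_init : forall n, (\int[rho]_(z in D) (z ^+ n)%:E = (M n 0)%:E)%E.

Definition norm_moment n t : R := M n t / Psi_prod n.

Local Notation G := norm_moment.

Lemma norm_moment_ge0 n t : 0 <= t -> 0 <= G n t.
Proof. by move=> t0; rewrite divr_ge0 ?M_ge0// ltW// Psi_prod_gt0. Qed.

Lemma norm_moment_sandwich n s t : 0 <= s -> s <= t ->
  (t - s) * G n t <= G n.+1 s - G n.+1 t <= (t - s) * G n s.
Proof.
move=> s0 st; have /andP[h1 h2] := M_sandwich n s0 st.
have p0 := Psi_prod_gt0 n; have q0 := Psi_gt0 N01 (ltr0Sn R n).
rewrite /norm_moment Psi_prodS -mulrBl; apply/andP; split.
  rewrite ler_pdivlMr ?mulr_gt0//; apply: le_trans h1.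
  by rewrite le_eqVlt; apply/orP; left; apply/eqP; field; rewrite gt_eqF.
rewrite ler_pdivrMr ?mulr_gt0//; apply: (le_trans h2).
by rewrite le_eqVlt; apply/orP; left; apply/eqP; field; rewrite gt_eqF.
Qed.

(** The sandwich one level up gives [t G_(n+1)(t) <= G_(n+2)(0)]. *)
Lemma norm_moment_cvg0 n : G n.+1 t @[t --> +oo] --> 0.
Proof.
have g0 := norm_moment_ge0 n.+2 (lexx 0).
apply/cvgrPdist_le => e e0; near=> t.
have t0 : 0 < t by near: t; apply: nbhs_pinfty_gt; exact: num_real.
have te : G n.+2 0 / e <= t by near: t; apply: nbhs_pinfty_ge; exact: num_real.
rewrite sub0r normrN ger0_norm ?norm_moment_ge0 ?(ltW t0)//.
have /andP[h1 _] := norm_moment_sandwich n.+1 (lexx 0) (ltW t0).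
rewrite subr0 in h1; rewrite -(ler_pM2l t0); apply: (le_trans h1).
rewrite ler_pdivrMr// in te; apply: le_trans te.
by rewrite gerBl norm_moment_ge0// ltW.
Unshelve. all: by end_near. Qed.

Lemma norm_moment_tail n t : 0 <= t ->
  ((G n.+1 t)%:E = \int[leb]_(s in `[t, +oo[) (G n s)%:E)%E.
Proof.
move=> t0; rewrite (sandwich_tail (norm_moment_sandwich n))//.
  by move=> s; exact: norm_moment_ge0.
exact: norm_moment_cvg0.
Qed.

Lemma measurable_norm_moment n : measurable_fun P (G n).
Proof.
apply: (sandwich_measurable (norm_moment_sandwich n)) => //.
by move=> x /P0 /ltW.
Qed.

Lemma moments_norm_moment n k :
  (\int[leb]_(t in P) (t ^+ n * G k t)%:E = (n`!%:R * G (k + n).+1 0)%:E)%E.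
Proof.
have mG j : measurable_fun P (fun t => (G j t)%:E).
  by apply/measurable_EFinP; exact: measurable_norm_moment.
have G0 j t : P t -> (0 <= (G j t)%:E)%E.
  by move=> /P0 t0; rewrite lee_fin norm_moment_ge0// ltW.
elim: n k => [|n IH] k.
  rewrite fact0 mul1r addn0 norm_moment_tail// -integral_itv_obnd_cbnd; last exact: mG.
  by apply: eq_integral => t _; rewrite expr0 mul1r.
transitivity (\int[leb]_(t in P) ((t ^+ n.+1)%:E * (G k t)%:E))%E.
  by apply: eq_integral => t _; rewrite EFinM.
rewrite (tail_moment n (mG k) (G0 k)).
transitivity (n.+1%:R%:E * \int[leb]_(t in P) (t ^+ n * G k.+1 t)%:E)%E.
  rewrite -ge0_integralZl//.
  - apply: eq_integral => s; rewrite inE => /P0 s0.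
    transitivity ((n.+1%:R * s ^+ n)%:E * (G k.+1 s)%:E)%E.
      by congr (_ * _)%E; rewrite (norm_moment_tail k (ltW s0)).
    by rewrite -!EFinM -mulrA.
  - apply/measurable_EFinP; apply: measurable_funM; last exact: measurable_norm_moment.
    by apply: measurable_funTS; apply: continuous_measurable_fun; exact: exprn_continuous.
  - by move=> t /P0 /ltW t0; rewrite lee_fin mulr_ge0 ?exprn_ge0 ?norm_moment_ge0.
by rewrite IH -EFinM factS natrM mulrA addSnnS.
Qed.

Definition mix_surv t : R := \int[rho]_(z in D) surv h (t / z).

Lemma mix_surv_integrable t : rho.-integrable D (EFin \o (fun z => surv h (t / z))).
Proof.
apply: (@integrable_bounded R _ (measurableTypeR R) rho D _ 1).
- exact: mD.
- by rewrite rhoD ltry.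
- apply: (measurableT_comp (measurable_surv hnd (@measurableT _ (measurableTypeR R)))).
  apply: measurable_funM; first exact: measurable_cst.
  exact: (measurable_funS mP DP (@measurable_invP R)).
- by move=> z _; rewrite ger0_norm ?surv_ge0// surv_le1.
Qed.

Lemma mix_surv_gt0 t : 0 < mix_surv t.
Proof.
have le1 z : D z -> surv h (t / z) <= 1 by move=> _; exact: surv_le1.
rewrite lt_neqAle Rintegral_ge0 ?andbT; last by move=> z _; exact: surv_ge0.
apply/eqP => /esym I0.
have i := mix_surv_integrable t.
have : (\int[rho]_(z in D) `|(surv h (t / z))%:E| = 0)%E.
  transitivity (\int[rho]_(z in D) (surv h (t / z))%:E)%E.
    by apply: eq_integral => z _; rewrite /= ger0_norm// surv_ge0.
  by rewrite -(fineK (integrable_fin_num mD i)); congr EFin.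
have mk : measurable_fun D (EFin \o (fun z => surv h (t / z))) by case/integrableP: i.
move/(ae_eq_integral_abs rho mD mk) => [A [mA A0 DA]].
have DAs : D `<=` A.
  move=> z Dz; apply: DA => /(_ Dz) /eqP; rewrite eqe => /eqP k0.
  by have := surv_gt0 h (t / z); rewrite k0 ltxx.
have : (rho D <= 0)%E by rewrite -A0 le_measure// inE.
by rewrite rhoD lee_fin ler10.
Qed.

Lemma mix_surv_ni s t : s <= t -> mix_surv t <= mix_surv s.
Proof.
move=> st; apply: le_Rintegral.
- exact: mD.
- exact: mix_surv_integrable.
- exact: mix_surv_integrable.
move=> z /D01[z0 _]; apply: surv_ni; first exact: hnd.
by rewrite ler_pM2r ?invr_gt0.
Qed.

Lemma measurable_mix_surv (A : set (measurableTypeR R)) : measurable A -> measurable_fun A mix_surv.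
Proof.
move=> mA; apply: nonincreasing_measurable; first exact: mA.
by move=> x y; exact: mix_surv_ni.
Qed.

Lemma mix_surv_continuous t : 0 < t -> {for t, continuous mix_surv}.
Proof.
move=> t0; apply: (@continuity_under_integral R _ _ rho (fun t z => surv h (t / z)) D mD 0 (2 * t)
  _ _ (fun=> 1)).
- by move=> y _; exact: mix_surv_integrable.
- apply/aeW => z Dz y _.
  apply: (@cvg_comp _ _ _ (fun y : R => y / z) (surv h) _ (nbhs (y / z))).
    by apply: cvgM; [exact: cvg_id|exact: cvg_cst].
  apply: continuous_cvg; first exact: continuous_expR.
  by apply: cvgN; exact: continuous_cumh.
- apply: (@integrable_bounded R _ (measurableTypeR R) rho D _ 1) => //.
  + by rewrite rhoD ltry.
  + by move=> x _; rewrite normr1.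
- by move=> y _; apply/aeW => z _; rewrite ger0_norm ?surv_ge0// surv_le1.
- by rewrite inE/= in_itv/= t0/= mulr2n mulrDl mul1r ltrDl.
Qed.

Lemma moments_mix_surv n :
  (\int[leb]_(t in P) (t ^+ n * mix_surv t)%:E = (n`!%:R * G n.+1 0)%:E)%E.
Proof.
transitivity (\int[leb]_(t in P) ((t ^+ n)%:E * \int[rho]_(z in D) (surv h (t / z))%:E))%E.
  apply: eq_integral => t _; have i := mix_surv_integrable t.
  by rewrite EFinM /mix_surv /Rintegral fineK//; exact: (integrable_fin_num mD i).
rewrite (moments_surv_mixture n mD DP rhoP) M_init -EFinM; congr EFin.
by rewrite /norm_moment; ring.
Qed.

(** The numerators are at most 1 since [z <= 1], and the product in the denominator is at least
    [Psi(1)^(n+1)]. This is the growth bound for determinacy. *)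
Lemma norm_moment0_le n : G n.+1 0 <= (Psi N 1)^-1 * (Psi N 1)^-1 ^+ n.
Proof.
have P1 := Psi_gt0 N01 ltr01.
have M1 : M n.+1 0 <= 1.
  rewrite -lee_fin -M_init -rhoD -[rho D]mul1e -integral_cst//.
  apply: ge0_le_integral => //.
  - by move=> z /D01[/ltW z0 _]; rewrite lee_fin exprn_ge0.
  - apply/measurable_EFinP; apply: measurable_funTS; apply: continuous_measurable_fun.
    exact: exprn_continuous.
  - by move=> z /D01[/ltW z0 z1]; rewrite lee_fin exprn_ile1.
have Pn : Psi N 1 ^+ n.+1 <= Psi_prod n.+1.
  elim: n {M1} => [|n IH]; first by rewrite Psi_prodS Psi_prod0 mul1r expr1.
  rewrite exprSr [leRHS]Psi_prodS; apply: ler_pM; [|exact: ltW|exact: IH|].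
    by rewrite exprn_ge0// ltW.
  by apply: (Psi_nd N01 ler01); rewrite ler1n.
rewrite -exprS exprVn /norm_moment; apply: (@le_trans _ _ (Psi_prod n.+1)^-1).
  by rewrite ler_piMl// invr_ge0 ltW// Psi_prod_gt0.
by rewrite lef_pV2 ?posrE ?exprn_gt0 ?Psi_prod_gt0.
Qed.

Lemma mass_integral_eq (A : set (measurableTypeR R)) : measurable A -> A `<=` P ->
  (\int[leb]_(t in A) (G 0%N t)%:E = \int[leb]_(t in A) (mix_surv t)%:E)%E.
Proof.
move=> mA AP.
have mm : measurable_fun P mix_surv by exact: measurable_mix_surv.
have [nu [n1 n2 n3]] := density_measure (measurable_norm_moment 0)
  (fun t Pt => norm_moment_ge0 0 (ltW (P0 Pt))) (fun n => moments_norm_moment n 0).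
have [nu' [n1' n2' n3']] := density_measure mm (fun t _ => ltW (mix_surv_gt0 t)) moments_mix_surv.
have P1 := Psi_gt0 N01 ltr01.
rewrite -n3// -n3'// -(setIidl AP).
apply: (@moment_unique R nu nu' (Psi N 1)^-1 (Psi N 1)^-1) => //.
- by rewrite invr_ge0 ltW.
- by rewrite invr_gt0.
- by move=> n; rewrite n2 mulrC ler_wpM2r// norm_moment0_le.
- by move=> n; rewrite n2 n2'.
Qed.

(** Equality of the integrals over every interval becomes pointwise: both functions are
    nonincreasing and [mix_surv] is continuous, so values of [G 0] are squeezed between one-sided
    limits of [mix_surv]. *)
Lemma mass_eq t : 0 < t -> G 0%N t = mix_surv t.
Proof.
move=> t0; have c := mix_surv_continuous t0.
have mm (A : set (measurableTypeR R)) : measurable A -> measurable_fun A (EFin \o mix_surv).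
  by move=> mA; apply/measurable_EFinP; exact: measurable_mix_surv.
have key s u : 0 < s -> s < u -> G 0%N u <= mix_surv s /\ mix_surv u <= G 0%N s.
  move=> s0 su; pose A : set (measurableTypeR R) := `]s, u]%classic.
  have mA : measurable A by exact: measurable_itv.
  have AP : A `<=` P by move=> x; rewrite /A/= !in_itv/= andbT => /andP[+ _]; exact: lt_trans.
  have us0 : 0 < u - s by rewrite subr_gt0.
  have E := mass_integral_eq mA AP.
  have mGA : measurable_fun A (EFin \o G 0%N).
    by apply/measurable_EFinP; exact: (measurable_funS mP AP (measurable_norm_moment 0)).
  have Gni := sandwich_ni (norm_moment_sandwich 0).
  have u0 := lt_trans s0 su.
  have bG x : s < x -> x <= u -> G 0%N u <= G 0%N x <= G 0%N s.
    move=> sx xu; rewrite (Gni x u (ltW (lt_trans s0 sx)) xu).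
    by rewrite (Gni s x (ltW s0) (ltW sx)).
  have bm x : s < x -> x <= u -> mix_surv u <= mix_surv x <= mix_surv s.
    by move=> sx xu; apply/andP; split; apply: mix_surv_ni; [exact: xu|exact: ltW sx].
  have /andP[g1 g2] := itv_integral_bounds su (norm_moment_ge0 0 (ltW u0)) mGA bG.
  have /andP[m1 m2] := itv_integral_bounds su (ltW (mix_surv_gt0 u)) (mm _ mA) bm.
  split; rewrite -(ler_pM2r us0) -lee_fin.
    by apply: (le_trans g1); rewrite E.
  by apply: (le_trans m1); rewrite -E.
apply/eqP; rewrite eq_le; apply/andP; split.
  have cl : mix_surv s @[s --> t^'-] --> mix_surv t by exact: cvg_at_left_filter.
  apply: (@cvg_le_near R _ t^'- _ (fun=> G 0%N t) _ _ _ (cvg_cst _) cl); near=> s.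
  have s0 : 0 < s by near: s; apply: nbhs_left_gt.
  have st : s < t by near: s; exact: nbhs_left_lt.
  by have [] := key _ _ s0 st.
have cr : mix_surv s @[s --> t^'+] --> mix_surv t by exact: cvg_at_right_filter.
apply: (@cvg_le_near R _ t^'+ _ _ (fun=> G 0%N t) _ _ cr (cvg_cst _)); near=> s.
have st : t < s by near: s; exact: nbhs_right_gt.
by have [] := key _ _ t0 st.
Unshelve. all: by end_near. Qed.

End MassRepresentation.

(** * Local exponential behaviour of the mass *)

Section MassAsymptotics.
Context {R : realType}.
Local Notation meas := {measure set (measurableTypeR R) -> \bar R}.
Local Notation D := (`]0%R, 1%R]%classic : set (measurableTypeR R)).
Implicit Types (s t x y z : R).
Variables (rho : meas) (h la : R -> R) (t1 : R).
Hypotheses (hnd : nd_ge0 h) (rhoD : rho D = 1%E) (t10 : 0 < t1).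
Hypothesis rho_top : forall w : R, 0 < w -> w < 1 -> (0 < rho `]w, 1%R]%classic)%E.
Hypotheses (la0 : forall t, t1 <= t -> 0 < la t)
  (la_nd : forall s t, t1 <= s -> s <= t -> la s <= la t)
  (la_slow : forall K : R, 1 < K -> exists2 delta : R, 1 < delta &
     exists t0, t1 <= t0 /\ forall t, t0 <= t -> la (delta * t) <= K * la t).
Hypotheses (h_ge : forall x, t1 <= x -> la x <= h x)
  (h_le : forall eta : R, 0 < eta -> exists x0, t1 <= x0 /\
     forall x, x0 <= x -> h x <= (1 + eta) * la x).

Local Notation m := (mix_surv rho h).

Let mD : measurable D. Proof. exact: measurable_itv. Qed.
Let D01 z : D z -> 0 < z /\ z <= 1. Proof. by rewrite /= in_itv/= => /andP[]. Qed.
Let im t := mix_surv_integrable hnd rhoD t.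

(** Smaller fragments decay faster: for [z <= 1] the rate of [surv h (t / z)] is
    [h(t / z) / z >= h(t) >= la(t)]. *)
Lemma mix_decay s t : t1 <= t -> t <= s -> m s <= expR (- (la t * (s - t))) * m t.
Proof.
move=> tt1 ts; have t0 := lt_le_trans t10 tt1.
rewrite /mix_surv -(RintegralZl _ mD (im t)); apply: le_Rintegral.
- exact: mD.
- exact: im.
- exact: (integrableZl mD _ (im t)).
move=> z /D01[z0 z1]; rewrite /surv -expRD ler_expR -opprD lerN2.
have iz : 1 <= z^-1 by rewrite invf_ge1.
have tz : t <= t / z by rewrite ler_peMr// ltW.
have tsz : t / z <= s / z by rewrite ler_pM2r// invr_gt0.
have tz0 : 0 <= t / z by rewrite (le_trans (ltW t0)).
have /andP[b _] := cumh_bounds hnd tz0 tsz.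
have h1 : la t * (s - t) <= h (t / z) * (s / z - t / z).
  apply: ler_pM; rewrite ?subr_ge0 ?(ltW (la0 tt1))//.
    by apply: (le_trans (h_ge tt1)); exact: hnd.1.
  by rewrite -mulrBl ler_peMr// subr_ge0.
by have := le_trans h1 b; rewrite lerBrDr.
Qed.

(** The increment [U / la(t)] stays below [U / la(t1)], whereas the admissible increment [(d - 1) t]
    grows without bound. *)
Lemma la_flat (e U : R) : 0 < e -> 0 < U -> exists T, t1 <= T /\
  forall t, T <= t -> la (t + U / la t) <= (1 + e) * la t.
Proof.
move=> e0 U0; have K1 : 1 < 1 + e by rewrite ltrDl.
have [d d1 [t0 [t01 H]]] := la_slow K1.
have l1 := la0 (lexx t1); have d10 : 0 < d - 1 by rewrite subr_gt0.
exists (Num.max t0 (U / la t1 / (d - 1))); split; first by rewrite le_max t01.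
move=> t; rewrite ge_max => /andP[tt0 tU]; have tt1 := le_trans t01 tt0.
have lt0 := la0 tt1.
apply: le_trans (H _ tt0); apply: la_nd.
  by rewrite (le_trans tt1)// lerDl divr_ge0 ?ltW.
rewrite ler_pdivrMr// in tU.
have : U / la t <= U / la t1 by rewrite ler_pM2l// lef_pV2 ?posrE// la_nd.
move=> h1; have := le_trans h1 tU; rewrite mulrBr mulr1 [t * d]mulrC; lra.
Qed.

Let m_top (w t p : R) : 0 < w -> w < 1 -> 0 <= t -> p%:E = rho `]w, 1%R]%classic ->
  surv h (t / w) * p <= m t.
Proof.
move=> w0 w1 t0 pE; pose A : set (measurableTypeR R) := `]w, 1%R]%classic.
have mA : measurable A by exact: measurable_itv.
have AD : A `<=` D.
  by move=> z; rewrite /A/= !in_itv/= => /andP[wz ->]; rewrite (lt_trans w0).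
have ci : rho.-integrable A (EFin \o (fun=> surv h (t / w))).
  apply: (@integrable_bounded R _ (measurableTypeR R) rho A _ `|surv h (t / w)|) => //.
  by rewrite -[rho _]pE ltry.
have iA := integrableS mD mA AD (im t).
have E1 : surv h (t / w) * p = \int[rho]_(z in A) surv h (t / w).
  by rewrite (@Rintegral_cst _ (measurableTypeR R) R rho _ mA) -[rho A]pE.
rewrite E1; apply: (@le_trans _ _ (\int[rho]_(z in A) surv h (t / z))).
  apply: le_Rintegral; [exact: mA|exact: ci|exact: iA|] => z.
  rewrite /A/= in_itv/= => /andP[wz z1]; apply: surv_ni; first exact: hnd.
  by rewrite ler_wpM2l// lef_pV2 ?posrE ?ltW// (lt_trans w0).
rewrite /mix_surv /Rintegral; apply: fine_le.
- exact: (integrable_fin_num mA iA).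
- exact: (integrable_fin_num mD (im t)).
- apply: ge0_subset_integral; [exact: mA|exact: mD| | |exact: AD].
  + by have /integrableP[] := im t.
  + by move=> z _; rewrite lee_fin surv_ge0.
Qed.

Let surv_ratio x y : t1 <= x -> x <= y -> surv h y <= expR (- (la t1 * (y - x))) * surv h x.
Proof.
move=> x1 xy; rewrite /surv -expRD ler_expR -opprD lerN2.
have /andP[b _] := cumh_bounds hnd (ltW (lt_le_trans t10 x1)) xy.
rewrite -lerBrDr; apply: le_trans b; rewrite ler_wpM2r ?subr_ge0//.
by apply: (le_trans (h_ge (lexx t1))); exact: hnd.1.
Qed.

(* The mass of [mu_t] is asymptotically carried by the descendants of the
   largest initial fragments. *)
Let m_bottom (om e : R) : 1 < om -> 0 < e -> exists T, t1 <= T /\ forall t, T <= t ->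
  surv h (t * om) <= e * m t.
Proof.
(* A ratio strictly between 1 and [om]: fragments with [z > 1 / om'] carry a positive mass and keep
   [m t] above a multiple of [surv h (t om')], and [surv h (t om)] is exponentially smaller in
   [t]. *)
move=> om1 e0; pose om' := (1 + om) / 2.
have o1 : 1 < om' by rewrite /om'; lra.
have o2 : 0 < om - om' by rewrite /om'; lra.
have o0 : 0 < om' by rewrite (lt_trans ltr01).
have w0 : 0 < om'^-1 by rewrite invr_gt0.
have w1 : om'^-1 < 1 by rewrite invf_lt1.
have pp := rho_top w0 w1.
have pfin : rho `]om'^-1, 1%R]%classic \is a fin_num.
  rewrite ge0_fin_numE//; apply: (@le_lt_trans _ _ (rho D)); last by rewrite rhoD ltry.
  apply: le_measure; rewrite ?inE; [exact: measurable_itv|exact: mD|].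
  by move=> z; rewrite /= !in_itv/= => /andP[wz ->]; rewrite (lt_trans w0).
pose p := fine (rho `]om'^-1, 1%R]%classic).
have pE : p%:E = rho `]om'^-1, 1%R]%classic by rewrite fineK.
have p0 : 0 < p by rewrite -lte_fin pE.
have l1 := la0 (lexx t1); have ep0 : 0 < e * p by exact: mulr_gt0.
exists (Num.max t1 (- ln (e * p) / (la t1 * (om - om')))); split; first by rewrite le_max lexx.
move=> t; rewrite ge_max => /andP[tt1 tT]; have t0 := lt_le_trans t10 tt1.
have b1 := m_top w0 w1 (ltW t0) pE; rewrite invrK in b1.
have x1 : t1 <= t * om' by rewrite (le_trans tt1)// ler_peMr ?ltW.
have xy : t * om' <= t * om by rewrite ler_pM2l// -subr_ge0 ltW.
apply: (le_trans (surv_ratio x1 xy)).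
have ee : expR (- (la t1 * (t * om - t * om'))) <= e * p.
  rewrite -[leRHS]lnK ?posrE// ler_expR lerNl.
  rewrite ler_pdivrMr ?mulr_gt0// in tT; apply: (le_trans tT).
  by rewrite le_eqVlt; apply/orP; left; apply/eqP; ring.
apply: (@le_trans _ _ (e * p * surv h (t * om'))).
  by rewrite ler_wpM2r// surv_ge0.
by rewrite -mulrA ler_pM2l// mulrC.
Qed.

(** Fragments with [z <= 1 / om] contribute at most the fraction [e] by [m_bottom]. On the others,
    [t / z] is within a factor [om] of [t], where [h] is at most slightly larger than [la(t)]. *)
Lemma mix_lower (e U : R) : 0 < e -> e < 1 -> 0 < U -> exists T, t1 <= T /\
  forall t s, T <= t -> t <= s -> la t * (s - t) <= U ->
    (1 - e) * expR (- ((1 + e) * (la t * (s - t)))) * m t <= m s.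
Proof.
(* Three factors [1 + eta] accumulate: from [h_le], from the flatness of [la], and from
   [1 / z <= om]. A seventh of [e] gives [(1 + eta)^3 <= 1 + e]. *)
move=> e0 e1 U0; pose eta := e / 7.
have eta0 : 0 < eta by rewrite divr_gt0.
have eta3 : (1 + eta) ^+ 2 * (1 + eta) <= 1 + e.
  by rewrite /eta !expr2; nra.
have eta1 : 1 < 1 + eta by rewrite ltrDl.
have eta00 : 0 < 1 + eta by rewrite (lt_trans ltr01).
have [d d1 [t0 [t01 Hd]]] := la_slow eta1.
have [xe [xe1 Hh]] := h_le eta0.
(* The second bound keeps [om < d], so that [s om <= d t] for large [t], within reach of
   [la_slow]. *)
pose om := Num.min (1 + eta) ((1 + d) / 2).
have om1 : 1 < om by rewrite lt_min eta1/=; lra.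
have om0 : 0 < om by rewrite (lt_trans ltr01).
have ome : om <= 1 + eta by rewrite ge_min lexx.
have omd : om < d by rewrite gt_min; apply/orP; right; lra.
have [T1 [T11 Hb]] := m_bottom om1 e0.
have l1 := la0 (lexx t1); have dom : 0 < d - om by rewrite subr_gt0.
exists (Num.max T1 (Num.max t0 (Num.max xe (om * U / la t1 / (d - om))))).
split; first by rewrite le_max T11.
move=> t s; rewrite !ge_max => /and4P[tT1 tt0 txe tU] ts sU.
have tt1 := le_trans T11 tT1; have tp := lt_le_trans t10 tt1.
have lt := la0 tt1; have b := Hb _ tT1.
pose A : set (measurableTypeR R) := `]om^-1, 1%R]%classic.
have w0 : 0 < om^-1 by rewrite invr_gt0.
have w1 : om^-1 < 1 by rewrite invf_lt1.
have mA : measurable A by exact: measurable_itv.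
have AD : A `<=` D.
  by move=> z; rewrite /A/= !in_itv/= => /andP[wz ->]; rewrite (lt_trans w0).
have iA u := integrableS mD mA AD (im u).
have sd : s * om <= d * t.
  have h1 : s <= t + U / la t1.
    rewrite -lerBlDl; apply: (@le_trans _ _ (U / la t)).
      by rewrite ler_pdivlMr// mulrC.
    by rewrite ler_pM2l// lef_pV2 ?posrE// la_nd.
  rewrite ler_pdivrMr// in tU.
  apply: (@le_trans _ _ ((t + U / la t1) * om)); first by rewrite ler_pM2r.
  have -> : (t + U / la t1) * om = t * om + om * U / la t1 by ring.
  have -> : d * t = t * om + t * (d - om) by ring.
  by rewrite lerD2l.
have pt z : A z -> expR (- ((1 + e) * (la t * (s - t)))) * surv h (t / z) <= surv h (s / z).
  rewrite /A/= in_itv/= => /andP[wz z1]; have z0 := lt_trans w0 wz.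
  have zom : z^-1 <= om by rewrite -[om]invrK lef_pV2 ?posrE// ltW.
  have iz : 1 <= z^-1 by rewrite invf_ge1.
  rewrite /surv -expRD ler_expR -opprD lerN2.
  have tsz : t / z <= s / z by rewrite ler_pM2r// invr_gt0.
  have tz0 : 0 <= t / z by rewrite divr_ge0 ?ltW.
  have /andP[_ c] := cumh_bounds hnd tz0 tsz.
  have s0 : 0 < s by exact: lt_le_trans ts.
  have ssz : s <= s / z by rewrite ler_peMr// ltW.
  have szd : s / z <= d * t by apply: le_trans sd; rewrite ler_pM2l.
  have xs : xe <= s / z by rewrite (le_trans txe)// (le_trans ts).
  have h1 : h (s / z) <= (1 + eta) ^+ 2 * la t.
    apply: (le_trans (Hh _ xs)); rewrite expr2 -mulrA ler_pM2l//.
    apply: le_trans (Hd _ tt0); apply: la_nd szd.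
    by rewrite (le_trans tt1)// (le_trans ts).
  have h2 : s / z - t / z <= (1 + eta) * (s - t).
    rewrite -mulrBl mulrC ler_wpM2r ?subr_ge0//; exact: le_trans ome.
  have h3 : h (s / z) * (s / z - t / z) <= (1 + e) * (la t * (s - t)).
    apply: (@le_trans _ _ (((1 + eta) ^+ 2 * la t) * ((1 + eta) * (s - t)))).
      by apply: ler_pM => //; [exact: hnd.2|rewrite subr_ge0].
    have -> : (1 + eta) ^+ 2 * la t * ((1 + eta) * (s - t)) =
      (1 + eta) ^+ 2 * (1 + eta) * (la t * (s - t)) by ring.
    by rewrite ler_wpM2r// mulr_ge0 ?subr_ge0// ltW.
  by have := le_trans c h3; rewrite lerBlDr.
have intA u : \int[rho]_(z in A) surv h (u / z) <= m u.
  rewrite /mix_surv /Rintegral; apply: fine_le.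
  - exact: (integrable_fin_num mA (iA u)).
  - exact: (integrable_fin_num mD (im u)).
  - apply: ge0_subset_integral; [exact: mA|exact: mD| | |exact: AD].
    + by have /integrableP[] := im u.
    + by move=> z _; rewrite lee_fin surv_ge0.
have split_t : (1 - e) * m t <= \int[rho]_(z in A) surv h (t / z).
  rewrite mulrBl mul1r lerBlDr.
  apply: (@le_trans _ _ (\int[rho]_(z in A) surv h (t / z) + surv h (t * om))); last first.
    by rewrite lerD2l.
  pose C : set (measurableTypeR R) := `]0%R, om^-1]%classic.
  have mC : measurable C by exact: measurable_itv.
  have DAC : D = A `|` C.
    apply/seteqP; split=> z; rewrite /A/C/= !in_itv/=.
      by move=> /andP[z0 z1]; rewrite z0 z1 andbT/=; have [zo|zo] := ltP om^-1 z; [left|right].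
    case=> /andP[h1 h2]; first by rewrite h2 (lt_trans w0).
    by rewrite h1 (le_trans h2)// ltW.
  have CD : C `<=` D by rewrite DAC; exact: subsetUr.
  have disj : [disjoint A & C].
    apply/disj_setPS => z [] ; rewrite /A/C/= !in_itv/= => /andP[h1 _] /andP[_ h2].
    by move: (lt_le_trans h1 h2); rewrite ltxx.
  have iC := integrableS mD mC CD (im t).
  have -> : m t = \int[rho]_(z in A) surv h (t / z) + \int[rho]_(z in C) surv h (t / z).
    rewrite /mix_surv DAC Rintegral_setU//.
    by rewrite -DAC; exact: im.
  rewrite lerD2l.
  have rC : (rho C <= 1)%E by rewrite -rhoD; apply: le_measure; rewrite ?inE.
  have rCf : rho C \is a fin_num by rewrite ge0_fin_numE// (le_lt_trans rC)// ltry.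
  have ci : rho.-integrable C (EFin \o (fun=> surv h (t * om))).
    apply: (@integrable_bounded R _ (measurableTypeR R) rho C _ `|surv h (t * om)|) => //.
    by rewrite -ge0_fin_numE.
  apply: (@le_trans _ _ (\int[rho]_(z in C) surv h (t * om))).
    apply: le_Rintegral; [exact: mC|exact: iC|exact: ci|] => z.
    rewrite /C/= in_itv/= => /andP[z0 zw]; apply: surv_ni; first exact: hnd.
    by rewrite ler_pM2l// -[om]invrK lef_pV2 ?posrE.
  rewrite (@Rintegral_cst _ (measurableTypeR R) R rho _ mC) ler_piMr ?surv_ge0//.
  by rewrite -lee_fin fineK.
apply: le_trans (intA s).
apply: (@le_trans _ _ (expR (- ((1 + e) * (la t * (s - t)))) * \int[rho]_(z in A) surv h (t / z))).
  by rewrite mulrAC mulrC ler_wpM2l// expR_ge0.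
rewrite -(RintegralZl _ mA (iA t)); apply: le_Rintegral.
- exact: mA.
- exact: (integrableZl mA _ (iA t)).
- exact: iA.
- exact: pt.
Qed.

End MassAsymptotics.

(** * The limit law *)

Section LimitLaw.
Context {R : realType}.
Local Notation meas := {measure set (measurableTypeR R) -> \bar R}.
Local Notation leb := (@lebesgue_measure R).
Local Notation P := (`]0%R, +oo[%classic : set (measurableTypeR R)).
Local Notation D0 := (`[0%R, +oo[%classic : set (measurableTypeR R)).
Implicit Types (s t u x y z : R) (n k : nat).
Variables (N : meas) (h : R -> R) (x0 : R).
Hypothesis N01 : (0 < N P < +oo)%E.
Hypotheses (hnd : nd_ge0 h) (hE : forall x, h x = hazard_op N h x).
Hypotheses (x00 : 0 < x0) (hx0 : 0 < h x0).

Let mP : measurable P. Proof. exact: measurable_itv. Qed.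
Let mD0 : measurable D0. Proof. exact: measurable_itv. Qed.
Let P0 z : P z -> 0 < z. Proof. by rewrite /= in_itv/= andbT. Qed.
Let PD0 : P `<=` D0. Proof. by move=> z /P0 /ltW z0; rewrite /= in_itv/= z0. Qed.

Let C0 : 0 < fine (N P).
Proof. by have /andP[h0 h1] := N01; rewrite fine_gt0// h0. Qed.

Let mexp n (A : set (measurableTypeR R)) : measurable A ->
  measurable_fun A (fun z : measurableTypeR R => (z ^+ n)%:E).
Proof.
move=> mA; apply/measurable_EFinP; apply: measurable_funTS; apply: continuous_measurable_fun.
exact: exprn_continuous.
Qed.

Lemma Psi_prod_le n : Psi_prod N n <= 1 * fine (N P) ^+ n * n`!%:R.
Proof.
rewrite mul1r; elim: n => [|n IH]; first by rewrite Psi_prod0 expr0 mul1r.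
rewrite Psi_prodS factS natrM exprS.
have pn := ltW (Psi_prod_gt0 N01 n); have p1 := Psi_ge0 N (ler0n R n.+1).
apply: le_trans (ler_pM pn p1 IH (Psi_le N01 (ler0n R n.+1))) _.
by rewrite le_eqVlt; apply/orP; left; apply/eqP; ring.
Qed.

(** The exponential law is treated as the survival function of the constant hazard rate 1. *)
Let survM1 n : survM (fun=> 1 : R) n = (n`!%:R : R)%:E.
Proof.
have nd1 : @nd_ge0 R (fun=> 1) by split => // ?; exact: ler01.
have c1 x : 0 < x -> {for x, continuous (fun=> 1 : R)} by move=> _; exact: cst_continuous.
elim: n => [|n IH].
  rewrite fact0 -(surv_integral_hazard nd1 c1 ltr01 ltr01); apply: eq_integral => t _.
  by rewrite expr0 !mul1r.
rewrite factS natrM EFinM -IH -(surv_moment_hazard nd1 c1 ltr01 ltr01 n).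
by apply: eq_integral => t _; rewrite mul1r.
Qed.

Section no_atom.
Variable Q : meas.
Hypothesis QM : forall n, (\int[Q]_(z in D0) (z ^+ n)%:E = (Psi_prod N n)%:E)%E.

Let QD0 : Q D0 = 1%E.
Proof.
rewrite -(Psi_prod0 N) -QM -[LHS]mul1e -integral_cst//.
Qed.

Let QP1 : (Q P <= 1)%E.
Proof. by rewrite -QD0; apply: le_measure; rewrite ?inE. Qed.

Let QPlty : (Q P < +oo)%E.
Proof. exact: le_lt_trans QP1 (ltry 1). Qed.

Let QPfin : Q P \is a fin_num.
Proof. by rewrite ge0_fin_numE. Qed.

Let w t : R := \int[Q]_(z in P) surv h (t / z).

Let iw t : Q.-integrable P (EFin \o (fun z => surv h (t / z))).
Proof.
apply: (@integrable_bounded R _ (measurableTypeR R) Q P _ 1).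
- exact: mP.
- exact: QPlty.
- apply: (measurableT_comp (measurable_surv hnd (@measurableT _ (measurableTypeR R)))).
  by apply: measurable_funM; [exact: measurable_cst|exact: measurable_invP].
- by move=> z _; rewrite ger0_norm ?surv_ge0// surv_le1.
Qed.

Let w_ni s t : s <= t -> w t <= w s.
Proof.
move=> st; apply: le_Rintegral; [exact: mP|exact: iw|exact: iw|].
move=> z /P0 z0; apply: surv_ni; first exact: hnd.
by rewrite ler_pM2r ?invr_gt0.
Qed.

Let w_ge0 t : 0 <= w t.
Proof. by apply: Rintegral_ge0 => z _; exact: surv_ge0. Qed.

Let w_le t : w t <= fine (Q P).
Proof.
rewrite -[leRHS]mul1r -(@Rintegral_cst _ (measurableTypeR R) R Q _ mP).
apply: le_Rintegral; [exact: mP|exact: iw| |by move=> z _; exact: surv_le1].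
apply: (@integrable_bounded R _ (measurableTypeR R) Q P _ 1); [exact: mP|exact: QPlty| |].
  exact: measurable_cst.
by move=> z _; rewrite normr1.
Qed.

Let mw (A : set (measurableTypeR R)) : measurable A -> measurable_fun A w.
Proof. by move=> mA; apply: nonincreasing_measurable => // x y; exact: w_ni. Qed.

(** The product in the moments of [surv h] cancels the one in the moments of [Q]. An atom of [Q] at
    0 would not be seen, since [z^(n+1)] vanishes there. *)
Let wM n : (\int[leb]_(t in P) (t ^+ n * w t)%:E = (n`!%:R)%:E)%E.
Proof.
transitivity (\int[leb]_(t in P) ((t ^+ n)%:E * \int[Q]_(z in P) (surv h (t / z))%:E))%E.
  apply: eq_integral => t _.
  by rewrite EFinM /w /Rintegral fineK//; exact: (integrable_fin_num mP (iw t)).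
rewrite (moments_surv_mixture N01 hnd hE x00 hx0 n mP (@subset_refl _ _) QPlty).
have -> : (\int[Q]_(z in P) (z ^+ n.+1)%:E = (Psi_prod N n.+1)%:E)%E.
  rewrite -QM [LHS]integral_mkcond [RHS]integral_mkcond; apply: eq_integral => z _.
  rewrite !patchE !mem_setE !in_itv/= !andbT le_eqVlt.
  by have [<-|] := eqVneq 0 z; rewrite /= ?ltxx ?expr0n.
by rewrite -EFinM divfK// gt_eqF// Psi_prod_gt0.
Qed.

(** [w] and [e^(- t)] have the same moments, hence the same integral over []0, u]]: at most [u Q(P)]
    for the first, at least [u e^(- u) >= u (1 - u)] for the second. *)
Let mass_ge u : 0 < u -> 1 - u <= fine (Q P).
Proof.
move=> u0; have nd1 : @nd_ge0 R (fun=> 1) by split => // ?; exact: ler01.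
have ms1 : measurable_fun P (surv (fun=> 1 : R)) by exact: measurable_surv.
have [nu [n1 n2 n3]] := density_measure (mw mP) (fun t _ => w_ge0 t) wM.
have [nu' [n1' n2' n3']] := density_measure ms1 (fun t _ => surv_ge0 _ t) survM1.
pose A : set (measurableTypeR R) := `]0, u]%classic.
have mA : measurable A by exact: measurable_itv.
have AP : A `<=` P by move=> x; rewrite /A/= !in_itv/= andbT => /andP[].
have nn : nu A = nu' A.
  rewrite -(setIidl AP); apply: (@moment_unique R nu nu' 1 1) => //.
  - by move=> n; rewrite n2 expr1n !mul1r.
  - by move=> n; rewrite n2 n2'.
rewrite n3// n3'// in nn.
have bw x : 0 < x -> x <= u -> 0 <= w x <= fine (Q P) by rewrite w_ge0 w_le.
have bs x : 0 < x -> x <= u -> surv (fun=> 1) u <= surv (fun=> 1 : R) x <= 1.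
  by move=> _ xu; apply/andP; split; [exact: (surv_ni nd1)|exact: (surv_le1 nd1)].
have mA1 : measurable_fun A (EFin \o w) by apply/measurable_EFinP; exact: mw.
have mA2 : measurable_fun A (EFin \o surv (fun=> 1 : R)).
  by apply/measurable_EFinP; exact: (measurable_funS mP AP).
have /andP[_ i1] := itv_integral_bounds u0 (lexx 0) mA1 bw.
have /andP[i2 _] := itv_integral_bounds u0 (surv_ge0 _ u) mA2 bs.
rewrite nn in i1; have := le_trans i2 i1.
rewrite subr0 lee_fin ler_pM2r// => /(le_trans _); apply.
have /andP[_ cu] := cumh_bounds nd1 (lexx 0) (ltW u0).
rewrite (cumh_ltr0 _ (lexx 0)) !subr0 mul1r in cu.
rewrite /surv; apply: le_trans (expR_ge1Dx _).
by rewrite lerD2l lerN2.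
Qed.

Lemma limit_law_pos : Q P = 1%E.
Proof.
have : 1 <= fine (Q P).
  by apply/ler_addgt0Pr => e e0; rewrite -lerBlDr; exact: mass_ge.
by rewrite -lee_fin fineK// => q1; apply/eqP; rewrite eq_le QP1.
Qed.

Lemma limit_law_set0 : Q [set 0] = 0%E.
Proof.
have m0 : measurable ([set 0] : set (measurableTypeR R)) by exact: measurable_set1.
have D0E : D0 = P `|` [set 0].
  apply/seteqP; split=> z; rewrite /= !in_itv/= !andbT.
    by rewrite le_eqVlt => /predU1P[<-|]; [right|left].
  by case=> [/ltW//|->].
have disj : P `&` [set 0] = set0.
  by apply/seteqP; split=> [z [/P0 z0 /= zE]|z //]; move: z0; rewrite zE ltxx.
have : Q D0 = (Q P + Q [set 0%R])%E by rewrite D0E measureU.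
rewrite QD0 limit_law_pos; case: (Q [set 0%R]) => [r| |]// -[] rE; congr EFin; lra.
Qed.

Lemma limit_law_D0P (f : R -> R) : measurable_fun D0 f ->
  (\int[Q]_(z in D0) (f z)%:E = \int[Q]_(z in P) (f z)%:E)%E.
Proof.
move=> mf; have -> : P = D0 `&` P by apply/esym/setIidr.
rewrite [RHS]integral_mkcondr; apply: ae_eq_integral.
- exact: mD0.
- exact/measurable_EFinP.
- apply/(measurable_restrict _ mP mD0); apply/measurable_EFinP; apply: measurable_funS mf => //.
- exists [set 0]; split; [exact: measurable_set1|exact: limit_law_set0|].
  move=> x /= /not_implyP[Dx]; rewrite patchE; case: ifPn => // /negP; rewrite inE/= => nD _.
  move: Dx nD; rewrite /= !in_itv/= !andbT => x0' /negP; rewrite -leNgt => x0''.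
  by apply/eqP; rewrite eq_le x0''.
Qed.

End no_atom.

Theorem Psi_law_exists T (F : set_system T) (FF : ProperFilter F) (nu : T -> meas) :
  (\forall i \near F, has_moments (nu i)) ->
  (forall n, moment (nu i) n @[i --> F] --> Psi_prod N n) ->
  exists Q : meas, [/\ Q (~` P) = 0%E, Q P = 1%E &
    forall n, (\int[Q]_(z in P) (z ^+ n)%:E = (Psi_prod N n)%:E)%E].
Proof.
move=> nuF nuc.
have [Q [Qc QM _]] := moment_limit FF ler01 C0 Psi_prod_le nuF nuc (Psi_prod0 N).
exists Q; split; [|exact: limit_law_pos|].
- apply/eqP; rewrite -measure_le0; have -> : ~` P = ~` D0 `|` [set 0].
    apply/seteqP; split=> z; rewrite /= !in_itv/= !andbT.
      move=> nz; have [z0|z0|z0] := ltgtP z 0; [by left|by []|by right].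
    case=> [nz zp|-> zp]; last by move: zp; rewrite ltxx.
    exact: nz (ltW zp).
  apply: (le_trans (@measureU2 _ _ _ Q _ _ (measurableC mD0) (measurable_set1 0))).
  have q1 : (Q (~` D0) <= 0)%E by rewrite -[leRHS]Qc.
  have q2 : (Q [set 0%R] <= 0)%E by rewrite -[leRHS](limit_law_set0 QM).
  by have := leeD q1 q2; rewrite adde0.
- move=> n; by rewrite -QM -(@limit_law_D0P Q QM (fun z => z ^+ n)).
Qed.

Let law_has_moments (Q : meas) :
  (forall n, (\int[Q]_(z in P) (z ^+ n)%:E = (Psi_prod N n)%:E)%E) -> has_moments Q.
Proof.
move=> QM n; apply/integrableP; split; first exact: mexp.
apply: (@le_lt_trans _ _ (Psi_prod N n)%:E); last exact: ltry.
rewrite -QM le_eqVlt; apply/orP; left; apply/eqP.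
by apply: eq_integral => z; rewrite inE => /P0 /ltW z0; rewrite /= ger0_norm// exprn_ge0.
Qed.

Lemma Psi_law_unique (Q Q' : meas) (A : set (measurableTypeR R)) :
  (forall n, (\int[Q]_(z in P) (z ^+ n)%:E = (Psi_prod N n)%:E)%E) ->
  (forall n, (\int[Q']_(z in P) (z ^+ n)%:E = (Psi_prod N n)%:E)%E) ->
  measurable A -> A `<=` P -> Q A = Q' A.
Proof.
move=> QM QM' mA AP; rewrite -(setIidl AP).
apply: (@moment_unique R Q Q' 1 (fine (N P)) ler01 C0) => //.
- exact: law_has_moments.
- exact: law_has_moments.
- by move=> n; rewrite /moment /Rintegral QM; exact: Psi_prod_le.
- by move=> n; rewrite /moment /Rintegral QM QM'.
Qed.

Theorem Psi_law_cvg T (F : set_system T) (FF : ProperFilter F) (nu : T -> meas) (Q : meas)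
  (f : R -> R) (K : R) :
  (\forall i \near F, has_moments (nu i)) ->
  (forall n, moment (nu i) n @[i --> F] --> Psi_prod N n) ->
  (forall n, (\int[Q]_(z in P) (z ^+ n)%:E = (Psi_prod N n)%:E)%E) ->
  {within P, continuous f} -> (forall z, 0 < z -> `|f z| <= K) ->
  \int[nu i]_(z in P) f z @[i --> F] --> \int[Q]_(z in P) f z.
Proof.
move=> nuF nuc QM cf fK.
have [Q' [Qc' QM' QG']] := moment_limit FF ler01 C0 Psi_prod_le nuF nuc (Psi_prod0 N).
have QP' := limit_law_pos QM'.
have QM'P n : (\int[Q']_(z in P) (z ^+ n)%:E = (Psi_prod N n)%:E)%E.
  by rewrite -QM' -(@limit_law_D0P Q' QM' (fun z => z ^+ n)).
(* The law produced by compactness is identified with the given [Q] by determinacy. *)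
have -> : \int[Q]_(z in P) f z = \int[Q']_(z in P) f z.
  rewrite /Rintegral; congr fine; apply: eq_measure_integral => A mA AP.
  exact: Psi_law_unique.
have d0 : 0 < (4 * fine (N P))^-1 by rewrite invr_gt0 mulr_gt0.
apply: (cvg_bounded_continuous FF d0 _ _ _ cf fK).
- near=> i; apply: has_moments_finite; near: i; exact: nuF.
- by rewrite QP' ltry.
move=> G cG; have := QG' G cG; rewrite {2}/Rintegral limit_law_D0P//.
apply: measurable_funTS; apply: continuous_measurable_fun => z.
apply: (@continuous_comp _ _ _ (fun z => expR (- ((4 * fine (N P))^-1 * z))) G z _ (cG _)).
apply: continuous_cvg; first exact: continuous_expR.
by apply: cvgN; apply: cvgM; [exact: cvg_cst|exact: cvg_id].
Unshelve. all: by end_near. Qed.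

End LimitLaw.

(** * Translation of the data of [B] into properties of [N] *)

Section FragmentationKernel.
Context {R : realType}.
Local Notation meas := {measure set (measurableTypeR R) -> \bar R}.
Local Notation P := (`]0%R, +oo[%classic : set (measurableTypeR R)).
Implicit Types (p q s t u v x y : R).
Variables (a : R) (B N : meas).
Hypothesis a0 : 0 < a.
Hypothesis N01 : (0 < N P < +oo)%E.
Hypothesis NB : forall k : measurableTypeR R -> R, measurable_fun setT k ->
  (\int[B]_(y in `]0%R, 1%R[) (y * k y)%:E = \int[N]_(v in P) (k (expR (- (v / a))) / v)%:E)%E.

Let mP : measurable P. Proof. exact: measurable_itv. Qed.
Let P0 z : P z -> 0 < z. Proof. by rewrite /= in_itv/= andbT. Qed.

Lemma frag_phiE p : frag_phi B (p * a) = Psi N p.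
Proof.
rewrite /frag_phi /Psi /Rintegral; congr fine.
have mk : measurable_fun [set: measurableTypeR R] (fun y : measurableTypeR R => 1 - y `^ (p * a)).
  by apply: measurable_funB; [exact: measurable_cst|exact: measurable_powR].
transitivity (\int[B]_(y in `]0%R, 1%R[) (y * (1 - y `^ (p * a)))%:E)%E.
  by apply: eq_integral => y _; rewrite mulrC.
rewrite (NB mk); apply: eq_integral => v _; congr (_ / _)%:E.
rewrite /powR gt_eqF ?expR_gt0// expRK; congr (1 - expR _).
by field; rewrite gt_eqF.
Qed.

Lemma frag_tailE v : 0 < v -> frag_tail B (1 - expR (- (v / a))) = Ntail N v.
Proof.
move=> v0; rewrite /frag_tail /Ntail /Rintegral; congr fine.
have -> : 1 - (1 - expR (- (v / a))) = expR (- (v / a)) by rewrite opprB addrC subrK.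
set c := expR (- (v / a)).
have c1 : c < 1 by rewrite expR_lt1 oppr_lt0 divr_gt0.
pose k (y : measurableTypeR R) : R := \1_(`]-oo, c]%classic : set (measurableTypeR R)) y.
have mk : measurable_fun [set: measurableTypeR R] k.
  by rewrite /k; apply: measurable_indic; exact: measurable_itv.
transitivity (\int[B]_(y in `]0%R, 1%R[) (y * k y)%:E)%E.
  have -> : (`]0%R, c]%classic : set (measurableTypeR R)) =
    (`]0%R, 1%R[%classic : set (measurableTypeR R)) `&` `]-oo, c]%classic.
    apply/seteqP; split=> y; rewrite /= !in_itv/=.
      by move=> /andP[-> yc]; rewrite yc (le_lt_trans yc).
    by case=> /andP[-> _] ->.
  rewrite integral_mkcondr; apply: eq_integral => y _; rewrite patchE /k indicE.
  by case: ifPn => _; rewrite ?mulr1 ?mulr0.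
rewrite (NB mk).
have -> : (`[v, +oo[%classic : set (measurableTypeR R)) = P `&` `[v, +oo[%classic.
  apply/seteqP; split=> y; rewrite /= !in_itv/= !andbT; last by case.
  by move=> vy; split => //; exact: lt_le_trans vy.
rewrite [RHS]integral_mkcondr; apply: eq_integral => y _.
rewrite patchE /k indicE !mem_setE !in_itv/= andbT /c ler_expR lerN2 ler_pM2r ?invr_gt0//.
by case: ifP => _; rewrite ?mul1r ?mul0r.
Qed.

Lemma Ntail_ni u v : 0 < u -> u <= v -> Ntail N v <= Ntail N u.
Proof.
move=> u0 uv; have /andP[_ NP] := N01.
have i (A : set (measurableTypeR R)) : measurable A -> A `<=` `[u, +oo[ ->
    N.-integrable A (EFin \o (fun x : R => x^-1)).
  move=> mA Au; have AP : A `<=` P.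
    by move=> x /Au; rewrite /= !in_itv/= !andbT; exact: lt_le_trans.
  apply: (@integrable_bounded R _ (measurableTypeR R) N A _ u^-1); first exact: mA.
  - by apply: le_lt_trans NP; apply: le_measure; rewrite ?inE.
  - exact: (measurable_funS mP AP (@measurable_invP R)).
  - move=> x /Au /=; rewrite in_itv/= andbT => ux.
    by rewrite ger0_norm ?invr_ge0 ?lef_pV2 ?posrE// ?(lt_le_trans u0 ux)// ltW// (lt_le_trans u0).
have mu1 : measurable (`[u, +oo[%classic : set (measurableTypeR R)) by exact: measurable_itv.
have mv1 : measurable (`[v, +oo[%classic : set (measurableTypeR R)) by exact: measurable_itv.
have sub : (`[v, +oo[%classic : set (measurableTypeR R)) `<=` `[u, +oo[%classic.
  by move=> x; rewrite /= !in_itv/= !andbT; exact: le_trans.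
rewrite /Ntail /Rintegral; apply: fine_le.
- exact: (integrable_fin_num mv1 (i _ mv1 sub)).
- exact: (integrable_fin_num mu1 (i _ mu1 (@subset_refl _ _))).
- apply: ge0_subset_integral; [exact: mv1|exact: mu1| | |exact: sub].
  + by have /integrableP[] := i _ mu1 (@subset_refl _ _).
  + move=> x /=; rewrite in_itv/= andbT => ux.
    by rewrite lee_fin invr_ge0 (le_trans (ltW u0)).
Qed.

(** Regular variation at the ratio 1/2 has limit [2^beta < 2], and [kappa] is the midpoint. Halving
    [v] is not halving [u = 1 - e^(- v / a)], but [u / 2] corresponds to some [w <= v / 2], because
    [e^(- v / (2 a)) <= (1 + e^(- v / a)) / 2]; monotonicity of the tail concludes. *)
Lemma Ntail_half beta : beta < 1 -> regularly_varying_at0 (frag_tail B) (- beta) ->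
  exists kappa v0, [/\ 0 < kappa, kappa < 2, 0 < v0 &
    forall v, 0 < v -> v <= v0 -> Ntail N (v / 2) <= kappa * Ntail N v].
Proof.
move=> b1 [[r r0 [_ fr]] rv].
have h0 : 0 < 2^-1 :> R by rewrite invr_gt0.
pose l : R := 2^-1 `^ (- beta).
have l0 : 0 < l by exact: powR_gt0.
have l2 : l < 2.
  rewrite /l /powR gt_eqF// lnV ?posrE// mulrNN -[ltRHS]lnK ?posrE//.
  by rewrite ltr_expR gtr_pMl// ln_gt0// ltr1n.
pose kappa := (l + 2) / 2.
have kl : l < kappa by rewrite /kappa; lra.
have : \forall u \near 0^'+, frag_tail B (2^-1 * u) / frag_tail B u < kappa.
  by move/cvgr_lt: (rv _ h0); apply; exact: kl.
move=> [d /= d0 Hd].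
pose u0 := Num.min d r; have u00 : 0 < u0 by rewrite lt_min d0.
have Hu u : 0 < u -> u < u0 -> frag_tail B (2^-1 * u) <= kappa * frag_tail B u.
  rewrite lt_min => up /andP[ud ur].
  have := Hd u; rewrite /= sub0r normrN gtr0_norm// => /(_ ud up).
  by rewrite ltr_pdivrMr ?fr// => /ltW.
exists kappa, (a * u0 / 2); split.
- by rewrite (lt_trans l0).
- by rewrite /kappa; lra.
- by rewrite divr_gt0 ?mulr_gt0.
move=> v v0' vv; have va0 : 0 < v / a by rewrite divr_gt0.
have va : v / a < u0.
  rewrite ltr_pdivrMr// mulrC; apply: (le_lt_trans vv).
  by rewrite ltr_pdivrMr// ltr_pMr ?ltr1n// mulr_gt0.
pose u := 1 - expR (- (v / a)).
have up : 0 < u by rewrite subr_gt0 expR_lt1 oppr_lt0.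
have uu : u < u0.
  by apply: le_lt_trans va; rewrite /u lerBlDr addrC -lerBlDr; exact: expR_ge1Dx.
have u1 : u < 1 by rewrite /u gtrBl expR_gt0.
pose w := - (a * ln (1 - 2^-1 * u)).
have q0 : 0 < 1 - 2^-1 * u by rewrite subr_gt0; lra.
have wE : 1 - expR (- (w / a)) = 2^-1 * u.
  rewrite /w mulNr opprK mulrAC mulfV ?gt_eqF// mul1r lnK//.
  by rewrite opprB addrC subrK.
have w0 : 0 < w.
  rewrite oppr_gt0 pmulr_rlt0// ln_lt0// q0/=; lra.
have wv : w <= v / 2.
  have : expR (- (v / 2 / a)) <= 1 - 2^-1 * u.
    have e0 := expR_gt0 (- (v / 2 / a)).
    have e1 : expR (- (v / a)) = expR (- (v / 2 / a)) ^+ 2.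
      rewrite -expRM_natl; congr expR; by field; rewrite gt_eqF.
    rewrite /u e1 expr2; set e := expR _ in e0 *.
    have := sqr_ge0 (e - 1); rewrite expr2; nra.
  rewrite -ler_ln ?posrE ?expR_gt0// expRK => h.
  have -> : v / 2 = a * (v / 2 / a) by field; rewrite gt_eqF.
  by rewrite /w -mulrN ler_pM2l// lerNl.
have := Hu _ up uu; rewrite -wE (frag_tailE w0) (frag_tailE v0'); apply: le_trans.
exact: Ntail_ni.
Qed.

End FragmentationKernel.

Section InverseScale.
Context {R : realType}.
Local Notation meas := {measure set (measurableTypeR R) -> \bar R}.
Local Notation P := (`]0%R, +oo[%classic : set (measurableTypeR R)).
Implicit Types (p q s t : R).
Variables (a : R) (B N : meas).
Hypothesis a0 : 0 < a.
Hypothesis N01 : (0 < N P < +oo)%E.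
Hypothesis phiE : forall p, frag_phi B (p * a) = Psi N p.
Hypothesis star : forall K, 1 < K -> exists2 theta : R, 0 < theta < 1 &
  exists p0 : R, 0 < p0 /\ forall p, p0 <= p -> Psi N (K * p) <= theta * K * Psi N p.

(** Each doubling of [p] multiplies [p / Psi(p)] by at least [1 / theta > 1]. *)
Let ratio_unbounded (W : R) : exists p, 1 <= p /\ W <= p / Psi N p.
Proof.
have [th /andP[th0 th1] [p0 [p00 H]]] := star (ltr1n R 2).
pose q := Num.max 1 p0; have q1 : 1 <= q by rewrite le_max lexx.
have q0 := lt_le_trans ltr01 q1.
have two n : 1 <= 2 ^+ n :> R by rewrite exprn_ege1// ler1n.
have key n : Psi N (2 ^+ n * q) <= (th * 2) ^+ n * Psi N q.
  elim: n => [|n IH]; first by rewrite !expr0 !mul1r.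
  rewrite exprS -mulrA; apply: le_trans (H _ _) _.
    apply: (@le_trans _ _ q); first by rewrite le_max lexx orbT.
    by rewrite ler_peMl// ltW.
  by rewrite exprS -!mulrA ler_pM2l// ler_pM2l//; rewrite mulrA.
have Pq := Psi_gt0 N01 q0.
have th1' : 1 < th^-1 by rewrite invf_gt1.
have [n Hn] : exists n, W * Psi N q / q <= th^-1 ^+ n.
  set V := W * Psi N q / q; have V0 : 0 < `|V| + 1 by rewrite ltr_wpDl.
  have nth : `|th| < 1 by rewrite gtr0_norm.
  have e0 : 0 < (`|V| + 1)^-1 by rewrite invr_gt0.
  have /cvgrPdist_le/(_ _ e0)[n _ Hn] := cvg_expr nth; exists n.
  have := Hn n (leqnn n); rewrite sub0r normrN gtr0_norm ?exprn_gt0//.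
  rewrite -[leLHS]invrK lef_pV2 ?posrE ?invr_gt0 ?exprn_gt0// exprVn; apply: le_trans.
  by rewrite (le_trans (ler_norm V))// lerDl.
exists (2 ^+ n * q); split; first by rewrite mulr_ege1.
have qn : 0 < 2 ^+ n * q by rewrite mulr_gt0// exprn_gt0.
rewrite ler_pdivlMr ?Psi_gt0//.
have [W0|W0] := leP W 0.
  apply: (@le_trans _ _ 0); last exact: ltW.
  apply: mulr_le0_ge0; [exact: W0|by apply: ltW; exact: Psi_gt0].
apply: (@le_trans _ _ (W * ((th * 2) ^+ n * Psi N q))); first by rewrite ler_pM2l.
have E : W * ((th * 2) ^+ n * Psi N q) = (W * Psi N q / q * th ^+ n) * (2 ^+ n * q).
  by rewrite exprMn; field; rewrite gt_eqF.
rewrite E ger_pMl//; apply: (@le_trans _ _ (th^-1 ^+ n * th ^+ n)).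
  by rewrite ler_pM2r// exprn_gt0.
by rewrite -exprMn mulVf ?gt_eqF// expr1n.
Qed.

(** [pinv] returns a preimage as soon as there is one; the intermediate value theorem supplies it,
    starting from [1 / Psi(1)], the value of [p / Psi(p)] at 1, which explains [t1]. *)
Lemma frag_varphi_spec : exists t1, 0 < t1 /\ forall t, t1 <= t ->
  let g := frag_varphi B (a * t) / a in 0 < g /\ g = t * Psi N g.
Proof.
exists (Psi N 1)^-1; split; first by rewrite invr_gt0 Psi_gt0.
move=> t tt1; pose f s := s / frag_phi B s.
have P1 := Psi_gt0 N01 (@ltr01 R).
have [q [q1 qt]] := ratio_unbounded t.
have cr : {within `[1, q], continuous (fun p => p / Psi N p)}.
  apply: continuous_in_subspaceT => p; rewrite inE/= in_itv/= => /andP[p1 _].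
  have p0 := lt_le_trans ltr01 p1.
  apply: cvgM; first exact: cvg_id.
  apply: cvgV; [apply: lt0r_neq0; exact: Psi_gt0|exact: Psi_continuous].
have [p /[!in_itv]/= /andP[p1 _] pE] : exists2 p, p \in `[1, q] & p / Psi N p = t.
  apply: (IVT q1 cr); rewrite div1r ge_min tt1/= le_max qt orbT//.
have p0 := lt_le_trans ltr01 p1.
have im : (a * t) \in f @` [set s | 0 < s].
  rewrite inE; exists (p * a); first by rewrite /= mulr_gt0.
  by rewrite /f phiE mulrAC mulrC pE.
have vK : f (frag_varphi B (a * t)) = a * t by exact: (pinvK _ im).
have v0 : 0 < frag_varphi B (a * t).
  apply: (@surjpinv_image_sub R R _ [set s : R | 0 < s] (f @` [set s : R | 0 < s]) f
    (@subset_refl _ _)).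
  by exists (a * t) => //; rewrite inE in im.
set g := _ / _; have g0 : 0 < g by rewrite divr_gt0.
split => //; have vE : frag_varphi B (a * t) = g * a by rewrite divfK ?gt_eqF.
move: vK; rewrite vE /f phiE => h; have Pg := Psi_gt0 N01 g0.
have : g / Psi N g = t.
  by apply: (@mulfI _ a); rewrite ?gt_eqF// -h; ring.
by move=> <-; rewrite divfK ?gt_eqF.
Qed.

End InverseScale.

(** * Asymptotics of the moments of a solution *)

Section RescaledSolution.
Context {R : realType}.
Local Notation meas := {measure set (measurableTypeR R) -> \bar R}.
Local Notation P := (`]0%R, +oo[%classic : set (measurableTypeR R)).
Local Notation D := (`]0%R, 1%R]%classic : set (measurableTypeR R)).
Implicit Types (c r s t w x y z : R) (n : nat).
Variables (alpha : R) (B mu0 N : meas) (mu : R -> meas).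
Hypothesis alpha0 : alpha < 0.
Let a := - alpha.
Hypothesis N01 : (0 < N P < +oo)%E.
Hypothesis NB : forall k : measurableTypeR R -> R, measurable_fun setT k ->
  (\int[B]_(y in `]0%R, 1%R[) (y * k y)%:E = \int[N]_(v in P) (k (expR (- (v / a))) / v)%:E)%E.
Hypothesis hmu : is_frag_solution alpha B mu0 mu.
Hypothesis mu0_top : is_support_sup mu0 1.

Let mu01 : mu0 `]1, +oo[%classic = 0%E. Proof. exact: mu0_top.1. Qed.
Let a0 : 0 < a. Proof. by rewrite oppr_gt0. Qed.
Let mP : measurable P. Proof. exact: measurable_itv. Qed.
Let mD : measurable D. Proof. exact: measurable_itv. Qed.
Let DP : D `<=` P.
Proof. by move=> x /=; rewrite !in_itv/= andbT => /andP[]. Qed.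
Let D01 x : D x -> 0 < x /\ x <= 1.
Proof. by rewrite /= in_itv/= => /andP[]. Qed.
Let P0 z : P z -> 0 < z. Proof. by rewrite /= in_itv/= andbT. Qed.

Let powE x r n : 0 < x -> (x `^ r) ^+ n = x `^ (n%:R * r).
Proof. by move=> x0; rewrite -powR_mulrn ?powR_ge0// -powRrM mulrC. Qed.

Let pow01 x r : 0 <= r -> D x -> 0 < x `^ r <= 1.
Proof.
move=> r0 /D01[x0 x1]; rewrite powR_gt0//=.
have := @ge0_ler_powR R r r0 x 1; rewrite !nnegrE powR1; apply => //.
exact: ltW.
Qed.

Lemma frag_massE t : frag_mass mu t = fmoment mu 0 t.
Proof.
rewrite /frag_mass /fmoment /Rintegral; congr fine; apply: eq_integral => x.
by rewrite inE => /P0 x0; rewrite powRr0 mulr1.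
Qed.

Lemma fmoment_ge0 r t : 0 <= fmoment mu r t.
Proof. by apply: Rintegral_ge0 => x /P0/ltW x0; rewrite mulr_ge0// powR_ge0. Qed.

Lemma fmoment00 : fmoment mu 0 0 = 1.
Proof.
have [[_ mu00] _ [_ h1] _] := hmu.
rewrite -frag_massE /frag_mass -[RHS]/(fine 1%E) -h1; congr fine.
by apply: eq_measure_integral => A mA _; exact: mu00.
Qed.

(** [rho] is the image of [x mu0(dx)] under [z = x^a]. It charges every neighbourhood of 1 because
    the support of [mu0] has supremum 1: []w, 1]] pulls back to []w^(1/a), 1]], where the density
    [x] is bounded below. *)
Lemma solution_mass_image : exists rho : meas, [/\ (rho P < +oo)%E, rho D = 1%E,
  forall w, 0 < w -> w < 1 -> (0 < rho `]w, 1%R]%classic)%E &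
  forall n, (\int[rho]_(z in D) (z ^+ n)%:E = (fmoment mu (n%:R * a) 0)%:E)%E].
Proof.
have [[_ mu00] _ _ _] := hmu.
have ms : measurable_fun [set: measurableTypeR R] (fun x : measurableTypeR R => x `^ a).
  exact: measurable_powR.
have w0 x : D x -> 0 <= x by move=> /D01[/ltW].
have [rho [rhoA rhoI]] := @weighted_image_integral _ _ (measurableTypeR R) (measurableTypeR R) R
  mu0 D id (fun x => x `^ a) mD (@measurable_id _ _ _) w0 ms.
have sD x : D x -> D (x `^ a).
  by move=> Dx; have /andP[h1 h2] := pow01 (ltW a0) Dx; rewrite /= in_itv/= h1.
have DD : D `&` (fun x => x `^ a) @^-1` D = D.
  by apply/seteqP; split => x; [case|move=> Dx; split => //; exact: sD].
have DPE : D `&` (fun x => x `^ a) @^-1` P = D.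
  by apply/seteqP; split => x; [case|move=> Dx; split => //; exact/DP/sD].
have I n : (\int[rho]_(z in D) (z ^+ n)%:E = (fmoment mu (n%:R * a) 0)%:E)%E.
  rewrite rhoI//; last first.
    apply/measurable_EFinP; apply: measurable_funTS; apply: continuous_measurable_fun.
    exact: exprn_continuous.
  have na0 : 0 <= n%:R * a by rewrite mulr_ge0// ltW.
  have i := fmoment_integrable hmu na0 (lexx 0).
  rewrite (fmomentE hmu mu01)// /Rintegral fineK; last exact: (integrable_fin_num mD i).
  rewrite DD; transitivity (\int[mu0]_(x in D) (x * x `^ (n%:R * a))%:E)%E.
    by apply: eq_integral => x; rewrite inE => /D01[x0 _]; rewrite -EFinM powE// mulrC.
  by apply: eq_measure_integral => A mA _; rewrite mu00.
have rhoD : rho D = 1%E.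
  have := I 0%N; rewrite mul0r fmoment00.
  transitivity (\int[rho]_(z in D) (z ^+ 0)%:E)%E => //.
  by rewrite -[LHS]mul1e -integral_cst.
have rhoP : rho P = 1%E by rewrite rhoA// DPE -rhoD rhoA// DD.
exists rho; split => //; first by rewrite rhoP ltry.
move=> w w0' w1; rewrite rhoA; last exact: measurable_itv.
pose c := w `^ a^-1; have c0 : 0 < c by exact: powR_gt0.
have c1 : c < 1.
  have := @gt0_ltr_powR R a^-1; rewrite invr_gt0 => /(_ a0 w 1).
  by rewrite !nnegrE powR1; apply => //; exact: ltW.
have cw x : c < x -> w < x `^ a.
  move=> cx; have -> : w = c `^ a by rewrite /c -powRrM mulVf ?gt_eqF// powRr1// ltW.
  by apply: gt0_ltr_powR => //; rewrite nnegrE ltW// (lt_trans c0).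
have [_ /(_ (1 - c))] := mu0_top.
rewrite subr_gt0 c1 gtrBl c0 => /(_ isT isT).
have -> : 1 - (1 - c) = c by rewrite opprB addrC subrK.
move=> mc; pose C : set (measurableTypeR R) := `]c, 1%R]%classic.
have mC : measurable C by exact: measurable_itv.
have C01 x : C x -> c < x /\ x <= 1 by rewrite /C/= in_itv/= => /andP[].
have CD : C `<=` D by move=> x /C01[cx x1]; rewrite /= in_itv/= x1 (lt_trans c0).
apply: (@lt_le_trans _ _ (\int[mu0]_(x in C) c%:E)%E).
  by rewrite integral_cst// mule_gt0.
apply: (@le_trans _ _ (\int[mu0]_(x in C) x%:E)%E).
  apply: ge0_le_integral => //.
  - by move=> x _; rewrite lee_fin ltW.
  - by move=> x /C01[cx _]; rewrite lee_fin ltW.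
apply: ge0_subset_integral => //.
- apply: measurableI => //; rewrite -[X in measurable X]setTI; exact: ms.
- by move=> x [/w0].
- move=> x Cx; split; first exact: CD.
  have /andP[_ h2] := pow01 (ltW a0) (CD _ Cx).
  by rewrite /= in_itv/= h2 andbT; apply: cw; have [] := C01 _ Cx.
Qed.

Variables (g : R -> R) (t1 : R).
Hypotheses (t10 : 0 < t1) (gP : forall t, t1 <= t -> 0 < g t /\ g t = t * Psi N (g t)).
Hypothesis star : forall K, 1 < K -> exists2 theta : R, 0 < theta < 1 &
  exists p0 : R, 0 < p0 /\ forall p, p0 <= p -> Psi N (K * p) <= theta * K * Psi N p.

Lemma rescaled_moment_cvg : (forall t, 0 <= t -> 0 < fmoment mu 0 t) /\
  forall n, lam g t ^+ n * fmoment mu (n%:R * a) t / fmoment mu 0 t @[t --> +oo] --> Psi_prod N n.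
Proof.
have [h [hnd hE h_ge h_le]] := hazard_fixpoint N01 t10 gP star.
have la0 t : t1 <= t -> 0 < lam g t by exact: (lam_gt0 t10 gP).
have la_nd := lam_nd (Psi_nd N01) (Psi_scale N01) (Psi_gt0 N01) t10 gP.
have la_slow := lam_slow (Psi_nd N01) (Psi_scale N01) (Psi_gt0 N01) t10 gP star.
have hx0 : 0 < h t1 by exact: lt_le_trans (la0 _ (lexx t1)) (h_ge _ (lexx t1)).
have [rho [rhoP rhoD rho_top rhoI]] := solution_mass_image.
pose M n t := fmoment mu (n%:R * a) t.
have M_ge0 n t : 0 <= t -> 0 <= M n t by move=> _; exact: fmoment_ge0.
have M_sandwich n s t : 0 <= s -> s <= t ->
    (t - s) * (Psi N n.+1%:R * M n t) <= M n.+1 s - M n.+1 t <=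
    (t - s) * (Psi N n.+1%:R * M n s).
  move=> s0 st; have ar : - alpha <= n.+1%:R * a.
    by rewrite -/a ler_peMl ?(ltW a0)// ler1n.
  have := fmoment_sandwich alpha0 N01 NB hmu mu01 ar s0 st.
  rewrite -/a mulfK; last exact: lt0r_neq0.
  have -> : n.+1%:R * a - a = n%:R * a by rewrite -natr1; ring.
  by [].
(* [mass_eq] covers positive times; at time 0 both sides are 1. *)
have G0 t : 0 <= t -> norm_moment N M 0 t = mix_surv rho h t.
  rewrite le_eqVlt => /predU1P[<-|]; last exact: (mass_eq N01 hnd hE t10 hx0 rhoP rhoD).
  rewrite /norm_moment Psi_prod0 divr1 /M mul0r fmoment00 /mix_surv.
  rewrite (_ : \int[rho]_(z in D) _ = \int[rho]_(z in D) 1); last first.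
    by apply: eq_Rintegral => z _; rewrite mul0r surv0.
  by rewrite Rintegral_cst// mul1r rhoD.
have m0 := mix_surv_gt0 hnd rhoD.
have M0 t : 0 <= t -> fmoment mu 0 t = mix_surv rho h t.
  by move=> t0; rewrite -(G0 _ t0) /norm_moment Psi_prod0 divr1 /M mul0r.
split=> [t t0|n]; first by rewrite M0.
have c := iter_tail_cvg t10 m0 la0 la_nd (mix_decay hnd rhoD t10 la0 h_ge)
  (mix_lower hnd rhoD t10 rho_top la0 la_nd la_slow h_ge h_le)
  (la_flat la0 la_nd la_slow) G0 (norm_moment_ge0 N01 M_ge0) (measurable_norm_moment N01 M_sandwich)
  (norm_moment_tail N01 M_ge0 M_sandwich) n.
rewrite -[X in _ --> X]mul1r; apply: cvg_trans (cvgM c (cvg_cst (Psi_prod N n))).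
apply: near_eq_cvg; near=> t.
have t0 : 0 <= t by near: t; apply: nbhs_pinfty_ge; exact: num_real.
rewrite /= M0// /norm_moment /M; have pn := Psi_prod_gt0 N01 n.
by field; rewrite !gt_eqF.
Unshelve. all: by end_near. Qed.

(** [nu] is the law of [c x^a] under the probability [x mu_t(dx) / m(t)]. *)
Lemma rescaled_law t c : 0 <= t -> 0 < c -> 0 < fmoment mu 0 t ->
  exists nu : meas, [/\ has_moments nu,
    forall n, moment nu n = c ^+ n * fmoment mu (n%:R * a) t / fmoment mu 0 t &
    forall (f : R -> R) (K : R), measurable_fun P f -> (forall z, 0 < z -> `|f z| <= K) ->
      \int[nu]_(z in P) f z = (fmoment mu 0 t)^-1 * \int[mu t]_(x in P) (f (c * x `^ a) * x)].
Proof.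
move=> t0 c0 m0; set m := fmoment mu 0 t in m0 *; pose sc x := c * x `^ a.
have ms : measurable_fun [set: measurableTypeR R] (sc : measurableTypeR R -> measurableTypeR R).
  by apply: measurable_funM; [exact: measurable_cst|exact: measurable_powR].
have w0 x : D x -> 0 <= m^-1 * x.
  by move=> /D01[x0 _]; apply: mulr_ge0; rewrite ?invr_ge0; exact: ltW.
have mw : measurable_fun D (fun x : measurableTypeR R => m^-1 * x).
  by apply: measurable_funM; [exact: measurable_cst|exact: measurable_id].
have [nu [nuA nuI]] := @weighted_image_integral _ _ (measurableTypeR R) (measurableTypeR R) R
  (mu t) D (fun x => m^-1 * x) sc mD mw w0 ms.
have DPE : D `&` sc @^-1` P = D.
  apply/seteqP; split => x; first by case.
  move=> Dx; split => //; have [x0 _] := D01 Dx.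
  by rewrite /= in_itv/= andbT mulr_gt0// powR_gt0.
have I n : (\int[nu]_(z in P) (z ^+ n)%:E = (c ^+ n * fmoment mu (n%:R * a) t / m)%:E)%E.
  rewrite nuI//; last first.
    apply/measurable_EFinP; apply: measurable_funTS; apply: continuous_measurable_fun.
    exact: exprn_continuous.
  have na0 : 0 <= n%:R * a by rewrite mulr_ge0// ltW.
  have i := fmoment_integrable hmu na0 t0.
  rewrite (fmomentE hmu mu01)// mulrAC EFinM /Rintegral fineK; last exact: (integrable_fin_num mD i).
  rewrite DPE -ge0_integralZl//.
  - apply: eq_integral => x; rewrite inE => /D01[x0 _].
    by rewrite -!EFinM /sc exprMn powE//; congr EFin; ring.
  - by have /integrableP[] := i.
  - by move=> x /D01[x0 _]; rewrite lee_fin mulr_ge0 ?powR_ge0// ltW.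
  - by rewrite lee_fin divr_ge0 ?exprn_ge0// ltW.
exists nu; split.
- move=> n; apply/integrableP; split.
    apply/measurable_EFinP; apply: measurable_funTS; apply: continuous_measurable_fun.
    exact: exprn_continuous.
  apply: (@le_lt_trans _ _ (c ^+ n * fmoment mu (n%:R * a) t / m)%:E); last exact: ltry.
  rewrite -I le_eqVlt; apply/orP; left; apply/eqP.
  by apply: eq_integral => z; rewrite inE => /P0 /ltW z0; rewrite /= ger0_norm// exprn_ge0.
- by move=> n; rewrite /moment /Rintegral I.
- move=> f K mf fK.
  have mg : measurable_fun P (fun x : measurableTypeR R => f (c * x `^ a) * x).
    apply: measurable_funM; last exact: measurable_id.
    apply: (@measurable_comp _ _ _ _ _ _ P f P sc) => //.
    + by move=> _ [x /P0 x0 <-]; rewrite /= in_itv/= andbT mulr_gt0// powR_gt0.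
    + by apply: measurable_funTS.
  rewrite (solution_integral_PD hmu mu01 t0 mg).
  have i1 := integrableZl mD K (integrableS mP mD DP (first_moment_integrable hmu t0)).
  have ig : (mu t).-integrable D (EFin \o (fun x : R => f (c * x `^ a) * x)).
    apply: (le_integrable mD _ _ i1).
      by apply/measurable_EFinP; exact: (measurable_funS mP DP mg).
    move=> x /D01[x0 _]; rewrite /= lee_fin normrM (gtr0_norm x0).
    apply: le_trans (ler_norm _); rewrite ler_pM2r// fK// mulr_gt0// powR_gt0//.
  rewrite -(RintegralZl _ mD ig) /Rintegral; congr fine.
  rewrite nuI//; last by apply/measurable_EFinP.
  by rewrite DPE; apply: eq_integral => x _; rewrite -EFinM /sc; congr EFin; ring.
Qed.

End RescaledSolution.

Section PowerImage.
Context {R : realType}.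
Local Notation meas := {measure set (measurableTypeR R) -> \bar R}.
Local Notation P := (`]0%R, +oo[%classic : set (measurableTypeR R)).
Implicit Types (p x z : R) (f : R -> R) (E A : set (measurableTypeR R)) (n : nat).

Let mP : measurable P. Proof. exact: measurable_itv. Qed.
Let P0 z : P z -> 0 < z. Proof. by rewrite /= in_itv/= andbT. Qed.
Let powP p z : P z -> P (z `^ p).
Proof. by move=> /P0 z0; rewrite /= in_itv/= andbT powR_gt0. Qed.
Let powK p z : 0 < p -> 0 < z -> (z `^ p) `^ p^-1 = z.
Proof. by move=> p0 z0; rewrite -powRrM mulfV ?gt_eqF// powRr1// ltW. Qed.

Lemma measurable_within_P f : {within P, continuous f} -> measurable_fun P f.
Proof. exact: subspace_continuous_measurable_fun. Qed.

Lemma within_P_powR f p : 0 < p -> {within P, continuous f} ->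
  {within P, continuous (fun z => f (z `^ p))}.
Proof.
move=> p0 cf; apply: continuous_in_subspaceT => z; rewrite inE => /P0 z0.
have oP : open (`]0%R, +oo[%classic : set R) by exact: interval_open.
have cfP x : 0 < x -> {for x, continuous f}.
  move=> x0; have := cf; rewrite (continuous_open_subspace _ oP) => /(_ x); apply.
  by rewrite inE/= in_itv/= x0.
apply: (@continuous_comp _ _ _ (fun z => z `^ p) f z).
  exact: (is_derive_continuous (is_derive1_powR p z0)).
by apply: cfP; exact: powR_gt0.
Qed.

(** The density [z^(- p)] undoes the size bias: with [x = z^p], the measure [x nu(dx)] is the plain
    image of [Q]. *)
Lemma unbiased_power_image (Q : meas) p : 0 < p -> exists nu : meas, nu (~` P) = 0%E /\
  forall E f, measurable E -> E `<=` P -> measurable_fun E f ->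
    (\int[nu]_(x in E) (f x * x)%:E =
     \int[Q]_(z in P `&` (fun z => z `^ p)%R @^-1` E) (f (z `^ p))%:E)%E.
Proof.
move=> p0.
have ms : measurable_fun [set: measurableTypeR R] (fun z : measurableTypeR R => z `^ p).
  exact: measurable_powR.
have mw : measurable_fun P (fun z : measurableTypeR R => z `^ (- p)).
  by apply: measurable_funTS; exact: measurable_powR.
have w0 z : P z -> 0 <= z `^ (- p) by move=> _; exact: powR_ge0.
have [nu [nuA nuI]] := @weighted_image_integral _ _ (measurableTypeR R) (measurableTypeR R) R
  Q P (fun z => z `^ (- p)) (fun z => z `^ p) mP mw w0 ms.
exists nu; split.
  rewrite nuA; last exact: measurableC.
  rewrite (_ : _ `&` _ = set0) ?integral_set0//; apply/seteqP; split => // z [Pz].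
  by apply; exact: powP.
move=> E f mE EP mf; rewrite nuI//; last first.
  by apply/measurable_EFinP; apply: measurable_funM => //; exact: measurable_id.
apply: eq_integral => z; rewrite inE => -[/P0 z0 _].
by rewrite -EFinM powRN -mulrA mulfV ?mulr1// gt_eqF// powR_gt0.
Qed.

Lemma power_image (Q : meas) p : 0 < p -> exists nu : meas,
  (forall f, measurable_fun P f ->
    (\int[nu]_(z in P) (f z)%:E = \int[Q]_(x in P) (f (x `^ p))%:E)%E) /\
  forall A, measurable A -> nu (P `&` (fun z => z `^ p^-1) @^-1` A) = Q (P `&` A).
Proof.
move=> p0.
have ms q : measurable_fun [set: measurableTypeR R] (fun z : measurableTypeR R => z `^ q).
  exact: measurable_powR.
have [nu [nuA nuI]] := @weighted_image_integral _ _ (measurableTypeR R) (measurableTypeR R) R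
  Q P (fun=> 1) (fun z => z `^ p) mP (measurable_cst _) (fun _ _ => ler01) (ms p).
exists nu; split.
  move=> f mf; rewrite nuI//; last by apply/measurable_EFinP.
  rewrite (_ : _ `&` _ = P); first by apply: eq_integral => z _; rewrite mule1.
  by apply/seteqP; split => [z []//|z Pz]; split => //; exact: powP.
move=> A mA.
have mC : measurable (P `&` (fun z : measurableTypeR R => z `^ p^-1) @^-1` A).
  by apply: measurableI => //; rewrite -[X in measurable X]setTI; exact: ms.
rewrite nuA//.
have -> : P `&` (fun z => z `^ p) @^-1` (P `&` (fun z => z `^ p^-1) @^-1` A) = P `&` A.
  apply/seteqP; split => z /=.
    by move=> [Pz [_]]; rewrite powK//; exact: P0.
  move=> [Pz Az]; split => //; split; first exact: powP.
  by rewrite powK//; exact: P0.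
by rewrite integral_cst ?mul1e//; exact: measurableI.
Qed.

End PowerImage.

(** * Return to the size variable *)

Section RescaledConvergence.
Context {R : realType}.
Local Notation meas := {measure set (measurableTypeR R) -> \bar R}.
Local Notation P := (`]0%R, +oo[%classic : set (measurableTypeR R)).
Implicit Types (t x z : R) (n : nat).
Variables (alpha : R) (B mu0 N : meas) (mu : R -> meas).
Hypothesis alpha0 : alpha < 0.
Let a := - alpha.
Hypothesis N01 : (0 < N P < +oo)%E.
Hypothesis NB : forall k : measurableTypeR R -> R, measurable_fun setT k ->
  (\int[B]_(y in `]0%R, 1%R[) (y * k y)%:E = \int[N]_(v in P) (k (expR (- (v / a))) / v)%:E)%E.
Hypothesis hmu : is_frag_solution alpha B mu0 mu.
Hypothesis mu0_top : is_support_sup mu0 1.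
Variables (g : R -> R) (t1 : R).
Hypotheses (t10 : 0 < t1) (gP : forall t, t1 <= t -> 0 < g t /\ g t = t * Psi N (g t)).
Hypothesis star : forall K, 1 < K -> exists2 theta : R, 0 < theta < 1 &
  exists p0 : R, 0 < p0 /\ forall p, p0 <= p -> Psi N (K * p) <= theta * K * Psi N p.

Let a0 : 0 < a. Proof. by rewrite oppr_gt0. Qed.

Lemma rescaled_laws (psi : R -> R) : psi t / lam g t @[t --> +oo] --> (1 : R) ->
  exists nu : R -> meas, [/\ \forall t \near +oo, has_moments (nu t),
    forall n, moment (nu t) n @[t --> +oo] --> Psi_prod N n &
    \forall t \near +oo, 0 < psi t /\
      forall (f : R -> R) (K : R), measurable_fun P f -> (forall z, 0 < z -> `|f z| <= K) ->
        \int[nu t]_(z in P) f z = (frag_mass mu t)^-1 * \int[mu t]_(x in P) (f (psi t * x `^ a) * x)].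
Proof.
move=> psilam; have [m0 cM] := rescaled_moment_cvg alpha0 N01 NB hmu mu0_top t10 gP star.
have good : \forall t \near +oo, [/\ 0 <= t, t1 <= t & 0 < psi t].
  near=> t.
  have t0 : 0 <= t by near: t; apply: nbhs_pinfty_ge; exact: num_real.
  have tt1 : t1 <= t by near: t; apply: nbhs_pinfty_ge; exact: num_real.
  split => //; have l0 := lam_gt0 t10 gP tt1.
  have : 0 < psi t / lam g t.
    by near: t; move/cvgr_gt: psilam; apply; exact: ltr01.
  by rewrite pmulr_lgt0// invr_gt0.
have ex t : exists nu : meas, 0 <= t -> 0 < psi t -> [/\ has_moments nu,
    forall n, moment nu n = psi t ^+ n * fmoment mu (n%:R * a) t / fmoment mu 0 t &
    forall (f : R -> R) (K : R), measurable_fun P f -> (forall z, 0 < z -> `|f z| <= K) ->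
      \int[nu]_(z in P) f z = (fmoment mu 0 t)^-1 * \int[mu t]_(x in P) (f (psi t * x `^ a) * x)].
  (* Where [t] or [psi t] has the wrong sign, [mu t] is a dummy value; this does not occur for large
     [t]. *)
  have [t0|t0] := leP 0 t; last by exists (mu t).
  have [c0|c0] := ltP 0 (psi t); last by exists (mu t).
  have [nu nuP] := rescaled_law alpha0 hmu mu0_top t0 c0 (m0 _ t0).
  by exists nu.
have [nu nuP] := choice ex.
exists nu; split.
- by apply: filterS good => t [t0 _ p0]; have [] := nuP t t0 p0.
- move=> n; have c1 : (psi t / lam g t) ^+ n @[t --> +oo] --> (1 : R) ^+ n.
    exact: (@cvg_comp _ _ _ (fun t => psi t / lam g t) (fun x : R => x ^+ n) _ _ _
      psilam (@exprn_continuous R n 1)).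
  rewrite -[X in _ --> X]mul1r -[X in X * _](expr1n R n); apply: cvg_trans (cvgM c1 (cM n)).
  apply: near_eq_cvg.
  apply: filterS good => t [t0 tt1 p0]; have [_ -> _] := nuP t t0 p0.
  have l0 := lam_gt0 t10 gP tt1; have mt := m0 _ t0.
  rewrite /= expr_div_n; field; rewrite expf_neq0; lra.
- apply: filterS good => t [t0 _ p0]; split => // f K mf fK.
  by have [_ _ H] := nuP t t0 p0; rewrite frag_massE; exact: (H f K).
Unshelve. all: by end_near. Qed.

Theorem rescaled_limit : exists muinf : meas, [/\ muinf (~` P) = 0%E,
  first_moment muinf = 1%E,
  forall n, (\int[muinf]_(x in P) (x `^ (a * n%:R) * x)%:E = (Psi_prod N n)%:E)%E,
  forall Q : meas, Q (~` P) = 0%E ->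
    (forall n, (\int[Q]_(x in P) (x `^ (a * n%:R))%:E = (Psi_prod N n)%:E)%E) ->
    forall A, measurable A -> Q A = (\int[muinf]_(x in A `&` P) x%:E)%E &
  forall psi : R -> R, psi t / lam g t @[t --> +oo] --> (1 : R) ->
    forall f : R -> R, {within P, continuous f} -> (exists C : R, forall x, 0 < x -> `|f x| <= C) ->
    (frag_mass mu t)^-1 * \int[mu t]_(x in P) (f (psi t `^ a^-1 * x) * x)
      @[t --> +oo] --> \int[muinf]_(x in P) (f x * x)].
Proof.
have mP : measurable P by exact: measurable_itv.
have P0 z : P z -> 0 < z by rewrite /= in_itv/= andbT.
have ia0 : 0 < a^-1 by rewrite invr_gt0.
have [h [hnd hE h_ge _]] := hazard_fixpoint N01 t10 gP star.
have hx0 : 0 < h t1 by exact: lt_le_trans (lam_gt0 t10 gP (lexx t1)) (h_ge _ (lexx t1)).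
have lam1 : lam g t / lam g t @[t --> +oo] --> (1 : R).
  apply: cvg_near_cst; near=> t.
  have tt1 : t1 <= t by near: t; apply: nbhs_pinfty_ge; exact: num_real.
  by rewrite mulfV// gt_eqF// (lam_gt0 t10 gP).
have powE x n : 0 < x -> x `^ (a * n%:R) = (x `^ a) ^+ n.
  by move=> x0; rewrite powRrM powR_mulrn// powR_ge0.
have [Q [QcP QP1 QM]] : exists Q : meas, [/\ Q (~` P) = 0%E, Q P = 1%E &
    forall n, (\int[Q]_(z in P) (z ^+ n)%:E = (Psi_prod N n)%:E)%E].
  have [nu [nu1 nu2 _]] := rescaled_laws lam1.
  exact: (Psi_law_exists N01 hnd hE t10 hx0 _ nu1 nu2).
have [muinf [muc muI]] := unbiased_power_image Q ia0.
have preP : P `&` (fun z : R => z `^ a^-1) @^-1` P = P.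
  apply/seteqP; split => [z []//|z Pz]; split => //.
  by rewrite /= in_itv/= andbT powR_gt0// P0.
have muIP (f : R -> R) : measurable_fun P f ->
    (\int[muinf]_(x in P) (f x * x)%:E = \int[Q]_(z in P) (f (z `^ a^-1))%:E)%E.
  by move=> mf; rewrite (muI P f mP (@subset_refl _ _) mf) preP.
have aK z : 0 < z -> (z `^ a^-1) `^ a = z.
  by move=> z0; rewrite -powRrM mulVf ?gt_eqF// powRr1// ltW.
have muM n : (\int[muinf]_(x in P) (x `^ (a * n%:R) * x)%:E = (Psi_prod N n)%:E)%E.
  rewrite muIP; last by apply: measurable_funTS; exact: measurable_powR.
  rewrite -QM; apply: eq_integral => z; rewrite inE => /P0 z0.
  by rewrite powE ?powR_gt0// aK.
exists muinf; split => //.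
- rewrite -[RHS](_ : (Psi_prod N 0)%:E = 1%E); last by rewrite Psi_prod0.
  rewrite -muM; apply: eq_integral => x; rewrite inE => /P0 x0.
  by rewrite mulr0 powRr0 mul1r.
(* In the variable [z = x^a] the moments of [Q'] become those of [Q], where determinacy is
   available; the event [A] is transported accordingly. *)
- move=> Q' Q'c Q'M A mA.
  have [nu [nuI nuA]] := power_image Q' a0.
  have mC : measurable (P `&` (fun z : measurableTypeR R => z `^ a^-1) @^-1` A).
    apply: measurableI => //; rewrite -[X in measurable X]setTI.
    by apply: measurable_powR.
  have -> : Q' A = Q' (P `&` A).
    apply/eqP; rewrite eq_le; apply/andP; split; last first.
      by apply: le_measure; rewrite ?inE//; exact: measurableI.
    have -> : A = (P `&` A) `|` (~` P `&` A) by rewrite -setIUl setUv setTI.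
    apply: (le_trans (@measureU2 _ _ _ Q' _ _ _ _)).
    + exact: measurableI.
    + by apply: measurableI => //; exact: measurableC.
    + have : (Q' (~` P `&` A) <= 0)%E.
        rewrite -[leRHS]Q'c; apply: le_measure; rewrite ?inE//.
        * by apply: measurableI => //; exact: measurableC.
        * exact: measurableC.
      move=> q0; apply: (@le_trans _ _ (Q' (P `&` A) + 0)%E); first exact: leeD2l.
      rewrite adde0; apply: le_measure; rewrite ?inE; [exact: measurableI| |].
        by rewrite -setIUl setUv setTI; exact: measurableI.
      by rewrite -setIUl setUv setTI.
  rewrite -nuA// (Psi_law_unique N01 (Q' := Q) _ QM mC); last by move=> z [].
    transitivity (\int[muinf]_(x in A `&` P) (1 * x)%:E)%E; last first.
      by apply: eq_integral => x _; rewrite mul1r.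
    have mAP : measurable (A `&` P) by exact: measurableI.
    rewrite (muI _ (fun=> 1) mAP); [|by move=> x []|exact: measurable_cst].
    rewrite preimage_setI setIA setIAC preP.
    by rewrite integral_cst ?mul1e// setIC.
  move=> n; rewrite nuI; last first.
    by apply: measurable_funTS; apply: continuous_measurable_fun; exact: exprn_continuous.
  by rewrite -Q'M; apply: eq_integral => x; rewrite inE => /P0 x0; rewrite powE.
(* The test function is [f(z^(1/a))], and [z = psi(t) x^a] gives [z^(1/a) = psi(t)^(1/a) x]. *)
- move=> psi psilam f cf [C fC].
  have [nu [nu1 nu2 nu3]] := rescaled_laws psilam.
  have cF := within_P_powR ia0 cf.
  have FC z : 0 < z -> `|f (z `^ a^-1)| <= C by move=> z0; apply: fC; exact: powR_gt0.
  have := Psi_law_cvg N01 hnd hE t10 hx0 (@proper_pinfty_nbhs R) nu1 nu2 QM cF FC.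
  rewrite -[X in _ --> X](_ : \int[muinf]_(x in P) (f x * x) = _); last first.
    by rewrite /Rintegral muIP//; exact: measurable_within_P.
  apply: cvg_trans; apply: near_eq_cvg; apply: filterS nu3 => t [p0 H].
  rewrite (H _ C (measurable_within_P cF) FC); congr (_ * _).
  apply: eq_Rintegral => x; rewrite inE => /P0 x0; congr (f _ * _).
  by rewrite powRM ?powR_ge0// ?(ltW p0)// -powRrM mulfV ?gt_eqF// powRr1// ltW.
Unshelve. all: by end_near. Qed.

End RescaledConvergence.

Theorem theorem1p3 (R : realType) (alpha beta : R)
  (B mu0 : {measure set (measurableTypeR R) -> \bar R})
  (mu : R -> {measure set (measurableTypeR R) -> \bar R})
  (halpha : alpha < 0)
  (hB : measure_on `]0, 1[ B)
  (hBint : (\int[B]_(y in `]0%R, 1%R[) (y * (1 - y))%R%:E < +oo)%E)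
  (hBpos : (0 < B `]0%R, 1%R[%classic)%E)
  (hmu0 : measure_on `]0, +oo[ mu0)
  (hmu0_mass : first_moment mu0 = 1%E)
  (hmu0_supp : is_support_sup mu0 1)
  (hmu : is_frag_solution alpha B mu0 mu)
  (hbeta0 : 0 <= beta) (hbeta1 : beta < 1)
  (hRV : regularly_varying_at0 (frag_tail B) (- beta))
  (hln : (\int[B]_(x in `]0%R, 1%R[) (`|ln x| * x)%R%:E < +oo)%E) :
  let psi0 := fun t : R => frag_varphi B (`|alpha| * t) / (`|alpha| * t) in
  exists muinf : {measure set (measurableTypeR R) -> \bar R},
    [/\ measure_on `]0, +oo[ muinf /\ first_moment muinf = 1%E,
        forall n : nat, (0 < n)%N ->
          (\int[muinf]_(x in `]0%R, +oo[) (x `^ (`|alpha| * n%:R) * x)%R%:E =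
           (\prod_(1 <= i < n.+1) frag_phi B (i%:R * `|alpha|))%R%:E)%E,
        forall P : probability (measurableTypeR R) R,
          measure_on `]0, +oo[ P ->
          (forall n : nat, (0 < n)%N ->
            (\int[P]_(x in `]0%R, +oo[) (x `^ (`|alpha| * n%:R))%R%:E =
             (\prod_(1 <= i < n.+1) frag_phi B (i%:R * `|alpha|))%R%:E)%E) ->
          forall A : set R, measurable A ->
            P A = (\int[muinf]_(x in A `&` `]0%R, +oo[) x%:E)%E,
        rescaled_cvg alpha mu muinf psi0 &
        forall psi : R -> R, asymp_equiv psi psi0 ->
          rescaled_cvg alpha mu muinf psi].
Proof.
move=> psi0; rewrite /rescaled_cvg; have aE : `|alpha| = - alpha by rewrite ltr0_norm.
have a0 : 0 < - alpha by rewrite oppr_gt0.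
have [N [N01 NB]] := log_image_measure a0 hBpos hln.
have [kappa [v0 [k0 k2 v00 tail_half]]] := Ntail_half a0 N01 NB hbeta1 hRV.
have star := @Psi_subregular R N N01 kappa v0 k0 k2 v00 tail_half.
have phiE := frag_phiE a0 NB.
have [t1 [t10 gP]] := frag_varphi_spec a0 N01 phiE star.
have [muinf [muc mu1 muM muU mucvg]] := rescaled_limit halpha N01 NB hmu hmu0_supp t10 gP star.
have prodE n : \prod_(1 <= i < n.+1) frag_phi B (i%:R * `|alpha|) = Psi_prod N n.
  by apply: eq_bigr => i _; rewrite aE phiE.
have lamE : lam (fun t => frag_varphi B (- alpha * t) / - alpha) = psi0.
  by apply/funext => t; rewrite /lam /psi0 aE -mulrA -invfM.
exists muinf; rewrite aE in prodE *; rewrite lamE in mucvg; split => //.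
- by move=> n _; rewrite muM prodE.
(* The moments are prescribed from order 1 on; order 0 is supplied by [Q] being a probability
   carried by the half-line. *)
- move=> Q Qc QM A mA; apply: (muU Q Qc _ A mA) => -[|n]; last by rewrite QM// prodE.
  have QP : Q `]0, +oo[%classic = 1%E.
    have := probability_setT Q; rewrite -(setUv `]0, +oo[%classic) measureU ?setICr//; last first.
      by apply: measurableC; exact: measurable_itv.
    move=> <-; rewrite -[LHS]adde0; congr (_ + _)%E; exact/esym/Qc.
  rewrite Psi_prod0 -QP -[RHS]mul1e -integral_cst; last exact: measurable_itv.
  by apply: eq_integral => x _; rewrite mulr0 powRr0.
(* The scale [psi0] is equivalent to itself, since it is nonzero from [t1] on. *)
- apply: mucvg; apply: cvg_near_cst; near=> t.
  have tt1 : t1 <= t by near: t; apply: nbhs_pinfty_ge; exact: num_real.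
  by rewrite mulfV// -lamE gt_eqF// (lam_gt0 t10 gP).
Unshelve. all: by end_near. Qed.
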